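(* Let $n\ge 1$, $0<s<1$, and let $\Omega\subset\mathbb{R}^n$ be an open and bounded domain which satisfies the segment property. Let $M$ be a Young function, let $a\colon\mathbb{R}^n\times\mathbb{R}^n\times\mathbb{R}\to\mathbb{R}$ be an admissible kernel for $M$ which is moreover coercive, and let $g\colon\mathbb{R}\to\mathbb{R}$ be an admissible source for $M$ (all as defined in the context). Then there exists a sequence of eigenpairs $\{(\lambda_i,u_i)\}_{i=1}^\infty\subset(0,\infty)\times W^s_0L_M(\Omega)$ of the problem $$\mathcal{L}_a^s u=\lambda g(u)\ \text{ in }\Omega,\qquad u=0\ \text{ in }\mathbb{R}^n\setminus\Omega .$$ Moreover, $\lambda_i\to+\infty$ and $u_i\to 0$ in $\sigma(W^s_0L_M(\Omega),W^{-s}E_{\bar M}(\Omega))$ as $i\to\infty$.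
   Context: Young functions. A Young function is an even, convex, continuous $M\colon\mathbb{R}\to\mathbb{R}$ with $M(t)>0$ for $t>0$, $M(t)/t\to0$ as $t\to0$, $M(t)/t\to\infty$ as $t\to\infty$, of the form $M(t)=\int_0^{|t|}m(\tau)\,d\tau$ with $m\colon[0,\infty)\to[0,\infty)$ increasing, right continuous, $m(t)=0$ iff $t=0$, and $m(t)\to\infty$ as $t\to\infty$. Its complementary function is $\bar M(t)=\sup\{\tau|t|-M(\tau):\tau\ge0\}$, and $\bar M^{-1}$ is the inverse of $\bar M$ on $[0,\infty)$. No $\Delta_2$-condition is assumed on $M$ or $\bar M$. Orlicz spaces. For a measure space $(U,\mu)$, $L_M(U,d\mu)$ is the set of measurable $u$ with $\int_U M(u/k)\,d\mu<\infty$ for some $k>0$, with Luxemburg norm $\inf\{k>0:\int_UM(u/k)\,d\mu\le1\}$; $E_M(U,d\mu)$ is the set of measurable $u$ with $\int_U M(u/k)\,d\mu<\infty$ for every $k>0$. Let $d\nu_n=\frac{dx\,dy}{|x-y|^n}$ on $\mathbb{R}^{2n}$. Write $L_M=L_M(\mathbb{R}^n,dx)$, $E_M=E_M(\mathbb{R}^n,dx)$, $L_M(\nu_n)=L_M(\mathbb{R}^{2n},d\nu_n)$, $E_M(\nu_n)=E_M(\mathbb{R}^{2n},d\nu_n)$, with norms $\|\cdot\|_M$, $\|\cdot\|_{M,\nu_n}$; similarly for $\bar M$. Fractional spaces. $D^su(x,y)=\frac{u(x)-u(y)}{|x-y|^s}$. $W^sL_M=\{u\in L_M:D^su\in L_M(\nu_n)\}$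 and $W^sE_M=\{u\in E_M:D^su\in E_M(\nu_n)\}$, with norm $\|u\|_{s,M}=\|u\|_M+\|D^su\|_{M,\nu_n}$, identified with subspaces of $L_M\times L_M(\nu_n)$ via $u\mapsto(u,D^su)$. $W^s_0L_M(\Omega)$ is the closure of $\mathcal{D}(\Omega)=C_c^\infty(\Omega)$ (extended by zero) in $W^sL_M$ for the topology $\sigma(L_M\times L_M(\nu_n),E_{\bar M}\times E_{\bar M}(\nu_n))$. For $F\in L_{\bar M}(\nu_n)$ the fractional divergence is $\mathrm{div}^sF(x)=\mathrm{p.v.}\int_{\mathbb{R}^n}\frac{F(y,x)-F(x,y)}{|x-y|^{n+s}}\,dy$, understood as the functional $\langle\mathrm{div}^sF,u\rangle=-\iint_{\mathbb{R}^{2n}}F\,D^su\,d\nu_n$. $W^{-s}L_{\bar M}(\Omega)$ (resp. $W^{-s}E_{\bar M}(\Omega)$) is the space of distributions on $\Omega$ of the form $f+\mathrm{div}^sF$ with $f\in L_{\bar M}$, $F\in L_{\bar M}(\nu_n)$ (resp. $f\in E_{\bar M}$, $F\in E_{\bar M}(\nu_n)$), paired with $W^s_0L_M(\Omega)$ by $\langle f+\mathrm{div}^sF,u\rangle=\int fu\,dx-\iint F\,D^su\,d\nu_n$. Convergence $u_i\to u$ in $\sigma(W^s_0L_M(\Omega),W^{-s}E_{\bar M}(\Omega))$ means $\langle\phi,u_i\rangle\to\langle\phi,u\rangle$ for all $\phi\in W^{-s}E_{\bar M}(\Omega)$. Admissible kernel for $M$. $a(x,y,\xi)$ is measurable in $(x,y)$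 for every $\xi$ and continuous in $\xi$ for a.e. $(x,y)$; and for a.e. $(x,y)\in\mathbb{R}^{2n}$ and all $\xi,\xi'\in\mathbb{R}$: $a(x,y,-\xi)=-a(x,y,\xi)$; $a(x,y,\xi)\xi>0$ if $\xi\ne0$; $|a(x,y,\xi)|\le d(x,y)+b\,\bar M^{-1}(M(c\xi))$ for some fixed $d\in E_{\bar M}(\nu_n)$ and constants $b,c>0$; $(a(x,y,\xi)-a(x,y,\xi'))(\xi-\xi')\ge0$. Coercive: there are constants $\theta,c_1>0$ with $a(x,y,\xi)\xi\ge\theta M(c_1\xi)$ for all $\xi\in\mathbb{R}$ and a.e. $(x,y)$. Operator. $\mathrm{Dom}(\mathcal{L}_a^s)=\{u\in W^s_0L_M(\Omega):a(x,y,D^su(x,y))\in L_{\bar M}(\nu_n)\}$ and $\mathcal{L}_a^su=-\mathrm{div}^s(a(x,y,D^su(x,y)))$. Admissible source for $M$. $g\colon\mathbb{R}\to\mathbb{R}$ is odd, continuous, $g(t)>0$ for $t>0$, and $|g(t)|\le e(x)+a_1\bar M^{-1}(a_2M(a_3t))$ for all $t\ge0$ and a.e. $x\in\Omega$, for some constants $a_1,a_2,a_3>0$ and some $e\in L_{\bar M}$. Eigenpair. $(\lambda,u)$ is an eigenpair of the problem if $u\in\mathrm{Dom}(\mathcal{L}_a^s)$ and $\iint_{\mathbb{R}^{2n}}a(x,y,D^su)D^sv\,d\nu_n=\lambda\int_\Omega g(u)v\,dx$ for all $v\in W^s_0L_M(\Omega)$. *)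

(* Defs.v *)
From HB Require Import structures.
From mathcomp Require Import all_boot all_order all_algebra.
From mathcomp Require Import all_classical all_reals all_analysis.
From mathcomp Require Import measurable_realfun.

Set Implicit Arguments.
Unset Strict Implicit.
Unset Printing Implicit Defensive.
Import Order.TTheory GRing.Theory Num.Theory.
Import numFieldNormedType.Exports.
Local Open Scope classical_set_scope.
Local Open Scope ring_scope.

(* The Borel sigma-algebra of R^n, generated by the coordinates. *)
Section rV_measurable.
Context (R : realType) (n : nat).

Definition rV_coord (i : 'I_n) (x : 'rV[R]_n) : measurableTypeR R := x ord0 i.

Let rV_set0 : g_sigma_preimage rV_coord set0.
Proof. exact: sigma_algebra0. Qed.

Let rV_setC A : g_sigma_preimage rV_coord A -> g_sigma_preimage rV_coord (~` A).
Proof. exact: sigma_algebraC. Qed.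

Let rV_bigcup (F : (set 'rV[R]_n)^nat) :
  (forall i, g_sigma_preimage rV_coord (F i)) ->
  g_sigma_preimage rV_coord (\bigcup_i (F i)).
Proof. exact: sigma_algebra_bigcup. Qed.

HB.instance Definition _ := @isMeasurable.Build
  (measure_tuple_display default_measure_display)
  'rV[R]_n (g_sigma_preimage rV_coord) rV_set0 rV_setC rV_bigcup.

Lemma measurable_rV_coord (i : 'I_n) : measurable_fun setT (rV_coord i).
Proof.
move=> _ Y mY; rewrite setTI; apply: sub_sigma_algebra => /=.
rewrite -bigcup_seq/=; exists i => /=; first by rewrite mem_index_enum.
by exists Y => //; rewrite setTI.
Qed.

Lemma measurable_fun_rVP d (T : measurableType d) (f : T -> 'rV[R]_n) :
  (forall i, measurable_fun setT (rV_coord i \o f)) -> measurable_fun setT f.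
Proof.
move=> mf.
have [_ _ + ]: [/\ True, True & g_sigma_preimage (fun i => rV_coord i \o f)
    `<=` measurable].
  split=> //; apply: smallest_sub; first exact: sigma_algebra_measurable.
  rewrite -bigcup_seq; apply: bigcup_sub => i _.
  by move=> A [B mB <-]; exact: mf.
rewrite g_sigma_preimage_comp => prefS _ A mA.
by apply: prefS; exists A.
Qed.

End rV_measurable.

(* Lebesgue measure on the Borel sets of R^n, by iterated products. *)
Section lebesgue_rV.
Context (R : realType).

Definition rV_cons n (p : measurableTypeR R * 'rV[R]_n) : 'rV[R]_n.+1 :=
  \row_i if unlift ord0 i is Some j then p.2 ord0 j else p.1.

Lemma measurable_rV_cons n : measurable_fun setT (@rV_cons n).
Proof.
apply: measurable_fun_rVP => i.
rewrite (_ : _ \o _ = fun p => if unlift ord0 i is Some j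
  then rV_coord j p.2 else p.1); last first.
  by apply/funext => p; rewrite /= /rV_coord mxE.
case: (unlift ord0 i) => [j|]; last exact: measurable_fst.
by apply: measurableT_comp; [exact: measurable_rV_coord|exact: measurable_snd].
Qed.

Section step.
Context (n : nat) (mu : {sigma_finite_measure set 'rV[R]_n -> \bar R}).

Definition lebesgue_rV_step : set 'rV[R]_n.+1 -> \bar R :=
  pushforward (@lebesgue_measure R \x mu)%E (@rV_cons n).

Let step0 : lebesgue_rV_step set0 = 0%E.
Proof. by rewrite /lebesgue_rV_step /pushforward preimage_set0 measure0. Qed.

Let step_ge0 A : (0 <= lebesgue_rV_step A)%E.
Proof. by rewrite /lebesgue_rV_step /pushforward; apply: measure_ge0. Qed.

Let step_sigma_additive : semi_sigma_additive lebesgue_rV_step.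
Proof.
move=> F mF tF mUF; rewrite /lebesgue_rV_step /pushforward preimage_bigcup.
apply: measure_semi_sigma_additive.
- by move=> k; rewrite -[X in measurable X]setTI; exact: measurable_rV_cons.
- apply/trivIsetP => /= i j _ _ ij; rewrite -preimage_setI.
  by move/trivIsetP : tF => /(_ _ _ _ _ ij) ->//; rewrite preimage_set0.
- by rewrite -preimage_bigcup -[X in measurable X]setTI; exact: measurable_rV_cons.
Qed.

HB.instance Definition _ := isMeasure.Build _ _ _
  lebesgue_rV_step step0 step_ge0 step_sigma_additive.

Let rV_uncons (x : 'rV[R]_n.+1) : measurableTypeR R * 'rV[R]_n :=
  (x ord0 ord0, \row_i x ord0 (lift ord0 i)).

Let rV_consK : cancel (@rV_cons n) rV_uncons.
Proof.
move=> [t x]; rewrite /rV_uncons !mxE unlift_none; congr (_, _).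
by apply/rowP => i; rewrite !mxE liftK.
Qed.

Let measurable_rV_uncons : measurable_fun setT rV_uncons.
Proof.
apply/measurable_fun_pairP; split => /=.
  exact: (@measurable_rV_coord R n.+1 ord0).
apply: measurable_fun_rVP => i.
rewrite (_ : _ \o _ = rV_coord (lift ord0 i)); first exact: measurable_rV_coord.
by apply/funext => x; rewrite /= /rV_coord mxE.
Qed.

Let step_sigma_finite : sigma_finite setT lebesgue_rV_step.
Proof.
have /sigma_finiteP[F [TF ndF Foo]] := sigma_finiteT (@lebesgue_measure R).
have /sigma_finiteP[G [TG ndG Goo]] := sigma_finiteT mu.
exists (fun k => rV_uncons @^-1` (F k `*` G k)).
  rewrite -preimage_bigcup (_ : \bigcup_k _ = setT) ?preimage_setT//.
  rewrite -subTset => -[x y] _.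
  have [i _ Fix] : (\bigcup_i F i) x by rewrite -TF.
  have [j _ Gjy] : (\bigcup_i G i) y by rewrite -TG.
  exists (maxn i j) => //; split => /=.
    by move: x Fix; exact/subsetPset/ndF/leq_maxl.
  by move: y Gjy; exact/subsetPset/ndG/leq_maxr.
move=> k; have [mF Fk] := Foo k; have [mG Gk] := Goo k; split.
  by rewrite -[X in measurable X]setTI; apply: measurable_rV_uncons => //; exact: measurableX.
rewrite /lebesgue_rV_step /pushforward -comp_preimage.
rewrite (_ : _ \o _ = id) ?preimage_id; last by apply/funext => p /=; rewrite rV_consK.
by rewrite product_measure1E// lte_mul_pinfty// ge0_fin_numE.
Qed.

HB.instance Definition _ := Measure_isSigmaFinite.Build _ _ _
  lebesgue_rV_step step_sigma_finite.

End step.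

Fixpoint lebesgue_rV n : {sigma_finite_measure set 'rV[R]_n -> \bar R} :=
  if n is m.+1 then lebesgue_rV_step (lebesgue_rV m) else \d_(0 : 'rV[R]_0).

End lebesgue_rV.

(* Caratheodory's construction from the outer measure of a sigma-finite Borel
   measure yields its completion: Rn and Rnn carry the Lebesgue-measurable sets
   and Lebesgue measure of R^n and R^n x R^n = R^{2n}. *)
Section lebesgue_complete.
Context (R : realType) (n : nat).
Local Open Scope ereal_scope.

Definition Rn := caratheodory_type (lebesgue_rV R n)^*%mu.
HB.instance Definition _ := Measurable.on Rn.

Definition dx : set Rn -> \bar R :=
  @completed_measure_extension _ _ _ (lebesgue_rV R n).
HB.instance Definition _ := Measure.on dx.

Definition Rnn := caratheodory_type (lebesgue_rV R n \x lebesgue_rV R n)^*%mu.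
HB.instance Definition _ := Measurable.on Rnn.

Definition dxdy : set Rnn -> \bar R :=
  @completed_measure_extension _ _ _ (lebesgue_rV R n \x lebesgue_rV R n).
HB.instance Definition _ := Measure.on dxdy.

End lebesgue_complete.
Arguments dx {R n}.
Arguments dxdy {R n}.

Section nu.
Context (R : realType) (n : nat).

(* Euclidean norm; the library's norm on 'rV[R]_n is the sup norm. *)
Definition enorm (x : 'rV[R]_n) : R := Num.sqrt (\sum_i x ord0 i ^+ 2).

Let kern (z : Rnn R n) := (enorm (z.1 - z.2) ^- n)%:E.

(* The measure dx dy / |x - y|^n; the convention 0^-1 = 0 only concerns the
   diagonal, which is null for dx dy when n > 0. *)
Definition nu (A : set (Rnn R n)) : \bar R :=
  (\int[dxdy]_(z in A) (enorm (z.1 - z.2) ^- n)%:E)%E.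

Let kern_ge0 z : (0 <= kern z)%E.
Proof. by rewrite lee_fin invr_ge0 exprn_ge0// sqrtr_ge0. Qed.

Let measurable_borel (f : 'rV[R]_n * 'rV[R]_n -> R) :
  measurable_fun setT f -> measurable_fun setT (f : Rnn R n -> R).
Proof.
move=> mf _ Y mY; rewrite setTI.
apply: caratheodory_measurable_mu_ext.
by rewrite -[X in _.-measurable X]setTI; exact: mf.
Qed.

Let measurable_kern : measurable_fun setT kern.
Proof.
apply/measurable_EFinP.
apply: (@measurable_borel (fun z => enorm (z.1 - z.2) ^- n)).
rewrite (_ : (fun _ => _) = (fun z => enorm (z.1 - z.2) `^ (- n%:R))); last first.
  by apply/funext => z; rewrite powR_invn ?sqrtr_ge0.
apply: (@measurableT_comp _ _ _ _ _ _ (fun r : R => r `^ (- n%:R))).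
  exact: measurable_powR.
apply: (@measurableT_comp _ _ _ _ _ _ (@Num.sqrt R)).
  by apply: continuous_measurable_fun; exact: sqrt_continuous.
apply: measurable_sum => i.
apply: measurable_funX.
rewrite (_ : (fun _ => _) = fun z => rV_coord i z.1 - rV_coord i z.2); last first.
  by apply/funext => z; rewrite /rV_coord !mxE.
apply: measurable_funB.
- exact: measurableT_comp (measurable_rV_coord i) measurable_fst.
- exact: measurableT_comp (measurable_rV_coord i) measurable_snd.
Qed.

Let nu0 : nu set0 = 0%E.
Proof. by rewrite /nu integral_set0. Qed.

Let nu_ge0 A : (0 <= nu A)%E.
Proof. by apply: integral_ge0 => z _; exact: kern_ge0. Qed.

Let nu_sigma_additive : semi_sigma_additive nu.
Proof.
move=> F mF tF mUF; rewrite /nu ge0_integral_bigcup//.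
- by apply: is_cvg_ereal_nneg_natsum_cond => k _ _; exact: nu_ge0.
- by apply: measurable_funTS; exact: measurable_kern.
- by move=> z _; exact: kern_ge0.
Qed.

HB.instance Definition _ := isMeasure.Build _ _ _ nu nu0 nu_ge0 nu_sigma_additive.

End nu.
Arguments nu {R n}.

Section young.
Context (R : realType).
Implicit Type M : R -> R.

Definition young M :=
  [/\ [/\ forall t, M (- t) = M t, @convex_function R R^o setT M,
          continuous M & forall t : R, 0 < t -> 0 < M t],
      M t / t @[t --> 0^'] --> 0,
      M t / t @[t --> +oo] --> +oo
    & exists m : R -> R,
      [/\ [/\ forall t : R, 0 <= t -> 0 <= m t,
              forall t t' : R, 0 <= t -> t <= t' -> m t <= m t',
              forall t : R, 0 <= t -> m t' @[t' --> t^'+] --> m t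
            & forall t : R, 0 <= t -> (m t = 0 <-> t = 0)],
          m t @[t --> +oo] --> +oo
        & forall t, (M t)%:E =
            (\int[lebesgue_measure]_(tau in `[0%R, `|t|%R]) (m tau)%:E)%E]].

Definition complementary M : R -> R :=
  fun t => sup [set tau * `|t| - M tau | tau in [set tau | 0 <= tau]].

Definition complementary_inv M : R -> R :=
  'pinv_(fun=> 0) [set t | 0 <= t] (complementary M).

End young.

Section orlicz.
Context d (U : measurableType d) (R : realType).
Context (mu : {measure set U -> \bar R}) (M : R -> R).

Definition orliczL : set (U -> R) :=
  [set u : U -> R | measurable_fun setT u /\
    exists2 k : R, 0 < k & (\int[mu]_x (M (u x / k))%:E < +oo)%E].

Definition orliczE : set (U -> R) :=
  [set u : U -> R | measurable_fun setT u /\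
    forall k : R, 0 < k -> (\int[mu]_x (M (u x / k))%:E < +oo)%E].

End orlicz.

Section domains.
Context (R : realType) (n : nat).
Implicit Type Omega : set 'rV[R]_n.

Definition segment_property Omega :=
  forall x, (closure Omega `\` interior Omega) x ->
  exists (U : set 'rV[R]_n) (y : 'rV[R]_n),
    [/\ open U, U x, y != 0 & forall z, (closure Omega `&` U) z ->
        forall t : R, 0 < t < 1 -> Omega (z + t *: y)].

Fixpoint Ck k (f : 'rV[R]_n -> R) : Prop :=
  continuous f /\
  if k is k'.+1 then
    forall i : 'I_n, (forall x, derivable f x (delta_mx ord0 i)) /\
                     Ck k' ('D_(delta_mx ord0 i) f)
  else True.

Definition test_functions Omega : set ('rV[R]_n -> R) :=
  [set f : 'rV[R]_n -> R |
    let supp := closure [set x | f x != 0] in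
    [/\ forall k, Ck k f, compact supp & supp `<=` Omega]].

End domains.

Section fractional.
Context (R : realType) (n : nat) (s : R) (M : R -> R).
Local Notation Mbar := (complementary M).

Definition Ds (u : Rn R n -> R) : Rnn R n -> R :=
  fun z => (u z.1 - u z.2) / (enorm (z.1 - z.2) `^ s).

Definition WsL : set (Rn R n -> R) :=
  [set u | orliczL dx M u /\ orliczL nu M (Ds u)].

Definition duality (p q : (Rn R n -> R) * (Rnn R n -> R)) : R :=
  \int[dx]_x (p.1 x * q.1 x) + \int[nu]_z (p.2 z * q.2 z).

(* Functions on R^n with the topology sigma(L_M x L_M(nu), E_Mbar x E_Mbar(nu))
   pulled back along u |-> (u, D^s u).  Functions are not identified up to
   null sets, so that this topology is not separated. *)
Definition sigma_topology : topologicalType :=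
  initial_topology ((fun (u : Rn R n -> R)
    (p : orliczE (@dx R n) Mbar `*` orliczE (@nu R n) Mbar) =>
      duality (val p) (u, Ds u)) : _ -> {ptws _ -> R}).

Definition Ws0L (Omega : set 'rV[R]_n) : set (Rn R n -> R) :=
  WsL `&` closure (test_functions Omega : set sigma_topology).

Definition fdiv (F : Rnn R n -> R) (u : Rn R n -> R) : R :=
  - \int[nu]_z (F z * Ds u z).

(* An element f + div^s F is represented by the functional it defines. *)
Definition WnegE : set ((Rn R n -> R) -> R) :=
  [set phi | exists f F, [/\ orliczE dx Mbar f, orliczE nu Mbar F &
     phi = fun u => \int[dx]_x (f x * u x) + fdiv F u]].

Definition sigma_cvg (u : nat -> Rn R n -> R) (u0 : Rn R n -> R) :=
  forall phi, WnegE phi -> phi (u i) @[i --> \oo] --> phi u0.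

Definition admissible_kernel (a : 'rV[R]_n -> 'rV[R]_n -> R -> R) :=
  [/\ forall xi, measurable_fun setT (fun z : Rnn R n => a z.1 z.2 xi),
      {ae dxdy, forall z : Rnn R n, continuous (a z.1 z.2)}
    & exists (d : Rnn R n -> R) (b c : R),
      [/\ orliczE nu Mbar d, 0 < b, 0 < c &
        {ae dxdy, forall z : Rnn R n, forall xi xi' : R,
          [/\ a z.1 z.2 (- xi) = - a z.1 z.2 xi,
              xi != 0 -> 0 < a z.1 z.2 xi * xi,
              `|a z.1 z.2 xi| <= d z + b * complementary_inv M (M (c * xi))
            & 0 <= (a z.1 z.2 xi - a z.1 z.2 xi') * (xi - xi')]}]].

Definition coercive_kernel (a : 'rV[R]_n -> 'rV[R]_n -> R -> R) :=
  exists theta c1 : R, [/\ 0 < theta, 0 < c1 &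
    {ae dxdy, forall z : Rnn R n, forall xi : R,
      theta * M (c1 * xi) <= a z.1 z.2 xi * xi}].

Definition admissible_source (Omega : set 'rV[R]_n) (g : R -> R) :=
  [/\ forall t, g (- t) = - g t, continuous g, forall t, 0 < t -> 0 < g t
    & exists (a1 a2 a3 : R) (e : Rn R n -> R),
      [/\ [/\ 0 < a1, 0 < a2 & 0 < a3], orliczL dx Mbar e &
        {ae dx, forall x : Rn R n, Omega x -> forall t : R, 0 <= t ->
          `|g t| <= e x + a1 * complementary_inv M (a2 * M (a3 * t))}]].

Definition domL (a : 'rV[R]_n -> 'rV[R]_n -> R -> R) (Omega : set 'rV[R]_n) :
    set (Rn R n -> R) :=
  [set u | Ws0L Omega u /\
           orliczL nu Mbar (fun z => a z.1 z.2 (Ds u z))].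

(* The integrals are taken in the extended reals: the left-hand side is finite
   by Hoelder's inequality, so that for lambda != 0 the equation includes the
   integrability of g(u) v on Omega. *)
Definition eigenpair (a : 'rV[R]_n -> 'rV[R]_n -> R -> R) (g : R -> R)
    (Omega : set 'rV[R]_n) (lambda : R) (u : Rn R n -> R) :=
  domL a Omega u /\ forall v, Ws0L Omega v ->
    (\int[nu]_z (a z.1 z.2 (Ds u z) * Ds v z)%:E =
     lambda%:E * \int[dx]_(x in Omega) (g (u x) * v x)%:E)%E.

End fractional.

(* Main.v *)
(** Restrict the problem to the span of [phi_0], ..., [phi_(k-1)], smooth functions
    supported in [Omega].  The critical points of the mass [\int G(u)], with [G]
    the primitive of [g], on the level set [\iint A(x, y, D^s u) dnu = 1], with
    [A] the primitive of [a], are found by a Lusternik-Schnirelmann argument: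
    among the sets of mass at least [alpha] on the level set, look at the images
    of odd maps.  By the Borsuk-Ulam theorem (proved with an odd mod 2 cochain on
    iterated subdivisions of the cross-polytope) an odd image of large dimension
    contains a function all of whose averages over small cubes vanish, hence one
    of small mass; if there were no critical point of intermediate mass, finitely
    many steepest ascent steps would push such an image to large mass.
    Bounds on the energy and quasi-interpolation on fine cubes give compactness
    in the modular sense, without any Delta_2-condition.  Coercivity and the
    monotonicity of [a] bound [\iint Mbar(a(D^s u) / K) dnu], and theorems of
    Fatou and Vitali let [k] tend to infinity in the equation tested with
    [phi_j].  By the segment property every test function is a modular limit of
    combinations of the [phi_j], so the equation holds on [W^s_0 L_M].  Doing
    this for masses tending to 0 gives eigenfunctions converging weakly to 0,
    and [lambda \int g(u) u >= 1] makes the eigenvalues blow up. *)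

Require Import Defs.
From HB Require Import structures.
From mathcomp Require Import all_boot all_order all_algebra.
From mathcomp Require Import all_classical all_reals all_analysis.
From mathcomp Require Import measurable_realfun.
From mathcomp Require Import ring lra zify.
Set Implicit Arguments.
Unset Strict Implicit.
Unset Printing Implicit Defensive.
Import Order.TTheory GRing.Theory Num.Theory.
Import numFieldNormedType.Exports.
Local Open Scope classical_set_scope.
Local Open Scope ring_scope.


(** Without a Delta_2-condition the energy may be infinite at some scales; on combinations of bumps
    it is finite at every scale, so gradients are only taken there. Constants cannot be moved out of
    [M]: sums are split by [M (x + y) <= (M (2 x) + M (2 y)) / 2] and the scale [K] in [M (u / K)]
    grows a bounded number of times. Two facts make this harmless. Quasi-interpolation of mesh [e]
    has an error controlled in [L_M] at a scale proportional to [e ^ s], which tends to 0, so an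
    energy bound at one scale controls [u] at all scales. And [D^s u] depends only on the values of
    [u] at two points, so a.e. convergence of [u] passes directly through the continuous kernel and
    identifies the limit of [a(D^s u)]. The lower bound [alpha] for the mass must not depend on [k];
    it is read off a sphere spanned by finitely many separated bumps chosen before [k]. The [phi_j]
    may be dependent, so a quadratic penalty, vanishing as [k] grows, makes the level sets compact.
    The multipliers are bounded by testing convexity with about twice the limit. *)

Module BorsukUlam.

(** * Mod 2 cochains and barycentric subdivision *)

Section cochains.
Context (V : Type).
Implicit Types (phi psi : seq V -> bool) (s t : seq V).

(** A list of vertices is an ordered simplex and a cochain is a function of lists; this is the
    coboundary of [phi] evaluated at [s]. The complex is augmented: the face of a single vertex is
    the empty list. *)
Fixpoint coboundary s phi : bool :=
  if s is p :: t then phi t (+) coboundary t (fun u => phi (p :: u)) else false.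

Lemma coboundary_ext s phi psi :
  (forall t, size t = (size s).-1 -> phi t = psi t) ->
  coboundary s phi = coboundary s psi.
Proof.
elim: s phi psi => //= p s IH phi psi H; rewrite H//; congr (_ (+) _).
case: s IH H => [|q s] IH H //; apply: IH => t st; apply: H.
by rewrite /= st.
Qed.

Lemma coboundaryD s phi psi :
  coboundary s (fun t => phi t (+) psi t) = coboundary s phi (+) coboundary s psi.
Proof. by elim: s phi psi => //= p s IH phi psi; rewrite IH addbACA. Qed.

Lemma coboundary_andl s b phi :
  coboundary s (fun t => b && phi t) = b && coboundary s phi.
Proof. by elim: s phi => [|p s IH] phi /=; [rewrite andbF|rewrite IH andb_addr]. Qed.

Lemma coboundary_coboundary s phi :
  coboundary s (fun t => coboundary t phi) = false.
Proof.
elim: s phi => //= p s IH phi; rewrite coboundaryD IH addbF; exact: addbb.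
Qed.

End cochains.

Section subdivision.
Context (R : realType) (V : normedModType R).
Implicit Types (phi psi : seq V -> bool) (s t : seq V).

Definition barycenter s : V := (size s)%:R^-1 *: \sum_(x <- s) x.

(** The subdivision of [s] is the cone, with apex the barycenter of [s], over the subdivisions of
    its faces. The faces are only reached through [coboundary], so the recursion needs fuel. *)
Fixpoint sd_fuel n s phi : bool :=
  if n is m.+1 then
    coboundary s (fun t => sd_fuel m t (fun u => phi (barycenter s :: u)))
  else phi s.

(* The transpose of barycentric subdivision, acting on cochains. *)
Definition sd s phi := sd_fuel (size s) s phi.

Lemma sd_cons p s phi : sd (p :: s) phi =
  coboundary (p :: s) (fun t => sd t (fun u => phi (barycenter (p :: s) :: u))).
Proof.
by rewrite {1}/sd; apply: coboundary_ext => t /= st; rewrite /sd st.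
Qed.

Lemma sdD s phi psi : sd s (fun t => phi t (+) psi t) = sd s phi (+) sd s psi.
Proof.
have [n] := ubnP (size s); elim: n s phi psi => // n IH [|p s] phi psi sn //.
rewrite !sd_cons -coboundaryD; apply: coboundary_ext => t /= st.
by rewrite IH// st; move: sn => /=; rewrite ltnS.
Qed.

(** Subdivision is a chain map: the boundary of a cone is its base plus the cone over the boundary
    of the base, and here the base is itself a boundary. *)
Lemma sd_coboundary s phi :
  sd s (fun t => coboundary t phi) = coboundary s (fun t => sd t phi).
Proof.
have [n] := ubnP (size s); elim: n s phi => // n IH [|p s] phi sn //.
rewrite sd_cons; set b := barycenter _ => /=.
rewrite -[X in X (+) _]/((fun t => sd t (fun u => phi u (+) coboundary u (fun v => phi (b :: v)))) s).
rewrite -[LHS]/(coboundary (p :: s) (fun t => sd t (fun u => phi u (+) coboundary u (fun v => phi (b :: v))))).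
under coboundary_ext => t st.
  rewrite sdD (IH t); last by rewrite st; move: sn => /=; rewrite ltnS.
  over.
by rewrite coboundaryD coboundary_coboundary addbF.
Qed.

(** Stand-in for convexity: only the averages formed by subdivision matter. Quantifying over all
    such sets in [refines] expresses that the vertices of [t] lie in the hull of [s]. *)
Definition average_closed (C : set V) :=
  forall s, s != [::] -> (forall x, x \in s -> C x) -> C (barycenter s).

Definition refines (d : R) s t := [/\ size t = size s,
  forall C, average_closed C -> (forall x, x \in s -> C x) ->
    forall x, x \in t -> C x
  & forall x y, x \in t -> y \in t -> `|x - y| <= d].

Let sum_const s (b : V) : \sum_(x <- s) b = (size s)%:R *: b.
Proof. by rewrite big_const_seq iter_addr_0 count_predT scaler_nat. Qed.

Lemma barycenter_dist (b : V) (d : R) s : s != [::] ->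
  (forall x, x \in s -> `|b - x| <= d) -> `|b - barycenter s| <= d.
Proof.
move=> s0 H; have ns : (0 < (size s)%:R :> R) by rewrite ltr0n lt0n size_eq0.
have -> : b - barycenter s = (size s)%:R^-1 *: \sum_(x <- s) (b - x).
  rewrite /barycenter sumrB scalerBr; congr (_ - _).
  by rewrite sum_const scalerA mulVf ?gt_eqF// scale1r.
rewrite normrZ ger0_norm ?invr_ge0 ?(ltW ns)// ler_pdivrMl//.
apply: le_trans (ler_norm_sum _ _ _) _.
rewrite [leLHS]big_seq.
apply: (@le_trans _ _ (\sum_(i <- s | i \in s) d)); first exact: ler_sum.
by rewrite -big_seq big_const_seq iter_addr_0 count_predT mulr_natl.
Qed.

(** The term of the sum at [y] itself vanishes, whence a factor below 1. *)
Lemma barycenter_dist_mem (d : R) s y : y \in s ->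
  (forall x y, x \in s -> y \in s -> `|x - y| <= d) ->
  `|barycenter s - y| <= (size s).-1%:R / (size s)%:R * d.
Proof.
move=> ys H.
have ns : (0 < (size s)%:R :> R) by rewrite ltr0n; case: (s) ys.
have -> : barycenter s - y = (size s)%:R^-1 *: \sum_(x <- s) (x - y).
  rewrite /barycenter sumrB scalerBr; congr (_ - _).
  by rewrite sum_const scalerA mulVf ?gt_eqF// scale1r.
rewrite normrZ ger0_norm ?invr_ge0 ?(ltW ns)// mulrAC mulrC ler_pM2r ?invr_gt0//.
apply: le_trans (ler_norm_sum _ _ _) _.
rewrite (big_rem y)//= subrr normr0 add0r.
rewrite [leLHS]big_seq.
apply: (@le_trans _ _ (\sum_(i <- rem y s | i \in rem y s) d)).
  by apply: ler_sum => i /mem_rem is_; exact: H.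
by rewrite -big_seq big_const_seq iter_addr_0 count_predT -[d *+ _]mulr_natl size_rem.
Qed.

(** The simplices of the subdivision are never listed; all that is kept of them is that [sd] depends
    on the cochain only through lists satisfying [refines]. The diameter contracts because the apex
    is within the smaller distance of every vertex of [s], hence of their hull, while the rest of
    the list refines a face. *)
Lemma sd_ext (k : nat) (d : R) s phi psi : 0 <= d -> (size s <= k.+1)%N ->
  (forall x y, x \in s -> y \in s -> `|x - y| <= d) ->
  (forall t, refines (k%:R / k.+1%:R * d) s t -> phi t = psi t) ->
  sd s phi = sd s psi.
Proof.
move=> d0; have [n] := ubnP (size s).
elim: n s phi psi => // n IH [|p s] phi psi sn sk sd_ H.
  by apply: H; split.
rewrite !sd_cons.
have face t : size t = size s -> (forall x, x \in t -> x \in p :: s) ->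
  sd t (fun u => phi (barycenter (p :: s) :: u)) =
  sd t (fun u => psi (barycenter (p :: s) :: u)).
  move=> st ts; apply: IH => //.
  - by rewrite st; exact: sn.
  - by rewrite st; exact: ltnW.
  - by move=> x y /ts ? /ts ?; exact: sd_.
  move=> u [su hu du]; apply: H; split => /=.
  - by rewrite su st.
  - move=> C aC sC x; rewrite inE => /orP[/eqP ->|]; first exact: aC.
    by apply: hu => // y /ts; exact: sC.
  - have bd y : y \in u -> `|barycenter (p :: s) - y| <= k%:R / k.+1%:R * d.
      apply: (hu [set y | `|barycenter (p :: s) - y| <= k%:R / k.+1%:R * d]).
        by move=> v v0 /= Hv; exact: barycenter_dist.
      move=> x /ts xs /=; apply: le_trans (barycenter_dist_mem xs sd_) _.
      apply: ler_wpM2r => //=; rewrite ler_pdivrMr ?ltr0n// mulrAC ler_pdivlMr ?ltr0n//.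
      by rewrite -!natrM ler_nat; move: sk => /=; rewrite ltnS; nia.
    move=> x y; rewrite !inE => /orP[/eqP ->|xu] /orP[/eqP ->|yu].
    + by rewrite subrr normr0 mulr_ge0// divr_ge0.
    + exact: bd.
    + by rewrite distrC; exact: bd.
    + exact: du.
(* [u] collects the vertices that have been passed and kept, so that [u ++ v] runs over the faces of
   [p :: s] as [coboundary] is unfolded. *)
have faces : forall t, (forall x, x \in t -> x \in p :: s) ->
    forall u, size u + (size t).-1 = size s -> (forall x, x \in u -> x \in p :: s) ->
    coboundary t (fun v => sd (u ++ v) (fun w => phi (barycenter (p :: s) :: w))) =
    coboundary t (fun v => sd (u ++ v) (fun w => psi (barycenter (p :: s) :: w))).
  elim=> // q t IHt qts u sz us /=; congr (_ (+) _).
    apply: face; first by rewrite size_cat -sz.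
    move=> x; rewrite mem_cat => /orP[/us//|xt]; apply: qts.
    by rewrite inE xt orbT.
  case: t IHt qts sz => [//|r t] IHt qts sz.
    have E ph : coboundary (r :: t) (fun v => sd (u ++ q :: v) ph) =
    coboundary (r :: t) (fun v => sd (rcons u q ++ v) ph).
    by apply: coboundary_ext => v _; rewrite cat_rcons.
  rewrite !E.
  apply: IHt.
  - by move=> x xt; apply: qts; rewrite inE xt orbT.
  - rewrite size_rcons; move: sz => /= <-; exact: (addSnnS (size u) (size t)).
  - move=> x; rewrite mem_rcons inE => /orP[/eqP->|/us//].
    by apply: qts; rewrite inE eqxx.
exact: (faces (p :: s) _ [::]).
Qed.

Fixpoint sdr r s phi : bool :=
  if r is r'.+1 then sd s (fun t => sdr r' t phi) else phi s.

Lemma sdrD r s phi psi :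
  sdr r s (fun t => phi t (+) psi t) = sdr r s phi (+) sdr r s psi.
Proof.
elim: r s => //= r IH s; rewrite -sdD; congr sd.
by apply/funext => t; exact: IH.
Qed.

Lemma sdr_coboundary r s phi :
  sdr r s (fun t => coboundary t phi) = coboundary s (fun t => sdr r t phi).
Proof.
elim: r s => //= r IH s; rewrite -sd_coboundary; congr sd.
by apply/funext => t; exact: IH.
Qed.

Lemma sdr_ext (k r : nat) (d : R) s phi psi : 0 <= d -> (size s <= k.+1)%N ->
  (forall x y, x \in s -> y \in s -> `|x - y| <= d) ->
  (forall t, refines ((k%:R / k.+1%:R) ^+ r * d) s t -> phi t = psi t) ->
  sdr r s phi = sdr r s psi.
Proof.
elim: r s d => [|r IH] s d d0 sk sd_ H /=.
  by apply: H; split => //; rewrite expr0 mul1r.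
apply: (sd_ext d0 sk sd_) => t [st ht dt]; apply: (IH _ _ _ _ dt).
- by rewrite mulr_ge0// divr_ge0.
- by rewrite st.
move=> u [su hu du]; apply: H; split.
- by rewrite su st.
- by move=> C aC sC; apply: (hu _ aC); exact: (ht _ aC).
- by move=> x y xu yu; rewrite exprSr -mulrA; exact: du.
Qed.

Let barycenterN s : barycenter (map -%R s) = - barycenter s.
Proof. by rewrite /barycenter size_map big_map sumrN scalerN. Qed.

Let coboundary_map s (f : V -> V) phi :
  coboundary (map f s) phi = coboundary s (fun t => phi (map f t)).
Proof. by elim: s phi => //= p s IH phi; rewrite IH. Qed.

Lemma sd_opp s phi : sd (map -%R s) phi = sd s (fun t => phi (map -%R t)).
Proof.
have [n] := ubnP (size s); elim: n s phi => // n IH [|p s] phi sn //.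
rewrite [map _ _]/= sd_cons -[- p :: map -%R s]/(map -%R (p :: s)).
rewrite barycenterN coboundary_map sd_cons.
apply: coboundary_ext => t /= st.
by rewrite IH// st; exact: sn.
Qed.

Lemma sdr_opp r s phi : sdr r (map -%R s) phi = sdr r s (fun t => phi (map -%R t)).
Proof.
elim: r s => //= r IH s; rewrite sd_opp; congr sd; by apply/funext => t.
Qed.

End subdivision.

Section borsuk_ulam.
Context (V : Type) (b : nat -> V -> bool).
Implicit Types (s t : seq V).

(** The k-th edge has to change the label of index [i + k]; so the value 1 on a small simplex means
    that each of the successive labels changes somewhere on it. *)
Fixpoint flips i s : bool :=
  if s is p :: t then
    if t is q :: _ then (b i p (+) b i q) && flips i.+1 t else true
  else true.

Fixpoint flips_last i s : bool :=
  if s is p :: t then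
    if t is q :: _ then (b i p (+) b i q) && flips_last i.+1 t else b i p
  else false.

(* Cup products: [flips] is the product of the coboundaries of the
   0-cochains [b i], [b i.+1], ... *)
Lemma coboundary_flips_last i p q s :
  coboundary (p :: q :: s) (flips_last i) = flips i (p :: q :: s).
Proof.
elim: s i p q => [|r s IH] i p q /=; first by rewrite andbT addbF addbC.
have /= <- := IH i.+1 q r.
have H : forall u, flips_last i [:: p, q & u] = (b i p (+) b i q) && flips_last i.+1 (q :: u) by [].
rewrite -!/(flips_last _ (_ :: _)).
rewrite (_ : coboundary s (fun u => flips_last i [:: p, q, r & u]) =
   (b i p (+) b i q) && coboundary s (fun u => flips_last i.+1 [:: q, r & u])); last first.
  by rewrite -coboundary_andl.
case: (b i p); case: (b i q); case: (b i r) => //=;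
 case: s IH => [|? ?] IH //=; rewrite ?addbA ?addbF ?addFb ?addbb //.
Qed.

End borsuk_ulam.

Section hemispheres.
Context (R : realType) (V : normedModType R) (e : nat -> V).
Implicit Types (phi psi : seq V -> bool) (s : seq V).

(* [hemisphere j] is evaluation on the j-dimensional upper hemisphere of the
   cross-polytope with vertices [e i] and [- e i], i <= j, a union of 2 ^ j
   simplices: the cone with apex [e j] over the sphere of dimension j - 1. *)
Fixpoint hemisphere j phi : bool :=
  if j is i.+1 then hemisphere i (fun s => phi (e j :: s)) (+)
                    hemisphere i (fun s => phi (e j :: map -%R s))
  else phi [:: e 0].

Definition signed_simplex (eps : nat -> bool) j :=
  [seq (if eps i then e i else - e i) | i <- rev (iota 0 j.+1)].

Lemma signed_simplexS eps j : signed_simplex eps j.+1 =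
  (if eps j.+1 then e j.+1 else - e j.+1) :: signed_simplex eps j.
Proof. by rewrite /signed_simplex -addn1 iotaD rev_cat. Qed.

Lemma signed_simplex_opp eps j :
  map -%R (signed_simplex eps j) = signed_simplex (negb \o eps) j.
Proof.
rewrite /signed_simplex -map_comp; apply: eq_map => i /=.
by case: (eps i); rewrite ?opprK.
Qed.

Lemma eq_signed_simplex eps eps' j : (forall i, (i <= j)%N -> eps i = eps' i) ->
  signed_simplex eps j = signed_simplex eps' j.
Proof.
move=> H; apply/eq_in_map => i; rewrite mem_rev mem_iota add0n => /andP[_ ij].
by rewrite H.
Qed.

Lemma hemisphere_ext j phi psi :
  (forall eps, phi (signed_simplex eps j) = psi (signed_simplex eps j)) ->
  hemisphere j phi = hemisphere j psi.
Proof.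
elim: j phi psi => [|j IH] phi psi H /=; first exact: (H (fun=> true)).
have K eps : phi (e j.+1 :: signed_simplex eps j) = psi (e j.+1 :: signed_simplex eps j).
  have := H (fun i => (i == j.+1) || eps i); rewrite signed_simplexS eqxx /=.
  rewrite (@eq_signed_simplex _ eps)// => i ij; rewrite (_ : i == _ = false)//.
  by apply/negbTE; rewrite neq_ltn ltnS ij.
by congr (_ (+) _); apply: IH => eps; rewrite ?signed_simplex_opp K.
Qed.

Lemma hemisphereD j phi psi : hemisphere j (fun s => phi s (+) psi s) =
  hemisphere j phi (+) hemisphere j psi.
Proof. by elim: j phi psi => //= j IH phi psi; rewrite !IH addbACA. Qed.

Let coboundary_map s (f : V -> V) phi :
  coboundary (map f s) phi = coboundary s (fun t => phi (map f t)).
Proof. by elim: s phi => //= p s IH phi; rewrite IH. Qed.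

(** The hemisphere is a cone over the sphere made of two antipodal hemispheres. Its boundary is that
    sphere plus the cone over the boundary of the sphere, and the latter is zero ([E]): antipodal
    hemispheres have the same boundary. *)
Lemma hemisphere_coboundary j phi :
  hemisphere j.+1 (fun s => coboundary s phi) =
  hemisphere j phi (+) hemisphere j (fun s => phi (map -%R s)).
Proof.
elim: j phi => [|j IH] phi; first by rewrite /= !addbF; move: (phi [:: e 1]) (phi [:: e 0]) (phi [:: - e 0]); do 3 case.
have E : forall psi, hemisphere j.+1 (fun s => coboundary s psi) (+)
   hemisphere j.+1 (fun s => coboundary (map -%R s) psi) = false.
  move=> psi; under [in X in _ (+) X]eq_fun do rewrite coboundary_map.
  rewrite !IH; set A := hemisphere _ psi; set B := hemisphere _ _; set C := hemisphere _ _.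
  rewrite (_ : C = A) ?[B (+) A]addbC ?addbb// /C /A; congr hemisphere.
  by apply/funext => s; rewrite -map_comp map_id_in// => x _ /=; rewrite opprK.
rewrite -[LHS]/(hemisphere j.+1 (fun s => phi s (+) coboundary s (fun u => phi (e j.+2 :: u))) (+)
  hemisphere j.+1 (fun s => phi (map -%R s) (+) coboundary (map -%R s) (fun u => phi (e j.+2 :: u)))).
by rewrite !hemisphereD addbACA E addbF.
Qed.

End hemispheres.

Lemma compact_uniform_continuity (R : realType) (U W : normedModType R)
    (K : set U) (f : U -> W) (e : R) : compact K ->
  (forall x, K x -> {for x, continuous f}) -> 0 < e ->
  exists2 d : R, 0 < d & forall x y, K x -> `|x - y| < d -> `|f x - f y| < e.
Proof.
move=> /compact_near_coveringP cK cf e0.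
have := cK R (0^'+) (fun (d : R) x => forall y, `|x - y| < d -> `|f x - f y| < e) _.
case=> [x Kx|d /= d0 H].
  have e20 : 0 < e / 2 by rewrite divr_gt0.
  have /cvgrPdist_lt/(_ _ e20)/nbhs_ballP[r /= r0 Hr] := cf x Kx.
  exists (ball x (r / 2), [set d | d < r / 2]) => /=.
    split; first by apply: nbhsx_ballx; rewrite divr_gt0.
    by apply: nbhs_right_lt; rewrite divr_gt0.
  move=> [x' d] /= [xx' dr] y x'y.
  rewrite -[f x'](subrK (f x)) -addrA (le_lt_trans (ler_normD _ _))// [ltRHS]splitr ltrD//.
    rewrite distrC; apply: Hr => /=; rewrite -ball_normE /= ; move: xx'; rewrite -ball_normE /= => xx'; rewrite (lt_trans xx')//.
    by rewrite ltr_pdivrMr// ltr_pMr// ltr1n.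
  apply: Hr; move: xx'; rewrite -!ball_normE /= => xx'; rewrite -[x](subrK x') -addrA (le_lt_trans (ler_normD _ _))//.
  by rewrite [ltRHS]splitr ltrD// (lt_trans x'y).
exists (d / 2); first by rewrite divr_gt0.
move=> x y Kx; apply: H => //=; last by rewrite divr_gt0.
by rewrite sub0r normrN gtr0_norm ?divr_gt0// ltr_pdivrMr// ltr_pMr// ltr1n.
Qed.

(** * The Borsuk-Ulam theorem *)

Section odd_zero.
Context (R : realType) (m : nat).
Local Notation V := 'rV[R]_m.+1.
Local Notation W := 'rV[R]_m.

(** The sign of the first nonzero coordinate: a label that is odd at every nonzero point. It breaks
    ties where a coordinate of [f] vanishes, so that all labels are odd. *)
Let lexpos (x : V) := [exists i, (0 < x ord0 i) && [forall j : 'I_m.+1, (j < i)%N ==> (x ord0 j == 0)]].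

Let lexposN x : x != 0 -> lexpos (- x) = ~~ lexpos x.
Proof.
move=> x0.
have [i0 xi0] : exists i, x ord0 i != 0.
  apply/existsP; apply: contraR x0 => /existsPn H; apply/eqP/rowP => i.
  by rewrite mxE; apply/eqP; have := H i; rewrite negbK.
case: (@arg_minnP _ i0 (fun i => x ord0 i != 0) (@nat_of_ord _)) => //= i xi mini.
have xj (j : 'I_m.+1) : (j < i)%N -> x ord0 j = 0.
  by move=> ji; apply/eqP; apply: contraTT ji => /mini; rewrite -leqNgt.
have E (y : V) : (forall j : 'I_m.+1, (j < i)%N -> y ord0 j = 0) -> y ord0 i != 0 ->
    lexpos y = (0 < y ord0 i).
  move=> yj yi; apply/existsP/idP => [[k /andP[yk /forallP H]]|yi0].
    have [ki|ik|/val_inj <-//] := ltngtP k i; first by rewrite yj ?ltxx in yk.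
    by have := H i; rewrite ik /= (negbTE yi).
  by exists i; rewrite yi0; apply/forallP => j; apply/implyP => /yj ->.
rewrite !E ?mxE ?oppr_eq0 ?oppr_gt0 //; last by move=> j /xj; rewrite mxE => ->; rewrite oppr0.
by rewrite -leNgt lt_neqAle xi.
Qed.

Context (f : V -> W).
Hypothesis f_odd : forall x, f (- x) = - f x.

Let sgn (i : nat) (x : V) : bool :=
  if insub i is Some k then (0 < f x ord0 k) || ((f x ord0 k == 0) && lexpos x)
  else lexpos x.

Let sgnN i x : x != 0 -> sgn i (- x) = ~~ sgn i x.
Proof.
move=> x0; rewrite /sgn; case: insub => [k|]; last exact: lexposN.
rewrite f_odd mxE oppr_gt0 oppr_eq0 lexposN//.
by case: ltgtP => //=; rewrite ?andbT.
Qed.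

Let sphere : set V := [set x | \sum_i `|x ord0 i| = 1].

Let sphere0 x : sphere x -> x != 0.
Proof.
move=> + ; apply: contraPneq => ->; rewrite /sphere /= big1 ?ltr01.
  by move=> /eqP; rewrite eq_sym oner_eq0.
by move=> i _; rewrite mxE normr0.
Qed.

Let e (i : nat) : V := delta_mx ord0 (inord i).

(** The l^1 sphere is not closed under averages but each of its facets is; this keeps the subdivided
    simplices of the cross-polytope on the sphere. *)
Let face (eps : nat -> bool) : set V := [set x | (forall i : 'I_m.+1, 0 <= (-1) ^+ (eps i) * x ord0 i) /\
  \sum_(i < m.+1) (-1) ^+ (eps i) * x ord0 i = 1].

Let face_sphere eps : face eps `<=` sphere.
Proof.
move=> x [x0 x1]; rewrite /sphere /= -[RHS]x1; apply: eq_bigr => i _.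
by rewrite -[RHS](ger0_norm (x0 i)) normrM normrX normrN1 expr1n mul1r.
Qed.

Let face_avg eps : average_closed (face eps).
Proof.
move=> s s0 Hs.
have ns : (0 < (size s)%:R :> R) by rewrite ltr0n lt0n size_eq0.
have E i : barycenter s ord0 i = (size s)%:R^-1 * \sum_(x <- s) x ord0 i.
  by rewrite /barycenter !mxE summxE.
split=> [i|].
  rewrite E mulrCA mulr_ge0 ?invr_ge0 ?(ltW ns)// mulr_sumr big_seq sumr_ge0// => x xs.
  by have [] := Hs x xs.
under eq_bigr do rewrite E mulrCA mulr_sumr.
rewrite -mulr_sumr exchange_big /= big_seq.
rewrite (eq_bigr (fun=> 1)); last by move=> x xs; have [] := Hs x xs.
by rewrite -big_seq big_const_seq iter_addr_0 count_predT mulVf ?gt_eqF.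
Qed.

Let simplex_face eps j : (j <= m)%N ->
  exists eps', forall x, x \in signed_simplex e eps j -> face eps' x.
Proof.
(* True stands for the sign + in [signed_simplex] and for - in [face]. *)
move=> jm; exists (negb \o eps) => x /mapP[i]; rewrite mem_rev mem_iota add0n ltnS => /andP[_ ij] ->.
have im : (i < m.+1)%N by rewrite ltnS (leq_trans ij).
have -> : (if eps i then e i else - e i) = (-1) ^+ (~~ eps i) *: e i.
  by case: (eps i); rewrite ?expr0 ?scale1r ?expr1 ?scaleN1r.
split=> [l|] /=.
  rewrite !mxE eqxx /=; case: eqVneq => [->|]; last by rewrite !mulr0.
  by rewrite inordK// mulr1 -expr2 sqrr_sign ler01.
rewrite (bigD1 (inord i))//= big1 ?addr0.
  by rewrite !mxE !eqxx inordK// mulr1 -expr2 sqrr_sign.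
by move=> l ji; rewrite !mxE eqxx /= (negbTE ji) !mulr0.
Qed.

Let signed_dist eps j x y : x \in signed_simplex e eps j -> y \in signed_simplex e eps j ->
  `|x - y| <= 2.
Proof.
have N z : z \in signed_simplex e eps j -> `|z| <= 1.
  move=> /mapP[i _ ->].
  have : `|e i| <= 1.
    rewrite /e [leLHS]mx_normrE; apply: bigmax_le => //= -[l k] _.
    by rewrite mxE; case: (_ && _); rewrite ?normr1 ?normr0.
  by case: (eps i); rewrite ?normrN.
move=> /N xs /N ys; apply: le_trans (ler_normB _ _) _.
by rewrite (natrD _ 1 1) lerD.
Qed.

Let size_simplex eps j : size (signed_simplex e eps j) = j.+1.
Proof. by rewrite size_map size_rev size_iota. Qed.

Let sdr_simplex_ext r eps j phi psi : (j <= m)%N ->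
  (forall t, size t = j.+1 -> (forall x, x \in t -> sphere x) ->
    (forall x y, x \in t -> y \in t -> `|x - y| <= (m%:R / m.+1%:R) ^+ r * 2) ->
    phi t = psi t) ->
  sdr r (signed_simplex e eps j) phi = sdr r (signed_simplex e eps j) psi.
Proof.
move=> jm H; apply: (@sdr_ext _ _ m r 2) => //.
- by rewrite size_simplex.
- by move=> x y; exact: signed_dist.
move=> t [st ht dt]; apply: H => //; first by rewrite st size_simplex.
have [eps' He] := simplex_face eps jm.
by move=> x xt; apply: (@face_sphere eps'); exact: (ht (face eps') (@face_avg eps') He).
Qed.

(** Under the antipode both labels of an edge flip, so the edge factors do not change; only the last
    factor, a bare label, changes by 1. *)
Let flips_lastN i t : t != [::] -> (forall x, x \in t -> sphere x) ->
  flips_last sgn i t (+) flips_last sgn i (map -%R t) = flips sgn i t.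
Proof.
elim: t i => // p t IH i _ H; case: t IH H => [|q t] IH H.
  by rewrite /= sgnN ?addbN ?addbb//; apply/sphere0/H; rewrite inE eqxx.
have /= <- := IH i.+1 isT (fun x xt => H x (mem_behead (s := [:: p, q & t]) xt)).
have pq x : x \in [:: p, q & t] -> sgn i (- x) = ~~ sgn i x by move=> /H /sphere0; exact: sgnN.
by rewrite !pq ?inE ?eqxx ?orbT// addbN addNb negbK andb_addr.
Qed.

(** A form of Tucker's lemma. [flips] is the coboundary of [flips_last], so its value on a
    hemisphere is that of [flips_last] on two antipodal hemispheres one dimension below, which
    oddness of the labels turns into [flips] again. On a point the empty product is 1. *)
Let hemi_flips r j : (j <= m)%N ->
  hemisphere e j (fun s => sdr r s (flips sgn 0)) = true.
Proof.
elim: j => [|j IH] jm.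
  have H : forall p, sdr r [:: p] (flips sgn 0) = true by elim: r => //= r IH p; rewrite /sd /= addbF IH.
  exact: H.
rewrite -[RHS]IH; last exact: ltnW.
rewrite (@hemisphere_ext _ _ e j.+1 _ (fun s => coboundary s (fun t => sdr r t (flips_last sgn 0)))); last first.
  move=> eps; rewrite -sdr_coboundary; apply: sdr_simplex_ext => //.
  by move=> [|p [|q t]]// _ _ _; rewrite coboundary_flips_last.
rewrite hemisphere_coboundary -hemisphereD; apply: hemisphere_ext => eps.
rewrite sdr_opp -sdrD; apply: sdr_simplex_ext; first exact: ltnW.
by move=> t st ts _; apply: flips_lastN => //; rewrite -size_eq0 st.
Qed.

Hypothesis f_cont : forall x, x != 0 -> {for x, continuous f}.

Let flips_nth i t k : flips sgn i t -> (k.+1 < size t)%N ->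
  sgn (i + k) (nth 0 t k) != sgn (i + k) (nth 0 t k.+1).
Proof.
elim: t i k => [|p t IH] i k //=; case: t IH => [|q t] IH //= /andP[H1 H2].
case: k => [_|k kt]; first by rewrite addn0; move: H1; case: sgn; case: sgn.
by rewrite addnS -addSn; exact: (IH i.+1 k).
Qed.

(** Otherwise [|f|] has a positive minimum on the sphere. On a fine subdivision [hemi_flips] yields
    a small simplex along which every coordinate of [f] changes sign, and there [|f|] falls below
    the minimum. *)
Lemma odd_continuous_zero : exists2 x, x != 0 & f x = 0.
Proof.
apply: contrapT => nf.
have f0 x : x != 0 -> f x != 0 by move=> x0; apply/eqP => fx; apply: nf; exists x.
have cs : compact sphere.
  apply: bounded_closed_compact.
    exists 1; split=> // M M1 x sx /=; rewrite [leLHS]mx_normrE; apply: bigmax_le => [|[i j] _].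
      exact: ltW (lt_trans ltr01 M1).
    rewrite /= (ord1 i) (le_trans _ (ltW M1))// -[leRHS]sx (bigD1 j)//= lerDl.
    by apply: sumr_ge0.
  apply: (@closed_comp _ _ (fun x : V => \sum_i `|x ord0 i|) [set 1]); last exact: closed_eq.
  have cN : continuous (fun x : V => \sum_i `|x ord0 i|).
    apply: continuous_big => [|i _ x]; first exact: add_continuous.
    by apply: (@continuous_comp _ _ _ (fun x : V => x ord0 i) Num.norm); [exact: coord_continuous|exact: norm_continuous].
  by move=> x _; exact: cN.
have sne : sphere !=set0.
  exists (e 0); apply: (@face_sphere (fun=> false)); split=> [j|].
    by rewrite expr0 mul1r mxE; case: (_ && _).
  rewrite (bigD1 (inord 0))//= big1 ?addr0; first by rewrite expr0 mul1r mxE !eqxx.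
  by move=> j j0; rewrite mxE (negbTE j0) mulr0.
have [x0 sx0 min0] : exists2 c, c \in sphere & forall t, t \in sphere -> `|f c| <= `|f t|.
  apply: compact_EVT_min => //; apply: continuous_in_subspaceT => x /set_mem /sphere0 x0.
  by apply: (@continuous_comp _ _ _ f Num.norm); [exact: f_cont|exact: norm_continuous].
have d0 : 0 < `|f x0| by rewrite normr_gt0 f0 ?sphere0//; exact: set_mem.
have [d dp Hd] := compact_uniform_continuity cs (fun x xs => f_cont (sphere0 xs)) (divr_gt0 d0 (ltr0Sn R 1) : 0 < `|f x0| / 2).
have [r Hr] : exists r, (m%:R / m.+1%:R) ^+ r * 2 < d.
  have q1 : `|m%:R / m.+1%:R : R| < 1.
    by rewrite ger0_norm ?divr_ge0// ltr_pdivrMr ?ltr0n// mul1r ltr_nat.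
  have := cvg_expr q1 => /cvgrPdist_lt/(_ (d / 2)) [|N _ /(_ N (leqnn _))]; first by rewrite divr_gt0.
  rewrite /= sub0r normrN => HN; exists N; rewrite -ltr_pdivlMr//.
  exact: le_lt_trans (ler_norm _) HN.
have := hemi_flips r (leqnn m).
(* The new cochain is zero, written as a sum of two equal terms: if [flips] vanished on all small
   simplices, the value 1 of [hemi_flips] would be 0. *)
rewrite (@hemisphere_ext _ _ e m _ (fun s => sdr r s (fun t => size t == 0) (+) sdr r s (fun t => size t == 0))).
  by rewrite hemisphereD addbb.
move=> eps; rewrite -sdrD; apply: sdr_simplex_ext => // t st ts dt; rewrite addbb.
apply/negP => fl.
have tin k : (k < m.+1)%N -> nth 0 t k \in t by move=> km; rewrite mem_nth// st.
have close k l : (k < m.+1)%N -> (l < m.+1)%N -> `|f (nth 0 t k) - f (nth 0 t l)| < `|f x0| / 2.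
  move=> km lm; apply: Hd; first exact/ts/tin.
  by apply: le_lt_trans Hr; apply: dt; exact: tin.
have := min0 (nth 0 t 0) (mem_set (ts _ (tin 0%N isT))).
apply/negP; rewrite -ltNge [ltLHS]mx_normrE; apply: bigmax_lt => //= -[i k] _ /=.
rewrite (ord1 i) [ltRHS]splitr.
have km : (k.+1 < m.+1)%N by rewrite ltnS.
have coord (x y : W) e0 : `|x - y| < e0 -> `|x ord0 k - y ord0 k| < e0.
  move=> xy; apply: le_lt_trans xy; rewrite [leRHS]mx_normrE.
  by apply: (le_trans _ (le_bigmax _ _ (ord0, k))); rewrite /= !mxE.
rewrite -[f (nth 0 t 0) ord0 k](subrK (f (nth 0 t k) ord0 k)) (le_lt_trans (ler_normD _ _))//.
apply: ltrD; first by apply/coord/close => //; exact: ltnW.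
have := coord _ _ _ (close k k.+1 (ltnW km) km); apply: le_lt_trans.
have := flips_nth fl (k := k); rewrite st => /(_ km); rewrite add0n /sgn valK.
(* A change of label, ties included, bounds a value by its increment. *)
have key (u v : R) (p q : bool) : (0 < u) || (u == 0) && p != (0 < v) || (v == 0) && q ->
    `|u| <= `|u - v|.
  case: (ltgtP u 0) => [u0|u0|->] /= uv; last by rewrite normr0.
  - case: (ltgtP v 0) uv => //= [v0 _|-> _]; last by rewrite subr0.
    by rewrite ltr0_norm// ler0_norm; lra.
  - case: (ltgtP v 0) uv => //= [v0 _|-> _]; last by rewrite subr0.
    by rewrite gtr0_norm// ger0_norm; lra.
exact: key.
Qed.

End odd_zero.

End BorsukUlam.
Import BorsukUlam.

Module MeasureTools.

(** * Completed measures and Borel measures *)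

Section completed.
Local Open Scope ereal_scope.
Context d (T : measurableType d) (R : realType).
Variable mu : {measure set T -> \bar R}.
Local Notation CT := (caratheodory_type (mu^*)%mu).
Local Notation cmu := (@completed_measure_extension _ _ _ mu).

Lemma borel_caratheodory (A : set T) : measurable A -> measurable (A : set CT).
Proof. exact: caratheodory_measurable_mu_ext. Qed.

Lemma measurable_fun_completed d' (T' : measurableType d') (f : T -> T') :
  measurable_fun setT f -> measurable_fun setT (f : CT -> T').
Proof.
move=> mf _ Y mY; rewrite setTI; apply: borel_caratheodory.
by rewrite -[X in _.-measurable X]setTI; exact: mf.
Qed.

Lemma completed_measureE (A : set T) : measurable A -> cmu A = mu A.
Proof. by move=> mA; exact: measurable_mu_extE. Qed.

(** The identity from the completed space to the Borel space is measurable and pushes the completed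
    measure forward to the Borel one. *)
Lemma ge0_integral_completed (f : T -> \bar R) : measurable_fun setT f ->
  (forall x, 0 <= f x) -> \int[cmu]_x f x = \int[mu]_x f x.
Proof.
move=> mf f0.
have mid : measurable_fun setT (idfun : CT -> T) := measurable_fun_completed (@measurable_id _ T setT).
rewrite -[LHS]/(\int[cmu]_(x in (idfun : CT -> T) @^-1` setT) (f \o (idfun : CT -> T)) x).
rewrite -ge0_integral_pushforward//.
by apply: eq_measure_integral => A mA _; exact: completed_measureE.
Qed.

(** The outer measure provides Borel coverings of measure at most [1 / (k + 1)]; their intersection
    over [k] is the required null set. *)
Lemma completed_null (A : set CT) : measurable A -> cmu A = 0 ->
  exists B : set T, [/\ measurable B, mu B = 0 & A `<=` B].
Proof.
move=> mA A0.
have H k : exists B : set T, [/\ measurable B, mu B <= (k.+1%:R^-1)%:E & A `<=` B].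
  have : ((mu^*)%mu A < (k.+1%:R^-1)%:E) by rewrite [ltLHS]A0 lte_fin invr_gt0.
  move=> /ereal_inf_lt[_ [/= F [mF AF] <-] FA].
  exists (\bigcup_i F i); split => //; first exact: bigcupT_measurable.
  apply: le_trans (ltW FA); apply: (@measure_sigma_subadditive _ _ _ mu) => //; exact: bigcupT_measurable.
have [B HB] := choice H.
exists (\bigcap_k B k); split.
- by apply: bigcapT_measurable => k; case: (HB k).
- apply/eqP; rewrite -measure_le0; apply/lee_addgt0Pr => e e0; rewrite add0e.
  have [k ke] : exists k, (k.+1%:R^-1 < e :> R)%R.
    by have [k _ /(_ k (leqnn k)) ke] := near_infty_natSinv_lt (PosNum e0); exists k.
  have [mBk Bk _] := HB k.
  apply: (@le_trans _ _ (mu (B k))).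
    apply: le_measure; rewrite ?inE//; last exact: bigcap_inf.
    by apply: bigcapT_measurable => l; case: (HB l).
  by apply: le_trans Bk _; rewrite lee_fin ltW.
- by move=> x Ax k _; case: (HB k) => _ _; apply.
Qed.

End completed.

Section completed_sigma_finite.
Local Open Scope ereal_scope.
Context d (T : measurableType d) (R : realType).
Variable mu : {sigma_finite_measure set T -> \bar R}.
Local Notation CT := (caratheodory_type (mu^*)%mu).
Local Notation cmu := (@completed_measure_extension _ _ _ mu).

(* A set of finite measure is approximated from outside by a countable
   intersection of coverings. *)
Lemma completed_measurable_hull (E : set CT) : measurable E -> cmu E < +oo ->
  exists A : set T, [/\ measurable A, E `<=` A & cmu (A `\` E) = 0].
Proof.
move=> mE Eoo.
have H k : exists B : set T, [/\ measurable B, mu B <= cmu E + (k.+1%:R^-1)%:E & E `<=` B].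
  have : ((mu^*)%mu E < cmu E + (k.+1%:R^-1)%:E).
    by rewrite -[ltLHS]/(cmu E) lteDl ?lte_fin ?invr_gt0// ge0_fin_numE// measure_ge0.
  move=> /ereal_inf_lt[_ [/= F [mF AF] <-] FA].
  exists (\bigcup_i F i); split => //; first exact: bigcupT_measurable.
  apply: le_trans (ltW FA); apply: (@measure_sigma_subadditive _ _ _ mu) => //; exact: bigcupT_measurable.
have [B HB] := choice H.
have mB : measurable (\bigcap_k B k) by apply: bigcapT_measurable => k; case: (HB k).
have EB : E `<=` \bigcap_k B k by move=> x Ax k _; case: (HB k) => _ _; apply.
exists (\bigcap_k B k); split => //.
have mBc : measurable ((\bigcap_k B k) : set CT) by exact: borel_caratheodory.
have le : cmu (\bigcap_k B k) <= cmu E.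
  apply/lee_addgt0Pr => e e0.
  have [k ke] : exists k, (k.+1%:R^-1 < e :> R)%R.
    by have [k _ /(_ k (leqnn k)) ke] := near_infty_natSinv_lt (PosNum e0); exists k.
  have [mBk Bk _] := HB k.
  rewrite completed_measureE//; apply: (@le_trans _ _ (mu (B k))).
    by apply: le_measure; rewrite ?inE//; exact: bigcap_inf.
  by apply: le_trans Bk _; rewrite leeD2l// lee_fin ltW.
have := @measureD _ _ _ cmu _ _ mBc mE (le_lt_trans le Eoo).
rewrite setIidr// => ->; apply/eqP; rewrite eq_le sube_le0 le/= sube_ge0.
  by apply: (@le_measure _ _ _ cmu); rewrite ?inE.
by apply/orP; left; rewrite ge0_fin_numE ?measure_ge0.
Qed.

(** Pieces of finite measure have Borel hulls that exceed them by a subset of a Borel null set;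
    sigma-finiteness glues the pieces. *)
Lemma completed_measurable_approx (E : set CT) : measurable E ->
  exists A B : set T, [/\ measurable A, measurable B, mu B = 0 &
    forall x, ~ B x -> (A x <-> E x)].
Proof.
move=> mE; have [F [TF mF]] := sigma_finiteT mu.
have H k : exists AB : set T * set T, [/\ measurable AB.1, measurable AB.2, mu AB.2 = 0 &
    E `&` F k `<=` AB.1 /\ AB.1 `\` (E `&` F k) `<=` AB.2].
  have [mFk Fk] := mF k.
  have mEF : measurable (E `&` F k : set CT).
    by apply: measurableI => //; exact: borel_caratheodory.
  have EFoo : cmu (E `&` F k) < +oo.
    apply: (@le_lt_trans _ _ (cmu (F k : set CT))); last by rewrite (completed_measureE mu mFk).
    apply: (@le_measure _ _ _ cmu (E `&` F k) (F k : set CT)); rewrite ?inE//.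
      exact: borel_caratheodory.
  have [A [mA EA A0]] := completed_measurable_hull mEF EFoo.
  have mAE : measurable (A `\` (E `&` F k) : set CT).
    by apply: measurableD => //; exact: borel_caratheodory.
  have [B [mB B0 AB]] := completed_null mAE A0.
  by exists (A, B).
have [AB HAB] := choice H.
exists (\bigcup_k ((AB k).1 `&` F k)), (\bigcup_k (AB k).2); split.
- by apply: bigcupT_measurable => k; apply: measurableI; [case: (HAB k)|case: (mF k)].
- by apply: bigcupT_measurable => k; case: (HAB k).
- apply/eqP; rewrite -measure_le0; apply: le_trans (@measure_sigma_subadditive _ _ _ mu _ (fun k => (AB k).2) _ _ _) _ => //.
  + by move=> k; case: (HAB k).
  + by apply: bigcupT_measurable => k; case: (HAB k).
  + by rewrite eseries0// => k _ _; case: (HAB k).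
- move=> x Bx; split => [[k _ [Ax Fx]]|Ex].
    apply: contrapT => Ex; apply: Bx; exists k => //.
    by have [_ _ _ [_]] := HAB k; apply; split => // -[].
  have : (\bigcup_i F i) x by rewrite -TF.
  move=> [k _ Fx]; exists k => //; split => //.
  by have [_ _ _ [+ _]] := HAB k; apply.
Qed.

(** Approximate the superlevel sets at rational heights and put the function to 0 on the union [N]
    of the countably many exceptional sets. This is the passage from functions on the completed
    spaces to Borel ones, for which product integrals and translations are computed. *)
Lemma completed_measurable_fun (f : CT -> R) : measurable_fun setT f ->
  exists (g : T -> R) (B : set T), [/\ measurable_fun setT g, measurable B, mu B = 0 &
    forall x, ~ B x -> g x = f x].
Proof.
move=> mf.
have H (q : rat) : exists AB : set T * set T, [/\ measurable AB.1, measurable AB.2, mu AB.2 = 0 &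
    forall x, ~ AB.2 x -> (AB.1 x <-> (ratr q < f x)%R)].
  have mE : measurable (f @^-1` `](ratr q : R), +oo[ : set CT).
    by rewrite -[X in _.-measurable X]setTI; exact: mf.
  have [A [B [mA mB B0 AB]]] := completed_measurable_approx mE.
  exists (A, B); split => //= x /AB ->.
  by rewrite /= in_itv/= andbT.
have [AB HAB] := choice H.
pose F k := (AB (odflt 0%R (unpickle k))).2.
have mF k : measurable (F k) by rewrite /F; case: (HAB (odflt 0%R (unpickle k))).
pose N := \bigcup_k F k.
have mN : measurable N by exact: bigcupT_measurable.
have NP x q : ~ N x -> ~ (AB q).2 x.
  by move=> Nx ABx; apply: Nx; exists (pickle q) => //; rewrite /F pickleK.
pose g x := if x \in N then 0%R else f x.
exists g, N; split => //; last by move=> x Nx; rewrite /g memNset.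
- move=> _; apply: (measurability _ (RGenOInfty.measurableE R)) => // _ [_ [c ->] <-]; rewrite setTI.
  rewrite [X in measurable X](_ : _ =
    \bigcup_(q : rat) (if (c < ratr q)%R then (AB q).1 `\` N else set0) `|`
    (if (c < 0)%R then N else set0)).
    apply: measurableU; last by case: ifP.
    apply: bigcupT_measurable_rat => q; case: ifP => // _.
    by apply: measurableD => //; case: (HAB q).
  apply/seteqP; split=> x /=; rewrite in_itv/= andbT /g.
    case: ifPn => [/set_mem Nx c0|]; first by right; rewrite c0.
    rewrite notin_setE => Nx cf; left.
    have [q] := rat_in_itvoo cf; rewrite in_itv /= => /andP[cq qf].
    exists q => //; rewrite cq; split => //.
    by have [_ _ _ ->] := HAB q; last exact: NP.
  case=> [[q _]|].
    case: ifP => // cq [ABx Nx]; rewrite memNset//; apply: lt_trans cq _.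
    by have [_ _ _ <-] := HAB q; last exact: NP.
  by case: ifP => // c0 Nx; rewrite mem_set.
- apply/eqP; rewrite -measure_le0; apply: le_trans (@measure_sigma_subadditive _ _ _ mu _ F mF mN _) _ => //.
  by rewrite eseries0// => k _ _; rewrite /F; case: (HAB (odflt 0%R (unpickle k))).
Qed.

End completed_sigma_finite.

Section density.
Local Open Scope ereal_scope.
Context d (T : measurableType d) (R : realType).
Variables (mu nu : {measure set T -> \bar R}) (k : T -> R).
Hypothesis k0 : forall x, (0 <= k x)%R.
Hypothesis mk : measurable_fun setT k.
Hypothesis nuE : forall A, measurable A -> nu A = \int[mu]_(x in A) (k x)%:E.

Import HBNNSimple.

(** True for indicators by [nuE], then for simple functions, then by monotone convergence. It is
    applied to [nu], which is defined by a density with respect to [dxdy]. *)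
Lemma ge0_integral_density (f : T -> \bar R) (D : set T) : measurable D ->
  measurable_fun D f -> (forall x, 0 <= f x) ->
  \int[nu]_(z in D) f z = \int[mu]_(z in D) (f z * (k z)%:E).
Proof.
have mkE : measurable_fun setT (EFin \o k) by exact/measurable_EFinP.
have mkD E : measurable_fun E (EFin \o k) by exact: measurable_funTS.
move=> mE mf f0; pose h := nnsfun_approx mE mf.
have mhD n : measurable_fun D (EFin \o h n).
  by apply/measurable_EFinP; apply: measurable_funTS; exact/measurable_funP.
have hnd x a b : D x -> (a <= b)%N -> (h a x <= h b x)%R.
  by move=> Dx ab; exact/lefP/nd_nnsfun_approx.
have hcvg x : D x -> (EFin \o h n) x @[n --> \oo] --> f x.
  by move=> Dx; exact: cvg_nnsfun_approx.
have -> : \int[nu]_(x in D) f x = lim (\int[nu]_(x in D) (EFin \o h n) x @[n --> \oo]).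
  under eq_integral => x /[!inE] /hcvg /cvg_lim <- //.
  apply: (@monotone_convergence _ _ _ nu D mE (fun n => EFin \o h n)) => //.
  - by move=> n x Ex //=; rewrite lee_fin.
  - by move=> x Ex a b ab; rewrite lee_fin; exact: hnd.
have -> : \int[mu]_(x in D) (f x * (k x)%:E) =
    lim (\int[mu]_(x in D) ((EFin \o h n) x * (k x)%:E) @[n --> \oo]).
  have fg x : D x -> ((EFin \o h n) x * (k x)%:E) @[n --> \oo] --> f x * (k x)%:E.
    by move=> Ex; apply: cvgeZr => //; exact: hcvg.
  under eq_integral => x /[!inE] /fg /cvg_lim <- //.
  apply: (@monotone_convergence _ _ _ mu D mE (fun n x => (EFin \o h n) x * (k x)%:E)) => //.
  - by move=> n; apply/emeasurable_funM.
  - by move=> n x Ex //=; rewrite mule_ge0 ?lee_fin.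
  - move=> x Ex a b ab/=; rewrite lee_wpmul2r ?lee_fin//; exact: hnd.
suff suf n : \int[nu]_(x in D) (EFin \o h n) x =
    \int[mu]_(x in D) ((EFin \o h n) x * (k x)%:E).
  by under eq_fun do rewrite suf.
transitivity (\int[nu]_(x in D)
    (\sum_(y \in range (h n)) (y * \1_(h n @^-1` [set y]) x)%:E)).
  by apply: eq_integral => t tE; rewrite /= fimfunE -fsumEFin.
have indich m r : measurable_fun D (fun x => (r * \1_(h m @^-1` [set r]) x)%:E).
  by apply: (measurable_comp measurableT) => //; exact: measurable_funM.
rewrite ge0_integral_fsum//; last by move=> m y Ey; exact: nnfun_muleindic_ge0.
transitivity (\int[mu]_(x in D) (\sum_(y \in range (h n))
    (y * \1_(h n @^-1` [set y]) x)%:E * (k x)%:E)); last first.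
  apply: eq_integral => x xE.
  rewrite -ge0_mule_fsuml => [|y]; last exact: nnfun_muleindic_ge0.
  by rewrite fsumEFin // -(fimfunE _ x).
rewrite ge0_integral_fsum//; last 2 first.
  - by move=> y; apply: emeasurable_funM.
  - by move=> m y Ey; rewrite mule_ge0 ?lee_fin// -lee_fin EFinM nnfun_muleindic_ge0.
apply: eq_fsbigr => r rhn.
under eq_integral do rewrite EFinM.
rewrite integralZl_indic_nnsfun => //.
under [RHS]eq_integral do rewrite EFinM -muleA.
rewrite [RHS]ge0_integralZl//.
- congr (_ * _); under [RHS]eq_integral do rewrite muleC.
  rewrite [RHS](eq_integral ((EFin \o k) \_ (h n @^-1` [set r]))); last first.
    by move=> x xE; rewrite epatch_indic.
  by rewrite -integral_mkcondr -nuE ?integral_indic// 1?setIC//; exact: measurableI.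
- by apply: emeasurable_funM => //; exact/measurable_EFinP.
- by move=> t Et; rewrite mule_ge0 ?lee_fin.
- by move: rhn; rewrite inE => -[t _ <-]; rewrite lee_fin.
Qed.

End density.

Section nu_integral.
Context (R : realType) (n : nat).
Local Open Scope ereal_scope.
Local Notation la := (lebesgue_rV R n).

Definition kern (z : 'rV[R]_n * 'rV[R]_n) : \bar R := (enorm (z.1 - z.2) ^- n)%:E.

Lemma enorm_ge0 (x : 'rV[R]_n) : (0 <= enorm x)%R.
Proof. exact: sqrtr_ge0. Qed.

Lemma kern_ge0 z : 0 <= kern z.
Proof. by rewrite lee_fin invr_ge0 exprn_ge0// enorm_ge0. Qed.

Lemma measurable_enormB : measurable_fun setT
  (fun z : 'rV[R]_n * 'rV[R]_n => enorm (z.1 - z.2)).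
Proof.
apply: (@measurableT_comp _ _ _ _ _ _ (@Num.sqrt R)).
  by apply: continuous_measurable_fun; exact: sqrt_continuous.
apply: measurable_sum => i; apply: measurable_funX.
rewrite (_ : (fun _ => _) = fun z => (rV_coord i z.1 - rV_coord i z.2)%R); last first.
  by apply/funext => z; rewrite /rV_coord !mxE.
apply: measurable_funB.
- exact: measurableT_comp (measurable_rV_coord i) measurable_fst.
- exact: measurableT_comp (measurable_rV_coord i) measurable_snd.
Qed.

Lemma measurable_kern : measurable_fun setT kern.
Proof.
apply/measurable_EFinP.
rewrite (_ : (fun _ => _) = (fun z => enorm (z.1 - z.2) `^ (- n%:R)))%R; last first.
  by apply/funext => z; rewrite powR_invn ?enorm_ge0.
apply: (@measurableT_comp _ _ _ _ _ _ (fun r : R => r `^ (- n%:R))%R).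
  exact: measurable_powR.
exact: measurable_enormB.
Qed.

Lemma measurable_kernc : measurable_fun setT (kern : Rnn R n -> _).
Proof.
have := measurable_fun_completed (mu := (la \x la)) measurable_kern.
exact.
Qed.


Lemma ge0_integral_nu (D : set (Rnn R n)) (f : Rnn R n -> \bar R) : measurable D ->
  measurable_fun D f -> (forall x, 0 <= f x) ->
  \int[nu]_(z in D) f z = \int[dxdy]_(z in D) (f z * kern z).
Proof.
move=> mD mf f0.
pose k (z : Rnn R n) : R := (enorm (z.1 - z.2) ^- n)%R.
have k0 z : (0 <= k z)%R by rewrite invr_ge0 exprn_ge0// enorm_ge0.
have mk : measurable_fun setT k by apply/measurable_EFinP; exact: measurable_kernc.
exact: (@ge0_integral_density _ _ _ (@dxdy R n) (@nu R n) k k0 mk (fun _ _ => erefl)).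
Qed.

Lemma ge0_integral_nuE (f : 'rV[R]_n * 'rV[R]_n -> \bar R) :
  measurable_fun setT f -> (forall x, 0 <= f x) ->
  \int[nu]_z (f : Rnn R n -> _) z = \int[la \x la]_z (f z * kern z).
Proof.
move=> mf f0; have mf' := measurable_fun_completed (mu := (la \x la)) mf.
rewrite (ge0_integral_nu measurableT mf' f0).
have mk : measurable_fun setT (fun z => f z * kern z).
  by apply: emeasurable_funM => //; exact: measurable_kern.
have k0 z : 0 <= f z * kern z by rewrite mule_ge0// kern_ge0.
exact: (@ge0_integral_completed _ _ _ (la \x la) _ mk k0).
Qed.

Lemma ge0_integral_dx (f : 'rV[R]_n -> \bar R) :
  measurable_fun setT f -> (forall x, 0 <= f x) ->
  \int[dx]_x (f : Rn R n -> _) x = \int[la]_z (f z).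
Proof. exact: ge0_integral_completed. Qed.

End nu_integral.

End MeasureTools.
Import MeasureTools.

Module Completion.

(** * Borel sets, cubes and translations in R^n *)

Section rV_borel.
Context (R : realType).
Implicit Types (n : nat).
Local Notation la n := (lebesgue_rV R n).

Lemma enormN n (x : 'rV[R]_n) : enorm (- x) = enorm x.
Proof. by congr Num.sqrt; apply: eq_bigr => i _; rewrite mxE sqrrN. Qed.

Lemma norm_le_enorm n (x : 'rV[R]_n) : `|x| <= enorm x.
Proof.
rewrite [leLHS]mx_normrE; apply: bigmax_le => [|[i j] _ /=]; first exact: enorm_ge0.
rewrite (ord1 i) -sqrtr_sqr ler_wsqrtr// (bigD1 j)//= lerDl.
by apply: sumr_ge0 => l _; exact: sqr_ge0.
Qed.

Lemma coord_le_norm n (x : 'rV[R]_n) i : `|x ord0 i| <= `|x|.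
Proof. by rewrite [leRHS]mx_normrE; apply: (le_trans _ (le_bigmax _ _ (ord0, i))). Qed.

Lemma norm_le_coord n (x : 'rV[R]_n) r : 0 <= r -> (forall i, `|x ord0 i| <= r) -> `|x| <= r.
Proof.
by move=> r0 H; rewrite [leLHS]mx_normrE; apply: bigmax_le => // -[i j] _ /=; rewrite (ord1 i).
Qed.

Lemma enorm_le_norm n (x : 'rV[R]_n) : enorm x <= n%:R * `|x|.
Proof.
rewrite -[leRHS](ger0_norm (mulr_ge0 _ _))// -sqrtr_sqr ler_wsqrtr//.
apply: (@le_trans _ _ (\sum_(i < n) `|x| ^+ 2)).
  by apply: ler_sum => i _; rewrite -real_normK ?num_real// ler_sqr ?nnegrE// coord_le_norm.
rewrite sumr_const card_ord exprMn -[(_ ^+ 2) *+ n]mulr_natl ler_wpM2r ?sqr_ge0//.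
by rewrite -natrX ler_nat; case: n {x} => // n; rewrite expnS leq_pmulr.
Qed.

Lemma enorm_eq0 n (x : 'rV[R]_n) : (enorm x == 0) = (x == 0).
Proof.
apply/eqP/eqP => [E|->].
  by apply/eqP; rewrite -normr_le0 -E norm_le_enorm.
by rewrite /enorm big1 ?sqrtr0// => i _; rewrite mxE expr0n.
Qed.

Lemma enorm_gt0 n (x : 'rV[R]_n) : (0 < enorm x) = (x != 0).
Proof. by rewrite lt_neqAle enorm_ge0 andbT eq_sym enorm_eq0. Qed.

Lemma measurable_ball_rV n (c : 'rV[R]_n) (r : R) :
  measurable [set x : 'rV[R]_n | forall i, `|x ord0 i - c ord0 i| < r].
Proof.
rewrite (_ : mkset _ = \bigcap_(i in [set: 'I_n]) ((fun x : 'rV[R]_n => rV_coord i x) @^-1` [set t | `|t - c ord0 i| < r])).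
  apply: fin_bigcap_measurable => // i _.
  rewrite -[X in measurable X]setTI; apply: measurable_rV_coord => //.
  rewrite (_ : mkset _ = `]c ord0 i - r, c ord0 i + r[%classic); first exact: measurable_itv.
  by apply/seteqP; split => t /=; rewrite in_itv/= ltr_distl.
by apply/seteqP; split => x /= H i; [move=> _|]; exact: H.
Qed.

(** The sigma-algebra is generated by the coordinates, and an open set is the union of those cubes
    with rational center and radius [1 / (k + 1)] that it contains; these are countably many. *)
Lemma open_measurable_rV n (U : set 'rV[R]_n) : open U -> measurable U.
Proof.
move=> oU.
pose B (p : {ffun 'I_n -> rat} * nat) : set 'rV[R]_n :=
  [set x | forall i, `|x ord0 i - (\row_j ratr (p.1 j)) ord0 i| < p.2.+1%:R^-1].
pose F k : set 'rV[R]_n := if unpickle k is Some p then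
  (if `[< B p `<=` U >] then B p else set0) else set0.
rewrite (_ : U = \bigcup_k F k).
  apply: bigcupT_measurable => k; rewrite /F; case: unpickle => // p.
  by case: ifP => // _; exact: measurable_ball_rV.
apply/seteqP; split => [x Ux|x [k _]]; last first.
  rewrite /F; case: unpickle => // p; case: ifPn => // /asboolP; exact.
have /nbhs_ballP[e /= e0 He] : nbhs x U by exact: open_nbhs_nbhs.
have e20 : 0 < e / 2 by rewrite divr_gt0.
have [k _ /(_ k (leqnn k)) /= ke] := near_infty_natSinv_lt (PosNum e20).
have kp : 0 < k.+1%:R^-1 :> R by rewrite invr_gt0.
have Hq i : exists q : rat, `|x ord0 i - ratr q| < k.+1%:R^-1.
  have : x ord0 i - k.+1%:R^-1 < x ord0 i + k.+1%:R^-1 by rewrite ltrBlDr -addrA ltrDl addr_gt0.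
  move=> /rat_in_itvoo[q]; rewrite in_itv/= => /andP[q1 q2]; exists q.
  by rewrite ltr_distlC q1 q2.
have [q qE] := choice Hq.
exists (pickle ([ffun i => q i], k)) => //; rewrite /F pickleK ifT.
  by move=> i; rewrite mxE ffunE.
apply/asboolP => y By; apply: He; rewrite -ball_normE /=.
apply: le_lt_trans (_ : `|x - y| <= 2 * k.+1%:R^-1) _; last by move: ke; rewrite ltr_pdivlMr// mulrC.
apply: norm_le_coord => [|i]; first by rewrite mulr_ge0// ltW.
rewrite !mxE; have := By i; rewrite mxE ffunE /= => Byi; have := qE i.
move=> qi.
have Dxy := ler_distD (ratr (q i)) (x ord0 i) (y ord0 i).
apply: le_trans Dxy _; rewrite [X in _ + X]distrC mulr_natl mulr2n lerD// ltW//.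
Qed.

Lemma closed_measurable_rV n (U : set 'rV[R]_n) : closed U -> measurable U.
Proof. by move=> cU; rewrite -[U]setCK; apply: measurableC; apply: open_measurable_rV; exact: closed_openC. Qed.

Lemma continuous_measurable_rV n (f : 'rV[R]_n -> R) : continuous f -> measurable_fun setT f.
Proof.
move=> cf _; apply: (measurability _ (RGenOInfty.measurableE R)) => // _ [_ [x ->] <-].
rewrite setTI; apply: open_measurable_rV.
by apply: open_comp => //; exact: interval_open.
Qed.

(** The norm is the sup norm, so this is a product of intervals of length [2 r]. *)
Definition cube n (c : 'rV[R]_n) (r : R) : set 'rV[R]_n := [set x | `|x - c| <= r].

Lemma measurable_cube n (c : 'rV[R]_n) r : measurable (cube c r).
Proof.
apply: closed_measurable_rV.
apply: (@closed_comp _ _ (fun x : 'rV[R]_n => `|x - c|) [set t | t <= r]); last exact: closed_le.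
move=> x _; apply: (@continuous_comp _ _ _ (fun x : 'rV[R]_n => x - c) Num.norm); last exact: norm_continuous.
by apply: (@cvgB _ _ _ (nbhs x)); [exact: cvg_id|exact: cvg_cst].
Qed.

Lemma lebesgue_cube n (c : 'rV[R]_n) r : 0 <= r -> la n (cube c r) = ((2 * r) ^+ n)%:E.
Proof.
move=> r0; elim: n c => [|n IH] c.
  rewrite expr0 /= diracE mem_set// /cube /= (_ : _ - c = 0) ?normr0//.
  by apply/rowP => -[].
rewrite /= /lebesgue_rV_step /pushforward.
rewrite (_ : _ @^-1` _ = `[c ord0 ord0 - r, c ord0 ord0 + r]%classic `*`
   cube (\row_i c ord0 (lift ord0 i)) r); last first.
  apply/seteqP; split => -[t x] /=.
    move=> H; split.
      have := le_trans (coord_le_norm _ ord0) H; rewrite !mxE unlift_none /= in_itv /= ler_distl.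
      by [].
    apply: norm_le_coord => // i; have := le_trans (coord_le_norm _ (lift ord0 i)) H.
    by rewrite !mxE liftK.
  rewrite in_itv /= -ler_distl => -[H1 H2]; apply: norm_le_coord => // i.
  rewrite !mxE; case: unliftP => [j ->|->]//.
  by have := le_trans (coord_le_norm _ j) H2; rewrite !mxE.
rewrite product_measure1E//; last exact: measurable_cube.
rewrite IH -[X in (X * _)%E]/(lebesgue_measure _) lebesgue_measure_itv /= lte_fin.
case: ltP => [_|rr].
  by rewrite -EFinD -EFinM exprS; congr (_ * _)%:E; ring.
have -> : r = 0 by lra.
by rewrite mulr0 exprS mul0r mul0e.
Qed.

Local Open Scope ereal_scope.

Lemma lebesgue_measure_translation (a : R) (A : set (measurableTypeR R)) : measurable A ->
  lebesgue_measure ((fun x => (x + a)%R) @^-1` A) = lebesgue_measure A.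
Proof.
move=> mA.
have mT : measurable_fun setT (fun x : measurableTypeR R => (x + a)%R : measurableTypeR R).
  by apply: measurable_funD => //; exact: measurable_id.
pose Tm : {mfun measurableTypeR R >-> measurableTypeR R} := HB.pack (fun x : measurableTypeR R => (x + a)%R : measurableTypeR R)
  (isMeasurableFun.Build _ _ _ _ _ mT).
have H : forall X, ocitv X -> lebesgue_measure X = pushforward (@lebesgue_measure R) Tm X.
  move=> _ [[p q] _ <-]; rewrite /pushforward /=.
  rewrite (_ : _ @^-1` _ = `](p - a)%R, (q - a)%R]%classic); last first.
    by apply/seteqP; split => x /=; rewrite !in_itv /= ltrBlDr lerBrDr.
  rewrite !lebesgue_measure_itv /= !lte_fin ltrD2r; case: ifP => // _.
  by rewrite -!EFinD; congr EFin; ring.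
exact: (esym (lebesgue_measure_unique (mu := pushforward (@lebesgue_measure R) Tm) H mA)).
Qed.

Lemma ge0_integral_lebesgue_translation (a : R) (f : measurableTypeR R -> \bar R) :
  measurable_fun setT f -> (forall x, 0 <= f x) ->
  \int[@lebesgue_measure R]_x f (x + a)%R = \int[@lebesgue_measure R]_x f x.
Proof.
move=> mf f0.
have mT : measurable_fun setT (fun x : measurableTypeR R => (x + a)%R : measurableTypeR R).
  by apply: measurable_funD => //; exact: measurable_id.
rewrite -[LHS]/(\int[@lebesgue_measure R]_(x in (fun x : measurableTypeR R => (x + a)%R) @^-1` setT) (f \o (fun x => (x + a)%R)) x).
rewrite -(@ge0_integral_pushforward _ _ _ _ R _ mT)//.
by apply: eq_measure_integral => A mA _; exact: lebesgue_measure_translation.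
Qed.

Lemma ge0_integral_rVS n (f : 'rV[R]_n.+1 -> \bar R) : measurable_fun setT f ->
  (forall x, 0 <= f x) ->
  \int[la n.+1]_x f x = \int[@lebesgue_measure R]_t \int[la n]_x f (rV_cons (t, x)).
Proof.
move=> mf f0.
rewrite -[LHS]/(\int[pushforward (@lebesgue_measure R \x la n) (@rV_cons R n)]_x f x).
rewrite ge0_integral_pushforward//; last exact: measurable_rV_cons.
rewrite preimage_setT fubini_tonelli1//; last by move=> x; exact: f0.
by apply: measurableT_comp => //; exact: measurable_rV_cons.
Qed.

Lemma measurable_rV_add n (y : 'rV[R]_n) : measurable_fun setT (fun x : 'rV[R]_n => (x + y)%R).
Proof.
apply: measurable_fun_rVP => i.
rewrite (_ : _ \o _ = fun x => (rV_coord i x + y ord0 i)%R); last first.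
  by apply/funext => x; rewrite /= /rV_coord mxE.
by apply: measurable_funD => //; exact: measurable_rV_coord.
Qed.

Lemma ge0_integral_translation n (y : 'rV[R]_n) (f : 'rV[R]_n -> \bar R) :
  measurable_fun setT f -> (forall x, 0 <= f x) ->
  \int[la n]_x f (x + y)%R = \int[la n]_x f x.
Proof.
elim: n y f => [|n IH] y f mf f0.
  by apply: eq_integral => x _; congr f; apply/rowP => -[].
have mfy : measurable_fun setT (fun x : 'rV[R]_n.+1 => f (x + y)%R).
  by apply: measurableT_comp => //; exact: measurable_rV_add.
rewrite !ge0_integral_rVS//.
pose y' : 'rV[R]_n := \row_i y ord0 (lift ord0 i).
have E t x : f (rV_cons (t, x) + y)%R = f (rV_cons (t + y ord0 ord0, x + y')%R).
  congr f; apply/rowP => i; rewrite !mxE /=; case: unliftP => [j ->|->]//.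
  by rewrite !mxE.
have mc : measurable_fun setT (fun p => f (@rV_cons R n p)).
  by apply: measurableT_comp => //; exact: measurable_rV_cons.
have mct t : measurable_fun setT (fun x => f (rV_cons (t, x))).
  by apply: (measurableT_comp mc); exact: pair1_measurable.
under eq_integral => t _.
  under eq_integral do rewrite E.
  rewrite (IH y' (fun x => f (rV_cons ((t + y ord0 ord0)%R, x))))//.
  over.
apply: (ge0_integral_lebesgue_translation (y ord0 ord0) (f := fun t => \int[la n]_x f (rV_cons (t, x)))).
  exact: (measurable_fun_fubini_tonelli_F (m2 := la n) (fun p => f (rV_cons p)) mc (fun p => f0 _)).
by move=> t; apply: integral_ge0.
Qed.

(** Dyadic shells: the cube of radius [2 a_j] has volume [4 ^ n a_j ^ n], so the j-th bound
    contributes [4 ^ n q ^ j] whatever the radii, and the total is a geometric series. *)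
Lemma kernel_integral_bound n (f : 'rV[R]_n -> \bar R) (a : nat -> R) (q : R) :
  measurable_fun setT f -> (forall x, 0 <= f x) -> (0 < q < 1)%R -> (forall j, 0 < a j)%R ->
  (forall h, f h = 0 \/ exists2 j, (`|h| <= 2 * a j)%R & f h <= (q ^+ j * a j ^- n)%:E) ->
  \int[la n]_h f h <= (4 ^+ n / (1 - q))%:E.
Proof.
move=> mf f0 /andP[q0 q1] a0 H.
pose g j (h : 'rV[R]_n) : \bar R := (q ^+ j * a j ^- n * \1_(cube 0 (2 * a j)) h)%:E.
have g0 j h : 0 <= g j h.
  by rewrite lee_fin !mulr_ge0// ?exprn_ge0 ?invr_ge0 ?exprn_ge0// ltW.
have mg j : measurable_fun setT (g j).
  apply/measurable_EFinP; apply: measurable_funM => //.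
  by apply: measurable_indic; exact: measurable_cube.
have fg h : f h <= \sum_(0 <= j <oo) g j h.
  have [->|[j hj fj]] := H h; first by apply: nneseries_ge0 => j _ _; exact: g0.
  apply: le_trans (_ : g j h <= _).
    by rewrite /g indicE mem_set ?mulr1//= /cube /= subr0.
  apply: le_trans (nneseries_lim_ge j.+1 _); last by move=> k _ _; exact: g0.
  by rewrite big_nat_recr//= leeDr//; apply: sume_ge0 => k _; exact: g0.
apply: (@le_trans _ _ (\int[la n]_h \sum_(0 <= j <oo) g j h)).
  apply: ge0_le_integral => //.
  by apply: ge0_emeasurable_sum => // k h _ _; exact: g0.
rewrite integral_nneseries//.
have E j : \int[la n]_h g j h = (4 ^+ n * q ^+ j)%:E.
  rewrite /g; under eq_integral do rewrite EFinM.
  rewrite ge0_integralZl_EFin//; last 2 first.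
  - by apply/measurable_EFinP; apply: measurable_indic; exact: measurable_cube.
  - by rewrite mulr_ge0// ?exprn_ge0 ?invr_ge0 ?exprn_ge0// ltW.
  rewrite integral_indic//; last exact: measurable_cube.
  have r0 : (0 <= 2 * a j)%R by rewrite mulr_ge0// ltW.
  rewrite setIT [X in _ * X](lebesgue_cube 0 r0).
  have E4 : ((2 * (2 * a j)) ^+ n = a j ^+ n * 4 ^+ n)%R by rewrite mulrA -natrM exprMn mulrC.
  by rewrite E4 -EFinM mulrA divfK 1?mulrC// expf_neq0// gt_eqF.
under eq_eseriesr do rewrite E.
have cv : series (geometric (4 ^+ n : R) q) @ \oo --> (4 ^+ n * (1 - q)^-1)%R.
  by apply: cvg_geometric_series; rewrite ger0_norm// ltW.
rewrite (_ : (fun k => _) = EFin \o series (geometric (4 ^+ n : R) q)); last first.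
  by apply/funext => k; rewrite /series /= -sumEFin.
by rewrite -[limn _]/(limn (EFin \o _)) EFin_lim ?(cvg_lim _ cv)//; apply/cvg_ex; exists (4 ^+ n * (1 - q)^-1)%R.
Qed.

End rV_borel.

End Completion.
Import Completion.

Module YoungFunctions.

(** * Young functions and their complementary functions *)

Section young_function.
Context (R : realType) (M : R -> R).
Hypothesis youngM : young M.
Implicit Types t x y w : R.
Local Notation Mbar := (complementary M).
Local Notation Minv := (complementary_inv M).

Lemma young_even t : M (- t) = M t.
Proof. by case: youngM => -[]. Qed.

Lemma young_abs t : M `|t| = M t.
Proof. by case: (ger0P t) => // _; rewrite young_even. Qed.

Lemma young_continuous : continuous M.
Proof. by case: youngM => -[]. Qed.

Lemma young_gt0 t : t != 0 -> 0 < M t.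
Proof.
move=> t0; rewrite -young_abs; case: youngM => -[_ _ _ + _ _ _]; apply.
by rewrite normr_gt0.
Qed.

Lemma young0 : M 0 = 0.
Proof.
have [_ _ _ [m [_ _ /(_ 0)]]] := youngM.
by rewrite normr0 set_itv1 integral_set1 => -[].
Qed.

Lemma young_ge0 t : 0 <= M t.
Proof. by have [->|/young_gt0/ltW//] := eqVneq t 0; rewrite young0. Qed.

Lemma young_convex w x y : 0 <= w <= 1 -> M (w * x + (1 - w) * y) <= w * M x + (1 - w) * M y.
Proof.
move=> /andP[w0 w1]; have [[_ cM _ _] _ _ _] := youngM.
have wi : (0 <= w <= 1) by rewrite w0.
by have := cM (Itv01 w0 w1) x y; rewrite !inE => /(_ I I); rewrite /conv /=.
Qed.

Lemma young_scale w x : 0 <= w <= 1 -> M (w * x) <= w * M x.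
Proof. by move=> wi; have := young_convex x 0 wi; rewrite young0 !mulr0 !addr0. Qed.

Lemma young_le x y : `|x| <= `|y| -> M x <= M y.
Proof.
move=> xy; have [y0|y0] := eqVneq y 0.
  by move: xy; rewrite y0 normr0 normr_le0 => /eqP ->.
have y1 : 0 < `|y| by rewrite normr_gt0.
have wi : 0 <= `|x| / `|y| <= 1 by rewrite divr_ge0//= ler_pdivrMr// mul1r.
rewrite -(young_abs x) -(young_abs y) -[`|x|](divfK (lt0r_neq0 y1)).
apply: le_trans (young_scale _ wi) _.
by case/andP: wi => ? ?; rewrite ler_piMl// young_ge0.
Qed.

(** The substitute for a Delta_2-condition: sums are split at the price of doubling the arguments,
    which is later absorbed by the scale of the modular. *)
Lemma young_half x y : M (x + y) <= (M (2 * x) + M (2 * y)) / 2.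
Proof.
have -> : x + y = 2^-1 * (2 * x) + (1 - 2^-1) * (2 * y) by field.
apply: le_trans (young_convex _ _ _) _; first by apply/andP; split; lra.
by rewrite le_eqVlt; apply/orP; left; apply/eqP; field.
Qed.

Lemma young_third x y z : M (x + y + z) <= (M (4 * x) + M (4 * y) + M (2 * z)) / 2.
Proof.
apply: le_trans (young_half _ _) _.
have : M (2 * (x + y)) <= M (4 * x) + M (4 * y).
  rewrite mulrDr; apply: le_trans (young_half _ _) _.
  rewrite !mulrA -natrM; have := young_ge0 (4 * x); have := young_ge0 (4 * y); lra.
have := young_ge0 (4 * y); lra.
Qed.

(* The slopes of chords with left end [x] decrease to the slope [p]. *)
Lemma young_support x : exists p, forall y, M x + p * (y - x) <= M y.
Proof.
pose S := [set (M (x + h) - M x) / h | h in [set h | 0 < h]].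
have lbS y : y < x -> lbound S ((M x - M y) / (x - y)).
  move=> yx _ [h /= h0 <-].
  have d0 : 0 < x - y by rewrite subr_gt0.
  have hd : 0 < h + (x - y) by rewrite addr_gt0.
  rewrite ler_pdivrMr// mulrAC ler_pdivlMr//.
  have wi : 0 <= h / (h + (x - y)) <= 1.
    by rewrite divr_ge0 ?(ltW h0) ?(ltW hd)//= ler_pdivrMr// mul1r lerDl ltW.
  have := young_convex y (x + h) wi.
  have -> : h / (h + (x - y)) * y + (1 - h / (h + (x - y))) * (x + h) = x.
    by field; rewrite gt_eqF.
  rewrite -(ler_pM2r hd) => H.
  have : (h / (h + (x - y)) * M y + (1 - h / (h + (x - y))) * M (x + h)) * (h + (x - y)) =
    h * M y + (x - y) * M (x + h) by field; rewrite gt_eqF.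
  by move=> E; rewrite E in H; nra.
have S0 : S !=set0 by exists ((M (x + 1) - M x) / 1); exists 1 => //=; exact: ltr01.
have hS : has_inf S by split => //; exists ((M x - M (x - 1)) / (x - (x - 1))); apply: lbS; rewrite ltrBlDr ltrDl.
exists (inf S) => y; have [yx|xy|->] := ltgtP y x; last by rewrite subrr mulr0 addr0.
  have : (M x - M y) / (x - y) <= inf S by apply: lb_le_inf => //; exact: lbS.
  by rewrite ler_pdivrMr ?subr_gt0//; nra.
have : inf S <= (M y - M x) / (y - x).
  apply: ge_inf; first by case: hS.
  by exists (y - x); rewrite /= ?subr_gt0// [x + _]addrC subrK.
by rewrite ler_pdivlMr ?subr_gt0//; nra.
Qed.

(** The weights may sum to less than 1: the missing weight is put at 0, where [M] vanishes. For the
    support line at the weighted sum [x] this means that its value [M x - p * x] at 0 is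
    nonpositive. *)
Lemma young_jensen (I : Type) (r : seq I) (P : pred I) (c f : I -> R) :
  (forall i, P i -> 0 <= c i) -> \sum_(i <- r | P i) c i <= 1 ->
  M (\sum_(i <- r | P i) c i * f i) <= \sum_(i <- r | P i) c i * M (f i).
Proof.
move=> c0 c1; set x := \sum_(i <- r | P i) c i * f i.
have [p Hp] := young_support x.
have Hp0 := Hp 0; rewrite young0 sub0r in Hp0.
apply: (@le_trans _ _ (\sum_(i <- r | P i) c i * (M x + p * (f i - x)))); last first.
  by apply: ler_sum => i Pi; rewrite ler_wpM2l// c0.
rewrite (eq_bigr (fun i => p * (c i * f i) + c i * (M x - p * x))); last by move=> i _; ring.
rewrite big_split /= -mulr_sumr -mulr_suml -/x; nra.
Qed.

Lemma young_superlinear (k : R) : exists2 T, 0 < T & forall t, T <= t -> k * t <= M t.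
Proof.
have [_ _ + _] := youngM => /cvgryPge/(_ k)[T [_ HT]].
exists (Num.max 1 (T + 1)) => [|t]; first by rewrite lt_max ltr01.
rewrite ge_max => /andP[t1 tT]; have := HT t; rewrite ler_pdivlMr; last exact: lt_le_trans t1.
by apply; apply: lt_le_trans tT; rewrite ltrDl.
Qed.

Let Mbar_set t := [set tau * `|t| - M tau | tau in [set tau : R | 0 <= tau]].

Lemma complementary_has_sup t : has_sup (Mbar_set t).
Proof.
split; first by exists (0 * `|t| - M 0); exists 0 => //=.
have [T T0 HT] := young_superlinear `|t|.
exists (T * `|t|) => _ [tau /= tau0 <-]; have [tT|/ltW Tt] := leP tau T.
  by rewrite lerBlDr ler_wpDr ?young_ge0// ler_wpM2r.
have H0 : 0 <= T * `|t| by rewrite mulr_ge0// ltW.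
by have := HT _ Tt; lra.
Qed.

Lemma young_ineq_ge0 x t : 0 <= x -> x * `|t| - M x <= Mbar t.
Proof. by move=> x0; apply: sup_upper_bound; [exact: complementary_has_sup|exists x]. Qed.

Lemma young_ineq x t : `|x * t| <= M x + Mbar t.
Proof. by rewrite normrM -(young_abs x) -lerBlDl young_ineq_ge0. Qed.

Lemma complementary_le_ub t (c : R) : (forall x, 0 <= x -> x * `|t| <= c + M x) -> Mbar t <= c.
Proof.
move=> H; apply: ge_sup; first by case: (complementary_has_sup t).
by move=> _ [x /= x0 <-]; rewrite lerBlDr H.
Qed.

Lemma complementary_ge0 t : 0 <= Mbar t.
Proof. by have := @young_ineq_ge0 0 t (lexx 0); rewrite mul0r young0 subr0. Qed.

Lemma complementary0 : Mbar 0 = 0.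
Proof.
apply/eqP; rewrite eq_le complementary_ge0 andbT; apply: complementary_le_ub => x x0.
by rewrite normr0 mulr0 add0r young_ge0.
Qed.

Lemma complementary_abs t : Mbar `|t| = Mbar t.
Proof. by rewrite /complementary normr_id. Qed.

Lemma complementary_le x y : `|x| <= `|y| -> Mbar x <= Mbar y.
Proof.
move=> xy; apply: complementary_le_ub => t t0; rewrite -lerBlDr.
by apply: le_trans (young_ineq_ge0 y t0); rewrite lerD2r ler_wpM2l.
Qed.

(** Where [M tau >= B * tau] the expression under the supremum is nonpositive, so only [tau <= T]
    counts, and each of these gives a function of slope at most [T]. *)
Lemma complementary_lipschitz (B : R) : exists2 T : R, 0 <= T & forall x y,
  `|x| <= B -> `|y| <= B -> `|Mbar x - Mbar y| <= T * `|x - y|.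
Proof.
have [T T0 HT] := young_superlinear B; exists T; first exact: ltW.
have K x y : `|x| <= B -> `|y| <= B -> Mbar x - Mbar y <= T * `|x - y|.
  move=> xB yB; rewrite lerBlDr; apply: complementary_le_ub => t t0.
  have [tT|/ltW Tt] := leP t T.
    have := young_ineq_ge0 y t0.
    have : t * `|x| - t * `|y| <= T * `|x - y|.
      rewrite -mulrBr; apply: le_trans (ler_wpM2r (normr_ge0 _) tT).
      by rewrite ler_wpM2l// lerB_dist.
    lra.
  have := HT _ Tt; have : t * `|x| <= B * t by rewrite mulrC ler_wpM2r.
  have := complementary_ge0 y; have : 0 <= T * `|x - y| by rewrite mulr_ge0// ltW.
  lra.
by move=> x y xB yB; rewrite ler_norml K// lerNl opprB distrC K.
Qed.

Lemma complementary_continuous : continuous Mbar.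
Proof.
move=> x; have [T T0 HT] := complementary_lipschitz (`|x| + 1).
apply/cvgrPdist_lt => e e0; near=> y.
have xy : `|x - y| < Num.min 1 (e / (T + 1)).
  near: y; apply: (@cvgr_dist_lt _ _ _ (nbhs x) _ id); first exact: cvg_id.
  by rewrite lt_min ltr01 divr_gt0// ltr_wpDl.
move: xy; rewrite lt_min => /andP[xy1 xye].
apply: le_lt_trans (HT _ _ _ _) _; first by rewrite lerDl.
  by rewrite -[y](subrK x) (le_trans (ler_normD _ _))// addrC lerD2l distrC ltW.
move: xye; rewrite ltr_pdivlMr ?ltr_wpDl//; apply: le_lt_trans.
by rewrite mulrC ler_wpM2l// lerDl.
Unshelve. all: by end_near. Qed.

Lemma complementary_surj y : 0 <= y -> exists2 t, 0 <= t & Mbar t = y.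
Proof.
move=> y0; pose T := y + M 1.
have T0 : 0 <= T by rewrite addr_ge0// young_ge0.
have yT : y <= Mbar T by have := @young_ineq_ge0 1 T ler01; rewrite mul1r ger0_norm// /T addrK.
have [||c] := @IVT R Mbar 0 T y T0.
- exact/continuous_subspaceT/complementary_continuous.
- by rewrite complementary0 ge_min y0 le_max yT orbT.
by rewrite in_itv /= => /andP[c0 _] cy; exists c.
Qed.

(** [complementary_inv] chooses a preimage; this identity and the sign of the choice are what all
    further properties rest on. *)
Lemma complementary_invK y : 0 <= y -> Mbar (Minv y) = y.
Proof.
move=> y0; apply: pinvK; rewrite inE; have [t t0 ty] := complementary_surj y0.
by exists t.
Qed.

Lemma complementary_inv_ge0 y : 0 <= y -> 0 <= Minv y.
Proof.
move=> y0; have [t t0 ty] := complementary_surj y0.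
pose B := [set y : R | 0 <= y].
have sM : set_surj [set t : R | 0 <= t] B Mbar.
  by move=> z /= z0; have [r r0 rz] := complementary_surj z0; exists r.
by have := surjpinv_image_sub sM; apply; exists y.
Qed.

Lemma complementary_inv_le x y : 0 <= x -> x <= y -> Minv x <= Minv y.
Proof.
move=> x0 xy; have y0 := le_trans x0 xy.
rewrite leNgt; apply/negP => yx.
have : Mbar (Minv y) <= Mbar (Minv x).
  by apply: complementary_le; rewrite !ger0_norm ?complementary_inv_ge0// ltW.
rewrite !complementary_invK// => yx'; have E : x = y by apply/le_anti; rewrite xy.
by rewrite E ltxx in yx.
Qed.

Lemma complementary_inv_ineq t y : 0 <= y -> `|t| * Minv y <= M t + y.
Proof.
move=> y0; have := young_ineq t (Minv y).
by rewrite normrM (ger0_norm (complementary_inv_ge0 y0)) complementary_invK.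
Qed.

(* Where [c `|x| <= tau] the growth of [f] is absorbed by [M tau]; elsewhere
   [tau * `|f x|] is controlled by [f x * x]. *)
Lemma complementary_monotone_bound (f : R -> R) (d b c K : R) :
  0 < b -> 0 < c -> 0 < K -> 4 * b <= K -> (forall x, 0 <= f x * x) ->
  (forall x, `|f x| <= d + b * Minv (M (c * x))) ->
  forall x, Mbar (f x / K) <= c / K * (f x * x) + Mbar (2 * d / K) / 2.
Proof.
move=> b0 c0 K0 bK fx gf x; apply: complementary_le_ub => t t0.
have Mb0 := complementary_ge0 (2 * d / K).
rewrite normrM [X in t * (_ * X)]gtr0_norm ?invr_gt0//.
have [tx|xt] := leP t (c * `|x|).
  have -> : c / K * (f x * x) = c * `|x| * (`|f x| / K).
    by rewrite -[f x * x]ger0_norm// normrM; ring.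
  have := young_ge0 t.
  have : t * (`|f x| / K) <= c * `|x| * (`|f x| / K).
    by rewrite ler_wpM2r// divr_ge0// ltW.
  lra.
have H1 : `|f x| <= d + b * Minv (M t).
  apply: le_trans (gf x) _; rewrite lerD2l ler_pM2l// complementary_inv_le ?young_ge0//.
  by apply: young_le; rewrite normrM (gtr0_norm c0) (ger0_norm t0) ltW.
have H2 := complementary_inv_ineq t (young_ge0 t).
rewrite ger0_norm// in H2.
have H3 := young_ineq t (2 * d / K).
have H4 := ler_norm (t * (2 * d / K)).
have H5 : 0 <= c / K * (f x * x) by rewrite mulr_ge0// divr_ge0// ltW.
have H6 : t * (`|f x| / K) <= t * (2 * d / K) / 2 + b / K * (t * Minv (M t)).
  have -> : t * (2 * d / K) / 2 + b / K * (t * Minv (M t)) = t * ((d + b * Minv (M t)) / K) by field; rewrite gt_eqF.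
  by rewrite ler_wpM2l// ler_pM2r// invr_gt0.
have H7 : b / K * (t * Minv (M t)) <= 4^-1 * (2 * M t).
  apply: ler_pM.
  - by rewrite divr_ge0// ltW.
  - by rewrite mulr_ge0// complementary_inv_ge0// young_ge0.
  - by rewrite ler_pdivrMr// ler_pdivlMl.
  - by rewrite mulr_natl mulr2n.
lra.
Qed.

(** Young's inequality against the constant 1: a function of finite modular is integrable on sets of
    finite measure. *)
Lemma abs_le_young (k t : R) : 0 < k -> `|t| <= k^-1 * (Mbar 1 + M (k * t)).
Proof.
by move=> k0; rewrite ler_pdivlMl// addrC; have := young_ineq (k * t) 1;
  rewrite mulr1 normrM (gtr0_norm k0).
Qed.

Lemma measurable_young : measurable_fun setT M.
Proof. by apply: continuous_measurable_fun; exact: young_continuous. Qed.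

Lemma measurable_complementary : measurable_fun setT Mbar.
Proof. by apply: continuous_measurable_fun; exact: complementary_continuous. Qed.

End young_function.

End YoungFunctions.
Import YoungFunctions.

Module DiscreteMinimax.

(** * A finite-dimensional Lusternik-Schnirelmann argument *)

Section dot_product.
Context (R : realType) (k : nat).
Local Notation V := 'rV[R]_k.
Implicit Types u v w : V.

Definition dotv u v := \sum_i u ord0 i * v ord0 i.

Lemma dotvC u v : dotv u v = dotv v u.
Proof. by apply: eq_bigr => i _; rewrite mulrC. Qed.

Lemma dotvDr u v w : dotv u (v + w) = dotv u v + dotv u w.
Proof. by rewrite -big_split; apply: eq_bigr => i _; rewrite mxE mulrDr. Qed.

Lemma dotvZr a u v : dotv u (a *: v) = a * dotv u v.
Proof. by rewrite mulr_sumr; apply: eq_bigr => i _; rewrite mxE mulrCA. Qed.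

Lemma dotvNr u v : dotv u (- v) = - dotv u v.
Proof. by rewrite -scaleN1r dotvZr mulN1r. Qed.

Lemma dotvBr u v w : dotv u (v - w) = dotv u v - dotv u w.
Proof. by rewrite dotvDr dotvNr. Qed.

Lemma dotvDl u v w : dotv (v + w) u = dotv v u + dotv w u.
Proof. by rewrite dotvC dotvDr !(dotvC u). Qed.

Lemma dotvZl a u v : dotv (a *: u) v = a * dotv u v.
Proof. by rewrite dotvC dotvZr dotvC. Qed.

Lemma dotvNl u v : dotv (- u) v = - dotv u v.
Proof. by rewrite dotvC dotvNr dotvC. Qed.

Lemma dotvBl u v w : dotv (v - w) u = dotv v u - dotv w u.
Proof. by rewrite dotvDl dotvNl. Qed.

Lemma dotv0 u : dotv u 0 = 0.
Proof. by apply: big1 => i _; rewrite mxE mulr0. Qed.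

Lemma dotvv_ge0 u : 0 <= dotv u u.
Proof. by apply: sumr_ge0 => i _; rewrite -expr2 sqr_ge0. Qed.

Lemma dotvv_gt0 u : u != 0 -> 0 < dotv u u.
Proof.
move=> u0; rewrite lt_neqAle dotvv_ge0 andbT eq_sym; apply: contra u0.
rewrite psumr_eq0; last by move=> i _; rewrite -expr2 sqr_ge0.
move=> /allP H; apply/eqP/rowP => i; rewrite mxE; apply/eqP.
by have := H i (mem_index_enum i); rewrite /= mulf_eq0 orbb.
Qed.

Lemma ler_coord_norm u i : `|u ord0 i| <= `|u|.
Proof. by rewrite [leRHS]mx_normrE; apply: (le_trans _ (le_bigmax _ _ (ord0, i))). Qed.

Lemma dotv_le u v : `|dotv u v| <= k%:R * (`|u| * `|v|).
Proof.
apply: le_trans (ler_norm_sum _ _ _) _.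
rewrite mulr_natl -[X in _ *+ X]card_ord -sumr_const; apply: ler_sum => i _.
by rewrite normrM ler_pM// ler_coord_norm.
Qed.

Lemma continuous_dotv (T : topologicalType) (f g : T -> V) x :
  {for x, continuous f} -> {for x, continuous g} ->
  {for x, continuous (fun y => dotv (f y) (g y))}.
Proof.
move=> cf cg.
have cc (h : T -> V) i : {for x, continuous h} -> {for x, continuous (fun y => h y ord0 i)}.
  by move=> ch; apply: (@continuous_comp _ _ _ h (fun v : V => v ord0 i)) => //; exact: coord_continuous.
rewrite /prop_for /continuous_at.
apply: (cvg_big (op := +%R)) => [|i _]; first exact: add_continuous.
by apply: cvgM; [exact: cc|exact: cc].
Qed.

End dot_product.

Lemma compact_norm_bound (R : realType) (U W : normedModType R) (K : set U) (f : U -> W) :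
  compact K -> (forall x, K x -> {for x, continuous f}) ->
  exists2 b : R, 0 < b & forall x, K x -> `|f x| <= b.
Proof.
move=> cK cf; have [K0|/set0P K0] := eqVneq K set0.
  by exists 1 => // x; rewrite K0.
have [c cinK Hc] : exists2 c, c \in K & forall t, t \in K -> `|f t| <= `|f c|.
  apply: compact_EVT_max => //; apply: continuous_in_subspaceT => x /set_mem Kx.
  by apply: (@continuous_comp _ _ _ f Num.norm); [exact: cf|exact: norm_continuous].
exists (`|f c| + 1) => [|x Kx]; first by rewrite ltr_wpDl.
by apply: le_trans (Hc x (mem_set Kx)) _; rewrite lerDl.
Qed.

Section lusternik_schnirelmann.
Context (R : realType) (k m : nat).
Local Notation V := 'rV[R]_k.
Context (A B : V -> R) (dA dB : V -> V) (P : V -> 'rV[R]_m) (io : 'rV[R]_m.+1 -> V).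
Context (alpha eps0 eps delta : R).
Hypothesis cdA : continuous dA.
Hypothesis cdB : continuous dB.
Hypothesis cB : continuous B.
Hypothesis A_even : forall v, A (- v) = A v.
Hypothesis dA_odd : forall v, dA (- v) = - dA v.
Hypothesis dB_odd : forall v, dB (- v) = - dB v.
Hypothesis A0 : A 0 = 0.
Hypothesis A_sub : forall v w, A v + dotv (dA v) (w - v) <= A w.
Hypothesis delta_gt0 : 0 < delta.
Hypothesis A_coer : forall v, delta * `|v| ^+ 2 <= A v.
Hypothesis B_diff : forall r e, 0 < e -> exists2 d, 0 < d &
  forall v w, `|v| <= r -> `|w - v| <= d -> B v + dotv (dB v) (w - v) - e * `|w - v| <= B w.
Hypothesis dB_pos : forall v, A v = 1 -> alpha <= B v -> 0 < dotv (dB v) v.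
Hypothesis cP : continuous P.
Hypothesis P_odd : forall v, P (- v) = - P v.
Hypothesis cio : continuous io.
Hypothesis io_odd : forall x, io (- x) = - io x.
Hypothesis io_inj : forall x, x != 0 -> io x != 0.
Hypothesis B_io : forall x t, A (t *: io x) = 1 -> alpha <= B (t *: io x).
Hypothesis B_P : forall v, A v = 1 -> P v = 0 -> B v < eps0.
Hypothesis eps0_lt : eps0 < eps.

Let S := [set v | A v = 1].

(** Convexity squeezes [A] between its tangent at [v] and the one at the moving point. *)
Let cA : continuous A.
Proof.
move=> v; have cm : {for v, continuous (fun w : V => w - v)}.
  by apply: (@cvgB _ _ _ (nbhs v)); [exact: cvg_id|exact: cvg_cst].
have cc : {for v, continuous (fun _ : V => dA v)} by exact: (@cst_continuous _ _ (dA v) v).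
apply: (@squeeze_cvgr _ (nbhs v) _ _ (fun w => A v + dotv (dA v) (w - v)) (fun w => A v + dotv (dA w) (w - v)) A).
- near=> w; rewrite A_sub /=; have := A_sub w v.
  by rewrite -opprB dotvNr lerBlDr.
- rewrite -[X in _ --> X]addr0 -(dotv0 (dA v)) -(subrr v).
  apply: cvgD; first exact: cvg_cst.
  exact: (continuous_dotv cc cm).
- rewrite -[X in _ --> X]addr0 -(dotv0 (dA v)) -(subrr v).
  apply: cvgD; first exact: cvg_cst.
  exact: (continuous_dotv (@cdA v) cm).
Unshelve. all: by end_near. Qed.

Let S_bound v : S v -> `|v| <= 1 + delta^-1.
Proof.
move=> Sv; have := A_coer v; rewrite Sv -ler_pdivlMl// mulr1 => H.
have [v1|v1] := leP `|v| 1; first by rewrite (le_trans v1)// lerDl invr_ge0 ltW.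
apply: le_trans (_ : _ <= delta^-1) _; last by rewrite lerDr.
by apply: le_trans H; rewrite expr2 ler_peMl// ltW.
Qed.

Let S_compact : compact S.
Proof.
apply: bounded_closed_compact.
  exists (1 + delta^-1); split; first exact: num_real.
  by move=> r hr v /S_bound vr; exact: le_trans vr (ltW hr).
apply: (@closed_comp _ _ A [set 1]); last exact: closed_eq.
by move=> x _; exact: cA.
Qed.

Let A_scale l v : 0 <= l <= 1 -> A (l *: v) <= l * A v.
Proof.
move=> /andP[l0 l1]; have := A_sub (l *: v) v; have := A_sub (l *: v) 0.
rewrite A0 sub0r dotvNr dotvBr dotvZr; set a := A _; set d := dotv _ _; nra.
Qed.

Let dA_ge v : A v <= dotv (dA v) v.
Proof. by have := A_sub v 0; rewrite A0 sub0r dotvNr subr_le0. Qed.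

Let A_lt s t w : 0 <= s -> s < t -> A (t *: w) = 1 -> A (s *: w) < 1.
Proof.
move=> s0 st At; have t0 : 0 < t by exact: le_lt_trans st.
have -> : s *: w = (s / t) *: (t *: w) by rewrite scalerA divfK// gt_eqF.
apply: le_lt_trans (A_scale _ _) _; first by rewrite divr_ge0// ?(ltW t0)//= ler_pdivrMr// mul1r ltW.
by rewrite At mulr1 ltr_pdivrMr// mul1r.
Qed.

Let gauge_ex w : w != 0 -> exists t, 0 < t /\ A (t *: w) = 1.
Proof.
move=> w0; have nw : 0 < `|w| by rewrite normr_gt0.
pose T := (1 + delta^-1) / `|w|.
have T0 : 0 <= T by rewrite divr_ge0// addr_ge0// invr_ge0 ltW.
have AT : 1 <= A (T *: w).
  apply: le_trans (A_coer _); rewrite normrZ (ger0_norm T0) divfK ?gt_eqF//.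
  have di : 0 < delta^-1 by rewrite invr_gt0.
  have dd : delta * delta^-1 = 1 by rewrite divff// gt_eqF.
  rewrite expr2; nra.
have cf : continuous (fun t : R => A (t *: w)).
  move=> t; apply: (@continuous_comp _ _ _ (fun t : R => t *: w) A); last exact: cA.
  by apply: cvgZr_tmp; exact: cvg_id.
have [||t] := @IVT R (fun t => A (t *: w)) 0 T 1 T0.
- exact: continuous_subspaceT.
- by rewrite scale0r A0 ge_min ler01 le_max AT orbT.
rewrite in_itv /= => /andP[t0 _] At; exists t; split => //.
by rewrite lt_neqAle t0 andbT; apply/eqP => t00; move: At; rewrite -t00 scale0r A0 => /eqP; rewrite eq_sym oner_eq0.
Qed.

(** Each ray meets the level set exactly once, at this parameter, so that [rho] below is the radial
    projection; the default 0 only concerns [w = 0]. *)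
Let tt (w : V) : R := xget 0 [set t | 0 < t /\ A (t *: w) = 1].

Let ttP w : w != 0 -> 0 < tt w /\ A (tt w *: w) = 1.
Proof.
by move=> /gauge_ex[t Ht]; exact: (@xgetPex _ 0 [set t | 0 < t /\ A (t *: w) = 1] (ex_intro _ t Ht)).
Qed.

Let ttN w : tt (- w) = tt w.
Proof.
rewrite /tt; congr xget; apply/funext => t /=; apply/propext.
by rewrite scalerN A_even.
Qed.

Let A_gt s w : w != 0 -> tt w < s -> 1 < A (s *: w).
Proof.
move=> w0 ts; have [t0 At] := ttP w0; have s0 := lt_trans t0 ts.
rewrite ltNge; apply/negP => As.
have : A (tt w *: w) <= tt w / s * A (s *: w).
  rewrite -[X in A X](_ : (tt w / s) *: (s *: w) = _); last by rewrite scalerA divfK// gt_eqF.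
  by apply: A_scale; rewrite divr_ge0 ?(ltW t0) ?(ltW s0)//= ler_pdivrMr// mul1r ltW.
rewrite At; apply/negP; rewrite -ltNge.
have ts1 : tt w / s < 1 by rewrite ltr_pdivrMr// mul1r.
apply: le_lt_trans ts1; rewrite -[leRHS]mulr1 ler_wpM2l// divr_ge0// ltW//.
Qed.

Let tt_cont w : w != 0 -> {for w, continuous tt}.
Proof.
move=> w0; have [t0 At] := ttP w0.
apply/(@cvgrPdist_lt _ _ _ (nbhs w)) => e e0.
pose s1 := Num.max 0 (tt w - e); pose s2 := tt w + e.
have s1t : s1 < tt w by rewrite gt_max t0 ltrBlDr ltrDl.
have cs s : {for w, continuous (fun w' : V => A (s *: w'))}.
  by apply: (@continuous_comp _ _ _ (fun w' : V => s *: w') A); [exact: scaler_continuous|exact: cA].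
have A1 : A (s1 *: w) < 1 by apply: A_lt s1t At; rewrite le_max lexx.
have A2 : 1 < A (s2 *: w) by apply: A_gt => //; rewrite ltrDl.
near=> w'.
have w'0 : w' != 0.
  rewrite -normr_gt0; near: w'; apply: (cvgr_gt _ (@norm_continuous _ _ w)).
  by rewrite normr_gt0.
have [t'0 At'] := ttP w'0.
have B1 : A (s1 *: w') < 1 by near: w'; exact: (cvgr_lt _ (cs s1)).
have B2 : 1 < A (s2 *: w') by near: w'; exact: (cvgr_gt _ (cs s2)).
rewrite ltr_distlC; apply/andP; split.
  apply: le_lt_trans (_ : _ <= s1) _; first by rewrite le_max lexx orbT.
  rewrite ltNge le_eqVlt; apply/negP => /orP[/eqP E|]; first by rewrite -E At' ltxx in B1.
  by move=> /(A_gt w'0) /(lt_trans B1); rewrite ltxx.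
rewrite ltNge le_eqVlt; apply/negP => /orP[/eqP E|]; first by rewrite /s2 in B2; rewrite E At' ltxx in B2.
move=> st; have := A_lt _ st At'; rewrite addr_ge0 ?ltW//.
by move=> /(_ isT) /(lt_trans B2); rewrite ltxx.
Unshelve. all: by end_near. Qed.

Let rho (w : V) : V := tt w *: w.

Let rhoN w : rho (- w) = - rho w.
Proof. by rewrite /rho ttN scalerN. Qed.

Let rho_S w : w != 0 -> S (rho w).
Proof. by move=> /ttP[]. Qed.

Let rho_cont w : w != 0 -> {for w, continuous rho}.
Proof. by move=> w0; apply: (@cvgZ _ _ _ (nbhs w)); [exact: tt_cont|exact: cvg_id]. Qed.

Let S0 v : S v -> v != 0.
Proof. by move=> Sv; apply/eqP => v0; move: Sv; rewrite /S /= v0 A0 => /eqP; rewrite eq_sym oner_eq0. Qed.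

(** Borsuk-Ulam for the odd map [P \o F \o rho \o io] from R^(m+1) to R^m: an odd deformation cannot
    move the sphere spanned by [io] off the zeros of [P]. *)
Let intersect (F : V -> V) : (forall v, F (- v) = - F v) ->
  (forall v, S v -> {for v, continuous F}) ->
  exists v, [/\ S v, alpha <= B v & P (F v) = 0].
Proof.
move=> F_odd cF.
have [||x x0 fx] := @odd_continuous_zero R m (fun x => P (F (rho (io x)))).
- by move=> x; rewrite io_odd rhoN F_odd P_odd.
- move=> x x0; apply: (@continuous_comp _ _ _ (fun x => F (rho (io x))) P); last exact: cP.
  apply: (@continuous_comp _ _ _ (fun x => rho (io x)) F); last exact/cF/rho_S/io_inj.
  by apply: (@continuous_comp _ _ _ io rho); [exact: cio|exact/rho_cont/io_inj].
exists (rho (io x)); split => //; first exact/rho_S/io_inj.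
by apply: B_io; exact/rho_S/io_inj.
Qed.

(* The component of [dB] tangent to the level sets of [A], times [|dA|^2]. *)
Let X (v : V) : V := dotv (dA v) (dA v) *: dB v - dotv (dB v) (dA v) *: dA v.

Let cX : continuous X.
Proof.
move=> v; apply: (@cvgB _ _ _ (nbhs v) _ (fun v => dotv (dA v) (dA v) *: dB v) (fun v => dotv (dB v) (dA v) *: dA v)); apply: (@cvgZ _ _ _ (nbhs v)); try exact: cdA; try exact: cdB.
  by apply: (@continuous_dotv _ _ _ dA dA); exact: cdA.
by apply: (@continuous_dotv _ _ _ dB dA); [exact: cdB|exact: cdA].
Qed.

Let XN v : X (- v) = - X v.
Proof. by rewrite /X dA_odd dB_odd !dotvNl !dotvNr !opprK !scalerN opprB addrC opprK. Qed.

Let dAX v : dotv (dA v) (X v) = 0.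
Proof. by rewrite dotvBr !dotvZr (dotvC (dB v)) mulrC subrr. Qed.

Let D v := dotv (dB v) (X v).

Let cD : continuous D.
Proof. by move=> v; apply: (@continuous_dotv _ _ _ dB X); [exact: cdB|exact: cX]. Qed.

Let XX v : dotv (X v) (X v) = dotv (dA v) (dA v) * D v.
Proof. by rewrite {1}/X dotvBl !dotvZl dAX mulr0 subr0. Qed.

(** Without such a point, an odd ascent step [T] raises [B] by a fixed amount wherever
    [alpha <= B <= eps] and never brings a higher point below [eps0]. Some iterate then has
    [B >= eps0] on everything that starts with [B >= alpha], while [intersect] finds a point of its
    image where [P] vanishes, hence [B < eps0]. *)
Lemma lusternik_schnirelmann : exists c l,
  [/\ 0 < l, A c = 1, dA c = l *: dB c & alpha <= B c <= eps].
Proof.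
apply: contrapT => ncrit.
have ae : alpha < eps0.
  have [||v [Sv av Pv]] := intersect (F := id); [by []|by move=> v _; exact: cvg_id|].
  exact: le_lt_trans av (B_P Sv Pv).
have dAdA v : S v -> 0 < dotv (dA v) (dA v).
  move=> Sv; apply: dotvv_gt0; apply/eqP => dA0.
  by have := dA_ge v; rewrite Sv dA0 dotvC dotv0 ler10.
have D0 v : S v -> 0 <= D v.
  by move=> Sv; have := dotvv_ge0 (X v); rewrite XX pmulr_rge0// dAdA.
(* If the tangential component vanishes, the gradients are parallel; the factor is positive because
   [dotv (dB v) v > 0] and [dotv (dA v) v >= 1]. *)
have Dpos v : S v -> alpha <= B v <= eps -> 0 < D v.
  move=> Sv aBe; rewrite lt_neqAle D0// andbT; apply/eqP => DE.
  have : X v = 0.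
    apply/eqP; apply: contraT => /dotvv_gt0; by rewrite XX -DE mulr0 ltxx.
  move=> /eqP; rewrite subr_eq0 => /eqP XE.
  have a0 := dAdA v Sv.
  have b0 : 0 < dotv (dB v) (dA v).
    have /andP[aB _] := aBe; have bv := dB_pos Sv aB.
    have av : 0 < dotv (dA v) v by apply: lt_le_trans (dA_ge v); rewrite Sv.
    have : dotv (dotv (dA v) (dA v) *: dB v) v = dotv (dotv (dB v) (dA v) *: dA v) v by rewrite XE.
    by rewrite !dotvZl => E; rewrite -(pmulr_lgt0 _ av) -E mulr_gt0.
  apply: ncrit; exists v, (dotv (dA v) (dA v) / dotv (dB v) (dA v)); split => //.
    by rewrite divr_gt0.
  by rewrite mulrC -scalerA XE scalerA mulVf ?scale1r// gt_eqF.
pose K := [set v | S v /\ alpha <= B v <= eps].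
have cK : compact K.
  apply: (subclosed_compact _ S_compact); last by move=> v [].
  have -> : K = (A @^-1` [set 1]) `&` (B @^-1` [set x | alpha <= x]) `&` (B @^-1` [set x | x <= eps]).
    by apply/seteqP; split => v; [move=> [? /andP[]]|move=> [[? ?] ?]; split => //; apply/andP].
  apply: closedI; first apply: closedI.
  - by apply: closed_comp => [x _|]; [exact: cA|exact: closed_eq].
  - by apply: closed_comp => [x _|]; [exact: cB|exact: closed_ge].
  - by apply: closed_comp => [x _|]; [exact: cB|exact: closed_le].
have [ka ka0 Hka] : exists2 ka, 0 < ka & forall v, K v -> ka <= D v.
  have [K0|/set0P K0] := eqVneq K set0; first by exists 1 => // v; rewrite K0.
  have [c cK' Hc] : exists2 c, c \in K & forall t, t \in K -> D c <= D t.
    by apply: compact_EVT_min => //; apply: continuous_subspaceT; exact: cD.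
  exists (D c); first by have [Sc ?] := set_mem cK'; exact: Dpos.
  by move=> v Kv; apply: Hc; exact: mem_set.
have cXS v : S v -> {for v, continuous X} by move=> _; exact: cX.
have [C C0 HC] := compact_norm_bound S_compact cXS.
have cdBS v : S v -> {for v, continuous dB} by move=> _; exact: cdB.
have cdAS v : S v -> {for v, continuous dA} by move=> _; exact: cdA.
have [b b0 Hb] := compact_norm_bound S_compact cdBS.
have [r r0 Sr] : exists2 r, 0 < r & forall v, S v -> `|v| <= r.
  exists (1 + delta^-1); last exact: S_bound.
  by rewrite ltr_wpDr// invr_ge0 ltW.
pose kk : R := k%:R + 1.
have kk0 : 0 < kk by rewrite ltr_wpDl.
(* [e] and [e1] make the error terms below smaller than [ka / 2]. *)
pose e := ka / (8 * (C + r + 1)).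
have e0 : 0 < e by rewrite divr_gt0// mulr_gt0// !addr_gt0.
have [dB1 dB10 HB1] := B_diff r e0.
pose q := Num.min 1 (ka / (8 * (kk * b * (r + 1)))).
have q0 : 0 < q by rewrite lt_min ltr01 divr_gt0// !mulr_gt0// addr_gt0.
pose e1 := q / (kk * C).
have e10 : 0 < e1 by rewrite divr_gt0// mulr_gt0.
have [d1 d10 Hd1] := compact_uniform_continuity S_compact cdAS e10.
(* In this order, the bounds keep the step bounded, within the uniform continuity of [dA], within
   the radius given by [B_diff], and make a loss above level [eps] at most [eps - eps0]. *)
pose tau := Num.min (Num.min (1 / (C + 1)) (d1 / (C + 1))) (Num.min (dB1 / (C + r + 1)) ((eps - eps0) / ka)).
have C10 : 0 < C + 1 by rewrite addr_gt0.
have Cr0 : 0 < C + r + 1 by rewrite !addr_gt0.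
have tau0 : 0 < tau by rewrite !lt_min !divr_gt0// subr_gt0.
have : tau <= tau by []; rewrite {2}/tau !le_min => /andP[/andP[]].
rewrite !ler_pdivlMr// => tau1 tau2 /andP[tau3 tau4].
pose T (v : V) : V := rho (v + tau *: X v).
have TN v : T (- v) = - T v by rewrite /T XN scalerN -opprD rhoN.
have step_neq0 v : S v -> v + tau *: X v != 0.
  move=> Sv; apply/eqP => E; have := A_sub v (v + tau *: X v).
  by rewrite [_ - v]addrC addKr dotvZr dAX mulr0 addr0 E A0 Sv ler10.
have cT v : S v -> {for v, continuous T}.
  move=> Sv; apply: (@continuous_comp _ _ _ (fun v : V => (v + tau *: X v : V)) rho); last exact/rho_cont/step_neq0.
  apply: (@cvgD _ _ _ (nbhs v) _ id (fun v => tau *: X v)); first exact: cvg_id.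
  by apply: (@cvgZ _ _ _ (nbhs v) _ (fun=> tau) X); [exact: cvg_cst|exact: cX].
have TS v : S v -> S (T v) by move=> /step_neq0; exact: rho_S.
have Bstep v : S v -> B v + tau * (D v - ka / 2) <= B (T v).
  move=> Sv; set w := v + tau *: X v; have w0 := step_neq0 v Sv.
  have [t0 Atw] := ttP w0; rewrite -/w in t0 Atw.
  have wv : w - v = tau *: X v by rewrite /w addrC addKr.
  have nX := HC v Sv.
  have nwv : `|w - v| <= tau * C by rewrite wv normrZ gtr0_norm// ler_wpM2l// ltW.
  have Aw : 1 <= A w by have := A_sub v w; rewrite wv dotvZr dAX mulr0 addr0 Sv.
  have t1 : tt w <= 1.
    rewrite leNgt; apply/negP => t1; have := A_lt ler01 t1 Atw.
    by rewrite scale1r ltNge Aw.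
  (* convexity of [A] at [T v] and at [w] *)
  have tw1 : (tt w)^-1 - 1 <= A w - 1.
    have := A_sub (tt w *: w) w; rewrite Atw.
    have -> : w - tt w *: w = ((tt w)^-1 - 1) *: (tt w *: w).
      by rewrite scalerBl scale1r scalerA mulVf ?gt_eqF// scale1r.
    rewrite dotvZr; have := dA_ge (tt w *: w); rewrite Atw.
    have : 0 <= (tt w)^-1 - 1 by rewrite subr_ge0 invf_ge1.
    set z := dotv _ _; nra.
  (* [X v] is tangent at [v], so the first-order term at [w] is a difference of gradients of [A]:
     going back to the level set costs [tau * q], with [q] small against [ka]. *)
  have tw2 : A w - 1 <= tau * q.
    have := A_sub w v; rewrite Sv -opprB dotvNr wv dotvZr => H.
    have E : dotv (dA w) (X v) = dotv (dA w - dA v) (X v) by rewrite dotvBl dAX subr0.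
    have : `|dotv (dA w - dA v) (X v)| <= q.
      apply: le_trans (dotv_le _ _) _.
      have dd : `|dA w - dA v| <= e1.
        rewrite distrC; apply/ltW/Hd1 => //; rewrite distrC; apply: le_lt_trans nwv _.
        by nra.
      apply: (@le_trans _ _ (kk * (e1 * C))).
        apply: ler_pM => //; first by rewrite /kk lerDl.
        exact: ler_pM.
      by rewrite /e1 le_eqVlt; apply/orP; left; apply/eqP; field; rewrite !gt_eqF.
    rewrite -E => /(le_trans (ler_norm _)) E'; nra.
  have t2 : 1 - tt w <= tau * q.
    apply: le_trans tw2; apply: le_trans tw1.
    have := mulfV (lt0r_neq0 t0); have : 0 < (tt w)^-1 by rewrite invr_gt0.
    set ti := (tt w)^-1; nra.
  have q1 : q <= 1 by rewrite ge_min lexx.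
  have yv : T v - v = tau *: X v - (1 - tt w) *: w.
    by rewrite /T /rho -/w -wv scalerBl scale1r opprB [RHS]addrC addrA subrK.
  have nv := Sr v Sv.
  have nw : `|w| <= r + 1.
    rewrite -[w](subrK v) addrC; apply: le_trans (ler_normD _ _) _.
    apply: lerD => //; apply: le_trans nwv _; apply: le_trans tau1.
    by rewrite ler_pM2l// lerDl.
  have nyv : `|T v - v| <= tau * (C + (r + 1)).
    rewrite yv; apply: le_trans (ler_normB _ _) _; rewrite -wv mulrDr; apply: lerD => //.
    rewrite normrZ ger0_norm ?subr_ge0//; apply: ler_pM => //; first by rewrite subr_ge0.
    by apply: le_trans t2 _; rewrite ler_piMr// ltW.
  have := HB1 v (T v) nv.
  have -> : dotv (dB v) (T v - v) = tau * D v - (1 - tt w) * dotv (dB v) w.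
    by rewrite yv dotvBr !dotvZr.
  have nd : `|T v - v| <= dB1 by apply: le_trans nyv _; rewrite addrA.
  move=> /(_ nd).
  have nBw : `|dotv (dB v) w| <= kk * (b * (r + 1)).
    apply: le_trans (dotv_le _ _) _; apply: ler_pM => //; first by rewrite /kk lerDl.
    by apply: ler_pM => //; exact: Hb.
  have q2 : q * (kk * (b * (r + 1))) <= ka / 8.
    have : q <= ka / (8 * (kk * b * (r + 1))) by rewrite ge_min lexx orbT.
    have g0 : 0 < kk * b * (r + 1) by rewrite !mulr_gt0// addr_gt0.
    have g8 : 0 < 8 * (kk * b * (r + 1)) by rewrite mulr_gt0.
    rewrite (ler_pdivlMr _ _ g8) ler_pdivlMr// => H; apply: le_trans H.
    by rewrite le_eqVlt; apply/orP; left; apply/eqP; ring.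
  have e2 : e * (C + (r + 1)) = ka / 8.
    by rewrite /e addrA; field; rewrite gt_eqF.
  have H1 : (1 - tt w) * dotv (dB v) w <= tau * (ka / 8).
    apply: le_trans (ler_norm _) _; rewrite normrM ger0_norm ?subr_ge0//.
    apply: (@le_trans _ _ (tau * q * (kk * (b * (r + 1))))).
      by apply: ler_pM => //; rewrite subr_ge0.
    by rewrite -mulrA ler_pM2l.
  have H2 : e * `|T v - v| <= tau * (ka / 8).
    by rewrite -e2 mulrCA ler_pM2l.
  have : 0 < tau * ka by rewrite mulr_gt0.
  move=> tk H0; lra.
(* Between the two levels the gain is at least [tau * ka / 2]; above [eps] the loss is at most that,
   and the choice of [tau] leaves the point above [eps0]. *)
have Bmin v : S v -> alpha <= B v -> Num.min (B v + tau * ka / 2) eps0 <= B (T v).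
  move=> Sv aB; have := Bstep v Sv; have [Be|Be] := leP (B v) eps.
    have := Hka v (conj Sv (introT andP (conj aB Be))) => kD H.
    rewrite ge_min; apply/orP; left; apply: le_trans H.
    by rewrite lerD2l -mulrA ler_pM2l//; lra.
  move=> H; rewrite ge_min; apply/orP; right.
  have := D0 v Sv; have : 0 < tau * ka by rewrite mulr_gt0.
  move=> tk Dv.
  have : 0 <= tau * D v by rewrite mulr_ge0// ltW.
  lra.
have Biter N v : S v -> alpha <= B v -> S (iter N T v) /\
    Num.min (alpha + N%:R * (tau * ka / 2)) eps0 <= B (iter N T v).
  move=> Sv aB; elim: N => [|N [SN BN]] /=.
    by split => //; rewrite mul0r addr0 ge_min aB.
  split; first exact: TS.
  have tk : 0 < tau * ka / 2 by rewrite divr_gt0// mulr_gt0.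
  have aBN : alpha <= B (iter N T v).
    apply: le_trans BN; rewrite le_min (ltW ae) andbT lerDl mulr_ge0// ltW//.
  apply: le_trans (Bmin _ SN aBN); rewrite le_min; apply/andP; split; last by rewrite ge_min lexx orbT.
  move: BN; rewrite !ge_min => /orP[BN|BN]; apply/orP; [left|right => //].
    by rewrite -natr1 mulrDl mul1r addrA lerD2r.
  by apply: le_trans BN _; rewrite lerDl ltW.
have [N HN] : exists N : nat, eps0 - alpha <= N%:R * (tau * ka / 2).
  have tk : 0 < tau * ka / 2 by rewrite divr_gt0// mulr_gt0.
  exists (Num.bound `|(eps0 - alpha) / (tau * ka / 2)|).
  by rewrite -ler_pdivrMr// ltW// (le_lt_trans (ler_norm _))// archi_boundP.
have [||v [Sv av Pv]] := intersect (F := iter N T).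
- by elim: N {HN} => //= N IH v; rewrite IH TN.
- elim: N {HN} => [|N IH] v Sv /=; first exact: cvg_id.
  apply: (@continuous_comp _ _ _ (iter N T) T); first exact: IH.
  apply: cT; elim: N {IH} => //= N; exact: TS.
have [SN BN] := Biter N v Sv av.
have := B_P SN Pv; apply/negP; rewrite -leNgt; apply: le_trans BN.
by rewrite le_min lexx andbT -lerBlDl.
Qed.

End lusternik_schnirelmann.

End DiscreteMinimax.
Import DiscreteMinimax.

Module Kernels.

(** * Kernels whose integrals do not depend on the scale *)

Section convolution.
Context (R : realType) (n : nat).
Local Notation la := (lebesgue_rV R n).
Local Notation X := 'rV[R]_n.
Local Open Scope ereal_scope.

Lemma measurable_rV_sub1 (x : X) : measurable_fun setT (fun y : X => (x - y)%R).
Proof.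
apply: measurable_fun_rVP => i.
rewrite (_ : _ \o _ = fun y => (x ord0 i - rV_coord i y)%R); last first.
  by apply/funext => y; rewrite /= /rV_coord !mxE.
by apply: measurable_funB => //; exact: measurable_rV_coord.
Qed.

Lemma measurable_rV_sub : measurable_fun setT (fun z : X * X => (z.1 - z.2)%R).
Proof.
apply: measurable_fun_rVP => i.
rewrite (_ : _ \o _ = fun z => (rV_coord i z.1 - rV_coord i z.2)%R); last first.
  by apply/funext => z; rewrite /= /rV_coord !mxE.
apply: measurable_funB.
- exact: measurableT_comp (measurable_rV_coord i) measurable_fst.
- exact: measurableT_comp (measurable_rV_coord i) measurable_snd.
Qed.

Lemma measurable_fun_sub d (T : measurableType d) (f : X -> T) : measurable_fun setT f ->
  measurable_fun setT (fun z : X * X => f (z.1 - z.2)%R).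
Proof. by move=> mf; apply: measurableT_comp => //; exact: measurable_rV_sub. Qed.

Lemma ge0_integral_reflect (k : X -> \bar R) (x : X) : measurable_fun setT k ->
  (forall h, 0 <= k h) -> (forall h, k (- h)%R = k h) ->
  \int[la]_y k (x - y)%R = \int[la]_h k h.
Proof.
move=> mk k0 kN; rewrite -(ge0_integral_translation (- x)%R mk k0).
by apply: eq_integral => y _; rewrite -kN opprB.
Qed.

Lemma ge0_integral_conv1 (W k : X -> \bar R) : measurable_fun setT W -> measurable_fun setT k ->
  (forall x, 0 <= W x) -> (forall h, 0 <= k h) -> (forall h, k (- h)%R = k h) ->
  \int[la \x la]_z (W z.1 * k (z.1 - z.2)%R) = \int[la]_x W x * \int[la]_h k h.
Proof.
move=> mW mk W0 k0 kN.
have mWk : measurable_fun setT (fun z : X * X => W z.1 * k (z.1 - z.2)%R).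
  apply: emeasurable_funM; last exact: measurable_fun_sub.
  exact: measurableT_comp mW measurable_fst.
rewrite (fubini_tonelli1 _ mWk); last by move=> z; rewrite mule_ge0.
rewrite /fubini_F /= -ge0_integralZr//; last exact: integral_ge0.
apply: eq_integral => x _.
rewrite ge0_integralZl//; last by apply: (measurableT_comp mk); exact: measurable_rV_sub1.
by rewrite ge0_integral_reflect.
Qed.

Lemma ge0_integral_conv2 (W k : X -> \bar R) : measurable_fun setT W -> measurable_fun setT k ->
  (forall x, 0 <= W x) -> (forall h, 0 <= k h) -> (forall h, k (- h)%R = k h) ->
  \int[la \x la]_z (W z.2 * k (z.1 - z.2)%R) = \int[la]_x W x * \int[la]_h k h.
Proof.
move=> mW mk W0 k0 kN.
have mWk : measurable_fun setT (fun z : X * X => W z.2 * k (z.1 - z.2)%R).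
  apply: emeasurable_funM; last exact: measurable_fun_sub.
  exact: measurableT_comp mW measurable_snd.
rewrite (fubini_tonelli2 _ mWk); last by move=> z; rewrite mule_ge0.
rewrite /fubini_G /= -ge0_integralZr//; last exact: integral_ge0.
apply: eq_integral => y _.
rewrite ge0_integralZl//; last first.
  apply: (measurableT_comp mk).
  exact: measurable_rV_add.
by rewrite ge0_integral_translation.
Qed.

End convolution.

Section kernels.
Context (R : realType) (n : nat) (g r : R).
Hypothesis g0 : 0 < g.
Hypothesis r0 : 0 < r.
Local Notation la := (lebesgue_rV R n).
Local Notation X := 'rV[R]_n.

(** The weight [|h| ^- n] of [nu], made integrable near 0 by a power of [|h| / r]; [outer_kernel]
    does the same at infinity. By homogeneity the bound [kernel_const] for both integrals is free of
    [r]. *)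
Definition inner_kernel (h : X) : R :=
  if `|h| < r then (`|h| / r) `^ g * enorm h ^- n else 0.

Definition outer_kernel (h : X) : R :=
  if `|h| < r then 0 else (r / `|h|) `^ g * enorm h ^- n.

Definition kernel_const : R := 4 ^+ n / (1 - (2^-1) `^ g).

Let halfg : 0 < (2^-1 : R) `^ g < 1.
Proof.
rewrite powR_gt0 ?invr_gt0//= -[ltRHS](congr1 (fun f => f g) (@powR1 R)).
by apply: gt0_ltr_powR; rewrite ?nnegrE ?invr_ge0// invf_lt1// ltr1n.
Qed.

Lemma kernel_const_ge0 : 0 <= kernel_const.
Proof. by rewrite divr_ge0 ?exprn_ge0// subr_ge0; case/andP: halfg => _ /ltW. Qed.

Lemma inner_kernel_ge0 h : 0 <= inner_kernel h.
Proof. by rewrite /inner_kernel; case: ifP => // _; rewrite mulr_ge0 ?powR_ge0// invr_ge0 exprn_ge0// enorm_ge0. Qed.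

Lemma outer_kernel_ge0 h : 0 <= outer_kernel h.
Proof. by rewrite /outer_kernel; case: ifP => // _; rewrite mulr_ge0 ?powR_ge0// invr_ge0 exprn_ge0// enorm_ge0. Qed.

Lemma inner_kernelN h : inner_kernel (- h) = inner_kernel h.
Proof. by rewrite /inner_kernel normrN enormN. Qed.

Lemma outer_kernelN h : outer_kernel (- h) = outer_kernel h.
Proof. by rewrite /outer_kernel normrN enormN. Qed.

Lemma measurable_enorm : measurable_fun setT (@enorm R n).
Proof.
apply: (@measurableT_comp _ _ _ _ _ _ (@Num.sqrt R)).
  by apply: continuous_measurable_fun; exact: sqrt_continuous.
by apply: measurable_sum => i; apply: measurable_funX; exact: measurable_rV_coord.
Qed.

Lemma measurable_norm_rV : measurable_fun setT (fun h : X => `|h|).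
Proof. by apply: continuous_measurable_rV; exact: norm_continuous. Qed.

Lemma measurable_enorm_pow : measurable_fun setT (fun h : X => enorm h ^- n).
Proof.
rewrite (_ : (fun _ => _) = (fun h => enorm h `^ (- n%:R))); last first.
  by apply/funext => z; rewrite powR_invn ?enorm_ge0.
by apply: (@measurableT_comp _ _ _ _ _ _ (fun r : R => r `^ (- n%:R))); [exact: measurable_powR|exact: measurable_enorm].
Qed.

Lemma measurable_inner_kernel : measurable_fun setT inner_kernel.
Proof.
apply: measurable_fun_ifT => //.
- by apply: measurable_fun_ltr => //; exact: measurable_norm_rV.
- apply: measurable_funM; last exact: measurable_enorm_pow.
  apply: (@measurableT_comp _ _ _ _ _ _ (fun r : R => r `^ g)); first exact: measurable_powR.
  by apply: measurable_funM => //; exact: measurable_norm_rV.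
Qed.

Lemma measurable_outer_kernel : measurable_fun setT outer_kernel.
Proof.
apply: measurable_fun_ifT => //.
- by apply: measurable_fun_ltr => //; exact: measurable_norm_rV.
- apply: measurable_funM; last exact: measurable_enorm_pow.
  apply: (@measurableT_comp _ _ _ _ _ _ (fun r : R => r `^ g)); first exact: measurable_powR.
  apply: measurable_funM => //.
  rewrite (_ : (fun _ => _) = (fun h : X => `|h| `^ (-1))); last first.
    by apply/funext => h; rewrite powR_inv1.
  by apply: (@measurableT_comp _ _ _ _ _ _ (fun r : R => r `^ (-1))); [exact: measurable_powR|exact: measurable_norm_rV].
Qed.

Let powRXn (x : R) j : 0 <= x -> (x `^ g) ^+ j = (x ^+ j) `^ g.
Proof. by move=> x0; rewrite -powR_mulrn ?powR_ge0// -powRrM mulrC powRrM powR_mulrn. Qed.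

Let enorm_pow_le (h : X) (a : R) : 0 < a -> a <= `|h| -> enorm h ^- n <= a ^- n.
Proof.
move=> a0 ah; have eh : a <= enorm h := le_trans ah (norm_le_enorm h).
by rewrite lef_pV2 ?posrE ?exprn_gt0 ?(lt_le_trans a0)// lerXn2r ?nnegrE ?enorm_ge0// ltW.
Qed.

Let half_cvg (e : R) : 0 < e -> exists j, (2^-1 : R) ^+ j < e.
Proof.
move=> e0; have q1 : `|2^-1 : R| < 1 by rewrite ger0_norm; lra.
have /cvgrPdist_lt/(_ e e0)[N _ /(_ N (leqnn N))] := cvg_expr q1.
by rewrite /= sub0r normrN => H; exists N; exact: le_lt_trans (ler_norm _) H.
Qed.

(** The shells are [r / 2 ^ (j + 1) <= |h| <= r / 2 ^ j], on which the power is at most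
    [(1 / 2 ^ j) ^ g]. *)
Lemma integral_inner_kernel : (\int[la]_h (inner_kernel h)%:E <= kernel_const%:E)%E.
Proof.
apply: (@kernel_integral_bound _ _ _ (fun j => r * 2^-1 ^+ j.+1) ((2^-1) `^ g) _ _ halfg) => //.
- by apply/measurable_EFinP; exact: measurable_inner_kernel.
- by move=> h; rewrite lee_fin inner_kernel_ge0.
- by move=> j; rewrite mulr_gt0// exprn_gt0// invr_gt0.
move=> h; rewrite /inner_kernel; case: ifPn => hr; last by left.
have [->|h0] := eqVneq h 0; first by left; rewrite normr0 mul0r powR0 ?gt_eqF// mul0r.
right; have nh : 0 < `|h| by rewrite normr_gt0.
have [j0 Hj0] : exists j, r * 2^-1 ^+ j.+1 <= `|h|.
  have [j Hj] := half_cvg (divr_gt0 nh r0); exists j.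
  rewrite mulrC -ler_pdivlMr//; apply: le_trans (ltW Hj).
  by rewrite exprS ler_piMl ?exprn_ge0 ?invr_ge0//; lra.
have [j Hj minj] := ex_minnP (ex_intro (fun j => r * 2^-1 ^+ j.+1 <= `|h|) j0 Hj0).
have hj : `|h| <= r * 2^-1 ^+ j.
  case: j minj {Hj} => [_|j minj]; first by rewrite expr0 mulr1 ltW.
  by rewrite ltW// ltNge; apply/negP => /minj; rewrite ltnn.
exists j; first by apply: le_trans hj _; rewrite exprS mulrCA mulVKf ?gt_eqF// mulrA divff ?mul1r ?gt_eqF.
rewrite lee_fin; apply: ler_pM; rewrite ?powR_ge0 ?invr_ge0 ?exprn_ge0 ?enorm_ge0//.
  rewrite powRXn ?invr_ge0//; apply: ge0_ler_powR; rewrite ?nnegrE ?(ltW g0)//.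
  - by rewrite divr_ge0// ltW.
  - by rewrite ler_pdivrMr// mulrC.
by apply: enorm_pow_le => //; rewrite mulr_gt0// exprn_gt0// invr_gt0.
Qed.

Lemma integral_outer_kernel : (\int[la]_h (outer_kernel h)%:E <= kernel_const%:E)%E.
Proof.
apply: (@kernel_integral_bound _ _ _ (fun j => r * 2 ^+ j) ((2^-1) `^ g) _ _ halfg) => //.
- by apply/measurable_EFinP; exact: measurable_outer_kernel.
- by move=> h; rewrite lee_fin outer_kernel_ge0.
- by move=> j; rewrite mulr_gt0// exprn_gt0.
move=> h; rewrite /outer_kernel; case: ifPn; first by left.
rewrite -leNgt => hr; right; have nh : 0 < `|h| := lt_le_trans r0 hr.
have [j0 Hj0] : exists j, `|h| <= r * 2 ^+ j.+1.
  have [j Hj] := half_cvg (divr_gt0 r0 nh); exists j.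
  have : `|h| <= r * 2 ^+ j.
    by move: Hj; rewrite exprVn ltr_pdivlMr// mulrC ltr_pdivrMr ?exprn_gt0// => /ltW.
  move=> H; apply: le_trans H _; rewrite ler_pM2l// exprS ler_peMl ?exprn_ge0//; lra.
have [j Hj minj] := ex_minnP (ex_intro (fun j => `|h| <= r * 2 ^+ j.+1) j0 Hj0).
have hj : r * 2 ^+ j <= `|h|.
  case: j minj {Hj} => [_|j minj]; first by rewrite expr0 mulr1.
  by rewrite leNgt; apply/negP => /ltW /minj; rewrite ltnn.
exists j; first by rewrite mulrCA -exprS.
rewrite lee_fin; apply: ler_pM; rewrite ?powR_ge0 ?invr_ge0 ?exprn_ge0 ?enorm_ge0//.
  rewrite powRXn ?invr_ge0//; apply: ge0_ler_powR; rewrite ?nnegrE ?(ltW g0)//.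
  - by rewrite divr_ge0// ltW.
  - by rewrite ler_pdivrMr// exprVn ler_pdivlMl ?exprn_gt0// mulrC.
by apply: enorm_pow_le => //; rewrite mulr_gt0// exprn_gt0.
Qed.

End kernels.

End Kernels.
Import Kernels.

Module Energies.

Section ge0_real_integral.
Local Open Scope ereal_scope.
Context d (T : measurableType d) (R : realType) (mu : {measure set T -> \bar R}).
Implicit Types f g : T -> R.

Lemma int_ge0 f : (forall x, (0 <= f x)%R) -> 0 <= \int[mu]_x (f x)%:E.
Proof. by move=> f0; apply: integral_ge0 => x _; rewrite lee_fin. Qed.

Lemma int_le f g : measurable_fun setT f -> measurable_fun setT g ->
  (forall x, (0 <= f x)%R) -> (forall x, (f x <= g x)%R) ->
  \int[mu]_x (f x)%:E <= \int[mu]_x (g x)%:E.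
Proof.
move=> mf mg f0 fg; apply: ge0_le_integral => //.
- by move=> x _; rewrite lee_fin.
- exact/measurable_EFinP.
- exact/measurable_EFinP.
- by move=> x _; rewrite lee_fin.
Qed.

Lemma intZ f c : measurable_fun setT f -> (forall x, (0 <= f x)%R) -> (0 <= c)%R ->
  \int[mu]_x (c * f x)%:E = c%:E * \int[mu]_x (f x)%:E.
Proof.
move=> mf f0 c0; under eq_integral do rewrite EFinM.
rewrite ge0_integralZl_EFin//.
- by move=> x _; rewrite lee_fin.
- exact/measurable_EFinP.
Qed.

Lemma intD f g : measurable_fun setT f -> measurable_fun setT g ->
  (forall x, (0 <= f x)%R) -> (forall x, (0 <= g x)%R) ->
  \int[mu]_x (f x + g x)%:E = \int[mu]_x (f x)%:E + \int[mu]_x (g x)%:E.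
Proof.
move=> mf mg f0 g0; under eq_integral do rewrite EFinD.
rewrite ge0_integralD//.
- by move=> x _; rewrite lee_fin.
- exact/measurable_EFinP.
- by move=> x _; rewrite lee_fin.
- exact/measurable_EFinP.
Qed.

End ge0_real_integral.

(** * Modulars of u and of D^s u *)

Section modular.
Context (R : realType) (n : nat) (s : R) (M : R -> R).
Hypothesis n0 : (0 < n)%N.
Hypothesis s01 : 0 < s < 1.
Hypothesis youngM : young M.
Local Notation la := (lebesgue_rV R n).
Local Notation X := 'rV[R]_n.
Local Notation M0 := (young0 youngM).
Local Notation M_ge0 := (young_ge0 youngM).
Implicit Types (u v w : X -> R) (K r : R) (z : X * X).

Let s0 : 0 < s. Proof. by case/andP: s01. Qed.
Let s1 : 0 < 1 - s. Proof. by rewrite subr_gt0; case/andP: s01. Qed.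
Let nR0 : 0 < n%:R :> R. Proof. by rewrite ltr0n. Qed.

(** The density of the modular of [D^s u] with respect to Lebesgue measure. [nmod] keeps the part
    near the diagonal, and [osc] also drops both singular weights. *)
Definition dmod K u z : R := M (@Ds R n s u z / K) * enorm (z.1 - z.2) ^- n.
Definition nmod r K u z : R := if `|z.1 - z.2| <= r then dmod K u z else 0.
Definition osc r K u z : R := if `|z.1 - z.2| <= r then M ((u z.1 - u z.2) / K) else 0.
Definition energy K u := (\int[la \x la]_z (dmod K u z)%:E)%E.
Definition near_energy r K u := (\int[la \x la]_z (nmod r K u z)%:E)%E.
Definition amod K u := (\int[la]_x (M (u x / K))%:E)%E.

Lemma invpow_ge0 (h : X) : 0 <= enorm h ^- n.
Proof. by rewrite invr_ge0 exprn_ge0// enorm_ge0. Qed.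

Lemma dmod_ge0 K u z : 0 <= dmod K u z.
Proof. by rewrite mulr_ge0 ?M_ge0 ?invpow_ge0. Qed.

Lemma nmod_ge0 r K u z : 0 <= nmod r K u z.
Proof. by rewrite /nmod; case: ifP => // _; exact: dmod_ge0. Qed.

Lemma osc_ge0 r K u z : 0 <= osc r K u z.
Proof. by rewrite /osc; case: ifP => // _; exact: M_ge0. Qed.

Lemma nmod_le_dmod r K u z : nmod r K u z <= dmod K u z.
Proof. by rewrite /nmod; case: ifP => // _; exact: dmod_ge0. Qed.

Lemma measurable_diff u : measurable_fun setT u -> measurable_fun setT (fun z => u z.1 - u z.2).
Proof.
move=> mu; apply: measurable_funB.
- exact: measurableT_comp mu measurable_fst.
- exact: measurableT_comp mu measurable_snd.
Qed.

Lemma measurable_Ds u : measurable_fun setT u -> measurable_fun setT (fun z : X * X => @Ds R n s u z).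
Proof.
move=> mu; apply: measurable_funM; first exact: measurable_diff.
rewrite (_ : (fun _ => _) = (fun z : X * X => enorm (z.1 - z.2) `^ (- s))); last first.
  by apply/funext => z; rewrite powRN.
apply: (@measurableT_comp _ _ _ _ _ _ (fun r : R => r `^ (- s))); first exact: measurable_powR.
exact: measurable_enormB.
Qed.

Lemma measurable_M_div d (T : measurableType d) (f : T -> R) K : measurable_fun setT f ->
  measurable_fun setT (fun x => M (f x / K)).
Proof.
by move=> mf; apply: (measurableT_comp (measurable_young youngM)); exact: measurable_funM.
Qed.

Lemma measurable_dmod K u : measurable_fun setT u -> measurable_fun setT (dmod K u).
Proof.
move=> mu; apply: measurable_funM; first by apply: measurable_M_div; exact: measurable_Ds.
apply: (measurable_fun_sub (f := fun h : X => enorm h ^- n)); exact: measurable_enorm_pow.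
Qed.

Lemma measurable_norm_sub_le r : measurable_fun setT (fun z : X * X => `|z.1 - z.2| <= r).
Proof.
apply: measurable_fun_ler => //; apply: (measurable_fun_sub (f := fun h : X => `|h|)).
exact: measurable_norm_rV.
Qed.

Lemma measurable_nmod r K u : measurable_fun setT u -> measurable_fun setT (nmod r K u).
Proof.
move=> mu; apply: measurable_fun_ifT => //; first exact: measurable_norm_sub_le.
exact: measurable_dmod.
Qed.

Lemma measurable_osc r K u : measurable_fun setT u -> measurable_fun setT (osc r K u).
Proof.
move=> mu; apply: measurable_fun_ifT => //; first exact: measurable_norm_sub_le.
by apply: measurable_M_div; exact: measurable_diff.
Qed.

Lemma near_energy_ge0 r K u : (0 <= near_energy r K u)%E.
Proof. by apply: int_ge0 => z; exact: nmod_ge0. Qed.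

Lemma near_energy_le r K u : measurable_fun setT u -> (near_energy r K u <= energy K u)%E.
Proof.
by move=> mu; apply: int_le; [exact: measurable_nmod|exact: measurable_dmod|move=> z; exact: nmod_ge0|move=> z; exact: nmod_le_dmod].
Qed.

Lemma M_div_le (t K K' : R) : 0 < K -> K <= K' -> M (t / K') <= M (t / K).
Proof.
move=> K0 KK; have K0' := lt_le_trans K0 KK.
apply: (young_le youngM); rewrite !normrM ler_wpM2l// !normfV !gtr0_norm//.
by rewrite lef_pV2.
Qed.

Lemma near_energy_mono r r' K K' u : measurable_fun setT u -> r <= r' -> 0 < K -> K <= K' ->
  (near_energy r K' u <= near_energy r' K u)%E.
Proof.
move=> mu rr K0 KK; apply: int_le; [exact: measurable_nmod|exact: measurable_nmod|move=> z; exact: nmod_ge0|].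
move=> z; rewrite /nmod; case: ifPn => [zr|_].
  by rewrite (le_trans zr rr) ler_wpM2r ?invpow_ge0 ?M_div_le.
by case: ifP => // _; exact: dmod_ge0.
Qed.

Lemma Ds_diag u z : z.1 = z.2 -> @Ds R n s u z = 0.
Proof. by move=> E; rewrite /Ds E subrr mul0r. Qed.

(** At sup distance at most [r] the Euclidean distance is at most [n r]; both singular weights are
    then bounded below, one paid in the scale, the other by a factor. *)
Lemma osc_le_nmod r K u z : 0 < r -> 0 < K ->
  osc r (K * (n%:R * r) `^ s) u z <= (n%:R * r) ^+ n * nmod r K u z.
Proof.
move=> r0 K0; rewrite /osc /nmod; case: ifPn => [zr|_]; last by rewrite mulr0.
have D0 : 0 < n%:R * r by rewrite mulr_gt0.
have [E|zz] := eqVneq z.1 z.2.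
  by rewrite E subrr mul0r M0 mulr_ge0 ?dmod_ge0// exprn_ge0// ltW.
have e0 : 0 < enorm (z.1 - z.2) by rewrite enorm_gt0 subr_eq0.
have eD : enorm (z.1 - z.2) <= n%:R * r by apply: le_trans (enorm_le_norm _) _; rewrite ler_pM2l.
apply: (@le_trans _ _ (M (@Ds R n s u z / K))).
  apply: (young_le youngM); rewrite /Ds invfM !normrM !normfV.
  rewrite [`|(n%:R * r) `^ s|]ger0_norm ?powR_ge0// [`|enorm _ `^ s|]ger0_norm ?powR_ge0//.
  rewrite -!mulrA ler_wpM2l// mulrC ler_pM2r ?invr_gt0 ?normr_gt0 ?gt_eqF// lef_pV2 ?posrE ?powR_gt0//.
  by apply: ge0_ler_powR; rewrite ?nnegrE ?(ltW s0) ?(ltW e0) ?(ltW D0).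
rewrite /dmod mulrCA -[leLHS]mulr1 ler_wpM2l ?M_ge0// ler_pdivlMr ?exprn_gt0// mul1r.
by rewrite lerXn2r ?nnegrE ?(ltW e0) ?(ltW D0).
Qed.

Lemma integral_osc r K u : measurable_fun setT u -> 0 < r -> 0 < K ->
  (\int[la]_x \int[la]_q (osc r (K * (n%:R * r) `^ s) u (x, q))%:E <=
    ((n%:R * r) ^+ n)%:E * near_energy r K u)%E.
Proof.
move=> mu r0 K0.
have mo : measurable_fun setT (EFin \o osc r (K * (n%:R * r) `^ s) u).
  by apply/measurable_EFinP; exact: measurable_osc.
rewrite -(@fubini_tonelli1 _ _ _ _ _ la la _ mo); last by move=> z; rewrite lee_fin osc_ge0.
have D0 : 0 <= (n%:R * r) ^+ n by rewrite exprn_ge0// mulr_ge0// ltW.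
rewrite /near_energy -intZ//; [|exact: measurable_nmod|by move=> z; exact: nmod_ge0].
apply: int_le => [||z|z].
- exact: measurable_osc.
- by apply: measurable_funM => //; exact: measurable_nmod.
- exact: osc_ge0.
- exact: osc_le_nmod.
Qed.

Definition avg (c : X) r u : R := ((2 * r) ^+ n)^-1 * \int[la]_(q in cube c r) u q.

Lemma amod_le K K' u : measurable_fun setT u -> 0 < K -> K <= K' -> (amod K' u <= amod K u)%E.
Proof.
move=> mu K0 KK; apply: int_le => [||x|x]; [exact: measurable_M_div|exact: measurable_M_div|exact: M_ge0|exact: M_div_le].
Qed.

Lemma integrable_cst_fin (A : set X) (c : R) : measurable A -> (la A < +oo)%E ->
  la.-integrable A (EFin \o cst c).
Proof.
move=> mA Aoo; apply/integrableP; split; first by apply/measurable_EFinP; exact: measurable_cst.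
rewrite (_ : (fun _ => _) = cst (`|c|%:E)); last by apply/funext.
by rewrite integral_cst// lte_mul_pinfty// lee_fin.
Qed.

Lemma amod_fin_integrable K u (A : set X) : measurable_fun setT u -> 0 < K -> (amod K u < +oo)%E ->
  measurable A -> (la A < +oo)%E -> la.-integrable A (EFin \o u).
Proof.
move=> mu K0 Koo mA Aoo.
have mK : measurable_fun setT (fun x => M (u x / K)) by exact: measurable_M_div.
have i1 : la.-integrable A (EFin \o (fun x => M (u x / K))).
  apply: (@integrableS _ _ _ la setT) => //.
  apply/integrableP; split; first exact/measurable_EFinP.
  by under eq_integral do rewrite /= ger0_norm ?M_ge0//.
have i2 : la.-integrable A (EFin \o cst (complementary M 1)) by exact: integrable_cst_fin.
have i3 : la.-integrable A (fun x => K%:E * ((EFin \o cst (complementary M 1)) x + (EFin \o (fun x => M (u x / K))) x))%E.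
  by apply: integrableZl => //; exact: integrableD.
apply: le_integrable i3 => //; first by apply/measurable_EFinP; exact: measurable_funTS.
move=> x _ /=; rewrite lee_fin.
have := abs_le_young youngM (u x) (_ : 0 < K^-1); rewrite invrK invr_gt0 => /(_ K0) H.
by apply: le_trans (ler_norm _); rewrite [u x / K]mulrC.
Qed.

Lemma amod_fin_integrable_cube K u (c : X) r : measurable_fun setT u -> 0 < K ->
  (amod K u < +oo)%E -> 0 <= r -> la.-integrable (cube c r) (EFin \o u).
Proof.
move=> mu K0 Koo r0; apply: amod_fin_integrable K0 Koo _ _ => //; first exact: measurable_cube.
by rewrite [X in (X < _)%E](lebesgue_cube c r0) ltry.
Qed.

(* Jensen's inequality, from a support line of [M] at [(avg c r u - t) / K]. *)
Lemma jensen_avg (c : X) r K u (t : R) : measurable_fun setT u -> 0 < r ->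
  la.-integrable (cube c r) (EFin \o u) ->
  ((M ((avg c r u - t) / K))%:E <=
    ((2 * r) ^- n)%:E * \int[la]_(q in cube c r) (M ((u q - t) / K))%:E)%E.
Proof.
move=> mu r0 iu; set Q := cube c r.
have V0 : 0 < (2 * r) ^+ n by rewrite exprn_gt0// mulr_gt0.
have mQ : measurable Q by exact: measurable_cube.
have LQ : la Q = ((2 * r) ^+ n)%:E by exact: (lebesgue_cube c (ltW r0)).
set f := fun q => M ((u q - t) / K).
have mf : measurable_fun setT f by apply: measurable_M_div; exact: measurable_funB.
have [I|] := ltP (\int[la]_(q in Q) (f q)%:E)%E +oo%E; last first.
  by rewrite leye_eq => /eqP ->; rewrite gt0_muley ?leey// lte_fin invr_gt0.
have i_f : la.-integrable Q (EFin \o f).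
  apply/integrableP; split; first by apply/measurable_EFinP; exact: measurable_funTS.
  by under eq_integral do rewrite /= ger0_norm ?M_ge0//.
set x0 := (avg c r u - t) / K.
have [p Hp] := young_support youngM x0.
set al := M x0 + p * (- (t / K) - x0); set be := p / K.
have ia : la.-integrable Q (EFin \o cst al) by apply: integrable_cst_fin => //; rewrite [X in (X < _)%E]LQ ltry.
have ib : la.-integrable Q (EFin \o (fun q => be * u q)).
  by rewrite (_ : _ \o _ = fun q => be%:E * (EFin \o u) q)%E; [exact: integrableZl|apply/funext].
have H : \int[la]_(q in Q) (al + be * u q) <= \int[la]_(q in Q) f q.
  apply: le_Rintegral => //.
    exact: (integrableD mQ ia ib).
  move=> q _; apply: le_trans (Hp _); rewrite /al /be -addrA lerD2l le_eqVlt; apply/orP; left; apply/eqP; ring.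
rewrite RintegralD// RintegralZl// (Rintegral_cst la mQ) [X in fine X]LQ /= in H.
rewrite -(@fineK _ (\int[la]_(q in Q) _)%E); last first.
  by apply: integrable_fin_num.
rewrite -EFinM lee_fin -ler_pdivrMl ?invr_gt0// invrK.
apply: le_trans H; rewrite le_eqVlt; apply/orP; left; apply/eqP.
have E : \int[la]_(q in Q) u q = (2 * r) ^+ n * avg c r u by rewrite /avg mulVKf// gt_eqF.
by rewrite E /al /be /x0; ring.
Qed.

Lemma avg_osc (c x : X) r r' K u : measurable_fun setT u -> 0 < r ->
  la.-integrable (cube c r) (EFin \o u) -> cube c r `<=` cube x r' ->
  ((M ((avg c r u - u x) / K))%:E <= ((2 * r) ^- n)%:E * \int[la]_q (osc r' K u (x, q))%:E)%E.
Proof.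
move=> mu r0 iu cc; apply: le_trans (jensen_avg K _ mu r0 iu) _.
rewrite lee_wpmul2l ?lee_fin ?invr_ge0 ?exprn_ge0 ?mulr_ge0 ?(ltW r0)//.
rewrite integral_mkcond; apply: ge0_le_integral => //.
- by move=> q _; rewrite /patch; case: ifP => // _; rewrite lee_fin M_ge0.
- apply/(measurable_restrictT _ (measurable_cube _ _)); apply: measurable_funTS; apply/measurable_EFinP.
  by apply: measurable_M_div; exact: measurable_funB.
- by apply/measurable_EFinP; apply: (measurableT_comp (measurable_osc r' K mu)); exact: pair1_measurable.
move=> q _; rewrite /patch /osc /=; case: ifPn => [/set_mem /cc /= qr|_].
  by rewrite distrC qr lee_fin -(young_even youngM) -mulNr opprB.
by rewrite lee_fin; case: ifP => // _; exact: M_ge0.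
Qed.

(** Jensen for the weights, then for each average. The slack in the total weight and the factors
    [sg] allow one lemma to cover both the error of a quasi-interpolant and its increments. *)
Lemma weighted_avg_osc (I : finType) (g : I -> X) (w sg : I -> R) (x : X) r r' K u :
  measurable_fun setT u -> 0 < r -> (forall c, la.-integrable (cube c r) (EFin \o u)) ->
  (forall i, 0 <= w i) -> \sum_i w i <= 1 -> (forall i, w i != 0 -> cube (g i) r `<=` cube x r') ->
  (forall i, `|sg i| <= 1) ->
  ((M (\sum_i w i * (sg i * ((avg (g i) r u - u x) / K))))%:E <=
    ((2 * r) ^- n * \sum_i w i)%:E * \int[la]_q (osc r' K u (x, q))%:E)%E.
Proof.
move=> mu r0 iu w0 w1 gx sg1.
have V0 : 0 < (2 * r) ^- n by rewrite invr_gt0 exprn_gt0// mulr_gt0.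
have J0 : (0 <= \int[la]_q (osc r' K u (x, q))%:E)%E by apply: int_ge0 => q; exact: osc_ge0.
apply: (@le_trans _ _ (\sum_i w i * M ((avg (g i) r u - u x) / K))%:E).
  rewrite lee_fin; apply: (@le_trans _ _ (\sum_i w i * M (sg i * ((avg (g i) r u - u x) / K)))).
    exact: young_jensen.
  apply: ler_sum => i _; rewrite ler_wpM2l//; apply: (young_le youngM).
  by rewrite normrM ler_piMl.
rewrite mulrC EFinM -muleA -[(\sum_i w i)%:E]sumEFin ge0_sume_distrl; last by move=> i _; rewrite lee_fin.
rewrite -sumEFin; apply: lee_sum => i _; rewrite EFinM.
have [->|wi] := eqVneq (w i) 0; first by rewrite !mul0e.
by rewrite lee_wpmul2l ?lee_fin//; exact: avg_osc (gx _ wi).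
Qed.

Lemma half_mul_double (c : R) (x : \bar R) : 0 < c -> (0 <= x)%E ->
  ((c / 2)%:E * (x + x) = c%:E * x)%E.
Proof.
case: x => [x|/=|//] c0 _; first by rewrite -EFinD -!EFinM; congr EFin; field.
by rewrite addye // !gt0_muley// lte_fin ?divr_gt0.
Qed.

(** Away from the diagonal the two values of [w] control the difference quotient; convexity pulls
    the factor [(r / |x - y|) ^ s] out of [M], and this makes the weight integrable at infinity. *)
Lemma far_bound r K w : measurable_fun setT w -> 0 < r -> 0 < K ->
  (\int[la \x la]_z (if `|z.1 - z.2| <= r then 0 else dmod K w z)%:E <=
    (kernel_const n s)%:E * amod (K * r `^ s / 2) w)%E.
Proof.
move=> mw r0 K0; set k := K * r `^ s / 2.
have rs0 : 0 < r `^ s by rewrite powR_gt0.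
pose o h := @outer_kernel R n s r h.
pose W x := M (w x / k).
have mW : measurable_fun setT W by exact: measurable_M_div.
have W0 x : 0 <= W x by exact: M_ge0.
have o0 h : 0 <= o h by exact: outer_kernel_ge0.
have mo : measurable_fun setT o by exact: measurable_outer_kernel.
have m1 : measurable_fun setT (fun z : X * X => W z.1 * o (z.1 - z.2)).
  apply: measurable_funM; last exact: measurable_fun_sub.
  exact: measurableT_comp mW measurable_fst.
have m2 : measurable_fun setT (fun z : X * X => W z.2 * o (z.1 - z.2)).
  apply: measurable_funM; last exact: measurable_fun_sub.
  exact: measurableT_comp mW measurable_snd.
apply: (@le_trans _ _ (\int[la \x la]_z (2^-1 * (W z.1 * o (z.1 - z.2) + W z.2 * o (z.1 - z.2)))%:E)%E).
  apply: int_le => [||z|z].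
  - apply: measurable_fun_ifT => //; first exact: measurable_norm_sub_le.
    exact: measurable_dmod.
  - by apply: measurable_funM => //; exact: measurable_funD.
  - by case: ifP => // _; exact: dmod_ge0.
  case: ifPn => [_|]; first by rewrite mulr_ge0 ?invr_ge0// addr_ge0// mulr_ge0.
  rewrite -ltNge => rz; have z0 : 0 < `|z.1 - z.2| := lt_trans r0 rz.
  have e0 : 0 < enorm (z.1 - z.2) := lt_le_trans z0 (norm_le_enorm _).
  rewrite /o /outer_kernel ltNge (ltW rz) /= /dmod -mulrDl mulrA mulrA ler_wpM2r ?invpow_ge0//.
  set q := (r / _) `^ s; have q1 : 0 <= q <= 1.
    rewrite powR_ge0 /=; apply: (@le_trans _ _ (1 `^ s)); last by rewrite powR1.
    by apply: ge0_ler_powR; rewrite ?nnegrE ?(ltW s0) ?divr_ge0 ?(ltW r0)// ler_pdivrMr// mul1r ltW.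
  apply: (@le_trans _ _ (M (q * ((w z.1 - w z.2) / (K * r `^ s))))).
    apply: (young_le youngM); rewrite /Ds.
    have -> : q * ((w z.1 - w z.2) / (K * r `^ s)) = (w z.1 - w z.2) / (`|z.1 - z.2| `^ s) / K.
      rewrite /q powRM ?invr_ge0 ?(ltW r0)//.
      have -> : `|z.1 - z.2|^-1 `^ s = (`|z.1 - z.2| `^ s)^-1.
        by rewrite -powR_inv1// -powRrM mulrC powRrM powR_inv1// powR_ge0.
      by field; rewrite !gt_eqF// powR_gt0.
    rewrite !normrM ler_wpM2r// ler_wpM2l// !normfV !ger0_norm ?powR_ge0//.
    rewrite lef_pV2 ?posrE ?powR_gt0//.
    by apply: ge0_ler_powR; rewrite ?nnegrE ?(ltW s0) ?(ltW e0)// norm_le_enorm.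
  apply: le_trans (young_scale youngM _ q1) _.
  rewrite [in leRHS]mulrA [leLHS]mulrC ler_wpM2r ?powR_ge0// [leRHS]mulrC mulrBl.
  apply: le_trans (young_half youngM _ _) _; rewrite ler_wpM2r ?invr_ge0// /W.
  have Hk (t : R) : 2 * (t / (K * r `^ s)) = t / k by rewrite /k; field; rewrite !gt_eqF.
  by rewrite mulrN Hk (young_even youngM) Hk.
rewrite intZ ?invr_ge0//; [|exact: measurable_funD|by move=> z; rewrite addr_ge0 ?mulr_ge0].
rewrite intD//; [|by move=> z; rewrite mulr_ge0|by move=> z; rewrite mulr_ge0].
under eq_integral do rewrite EFinM.
under [X in (_ * (_ + X))%E]eq_integral do rewrite EFinM.
have mWE : measurable_fun setT (EFin \o W) by exact/measurable_EFinP.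
have moE : measurable_fun setT (EFin \o o) by exact/measurable_EFinP.
have W0E x : (0 <= (EFin \o W) x)%E by rewrite lee_fin.
have o0E x : (0 <= (EFin \o o) x)%E by rewrite lee_fin.
have oN x : (EFin \o o) (- x) = (EFin \o o) x by rewrite /= /o outer_kernelN.
rewrite (ge0_integral_conv1 mWE moE W0E o0E oN) (ge0_integral_conv2 mWE moE W0E o0E oN).
have I0 : (0 <= amod k w)%E by exact: int_ge0.
have HO : (\int[la]_h (o h)%:E <= (kernel_const n s)%:E)%E by exact: integral_outer_kernel.
rewrite -[2^-1]mul1r half_mul_double//; last by rewrite mule_ge0//; exact: int_ge0.
by rewrite mul1e muleC lee_wpmul2r.
Qed.

Lemma dmod_split r K w z : dmod K w z = nmod r K w z + (if `|z.1 - z.2| <= r then 0 else dmod K w z).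
Proof. by rewrite /nmod; case: ifP => _; rewrite ?addr0 ?add0r. Qed.

(** Beyond distance [r] an [L_M] modular at a scale of order [r ^ s] takes over; a function that is
    small at that scale only needs a small near energy. *)
Lemma energy_split r K w : measurable_fun setT w -> 0 < r -> 0 < K ->
  (energy K w <= near_energy r K w + (kernel_const n s)%:E * amod (K * r `^ s / 2) w)%E.
Proof.
move=> mw r0 K0; rewrite /energy.
under eq_integral do rewrite (dmod_split r).
rewrite intD.
- by rewrite leeD2l ?far_bound.
- exact: measurable_nmod.
- apply: measurable_fun_ifT => //; first exact: measurable_norm_sub_le.
  exact: measurable_dmod.
- by move=> z; exact: nmod_ge0.
- by move=> z; case: ifP => // _; exact: dmod_ge0.
Qed.

Lemma DsB u v z : @Ds R n s (fun x => u x - v x) z = @Ds R n s u z - @Ds R n s v z.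
Proof. by rewrite /Ds; ring. Qed.

Lemma M_half_div K (a b : R) : M ((a - b) / (2 * K)) <= 2^-1 * (M (a / K) + M (b / K)).
Proof.
have -> : (a - b) / (2 * K) = a / K / 2 + - (b / K / 2) by rewrite invfM; ring.
apply: le_trans (young_half youngM _ _) _.
by rewrite mulrN (young_even youngM) ![2 * _]mulrC !divfK// mulrC.
Qed.

Lemma near_energyB r K u v : measurable_fun setT u -> measurable_fun setT v ->
  (near_energy r (2 * K) (fun x => u x - v x)%R <= (2^-1)%:E * (near_energy r K u + near_energy r K v))%E.
Proof.
move=> mu mv; have mB : measurable_fun setT (fun x => u x - v x) by exact: measurable_funB.
have m1 := measurable_nmod r K mu; have m2 := measurable_nmod r K mv.
rewrite /near_energy -intD// -?intZ//; [|exact: measurable_funD|by move=> z; rewrite addr_ge0 ?nmod_ge0|exact: nmod_ge0|exact: nmod_ge0].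
apply: int_le => [||z|z].
- exact: measurable_nmod.
- by apply: measurable_funM => //; exact: measurable_funD.
- exact: nmod_ge0.
rewrite /nmod; case: ifP => _; last by rewrite addr0 mulr0.
by rewrite /dmod -mulrDl mulrA ler_wpM2r ?invpow_ge0// DsB M_half_div.
Qed.

Lemma amodB K u v : measurable_fun setT u -> measurable_fun setT v ->
  (amod (2 * K) (fun x => u x - v x)%R <= (2^-1)%:E * (amod K u + amod K v))%E.
Proof.
move=> mu mv; have mB : measurable_fun setT (fun x => u x - v x) by exact: measurable_funB.
have m1 := measurable_M_div K mu; have m2 := measurable_M_div K mv.
rewrite /amod -intD// -?intZ//; [|exact: measurable_funD|by move=> z; rewrite addr_ge0 ?M_ge0|by move=> z; exact: M_ge0|by move=> z; exact: M_ge0].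
apply: int_le => [||z|z]; [exact: measurable_M_div|by apply: measurable_funM => //; exact: measurable_funD|exact: M_ge0|exact: M_half_div].
Qed.

Lemma integral_translation2 (h : X) (f : X * X -> \bar R) : measurable_fun setT f ->
  (forall z, 0 <= f z)%E ->
  (\int[la \x la]_z f ((z.1 + h)%R, (z.2 + h)%R) = \int[la \x la]_z f z)%E.
Proof.
move=> mf f0.
have mT : measurable_fun setT (fun z : X * X => (z.1 + h, z.2 + h)).
  apply/measurable_fun_pairP; split => /=.
  - exact: measurableT_comp (measurable_rV_add h) measurable_fst.
  - exact: measurableT_comp (measurable_rV_add h) measurable_snd.
have mfT : measurable_fun setT (fun z : X * X => f (z.1 + h, z.2 + h)) by exact: (measurableT_comp mf).
rewrite (@fubini_tonelli1 _ _ _ _ _ la la _ mfT)// (@fubini_tonelli1 _ _ _ _ _ la la _ mf)//.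
have mF : measurable_fun setT (fubini_F la f) by exact: measurable_fun_fubini_tonelli_F.
rewrite -(ge0_integral_translation h mF); last by move=> x; exact: integral_ge0.
apply: eq_integral => x _; rewrite /fubini_F /=.
by rewrite (@ge0_integral_translation _ _ h (fun y => f (x + h, y)))//; apply: (measurableT_comp mf); exact: pair1_measurable.
Qed.

Lemma near_energy_translation (h : X) r K u : measurable_fun setT u ->
  near_energy r K (fun x => u (x + h)) = near_energy r K u.
Proof.
move=> mu; rewrite /near_energy -(integral_translation2 h (f := EFin \o nmod r K u)).
- by apply: eq_integral => z _; rewrite /= /nmod /dmod /Ds /= opprD addrACA subrr addr0.
- by apply/measurable_EFinP; exact: measurable_nmod.
- by move=> z; rewrite lee_fin nmod_ge0.
Qed.

(* [w] is small in the modular of [W^s L_M] when it is small in [L_M] at the scale [r]. *)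
Lemma translation_amod (h : X) r K u : measurable_fun setT u -> 0 < r -> `|h| <= r -> 0 < K ->
  (amod (2 * (K * (n%:R * (2 * r)) `^ s)) (fun x => u (x + h) - u x)%R <=
    (n%:R ^+ n)%:E * near_energy (2 * r) K u)%E.
Proof.
move=> mu r0 hr K0; set k := K * _.
have r20 : 0 < 2 * r by rewrite mulr_gt0.
have muh : measurable_fun setT (fun x : X => u (x + h)) by apply: measurableT_comp mu _; exact: measurable_rV_add.
pose J x := (\int[la]_q (osc (2 * r) k u (x, q))%:E)%E.
have moE : measurable_fun setT (EFin \o osc (2 * r) k u) by apply/measurable_EFinP; exact: measurable_osc.
have mJ : measurable_fun setT J.
  by apply: (measurable_fun_fubini_tonelli_F (m2 := la) _ moE) => z; rewrite lee_fin osc_ge0.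
have J0 x : (0 <= J x)%E by apply: int_ge0 => q; exact: osc_ge0.
have V0 : 0 < (2 * r) ^+ n by rewrite exprn_gt0.
(* The constant is spread over the cube in order to compare [u (x + h)] and [u x] with [u q] for all
   [q] in it; the distances involved are at most [2 r]. *)
have cI x : (\int[la]_(q in cube x r) (cst ((M ((u (x + h) - u x) / (2 * k)))%:E) q) = ((2 * r) ^+ n)%:E * (M ((u (x + h) - u x) / (2 * k)))%:E)%E.
  by rewrite integral_cst ?[X in (_ * X)%E](lebesgue_cube x (ltW r0)) 1?muleC//; exact: measurable_cube.
have mos x : measurable_fun setT (fun q => osc (2 * r) k u (x, q)).
  by apply: (measurableT_comp (measurable_osc (2 * r) k mu)); exact: pair1_measurable.
have P x : (((2 * r) ^+ n)%:E * (M ((u (x + h) - u x) / (2 * k)))%:E <= (2^-1)%:E * (J (x + h)%R + J x))%E.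
  rewrite -cI integral_mkcond /J -intD//; [|by move=> q; exact: osc_ge0|by move=> q; exact: osc_ge0].
  rewrite -intZ ?invr_ge0//; [|exact: measurable_funD|by move=> q; rewrite addr_ge0 ?osc_ge0].
  apply: ge0_le_integral => //.
  - by move=> q _; rewrite /patch; case: ifP => // _; rewrite lee_fin M_ge0.
  - by apply/(measurable_restrictT _ (measurable_cube _ _)); exact: measurable_cst.
  - by apply/measurable_EFinP; apply: measurable_funM => //; exact: measurable_funD.
  move=> q _; rewrite /patch /=; case: ifPn => [/set_mem /= qr|_]; last first.
    by rewrite lee_fin mulr_ge0 ?invr_ge0// addr_ge0 ?osc_ge0.
  have q1 : `|x - q| <= 2 * r by rewrite distrC; apply: le_trans qr _; lra.
  have q2 : `|x + h - q| <= 2 * r.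
    have qr' : `|q - x| <= r := qr.
    by rewrite addrAC; apply: le_trans (ler_normD _ _) _; rewrite distrC; lra.
  rewrite lee_fin /osc /= q1 q2.
  have -> : u (x + h) - u x = (u (x + h) - u q) - (u x - u q) by ring.
  exact: M_half_div.
have P' x : ((M ((u (x + h) - u x) / (2 * k)))%:E <= ((2 * r) ^- n / 2)%:E * (J (x + h)%R + J x))%E.
  by rewrite EFinM -muleA -lee_pdivrMl ?invr_gt0// invrK; exact: P.
have mJh : measurable_fun setT (fun x : X => J (x + h)%R) by apply: measurableT_comp mJ _; exact: measurable_rV_add.
apply: (@le_trans _ _ (\int[la]_x (((2 * r) ^- n / 2)%:E * (J (x + h)%R + J x)))%E).
  apply: ge0_le_integral => //.
  - by move=> x _; rewrite lee_fin M_ge0.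
  - by apply/measurable_EFinP; apply: measurable_M_div; exact: measurable_funB.
  - by apply: measurable_funeM; exact: emeasurable_funD.
have c0 : 0 < (2 * r) ^- n by rewrite invr_gt0.
rewrite ge0_integralZl_EFin//; [|by move=> x _; rewrite adde_ge0|exact: emeasurable_funD|by rewrite divr_ge0// ltW].
rewrite ge0_integralD// (ge0_integral_translation h mJ J0) half_mul_double//; last exact: integral_ge0.
have := integral_osc mu r20 K0; rewrite -/k => H.
apply: (@le_trans _ _ (((2 * r) ^- n)%:E * (((n%:R * (2 * r)) ^+ n)%:E * near_energy (2 * r) K u)))%E.
  by rewrite lee_wpmul2l// lee_fin ltW.
rewrite muleA -EFinM -exprVn -exprMn (_ : _^-1 * _ = n%:R)//.
by field; rewrite gt_eqF.
Qed.

Lemma energy_of_near (w : X -> R) r K K' (a b : \bar R) : measurable_fun setT w -> 0 < r -> 0 < K -> 0 < K' ->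
  K' <= K * r `^ s / 2 -> (near_energy r K w <= a)%E -> (amod K' w <= b)%E ->
  (energy K w <= a + (kernel_const n s)%:E * b)%E.
Proof.
move=> mw r0 K0 K0' KK Ha Hb; apply: le_trans (energy_split mw r0 K0) _.
apply: leeD => //; rewrite lee_wpmul2l ?lee_fin ?kernel_const_ge0//.
by apply: le_trans Hb; exact: amod_le.
Qed.

(** The near energy of the difference is simply bounded by that of [u], by translation invariance;
    it becomes small because the near energy of [u] does as [r] decreases. *)
Lemma translation_energy (h : X) r K u : measurable_fun setT u -> 0 < r -> `|h| <= r -> 0 < K ->
  (energy (K * (2 + 4 * (n%:R * 2) `^ s)) (fun x => u (x + h) - u x)%R <=
    (1 + kernel_const n s * n%:R ^+ n)%:E * near_energy (2 * r) K u)%E.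
Proof.
move=> mu r0 hr K0; set K1 := K * _.
have muh : measurable_fun setT (fun x : X => u (x + h)) by apply: measurableT_comp mu _; exact: measurable_rV_add.
have p0 : 0 <= (n%:R * 2) `^ s by exact: powR_ge0.
have K10 : 0 < K1 by rewrite mulr_gt0// ltr_pwDl// mulr_ge0.
have rs0 : 0 < r `^ s by rewrite powR_gt0.
have ps0 : 0 < (n%:R * (2 * r)) `^ s by rewrite powR_gt0// !mulr_gt0.
have Hb := translation_amod mu r0 hr K0.
have NE0 := near_energy_ge0 (2 * r) K u.
have Ha : (near_energy r K1 (fun x => u (x + h) - u x)%R <= near_energy (2 * r) K u)%E.
  apply: (@le_trans _ _ (near_energy r (2 * K) (fun x => u (x + h) - u x)%R)).
    apply: near_energy_mono => //; first exact: measurable_funB.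
      by rewrite mulr_gt0.
    by rewrite /K1 mulrC ler_pM2l// lerDl mulr_ge0.
  apply: le_trans (near_energyB r K muh mu) _.
  rewrite near_energy_translation// -[2^-1]mul1r half_mul_double ?near_energy_ge0// mul1e.
  by apply: near_energy_mono => //; lra.
have := energy_of_near (measurable_funB muh mu) r0 K10 _ _ Ha Hb.
have k0 : 0 < 2 * (K * (n%:R * (2 * r)) `^ s) by rewrite !mulr_gt0.
move=> /(_ k0) H; apply: le_trans (H _) _.
  rewrite /K1 [n%:R * (2 * r)]mulrA (@powRM _ (n%:R * 2)) ?mulr_ge0 ?(ltW r0)//.
  set q := (n%:R * 2) `^ s in p0 *.
  have : 0 <= K * r `^ s by rewrite mulr_ge0// ltW.
  have : 0 <= K * r `^ s * q by rewrite mulr_ge0// mulr_ge0// ltW.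
  by lra.
rewrite EFinD EFinM [X in (_ <= X)%E]ge0_muleDl//; last first.
  by rewrite lee_fin mulr_ge0 ?kernel_const_ge0// exprn_ge0.
by rewrite mul1e muleA.
Qed.

Definition cut_kernel (h : X) : R := @inner_kernel R n (1 - s) 1 h + @outer_kernel R n s 1 h.
Definition cut_const : R := kernel_const n (1 - s) + kernel_const n s.

Lemma cut_kernel_ge0 h : 0 <= cut_kernel h.
Proof. by rewrite addr_ge0 ?inner_kernel_ge0 ?outer_kernel_ge0. Qed.

Lemma cut_kernelN h : cut_kernel (- h) = cut_kernel h.
Proof. by rewrite /cut_kernel inner_kernelN outer_kernelN. Qed.

Lemma cut_const_ge0 : 0 <= cut_const.
Proof. by rewrite addr_ge0 ?kernel_const_ge0. Qed.

Lemma measurable_cut_kernel : measurable_fun setT cut_kernel.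
Proof. by apply: measurable_funD; [exact: measurable_inner_kernel|exact: measurable_outer_kernel]. Qed.

Lemma integral_cut_kernel : (\int[la]_h (cut_kernel h)%:E <= cut_const%:E)%E.
Proof.
rewrite intD; [|exact: measurable_inner_kernel|exact: measurable_outer_kernel|exact: inner_kernel_ge0|exact: outer_kernel_ge0].
by rewrite EFinD leeD ?integral_inner_kernel ?integral_outer_kernel.
Qed.

(** The Lipschitz bound leaves a power [1 - s] of the distance near the diagonal, the uniform bound
    a power [- s] away from it: these are the two parts of [cut_kernel]. *)
Lemma cut_bound L (psi : X -> R) (c : R) z : 0 <= L -> (forall x y, `|psi x - psi y| <= L) ->
  (forall x y, `|psi x - psi y| <= L * `|x - y|) ->
  M (c * @Ds R n s psi z) * enorm (z.1 - z.2) ^- n <= cut_kernel (z.1 - z.2) * M (c * L).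
Proof.
move=> L0 psiL psiLip; have [E|zz] := eqVneq z.1 z.2.
  by rewrite Ds_diag// mulr0 M0 mul0r mulr_ge0 ?M_ge0// cut_kernel_ge0.
have z0 : 0 < `|z.1 - z.2| by rewrite normr_gt0 subr_eq0.
have e0 : 0 < enorm (z.1 - z.2) := lt_le_trans z0 (norm_le_enorm _).
have es : `|z.1 - z.2| `^ s <= enorm (z.1 - z.2) `^ s.
  by apply: ge0_ler_powR; rewrite ?nnegrE ?(ltW s0) ?(ltW e0)// norm_le_enorm.
have zs0 : 0 < `|z.1 - z.2| `^ s by rewrite powR_gt0.
have key q : 0 <= q <= 1 -> `|psi z.1 - psi z.2| <= q * `|z.1 - z.2| `^ s * L ->
    M (c * @Ds R n s psi z) <= q * M (c * L).
  move=> q01 H; have /andP[q0 _] := q01; apply: le_trans (young_scale youngM _ q01).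
  apply: (young_le youngM); rewrite !normrM [leRHS]mulrCA ler_wpM2l// (ger0_norm L0) (ger0_norm q0).
  rewrite normfV [`|enorm _ `^ s|]ger0_norm ?powR_ge0//.
  rewrite ler_pdivrMr ?powR_gt0//; apply: le_trans H _.
  by rewrite mulrAC ler_wpM2l// mulr_ge0.
rewrite /cut_kernel /inner_kernel /outer_kernel; case: ifPn => [z1|]; last rewrite -leNgt => z1.
  rewrite addr0 divr1 mulrAC ler_wpM2r ?invpow_ge0//; apply: key.
    rewrite powR_ge0 /= -[leRHS](congr1 (fun f => f (1 - s)) (@powR1 R)).
    by apply: ge0_ler_powR; rewrite ?nnegrE ?(ltW s1)// ltW.
  rewrite -powRD; last by rewrite (gt_eqF z0) implybT.
  by rewrite subrK powRr1// mulrC.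
rewrite add0r mulrAC ler_wpM2r ?invpow_ge0//; apply: key.
  rewrite powR_ge0 /= -[leRHS](congr1 (fun f => f s) (@powR1 R)).
  by apply: ge0_ler_powR; rewrite ?nnegrE ?(ltW s0) ?divr_ge0// ler_pdivrMr// mul1r.
by rewrite -powRM ?divr_ge0// divfK ?gt_eqF// (congr1 (fun f => f s) (@powR1 R)) mul1r.
Qed.

Lemma integral_cut_conv1 (W : X -> R) : measurable_fun setT W -> (forall x, 0 <= W x) ->
  (\int[la \x la]_z (W z.1 * cut_kernel (z.1 - z.2))%:E <= cut_const%:E * \int[la]_x (W x)%:E)%E.
Proof.
move=> mW W0; under eq_integral do rewrite EFinM.
rewrite (@ge0_integral_conv1 _ _ (EFin \o W) (EFin \o cut_kernel)).
- rewrite muleC lee_wpmul2r ?integral_cut_kernel//; exact: int_ge0.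
- exact/measurable_EFinP.
- by apply/measurable_EFinP; exact: measurable_cut_kernel.
- by move=> x; rewrite lee_fin.
- by move=> h; rewrite lee_fin cut_kernel_ge0.
- by move=> h; rewrite /= cut_kernelN.
Qed.

Lemma integral_cut_conv2 (W : X -> R) : measurable_fun setT W -> (forall x, 0 <= W x) ->
  (\int[la \x la]_z (W z.2 * cut_kernel (z.1 - z.2))%:E <= cut_const%:E * \int[la]_x (W x)%:E)%E.
Proof.
move=> mW W0; under eq_integral do rewrite EFinM.
rewrite (@ge0_integral_conv2 _ _ (EFin \o W) (EFin \o cut_kernel)).
- rewrite muleC lee_wpmul2r ?integral_cut_kernel//; exact: int_ge0.
- exact/measurable_EFinP.
- by apply/measurable_EFinP; exact: measurable_cut_kernel.
- by move=> x; rewrite lee_fin.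
- by move=> h; rewrite lee_fin cut_kernel_ge0.
- by move=> h; rewrite /= cut_kernelN.
Qed.

Lemma measurable_cut_sub : measurable_fun setT (fun z : X * X => cut_kernel (z.1 - z.2)).
Proof. by apply: measurable_fun_sub; exact: measurable_cut_kernel. Qed.

(** A Leibniz rule: [D^s (psi v)] at [(x, y)] is [psi x * D^s v + v y * D^s psi], and the second
    term falls under [cut_bound]. *)
Lemma energyM L K (psi v : X -> R) : measurable_fun setT psi -> measurable_fun setT v ->
  0 < K -> 0 < L -> (forall x, `|psi x| <= 1) -> (forall x y, `|psi x - psi y| <= L) ->
  (forall x y, `|psi x - psi y| <= L * `|x - y|) ->
  (energy (2 * K) (fun x => psi x * v x)%R <= (2^-1)%:E * (energy K v + cut_const%:E * amod (K / L) v))%E.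
Proof.
move=> mpsi mv K0 L0 psi1 psiL psiLip.
pose W x := M (v x / (K / L)).
have mW : measurable_fun setT W by exact: measurable_M_div.
have mWk : measurable_fun setT (fun z : X * X => W z.2 * cut_kernel (z.1 - z.2)).
  apply: measurable_funM; last exact: measurable_cut_sub.
  exact: measurableT_comp mW measurable_snd.
have Wk0 z : 0 <= W z.2 * cut_kernel (z.1 - z.2) by rewrite mulr_ge0 ?M_ge0 ?cut_kernel_ge0.
have md := measurable_dmod K mv.
apply: (@le_trans _ _ (\int[la \x la]_z (2^-1 * (dmod K v z + W z.2 * cut_kernel (z.1 - z.2)))%:E)%E).
  apply: int_le => [||z|z].
  - by apply: measurable_dmod; exact: measurable_funM.
  - by apply: measurable_funM => //; exact: measurable_funD.
  - exact: dmod_ge0.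
  have -> : W z.2 = M (v z.2 / K * L) by congr M; field; rewrite !gt_eqF.
  have HC := cut_bound (v z.2 / K) z (ltW L0) psiL psiLip.
  have -> : dmod (2 * K) (fun x => psi x * v x) z = M ((psi z.1 * @Ds R n s v z - - (v z.2 * @Ds R n s psi z)) / (2 * K)) * enorm (z.1 - z.2) ^- n.
    by congr (M (_ / _) * _); rewrite /Ds; ring.
  apply: (@le_trans _ _ (2^-1 * (M (psi z.1 * @Ds R n s v z / K) + M (- (v z.2 * @Ds R n s psi z) / K)) * enorm (z.1 - z.2) ^- n)).
    by rewrite ler_wpM2r ?invpow_ge0 ?M_half_div.
  rewrite -mulrA ler_wpM2l ?invr_ge0// mulrDl; apply: lerD.
    rewrite ler_wpM2r ?invpow_ge0//; apply: (young_le youngM).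
    by rewrite -mulrA normrM ler_piMl.
  rewrite mulNr (young_even youngM) [leRHS]mulrC; apply: le_trans HC.
  by rewrite mulrAC.
rewrite intZ ?invr_ge0//; [|exact: measurable_funD|by move=> z; rewrite addr_ge0 ?dmod_ge0].
rewrite intD//; last by move=> z; exact: dmod_ge0.
rewrite lee_wpmul2l ?lee_fin ?invr_ge0// leeD2l//.
by apply: integral_cut_conv2 => // x; exact: M_ge0.
Qed.

Lemma energy_fin_cube L K u (c : X) r : measurable_fun setT u -> 0 <= r -> 0 < L ->
  (forall x y, `|u x - u y| <= L) -> (forall x y, `|u x - u y| <= L * `|x - y|) ->
  (forall x, ~ cube c r x -> u x = 0) -> (energy K u < +oo)%E.
Proof.
move=> mu r0 L0 uL uLip uc; pose W x : R := M (K^-1 * L) * \1_(cube c r) x.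
have mW : measurable_fun setT W.
  by apply: measurable_funM => //; apply: measurable_indic; exact: measurable_cube.
have W0 x : 0 <= W x by rewrite mulr_ge0// M_ge0.
have m1 : measurable_fun setT (fun z : X * X => W z.1 * cut_kernel (z.1 - z.2)).
  apply: measurable_funM; last exact: measurable_cut_sub.
  exact: measurableT_comp mW measurable_fst.
have m2 : measurable_fun setT (fun z : X * X => W z.2 * cut_kernel (z.1 - z.2)).
  apply: measurable_funM; last exact: measurable_cut_sub.
  exact: measurableT_comp mW measurable_snd.
apply: (@le_lt_trans _ _ (\int[la \x la]_z (W z.1 * cut_kernel (z.1 - z.2) + W z.2 * cut_kernel (z.1 - z.2))%:E)%E).
  apply: int_le => [||z|z]; [exact: measurable_dmod|exact: measurable_funD|exact: dmod_ge0|].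
  rewrite -mulrDl /W -mulrDr !indicE; have kz := cut_kernel_ge0 (z.1 - z.2).
  have [z1|z1] := pselect (cube c r z.1); last first.
    have [z2|z2] := pselect (cube c r z.2); last first.
      by rewrite /dmod /Ds !uc// subrr !mul0r M0 mul0r mulr_ge0// mulr_ge0 ?M_ge0// addr_ge0.
    have := cut_bound K^-1 z (ltW L0) uL uLip.
    by rewrite memNset// mem_set// add0r mulr1 /dmod [_ / K]mulrC [_ * cut_kernel _]mulrC.
  have := cut_bound K^-1 z (ltW L0) uL uLip.
  rewrite mem_set// => H; rewrite /dmod [_ / K]mulrC; apply: le_trans H _; rewrite mulrC.
  by rewrite ler_wpM2r// ler_peMr ?M_ge0// lerDl.
rewrite intD//; [|by move=> z; rewrite mulr_ge0 ?cut_kernel_ge0|by move=> z; rewrite mulr_ge0 ?cut_kernel_ge0].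
have IW : (\int[la]_x (W x)%:E < +oo)%E.
  rewrite intZ ?M_ge0//; last by apply: measurable_indic; exact: measurable_cube.
  rewrite integral_indic//; last exact: measurable_cube.
  by rewrite setIT [X in (_ * X)%E](lebesgue_cube c r0) -EFinM ltry.
have IW' : (cut_const%:E * \int[la]_x (W x)%:E < +oo)%E.
  by rewrite lte_mul_pinfty// ?lee_fin ?cut_const_ge0//.
by apply: lte_add_pinfty; apply: le_lt_trans IW'; [exact: integral_cut_conv1|exact: integral_cut_conv2].
Qed.

(** [u] vanishes on the cube of radius 1 around [p], whose points are within [2 b + 3] of those of
    the ball of radius [b]: for such pairs the difference quotient is a value of [u] over a bounded
    quantity. *)
Lemma poincare b K u : measurable_fun setT u -> 0 <= b -> 0 < K -> (forall x, b < `|x| -> u x = 0) ->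
  (amod (K * (n%:R * (2 * b + 3)) `^ s) u <= ((n%:R * (2 * b + 3)) ^+ n / 2 ^+ n)%:E * energy K u)%E.
Proof.
move=> mu b0 K0 ub; set D := n%:R * _.
have D0 : 0 < D by rewrite mulr_gt0//; lra.
pose p : X := const_mx (b + 2).
have mdE : measurable_fun setT (EFin \o dmod K u) by apply/measurable_EFinP; exact: measurable_dmod.
have md0 z : (0 <= (EFin \o dmod K u) z)%E by rewrite lee_fin dmod_ge0.
pose J x := (\int[la]_q (dmod K u (x, q))%:E)%E.
have mJ : measurable_fun setT J by exact: (measurable_fun_fubini_tonelli_F (m2 := la) _ mdE).
have V0 : (0 : R) < 2 ^+ n by rewrite exprn_gt0.
have far x : `|x| <= b -> ((2 ^+ n)%:E * (M (u x / (K * D `^ s)))%:E <= (D ^+ n)%:E * J x)%E.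
  move=> xb; have -> : ((2 ^+ n)%:E * (M (u x / (K * D `^ s)))%:E = \int[la]_(q in cube p 1) (cst ((M (u x / (K * D `^ s)))%:E) q))%E.
    rewrite integral_cst; last exact: measurable_cube.
    by rewrite [X in (_ = _ * X)%E](lebesgue_cube p ler01) mulr1 muleC.
  have mq : measurable_fun setT (fun q => dmod K u (x, q)).
    by apply: (measurableT_comp (measurable_dmod K mu)); exact: pair1_measurable.
  rewrite integral_mkcond /J -intZ ?exprn_ge0 ?(ltW D0)//; last by move=> q; exact: dmod_ge0.
  apply: ge0_le_integral => //.
  - by move=> q _; rewrite /patch; case: ifP => // _; rewrite lee_fin M_ge0.
  - by apply/(measurable_restrictT _ (measurable_cube _ _)); exact: measurable_cst.
  - by apply/measurable_EFinP; apply: measurable_funM.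
  move=> q _; rewrite /patch /=; case: ifPn => [/set_mem /= qp|_]; last first.
    by rewrite lee_fin mulr_ge0 ?dmod_ge0// exprn_ge0// ltW.
  have i0 : 'I_n by exact: (Ordinal n0).
  have nq : b < `|q|.
    have := le_trans (coord_le_norm (q - p) i0) qp; rewrite !mxE ler_norml => /andP[q1 _].
    apply: lt_le_trans (le_trans (ler_norm _) (coord_le_norm q i0)); lra.
  have nq2 : `|q| <= b + 3.
    rewrite -[q](subrK p); apply: le_trans (ler_normD _ _) _.
    have : `|p| <= b + 2 by apply: norm_le_coord => [|i]; rewrite ?mxE ?ger0_norm; lra.
    have qp' : `|q - p| <= 1 := qp.
    lra.
  have xq : x != q by apply/eqP => E; move: nq; rewrite -E ltNge xb.
  have e0 : 0 < enorm (x - q) by rewrite enorm_gt0 subr_eq0.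
  have eD : enorm (x - q) <= D.
    apply: le_trans (enorm_le_norm _) _; rewrite ler_pM2l//.
    apply: le_trans (ler_normB _ _) _; lra.
  rewrite lee_fin /dmod /Ds /= (ub q nq) subr0.
  apply: (@le_trans _ _ (M (u x / enorm (x - q) `^ s / K))).
    apply: (young_le youngM); rewrite invfM !normrM !normfV.
    rewrite [`|D `^ s|]ger0_norm ?powR_ge0// [`|enorm _ `^ s|]ger0_norm ?powR_ge0//.
    rewrite -!mulrA ler_wpM2l// mulrC ler_pM2r ?invr_gt0 ?normr_gt0 ?gt_eqF// lef_pV2 ?posrE ?powR_gt0//.
    by apply: ge0_ler_powR; rewrite ?nnegrE ?(ltW s0) ?(ltW e0) ?(ltW D0).
  rewrite mulrCA -[leLHS]mulr1 ler_wpM2l ?M_ge0// ler_pdivlMr ?exprn_gt0// mul1r.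
  by rewrite lerXn2r ?nnegrE ?(ltW e0) ?(ltW D0).
have J0 x : (0 <= J x)%E by apply: int_ge0 => q; exact: dmod_ge0.
apply: (@le_trans _ _ (\int[la]_x ((D ^+ n / 2 ^+ n)%:E * J x))%E).
  apply: ge0_le_integral => //.
  - by move=> x _; rewrite lee_fin M_ge0.
  - by apply/measurable_EFinP; exact: measurable_M_div.
  - exact: measurable_funeM.
  move=> x _; have [xb|bx] := leP `|x| b; last first.
    by rewrite ub// mul0r M0 mule_ge0// lee_fin divr_ge0 ?exprn_ge0// ltW.
  by rewrite [_ / 2 ^+ n]mulrC EFinM -muleA lee_pdivlMl//; exact: far.
rewrite ge0_integralZl_EFin//; last by rewrite divr_ge0 ?exprn_ge0// ltW.
by rewrite /energy (@fubini_tonelli1 _ _ _ _ _ la la _ mdE).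
Qed.

(** Dominated convergence: off the diagonal the truncated integrands are eventually 0, and on it
    [D^s u] is 0. *)
Lemma near_energy_small K u (e : R) : measurable_fun setT u -> 0 < e -> (energy K u < +oo)%E ->
  exists2 r, 0 < r & (near_energy r K u <= e%:E)%E.
Proof.
move=> mu e0 Koo.
pose f j z : \bar R := (nmod j.+1%:R^-1 K u z)%:E.
have [] := @dominated_convergence _ _ _ (la \x la)%E setT measurableT f (cst 0%E) (EFin \o dmod K u).
- by move=> j; apply/measurable_EFinP; exact: measurable_nmod.
- exact: measurable_cst.
- apply: aeW => z _; apply: cvg_near_cst.
  have [E|zz] := eqVneq z.1 z.2.
    by near=> j; rewrite /f /nmod /dmod Ds_diag// mul0r M0 mul0r; case: ifP.
  have z0 : 0 < `|z.1 - z.2| by rewrite normr_gt0 subr_eq0.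
  near=> j; rewrite /f /nmod ifF//; apply/negbTE; rewrite -ltNge.
  by near: j; exact: (near_infty_natSinv_lt (PosNum z0)).
- apply/integrableP; split; first by apply/measurable_EFinP; exact: measurable_dmod.
  by under eq_integral do rewrite /= ger0_norm ?dmod_ge0//.
- by apply: aeW => z j _; rewrite /f abse_EFin lee_fin ger0_norm ?nmod_ge0 ?nmod_le_dmod.
move=> _ _; rewrite integral0 => /fine_cvgP[_ /cvgrPdist_lt/(_ e e0)[N _ /(_ N (leqnn N))]].
move=> H; exists N.+1%:R^-1; first by rewrite invr_gt0.
have fin : near_energy N.+1%:R^-1 K u \is a fin_num.
  by rewrite ge0_fin_numE ?near_energy_ge0//; apply: le_lt_trans Koo; exact: near_energy_le.
rewrite -(fineK fin) lee_fin ltW//; apply: le_lt_trans H; rewrite /= sub0r normrN.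
exact: ler_norm.
Unshelve. all: by end_near.
Qed.

End modular.

End Energies.
Import Energies.

Module Bumps.

(** * Smooth bump functions *)

Section smooth.
Context (R : realType).
Implicit Types (f g : R -> R) (x t : R).

Lemma is_derive_cvg (V : normedModType R) (f : V -> R) (a v : V) (df : R) :
  h^-1 *: ((f \o shift a) (h *: v) - f a) @[h --> 0^'] --> df -> is_derive a v f df.
Proof. by move=> H; split; [apply/cvg_ex; exists df|exact: cvg_lim H]. Qed.

Lemma derive_eq (V : normedModType R) (f : V -> R) (a v : V) (df df' : R) :
  is_derive a v f df -> df = df' -> is_derive a v f df'.
Proof. by move=> + <-. Qed.

Lemma is_derive_continuous f x df : is_derive x 1 f df -> {for x, continuous f}.
Proof. by move=> [d _]; apply/differentiable_continuous/derivable1_diffP. Qed.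

(** The class C^k with the derivatives given as witnesses, so that sums, products and inverses go
    through by induction on [k]. *)
Fixpoint smooth k f : Prop :=
  if k is k'.+1 then exists2 g : R -> R, (forall x, is_derive x 1 f (g x)) & smooth k' g
  else continuous f.

Lemma smoothW k f : smooth k.+1 f -> smooth k f.
Proof.
elim: k f => [|k IH] f /= [g fg sg]; first by move=> x; exact: is_derive_continuous (fg x).
by exists g => //; apply: IH.
Qed.

Lemma smooth_cst k (c : R) : smooth k (fun=> c).
Proof.
by elim: k c => [|k IH] c /=; [move=> x; exact: cst_continuous|exists (fun=> 0) => // x; exact: is_derive_cst].
Qed.

Lemma smoothD k f g : smooth k f -> smooth k g -> smooth k (fun x => f x + g x).
Proof.
elim: k f g => [|k IH] f g /=; first by move=> cf cg x; apply: cvgD; [exact: cf|exact: cg].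
move=> [f' ff sf] [g' gg sg]; exists (fun x => f' x + g' x); last exact: IH.
by move=> x; exact: is_deriveD.
Qed.

Lemma smoothM k f g : smooth k f -> smooth k g -> smooth k (fun x => f x * g x).
Proof.
elim: k f g => [|k IH] f g; first by move=> cf cg x; apply: cvgM; [exact: cf|exact: cg].
move=> sf1 sg1; have [f' ff sf] := sf1; have [g' gg sg] := sg1.
exists (fun x => f x * g' x + g x * f' x); last by apply: smoothD; apply: IH => //; exact: smoothW.
by move=> x; exact: is_deriveM.
Qed.

Lemma smoothZ k (c : R) f : smooth k f -> smooth k (fun x => c * f x).
Proof. by apply: smoothM; exact: smooth_cst. Qed.

Lemma smoothV k f : (forall x, f x != 0) -> smooth k f -> smooth k (fun x => (f x)^-1).
Proof.
move=> f0; elim: k => [|k IH]; first by move=> cf x; apply: cvgV => //; exact: cf.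
move=> sf1; have [f' ff sf] := sf1; exists (fun x => -1 * ((f x)^-1 * (f x)^-1 * f' x)).
  move=> x; apply: (derive_eq (is_deriveV (f0 x) (ff x))).
  by rewrite /GRing.scale /= expr2 invfM; ring.
by apply: smoothZ; apply: smoothM => //; apply: smoothM; apply: IH; exact: smoothW.
Qed.

Lemma smooth_affine k f (a b : R) : smooth k f -> smooth k (fun x => f (a * x + b)).
Proof.
elim: k f => [|k IH] f.
  move=> cf x; apply: (@continuous_comp _ _ _ (fun x => a * x + b) f); last exact: cf.
  by apply: cvgD; [apply: cvgM; [exact: cvg_cst|exact: cvg_id]|exact: cvg_cst].
move=> [f' ff sf]; exists (fun x => a * f' (a * x + b)); last by apply: smoothZ; exact: IH.
move=> x; have H : is_derive x 1 (fun x : R => a * x + b) a.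
  apply: (derive_eq (is_deriveD (is_deriveM (is_derive_cst a x (1 : R)) (is_derive_id x (1 : R))) (is_derive_cst b x (1 : R)))).
  by rewrite /GRing.scale /= !mulr0 !mulr1 !addr0.
apply: (derive_eq (is_derive1_comp (ff _) H)).
by rewrite mulrC.
Qed.

(** Differentiation stays in the span of this family; smoothness at 0 thus reduces to derivative 0
    for each member, which follows from the quadratic bound below. *)
Definition flat m t : R := if 0 < t then t^-1 ^+ m * expR (- t^-1) else 0.

Let is_derive_inv x : x != 0 -> is_derive x 1 (fun t => t^-1) (- x^-1 ^+ 2).
Proof.
move=> x0; apply: (derive_eq (is_deriveV x0 (is_derive_id x (1 : R)))).
by rewrite /GRing.scale /= mulr1 exprVn.
Qed.

Let is_derive_flat_pos m x : x != 0 -> is_derive x 1 (fun t => t^-1 ^+ m * expR (- t^-1))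
  (- m%:R * (x^-1 ^+ m.+1 * expR (- x^-1)) + x^-1 ^+ m.+2 * expR (- x^-1)).
Proof.
move=> x0; elim: m => [|m IH].
  rewrite (_ : (fun _ => _) = fun t => expR (- t^-1)); last by apply/funext => t; rewrite expr0 mul1r.
  have Hi : is_derive x 1 (fun t => - t^-1) (x^-1 ^+ 2).
    by apply: derive_eq; [apply: is_deriveN; exact: is_derive_inv|rewrite opprK].
  apply: (derive_eq (is_derive1_comp (is_derive_expR _) Hi)).
  by rewrite oppr0 mul0r add0r mulrC.
rewrite (_ : (fun _ => _) = (fun t => t^-1 * (t^-1 ^+ m * expR (- t^-1)))); last first.
  by apply/funext => t; rewrite exprS mulrA.
apply: derive_eq; first by apply: is_deriveM; exact: is_derive_inv.
by rewrite /GRing.scale /= -natr1 !exprS; ring.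
Qed.

Lemma flat_quadratic m : exists2 C, 0 <= C & forall t, `|flat m t| <= C * t ^+ 2.
Proof.
exists (m.+2)`!%:R => // t; rewrite /flat; case: ifPn => t0; last first.
  by rewrite normr0 mulr_ge0 ?sqr_ge0.
have u0 : 0 < t^-1 by rewrite invr_gt0.
rewrite ger0_norm; last by rewrite mulr_ge0 ?expR_ge0 ?exprn_ge0 ?(ltW u0).
have := @expR_ge1Dxn _ _ m.+1 (ltW u0); rewrite expRN => H.
have H' : t^-1 ^+ m.+2 <= expR t^-1 * (m.+2)`!%:R.
  by rewrite -ler_pdivrMr ?ltr0n ?fact_gt0//; apply: le_trans H; rewrite lerDr.
rewrite ler_pdivrMr ?expR_gt0//.
have -> : t^-1 ^+ m = t ^+ 2 * t^-1 ^+ m.+2.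
  by rewrite !exprS; field; rewrite gt_eqF.
by rewrite [leRHS]mulrAC [leRHS]mulrC ler_wpM2l ?sqr_ge0// mulrC.
Qed.

Lemma is_derive_flat m x : is_derive x 1 (flat m) (- m%:R * flat m.+1 x + flat m.+2 x).
Proof.
have [x0|x0|->] := ltgtP x 0.
- rewrite /flat !ifF ?(lt_gtF x0)// mulr0 addr0.
  apply: (near_eq_is_derive _ (is_derive_cst (0 : R) x (1 : R))).
  have := lt_nbhsl x0; apply: filterS => y /= y0; rewrite /flat ifF//.
  by apply/negbTE; rewrite -leNgt ltW.
- rewrite /flat !x0.
  apply: (@near_eq_is_derive _ _ _ (fun t => t^-1 ^+ m * expR (- t^-1))).
    by have := lt_nbhsr x0; apply: filterS => y /= y0; rewrite /flat y0.
  by apply: is_derive_flat_pos; rewrite gt_eqF.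
have [C C0 HC] := flat_quadratic m.
rewrite {2 3}/flat ltxx mulr0 addr0; apply: is_derive_cvg.
apply/cvgr0Pnorm_lt => e e0; near=> h.
have h0 : h != 0 by near: h; exact: nbhs_dnbhs_neq.
have he : `|h| < e / (C + 1).
  by near: h; apply: dnbhs0_lt; rewrite divr_gt0// ltr_wpDl.
rewrite /= {2}/flat ltxx subr0 addr0 /GRing.scale /= mulr1 normrM.
apply: (@le_lt_trans _ _ (`|h^-1| * (C * h ^+ 2))); first by rewrite ler_wpM2l.
rewrite normfV mulrC -[h ^+ 2](real_normK (num_real _)) expr2 !mulrA mulfK ?normr_eq0//.
rewrite ltr_pdivlMr ?ltr_wpDl// in he; apply: le_lt_trans he.
by rewrite mulrC ler_wpM2l// lerDl.
Unshelve. all: by end_near.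
Qed.

Lemma smooth_flat k m : smooth k (flat m).
Proof.
elim: k m => [|k IH] m; first by move=> x; exact: is_derive_continuous (is_derive_flat m x).
exists (fun x => - m%:R * flat m.+1 x + flat m.+2 x); first exact: is_derive_flat.
by apply: smoothD => //; apply: smoothZ.
Qed.

Lemma flat_gt0 t : 0 < t -> 0 < flat 0 t.
Proof. by move=> t0; rewrite /flat t0 mulr_gt0 ?expR_gt0. Qed.

Lemma flat_le0 m t : t <= 0 -> flat m t = 0.
Proof. by move=> t0; rewrite /flat ltNge t0. Qed.

Lemma flat_ge0 t : 0 <= flat 0 t.
Proof. by have [/flat_le0 ->|/flat_gt0/ltW] := leP t 0. Qed.

Lemma flat_le t t' : t <= t' -> flat 0 t <= flat 0 t'.
Proof.
move=> tt; have [t0|t0] := leP t 0; first by rewrite flat_le0// flat_ge0.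
have t0' := lt_le_trans t0 tt.
by rewrite /flat t0 t0' !expr0 !mul1r ler_expR lerN2 lef_pV2.
Qed.

Let flatD_gt0 t : 0 < flat 0 t + flat 0 (1 - t).
Proof.
have [t0|t0] := leP t 0; first by rewrite ltr_wpDl ?flat_ge0// flat_gt0//; lra.
by rewrite ltr_wpDr ?flat_ge0// flat_gt0.
Qed.

Definition step t : R := flat 0 t / (flat 0 t + flat 0 (1 - t)).

Lemma smooth_step k : smooth k step.
Proof.
have s1 : smooth k (fun t => flat 0 (1 - t)).
  rewrite (_ : (fun _ => _) = fun t => flat 0 (-1 * t + 1)); last by apply/funext => t; rewrite mulN1r addrC.
  by apply: (@smooth_affine k (flat 0)); exact: smooth_flat.
apply: smoothM; first exact: smooth_flat.
apply: smoothV; first by move=> x; rewrite gt_eqF.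
by apply: smoothD => //; exact: smooth_flat.
Qed.

Lemma step_le0 t : t <= 0 -> step t = 0.
Proof. by move=> t0; rewrite /step flat_le0// mul0r. Qed.

Lemma step_ge1 t : 1 <= t -> step t = 1.
Proof.
by move=> t1; rewrite /step [flat 0 (1 - t)]flat_le0 ?subr_le0// addr0 divff// gt_eqF// flat_gt0//; lra.
Qed.

Lemma step_le t t' : t <= t' -> step t <= step t'.
Proof.
move=> tt; rewrite /step ler_pdivrMr// mulrAC ler_pdivlMr// !mulrDr [flat 0 t * flat 0 t']mulrC lerD2l.
by apply: ler_pM; rewrite ?flat_ge0 ?flat_le// lerB.
Qed.

Lemma step_ge0 t : 0 <= step t.
Proof. by rewrite /step divr_ge0 ?flat_ge0// ltW. Qed.

Lemma step_lipschitz : exists2 L, 0 < L & forall t t', `|step t - step t'| <= L * `|t - t'|.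
Proof.
have [f' ff sf] := smooth_step 1.
have cf : {within `[0, 1], continuous (fun x => `|f' x|)}.
  apply: continuous_subspaceT => x; apply: (@continuous_comp _ _ _ f' Num.norm); first exact: sf.
  exact: norm_continuous.
have [c c01 Hc] := EVT_max ler01 cf.
have L0 : 0 <= `|f' c| by [].
have cl x y : 0 <= x -> x <= y -> y <= 1 -> `|step y - step x| <= `|f' c| * `|y - x|.
  move=> x0 xy y1; have [|z] := @MVT_segment _ step f' x y xy (fun z _ => ff z).
    by apply: continuous_subspaceT => z; exact: is_derive_continuous (ff z).
  rewrite in_itv /= => /andP[xz zy] ->; rewrite normrM ler_wpM2r// Hc// in_itv /=.
  by rewrite (le_trans x0 xz) (le_trans zy y1).
pose cla x := Num.max 0 (Num.min x 1).
have cla0 x : 0 <= cla x by rewrite le_max lexx.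
have cla1 x : cla x <= 1 by rewrite ge_max ler01 ge_min lexx orbT.
have scla x : step (cla x) = step x.
  rewrite /cla; have [x0|x0] := leP x 0.
    by rewrite min_l ?(le_trans x0)// max_l// !step_le0.
  have [x1|x1] := leP x 1; first by rewrite max_r// ltW.
  by rewrite max_r// !step_ge1// ltW.
have clale x y : x <= y -> cla x <= cla y /\ cla y - cla x <= y - x.
  move=> xy; rewrite /cla /Num.max /Num.min; do !case: ifPn; rewrite -?leNgt; lra.
exists (`|f' c| + 1); first by rewrite ltr_wpDl.
have H x y : x <= y -> `|step y - step x| <= (`|f' c| + 1) * `|y - x|.
  move=> xy; rewrite -scla -(scla x); have [c1 c2] := clale _ _ xy.
  apply: le_trans (cl _ _ _ _ _) _ => //; apply: ler_pM => //; first by rewrite lerDl.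
  by rewrite !ger0_norm ?subr_ge0.
move=> t t'; have [tt|/ltW tt] := leP t t'; last exact: H.
by rewrite distrC [X in _ <= _ * X]distrC; exact: H.
Qed.

End smooth.

Section bump.
Context (R : realType).
Implicit Types t : R.

(* The integer translates of [hat] telescope to a partition of unity. *)
Definition hat t : R := step (t + 1) - step t.

Lemma hat_ge0 t : 0 <= hat t.
Proof. by rewrite subr_ge0 step_le// lerDl. Qed.

Lemma step_le1 t : step t <= 1.
Proof.
have [t1|/ltW t1] := leP t 1; last by rewrite step_ge1.
by rewrite -(@step_ge1 R 1)// step_le.
Qed.

Lemma hat_le1 t : hat t <= 1.
Proof. by rewrite lerBlDr ler_wpDr ?step_ge0// step_le1. Qed.

Lemma hat_support t : 1 <= `|t| -> hat t = 0.
Proof.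
move=> H; rewrite /hat; have [t0|t0] := leP 0 t.
  by rewrite !step_ge1 ?subrr//; move: H; rewrite ger0_norm//; lra.
by rewrite !step_le0 ?subrr//; move: H; rewrite ltr0_norm//; lra.
Qed.

Lemma hat0 : hat 0 = 1.
Proof. by rewrite /hat add0r step_ge1// step_le0// subr0. Qed.

Lemma hat_nat_lt (N : nat) t : \sum_(k < N) hat (t - k%:R) = step (t + 1) - step (t - N%:R + 1).
Proof.
elim: N => [|N IH]; first by rewrite big_ord0 subr0 subrr.
rewrite big_ord_recr /= IH /hat -natr1 opprD !addrA subrK.
by congr (_ - step _); ring.
Qed.

Lemma hat_sum_le1 (N : nat) t : \sum_(k < N) hat (t - k%:R) <= 1.
Proof. by rewrite hat_nat_lt lerBlDr ler_wpDr ?step_ge0// step_le1. Qed.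

Lemma hat_sum1 (N : nat) t : 0 <= t -> t <= N%:R -> \sum_(k < N.+1) hat (t - k%:R) = 1.
Proof.
by move=> t0 tN; rewrite hat_nat_lt step_ge1 ?step_le0 ?subr0 -?natr1//; lra.
Qed.

Lemma smooth_hat k : smooth k hat.
Proof.
apply: smoothD.
  rewrite (_ : (fun _ => _) = fun t => step (1 * t + 1)); last by apply/funext => t; rewrite mul1r.
  by apply: (@smooth_affine _ k (@step R)); exact: smooth_step.
rewrite (_ : (fun _ => _) = fun t => -1 * step t); last by apply/funext => t; rewrite mulN1r.
by apply: smoothZ; exact: smooth_step.
Qed.

Lemma hat_lipschitz : exists2 L, 0 < L & forall t t', `|hat t - hat t'| <= L * `|t - t'|.
Proof.
have [L L0 HL] := step_lipschitz R; exists (L + L); first by rewrite addr_gt0.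
move=> t t'; have -> : hat t - hat t' = (step (t + 1) - step (t' + 1)) - (step t - step t').
  by rewrite /hat; ring.
apply: le_trans (ler_normB _ _) _; rewrite mulrDl; apply: lerD => //.
by apply: le_trans (HL _ _) _; rewrite opprD addrACA subrr addr0.
Qed.

End bump.

Section bump_rV.
Context (R : realType) (n : nat).
Local Notation X := 'rV[R]_n.

Definition bump (c : X) (e : R) (x : X) : R := \prod_i hat ((x ord0 i - c ord0 i) / e).

Lemma continuous_prod_coord (F : 'I_n -> R -> R) : (forall i, continuous (F i)) ->
  continuous (fun x : X => \prod_i F i (x ord0 i)).
Proof.
move=> cF x.
rewrite /continuous_at.
apply: (@cvg_big R _ *%R 1 predT mul_continuous _ (nbhs x)) => i _.
 apply: (@continuous_comp _ _ _ (fun x : X => x ord0 i) (F i)); last exact: cF.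
exact: coord_continuous.
Qed.

Lemma is_derive_prod (F : 'I_n -> R -> R) (i : 'I_n) (x : X) (d : R) :
  is_derive (x ord0 i) 1 (F i) d ->
  is_derive x (delta_mx ord0 i) (fun y : X => \prod_j F j (y ord0 j))
    (d * \prod_(j | j != i) F j (x ord0 j)).
Proof.
move=> [dF <-]; apply: is_derive_cvg.
rewrite (_ : (fun _ => _) = fun h => (h^-1 *: ((F i \o shift (x ord0 i)) (h *: 1) - F i (x ord0 i)))
    * \prod_(j | j != i) F j (x ord0 j)); last first.
  apply/funext => h /=; rewrite (bigD1 i)//= [in X in _ - X](bigD1 i)//= /GRing.scale /=.
  rewrite !mxE !eqxx !mulr1.
  rewrite (eq_bigr (fun j => F j (x ord0 j))); last first.
    by move=> j ji; rewrite !mxE (negbTE ji) andbF mulr0 add0r.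
  by rewrite -mulrBl mulrA.
by apply: cvgM; [exact: dF|exact: cvg_cst].
Qed.

(** A partial derivative of a product of functions of single coordinates has the same form with one
    factor differentiated, so the induction stays in this class. *)
Lemma Ck_prod k (F : 'I_n -> R -> R) : (forall i l, smooth l (F i)) ->
  Ck k (fun x : X => \prod_i F i (x ord0 i)).
Proof.
elim: k F => [|k IH] F sF; (split; first by apply: continuous_prod_coord => i; exact: (sF i 0)).
  by [].
move=> i; have [f' ff _] := sF i 1.
have H x := @is_derive_prod F i x _ (ff (x ord0 i)).
split; first by move=> x; case: (H x).
rewrite (_ : 'D_(delta_mx ord0 i) _ = (fun x : X => \prod_j (if j == i then f' else F j) (x ord0 j))).
  apply: (IH (fun j => if j == i then f' else F j)) => j l; case: eqP => // _; have [g fg sg] := sF i l.+1.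
  rewrite (_ : f' = g)//; apply/funext => x.
  by case: (ff x) => _ <-; case: (fg x) => _ <-.
apply/funext => x; case: (H x) => _ ->; rewrite [RHS](bigD1 i)//= eqxx; congr (_ * _).
by apply: eq_bigr => j /negbTE ->.
Qed.

Lemma Ck_bump c (e : R) k : Ck k (bump c e).
Proof.
apply: (@Ck_prod k (fun i t => hat ((t - c ord0 i) / e))) => i l.
rewrite (_ : (fun _ => _) = fun t => hat (e^-1 * t + - (c ord0 i / e))).
  by apply: (@smooth_affine _ l (@hat R)); exact: smooth_hat.
by apply/funext => t; congr hat; ring.
Qed.

Lemma continuous_bump c e : continuous (bump c e).
Proof. by case: (Ck_bump c e 0). Qed.

Lemma bump_ge0 c e x : 0 <= bump c e x.
Proof. by apply: prodr_ge0 => i _; exact: hat_ge0. Qed.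

Lemma bump_le1 c e x : bump c e x <= 1.
Proof. by apply: prodr_ile1 => i; rewrite hat_ge0 hat_le1. Qed.

Lemma bump_support c e x : 0 < e -> bump c e x != 0 -> `|x - c| < e.
Proof.
move=> e0; apply: contraR; rewrite -leNgt => H.
have [i Hi] : exists i, e <= `|(x - c) ord0 i|.
  apply/not_existsP => K; move: H; apply/negP; rewrite -ltNge.
  rewrite [ltLHS]mx_normrE; apply/bigmax_ltP; split=> // -[j i] _ /=.
  by rewrite (ord1 j) ltNge; apply/negP; exact: K.
rewrite /bump (bigD1 i)//= hat_support ?mul0r//.
by rewrite normrM normfV (gtr0_norm e0) ler_pdivlMr// mul1r; rewrite !mxE in Hi.
Qed.

Lemma bump_center c e : bump c e c = 1.
Proof. by rewrite /bump big1// => i _; rewrite subrr mul0r hat0. Qed.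

Lemma prod_lipschitz (a b : 'I_n -> R) (d : R) : (forall i, 0 <= a i <= 1) ->
  (forall i, 0 <= b i <= 1) -> (forall i, `|a i - b i| <= d) ->
  `|\prod_i a i - \prod_i b i| <= n%:R * d.
Proof.
elim: n a b => [|m IH] a b a1 b1 ab; first by rewrite !big_ord0 subrr normr0 mul0r.
rewrite !big_ord_recl; set A := \prod_(i < m) _; set B := \prod_(i < m) _.
have -> : a ord0 * A - b ord0 * B = (a ord0 - b ord0) * A + b ord0 * (A - B) by ring.
apply: le_trans (ler_normD _ _) _; rewrite !normrM -nat1r mulrDl mul1r; apply: lerD.
  rewrite -[leRHS]mulr1; apply: ler_pM => //.
  by rewrite ger0_norm ?prodr_ge0 ?prodr_ile1// => i *; case/andP: (a1 (lift ord0 i)).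
rewrite -[leRHS]mul1r; apply: ler_pM => //; last exact: IH.
by have /andP[b0 b2] := b1 ord0; rewrite ger0_norm.
Qed.

Lemma bump_lipschitz : exists2 L, 0 < L & forall c e x y, 0 < e ->
  `|bump c e x - bump c e y| <= L * (`|x - y| / e).
Proof.
have [L L0 HL] := hat_lipschitz R; exists ((n%:R + 1) * L); first by rewrite mulr_gt0// ltr_wpDl.
move=> c e x y e0; apply: (@le_trans _ _ (n%:R * (L * (`|x - y| / e)))); last first.
  by rewrite -mulrA ler_wpM2r ?lerDl// mulr_ge0 ?(ltW L0)// divr_ge0// ltW.
apply: prod_lipschitz => i; rewrite ?hat_ge0 ?hat_le1//.
apply: le_trans (HL _ _) _; rewrite ler_pM2l// -mulrBl normrM normfV (gtr0_norm e0).
rewrite ler_pM2r ?invr_gt0//.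
have -> : x ord0 i - c ord0 i - (y ord0 i - c ord0 i) = (x - y) ord0 i by rewrite !mxE; ring.
exact: coord_le_norm.
Qed.

Lemma compact_cube (c : X) r : (0 < n)%N -> compact (cube c r).
Proof.
case: n c => // m c _.
rewrite (_ : cube c r = [set v : 'rV[R]_m.+1 | forall i, `[c ord0 i - r, c ord0 i + r]%classic (v ord0 i)]).
  by apply: (@rV_compact _ _ (fun i => `[c ord0 i - r, c ord0 i + r]%classic)) => i; exact: segment_compact.
apply/seteqP; split => x /= H.
  move=> i; have := le_trans (coord_le_norm (x - c) i) H.
  by rewrite !mxE ler_norml in_itv /= => /andP[? ?]; apply/andP; split; lra.
have r0 : 0 <= r by have := H ord0; rewrite in_itv /= => /andP[? ?]; lra.
apply: norm_le_coord => // i; have := H i; rewrite in_itv /= => /andP[? ?].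
by rewrite !mxE ler_norml; apply/andP; split; lra.
Qed.

Lemma closed_cube (c : X) r : closed (cube c r).
Proof.
apply: (@closed_comp _ _ (fun x : X => `|x - c|) [set t | t <= r]); last exact: closed_le.
move=> x _; apply: (@continuous_comp _ _ _ (fun x : X => x - c) Num.norm); last exact: norm_continuous.
by apply: (@cvgB _ _ _ (nbhs x)); [exact: cvg_id|exact: cvg_cst].
Qed.

Lemma bump_test_function (Omega : set X) c e : (0 < n)%N -> 0 < e -> cube c e `<=` Omega ->
  test_functions Omega (bump c e).
Proof.
move=> n0 e0 cO.
have supp : closure [set x | bump c e x != 0] `<=` cube c e.
  apply: (@subset_trans _ (closure (cube c e))); last by rewrite -(closure_id _).1//; exact: closed_cube.
  by apply: closure_subset => x /= /(bump_support e0) /ltW.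
split; first by move=> k; exact: Ck_bump.
  by apply: subclosed_compact supp; [exact: closed_closure|exact: compact_cube].
exact: subset_trans cO.
Qed.

End bump_rV.

End Bumps.
Import Bumps.

Module SmoothEnergies.

(** * Quasi-interpolation on a grid *)

Section grid.
Context (R : realType) (n N : nat) (e : R).
Hypothesis e0 : 0 < e.
Local Notation X := 'rV[R]_n.

(** Subtracting [N] in [gpt] centers the indices, so that the grid fills the box of radius [e N] and
    the bumps sum to 1 on it. *)
Definition grid := {ffun 'I_n -> 'I_(N.*2).+1}.
Definition gpt (z : grid) : X := \row_i (e * ((z i)%:R - N%:R)).

Lemma grid_coordE (x : X) (z : grid) i :
  (x ord0 i - gpt z ord0 i) / e = x ord0 i / e + N%:R - (z i)%:R.
Proof. by rewrite mxE; field; rewrite gt_eqF. Qed.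

Lemma grid_sumE (x : X) : \sum_(z : grid) bump (gpt z) e x =
  \prod_i \sum_(k < (N.*2).+1) hat (x ord0 i / e + N%:R - k%:R).
Proof.
rewrite bigA_distr_bigA /=; apply: eq_bigr => z _; apply: eq_bigr => i _.
by rewrite grid_coordE.
Qed.

Lemma grid_sum_le1 x : \sum_(z : grid) bump (gpt z) e x <= 1.
Proof.
rewrite grid_sumE; apply: prodr_ile1 => i; rewrite hat_sum_le1 andbT.
by move=> _; apply: sumr_ge0 => k _; exact: hat_ge0.
Qed.

Lemma grid_sum1 (x : X) : `|x| <= e * N%:R -> \sum_(z : grid) bump (gpt z) e x = 1.
Proof.
move=> xN; rewrite grid_sumE big1// => i _.
have := le_trans (coord_le_norm x i) xN; rewrite ler_norml => /andP[x1 x2].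
have E : x ord0 i = x ord0 i / e * e by rewrite divfK ?gt_eqF.
apply: hat_sum1.
  rewrite -lerBlDr sub0r ler_pdivlMr// mulNr mulrC; exact: x1.
rewrite -addnn natrD lerD2r ler_pdivrMr// mulrC; exact: x2.
Qed.

Lemma count_near (t : R) m : (#|[pred k : 'I_m | (`|t - k%:R| < 2)%R]| <= 5)%N.
Proof.
set P := [pred k : 'I_m | `|t - k%:R| < 2].
case: (pickP P) => [k0 Pk0|P0]; last by rewrite eq_card0.
case: (@arg_minnP _ k0 P (fun k => nat_of_ord k) Pk0) => k1 Pk1 mink1.
pose f (k : 'I_m) : 'I_5 := inord (k - k1).
have fk k : P k -> (k - k1 < 5)%N.
  move=> Pk; rewrite -(ltr_nat R) natrB ?mink1//.
  by move: Pk Pk1; rewrite /P /= !ltr_norml => /andP[? ?] /andP[? ?]; lra.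
rewrite -(@card_in_image _ _ f); first by rewrite (leq_trans (max_card _))// card_ord.
move=> x y Px Py /(congr1 (@nat_of_ord 5)); rewrite /f !inordK ?fk// => H.
by apply: val_inj; rewrite /= -(subnK (mink1 _ Px)) -(subnK (mink1 _ Py)) H.
Qed.

Lemma count_grid (x : X) : \sum_(z : grid) (`|x - gpt z| < 2 * e)%R%:R <= 5 ^+ n :> R.
Proof.
pose c i (k : 'I_(N.*2).+1) : R := (`|x ord0 i / e + N%:R - k%:R| < 2)%R%:R.
apply: (@le_trans _ _ (\sum_(z : grid) \prod_i c i (z i))).
  apply: ler_sum => z _; have [H|_] := boolP (`|x - gpt z| < 2 * e); last first.
    by rewrite prodr_ge0.
  rewrite big1// => i _; rewrite /c (_ : (_ < 2) = true)//.
  rewrite -grid_coordE normrM normfV (gtr0_norm e0) ltr_pdivrMr//.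
  by apply: le_lt_trans H; have := coord_le_norm (x - gpt z) i; rewrite !mxE.
rewrite -bigA_distr_bigA /=; apply: (@le_trans _ _ (\prod_(i < n) 5)); last by rewrite prodr_const card_ord.
apply: ler_prod => i _; rewrite sumr_ge0//= /c -natr_sum ler_nat.
apply: leq_trans (count_near (x ord0 i / e + N%:R) (N.*2).+1).
by rewrite -sum1_card [leqRHS]big_mkcond /=; apply: leq_sum => j _; rewrite inE; case: (_ < _).
Qed.

End grid.

Section quasi_interpolant.
Context (R : realType) (n : nat) (s : R) (M : R -> R).
Hypothesis n0 : (0 < n)%N.
Hypothesis s01 : 0 < s < 1.
Hypothesis youngM : young M.
Local Notation la := (lebesgue_rV R n).
Local Notation X := 'rV[R]_n.
Local Notation M0 := (young0 youngM).
Local Notation M_ge0 := (young_ge0 youngM).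

Let s0 : 0 < s. Proof. by case/andP: s01. Qed.
Let s1 : 0 < 1 - s. Proof. by rewrite subr_gt0; case/andP: s01. Qed.
Let nR0 : 0 < n%:R :> R. Proof. by rewrite ltr0n. Qed.

(** Averages replace point values, which a merely measurable [u] does not control; Jensen's
    inequality applies to them. *)
Definition qint N (e : R) (u : X -> R) (x : X) : R :=
  \sum_(z : grid n N) bump (gpt e z) e x * avg (gpt e z) e u.

Lemma continuous_qint N e u : continuous (qint N e u).
Proof.
move=> x; rewrite /continuous_at; apply: (@cvg_big R _ +%R 0 predT add_continuous _ (nbhs x)) => z _.
by apply: cvgM; [exact: continuous_bump|exact: cvg_cst].
Qed.

Lemma measurable_qint N e u : measurable_fun setT (qint N e u).
Proof. by apply: continuous_measurable_rV; exact: continuous_qint. Qed.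

Context (L : R).
Hypothesis L0 : 0 < L.
Hypothesis HL : forall (c : X) (e : R) x y, 0 < e -> `|bump c e x - bump c e y| <= L * (`|x - y| / e).
Context (N : nat) (e K : R) (u : X -> R).
Hypothesis e0 : 0 < e.
Hypothesis K0 : 0 < K.
Hypothesis mu : measurable_fun setT u.
Hypothesis iu : forall c : X, la.-integrable (cube c e) (EFin \o u).
Hypothesis u_supp : forall x, e * N%:R - e < `|x| -> u x = 0.

Let k := K * (n%:R * (3 * e)) `^ s.
Let J x := (\int[la]_q (osc M (3 * e) k u (x, q))%:E)%E.
Let e30 : 0 < 3 * e. Proof. by rewrite mulr_gt0. Qed.
Let k0 : 0 < k. Proof. by rewrite mulr_gt0// powR_gt0// mulr_gt0. Qed.

Let moE : measurable_fun setT (EFin \o osc M (3 * e) k u).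
Proof. by apply/measurable_EFinP; exact: measurable_osc. Qed.

Let mJ : measurable_fun setT J.
Proof.
by apply: (measurable_fun_fubini_tonelli_F (m2 := la) _ moE) => z; rewrite lee_fin osc_ge0.
Qed.

Let J0 x : (0 <= J x)%E. Proof. by apply: int_ge0 => q; exact: osc_ge0. Qed.

Let V0 : 0 < (2 * e) ^- n. Proof. by rewrite invr_gt0 exprn_gt0// mulr_gt0. Qed.

Let cube_sub (x : X) (z : grid n N) : `|x - gpt e z| < 2 * e -> cube (gpt e z) e `<=` cube x (3 * e).
Proof.
move=> H q; rewrite /cube /= => qz.
rewrite -(subrK (gpt e z) q) -addrA; apply: le_trans (ler_normD _ _) _.
by rewrite [X in _ + X <= _]distrC; lra.
Qed.

Let int_J : (\int[la]_x J x <= ((n%:R * (3 * e)) ^+ n)%:E * near_energy s M (3 * e) K u)%E.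
Proof. exact: integral_osc. Qed.

Let VJ : (((2 * e) ^- n)%:E * (\int[la]_x J x) <= ((n%:R * 3 / 2) ^+ n)%:E * near_energy s M (3 * e) K u)%E.
Proof.
apply: (@le_trans _ _ (((2 * e) ^- n)%:E * (((n%:R * (3 * e)) ^+ n)%:E * near_energy s M (3 * e) K u)))%E.
  by rewrite lee_wpmul2l// lee_fin ltW.
rewrite muleA -EFinM -exprVn -exprMn (_ : _^-1 * _ = n%:R * 3 / 2)//.
by field; rewrite gt_eqF.
Qed.

(** Where the bumps sum to 1 the error is a weighted mean of [avg - u x] over cubes that lie within
    [3 e] of [x]; elsewhere [u x = 0] by [u_supp]. *)
Lemma qint_amod : (amod M k (fun x => qint N e u x - u x)%R <=
  ((n%:R * 3 / 2) ^+ n)%:E * near_energy s M (3 * e) K u)%E.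
Proof.
apply: le_trans VJ; rewrite -ge0_integralZl_EFin ?(ltW V0)//.
apply: ge0_le_integral => //.
- by move=> x _; rewrite lee_fin M_ge0.
- by apply/measurable_EFinP; apply: measurable_M_div => //; apply: measurable_funB => //; exact: measurable_qint.
- exact: measurable_funeM.
move=> x _; pose w (z : grid n N) := bump (gpt e z) e x.
have E : qint N e u x - u x = \sum_(z : grid n N) w z * (1 * (avg (gpt e z) e u - u x)).
  under [RHS]eq_bigr do rewrite mul1r mulrBr.
  rewrite sumrB -mulr_suml /qint; congr (_ - _).
  have [xN|xN] := leP `|x| (e * N%:R); first by rewrite grid_sum1// mul1r.
  have ux : u x = 0 by apply: u_supp; apply: le_lt_trans xN; rewrite gerBl ltW.
  by rewrite ux mulr0.
have -> : (qint N e u x - u x) / k = \sum_(z : grid n N) w z * (1 * ((avg (gpt e z) e u - u x) / k)).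
  by rewrite E mulr_suml; apply: eq_bigr => z _; rewrite !mulrA.
apply: (@le_trans _ _ (((2 * e) ^- n * \sum_(z : grid n N) w z)%:E * J x)%E).
  apply: weighted_avg_osc => //.
  - by move=> z; exact: bump_ge0.
  - exact: grid_sum_le1.
  - move=> z /(bump_support e0) xz; apply: cube_sub; apply: lt_le_trans xz _.
    by rewrite ler_peMl ?(ltW e0)// ler1n.
  - by move=> z; rewrite normr1.
rewrite lee_wpmul2r// lee_fin ler_piMr ?(ltW V0)//; exact: grid_sum_le1.
Qed.

Let Cq := 2 * 5 ^+ n * L * (n%:R * 3) `^ s.
Let Cq0 : 0 < Cq. Proof. by rewrite !mulr_gt0 ?exprn_gt0// powR_gt0// mulr_gt0. Qed.

(** The increments of the bumps sum to 0 where [u x != 0], so the increment of the quasi-interpolant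
    combines the differences [avg - u x]. Its coefficients are of order [|x - y| / e], and division
    by [|x - y| ^ s] leaves the power [1 - s] of [inner_kernel]. *)
Let qint_near_pt z : ((nmod s M e (Cq * K) (qint N e u) z)%:E <=
  ((2 * e) ^- n)%:E * (J z.1 * (@inner_kernel R n (1 - s) (2 * e) (z.1 - z.2))%:E))%E.
Proof.
have R0 : (0 <= ((2 * e) ^- n)%:E * (J z.1 * (@inner_kernel R n (1 - s) (2 * e) (z.1 - z.2))%:E))%E.
  by rewrite mule_ge0 ?lee_fin ?(ltW V0)// mule_ge0// lee_fin inner_kernel_ge0.
rewrite /nmod; case: ifPn => [ze|_]; last exact: R0.
have [E|zz] := eqVneq z.1 z.2; first by rewrite /dmod Ds_diag// mul0r M0 mul0r.
have z0 : 0 < `|z.1 - z.2| by rewrite normr_gt0 subr_eq0.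
have en0 : 0 < enorm (z.1 - z.2) := lt_le_trans z0 (norm_le_enorm _).
set d := `|z.1 - z.2| in ze z0 *; set x := z.1; set y := z.2.
have e20 : 0 < 2 * e by rewrite mulr_gt0.
set rho := (d / (2 * e)) `^ (1 - s).
have rho0 : 0 < rho by rewrite powR_gt0// divr_gt0.
have rho1 : rho <= 1.
  rewrite -[leRHS](congr1 (fun f => f (1 - s)) (@powR1 R)).
  apply: ge0_ler_powR; rewrite ?nnegrE ?(ltW s1) ?divr_ge0 ?(ltW z0) ?(ltW e20)//.
  by rewrite ler_pdivrMr// mul1r; lra.
pose chi (z : grid n N) : R := (`|x - gpt e z| < 2 * e)%R%:R.
(* At most [5 ^ n] grid points are active, so these weights sum to at most [rho <= 1]. What remains
   of each coefficient is [sg], which the value of [Cq] bounds by 1. *)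
pose w z := rho * (chi z / 5 ^+ n).
have F0 : (0 : R) < 5 ^+ n by rewrite exprn_gt0.
pose df (z : grid n N) := bump (gpt e z) e x - bump (gpt e z) e y.
have df0 z' : ~~ (`|x - gpt e z'| < 2 * e) -> df z' = 0.
  move=> H; rewrite /df.
  have -> : bump (gpt e z') e x = 0.
    by apply/eqP; apply/negPn/negP => /(bump_support e0) xz; move: H; apply/negP; rewrite negbK; lra.
  have -> : bump (gpt e z') e y = 0.
    apply/eqP; apply/negPn/negP => /(bump_support e0) yz; move: H; apply/negP; rewrite negbK.
    rewrite -(subrK y x) -addrA; apply: le_lt_trans (ler_normD _ _) _.
    by rewrite -/d; lra.
  by rewrite subrr.
have ds0 : 0 < enorm (x - y) `^ s by rewrite powR_gt0.
pose sg z' := df z' * k / (enorm (x - y) `^ s * (Cq * K) * (rho / 5 ^+ n)).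
have den0 : 0 < enorm (x - y) `^ s * (Cq * K) * (rho / 5 ^+ n).
  exact: mulr_gt0 (mulr_gt0 ds0 (mulr_gt0 Cq0 K0)) (divr_gt0 rho0 F0).
have sg1 z' : `|sg z'| <= 1.
  rewrite /sg normrM normfV normrM (gtr0_norm k0) (gtr0_norm den0).
  rewrite ler_pdivrMr ?mul1r//.
  apply: (@le_trans _ _ (L * (d / e) * k)); first by rewrite ler_wpM2r ?(ltW k0)//; exact: HL.
  have dE : d / e = 2 * (rho * (d / (2 * e)) `^ s).
    rewrite /rho -powRD; last by rewrite (gt_eqF (divr_gt0 z0 e20)) implybT.
    by rewrite subrK powRr1 ?divr_ge0 ?(ltW z0) ?(ltW e20)//; field; rewrite gt_eqF.
  have kE : k = K * (n%:R * 3) `^ s * e `^ s by rewrite /k [n%:R * (3 * e)]mulrA (@powRM _ (n%:R * 3)) ?mulr_ge0 ?(ltW e0)// mulrA.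
  have de : (d / (2 * e)) `^ s * e `^ s <= enorm (x - y) `^ s.
    rewrite -powRM ?divr_ge0 ?(ltW z0) ?(ltW e20) ?(ltW e0)//.
    apply: ge0_ler_powR; rewrite ?nnegrE ?(ltW s0) ?(ltW en0)//.
      by rewrite mulr_ge0 ?divr_ge0 ?(ltW z0) ?(ltW e20) ?(ltW e0).
    apply: le_trans (norm_le_enorm _); rewrite -/d.
    have -> : d / (2 * e) * e = d / 2 by field; rewrite gt_eqF.
    by lra.
  rewrite dE kE /Cq.
  have -> : L * (2 * (rho * (d / (2 * e)) `^ s)) * (K * (n%:R * 3) `^ s * e `^ s) =
    2 * L * rho * K * (n%:R * 3) `^ s * ((d / (2 * e)) `^ s * e `^ s) by ring.
  have -> : enorm (x - y) `^ s * (2 * 5 ^+ n * L * (n%:R * 3) `^ s * K) * (rho / 5 ^+ n) =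
    2 * L * rho * K * (n%:R * 3) `^ s * enorm (x - y) `^ s.
    by field; rewrite gt_eqF.
  rewrite ler_wpM2l// !mulr_ge0 ?powR_ge0 ?(ltW L0) ?(ltW rho0) ?(ltW K0)//.
have sumw : \sum_z w z <= rho.
  rewrite /w -mulr_sumr -mulr_suml ler_piMr ?(ltW rho0)// ler_pdivrMr// mul1r.
  exact: count_grid.
have E : qint N e u x - qint N e u y = \sum_(z : grid n N) df z * (avg (gpt e z) e u - u x).
  under [RHS]eq_bigr do rewrite mulrBr mulrBl.
  rewrite !sumrB -/(qint N e u x) -/(qint N e u y) -mulr_suml /df sumrB.
  have [->|ux] := eqVneq (u x) 0; first by rewrite mulr0 subr0.
  have xN : `|x| <= e * N%:R - e by rewrite leNgt; apply/negP => /u_supp E; rewrite E eqxx in ux.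
  rewrite !grid_sum1 ?subrr ?mul0r ?subr0//; last by lra.
  rewrite -(subrK x y); apply: le_trans (ler_normD _ _) _.
  by rewrite distrC -/d; lra.
have E2 : @Ds R n s (qint N e u) z / (Cq * K) = \sum_(z : grid n N) w z * (sg z * ((avg (gpt e z) e u - u x) / k)).
  rewrite /Ds -/x -/y E !mulr_suml; apply: eq_bigr => z' _.
  have [H|H] := boolP (`|x - gpt e z'| < 2 * e).
    by rewrite /w /chi /sg H /=; field; rewrite !gt_eqF.
  by rewrite (df0 _ H) /w /chi (negbTE H) !mul0r mulr0 mul0r.
rewrite /dmod E2 EFinM.
have H : ((M (\sum_(z : grid n N) w z * (sg z * ((avg (gpt e z) e u - u x) / k))))%:E <=
    ((2 * e) ^- n * \sum_(z : grid n N) w z)%:E * J x)%E.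
  apply: weighted_avg_osc => //.
  - by move=> z'; rewrite mulr_ge0 ?(ltW rho0)// divr_ge0// ltW.
  - exact: le_trans sumw rho1.
  move=> z' wz; apply: cube_sub; apply/negPn/negP => H; move: wz.
  by rewrite /w /chi (negbTE H) mul0r mulr0 eqxx.
apply: (@le_trans _ _ (((2 * e) ^- n * rho)%:E * J x * (enorm (x - y) ^- n)%:E)%E).
  rewrite lee_wpmul2r ?lee_fin ?invpow_ge0//; apply: le_trans H _.
  by rewrite lee_wpmul2r// lee_fin ler_wpM2l// ltW.
rewrite /inner_kernel -/d ifT; last by lra.
by rewrite -/rho EFinM -!muleA lee_wpmul2l ?lee_fin ?(ltW V0)// muleCA EFinM.
Qed.

Let qint_near : (near_energy s M e (Cq * K) (qint N e u) <=
  (kernel_const n (1 - s) * (n%:R * 3 / 2) ^+ n)%:E * near_energy s M (3 * e) K u)%E.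
Proof.
have mi : measurable_fun setT (EFin \o @inner_kernel R n (1 - s) (2 * e)).
  by apply/measurable_EFinP; exact: measurable_inner_kernel.
have i0 h : (0 <= (EFin \o @inner_kernel R n (1 - s) (2 * e)) h)%E by rewrite lee_fin inner_kernel_ge0.
have iN h : (EFin \o @inner_kernel R n (1 - s) (2 * e)) (- h) = (EFin \o @inner_kernel R n (1 - s) (2 * e)) h.
  by rewrite /= inner_kernelN.
have mJk : measurable_fun setT (fun z : X * X => J z.1 * (EFin \o @inner_kernel R n (1 - s) (2 * e)) (z.1 - z.2)%R)%E.
  apply: emeasurable_funM; first exact: measurableT_comp mJ measurable_fst.
  exact: measurable_fun_sub.
apply: (@le_trans _ _ (\int[la \x la]_z (((2 * e) ^- n)%:E * (J z.1 * (EFin \o @inner_kernel R n (1 - s) (2 * e)) (z.1 - z.2)%R)))%E).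
  apply: ge0_le_integral => //.
  - by move=> z _; rewrite lee_fin nmod_ge0.
  - by apply/measurable_EFinP; apply: measurable_nmod => //; exact: measurable_qint.
  - exact: measurable_funeM.
rewrite ge0_integralZl_EFin ?(ltW V0)//; last by move=> z _; rewrite mule_ge0.
rewrite (ge0_integral_conv1 mJ mi J0 i0 iN) muleA [X in (_ <= X)%E](_ : _ =
  ((n%:R * 3 / 2) ^+ n)%:E * near_energy s M (3 * e) K u * (kernel_const n (1 - s))%:E)%E; last first.
  by rewrite EFinM -muleA muleC.
apply: lee_pmul => //; [|by apply: integral_ge0 => h _; exact: i0|by apply: integral_inner_kernel; rewrite ?mulr_gt0].
by rewrite mule_ge0 ?lee_fin ?(ltW V0)//; exact: integral_ge0.
Qed.

(** The summands serve the near energy of the quasi-interpolant, that of [u], and the [L_M] modular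
    of the error; the factor 2 pays for taking the difference. *)
Definition qint_scale : R := 2 * (Cq + 1 + (n%:R * 3) `^ s).
Definition qint_const : R := (kernel_const n (1 - s) + kernel_const n s) * (n%:R * 3 / 2) ^+ n + 1.

Lemma qint_energy : (energy s M (qint_scale * K) (fun x => qint N e u x - u x)%R <=
  qint_const%:E * near_energy s M (3 * e) K u)%E.
Proof.
have p0 : 0 < (n%:R * 3) `^ s by rewrite powR_gt0// mulr_gt0.
have es0 : 0 < e `^ s by rewrite powR_gt0.
have mq : measurable_fun setT (qint N e u) by exact: measurable_qint.
have A0 : 0 < Cq + 1 + (n%:R * 3) `^ s by rewrite !addr_gt0.
have NE0 : (0 <= near_energy s M (3 * e) K u)%E by exact: near_energy_ge0.
have c0 : (0 : R) <= (n%:R * 3 / 2) ^+ n by rewrite exprn_ge0// divr_ge0// mulr_ge0.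
have kc0 := kernel_const_ge0 n s1; have kc1 := kernel_const_ge0 n s0.
have H1 : (near_energy s M e (qint_scale * K) (fun x => qint N e u x - u x)%R <=
    (2^-1)%:E * ((kernel_const n (1 - s) * (n%:R * 3 / 2) ^+ n)%:E * near_energy s M (3 * e) K u + near_energy s M (3 * e) K u))%E.
  rewrite /qint_scale -mulrA; apply: le_trans (near_energyB _ youngM _ _ mq mu) _.
  rewrite lee_wpmul2l ?lee_fin ?invr_ge0//; apply: leeD.
    apply: le_trans qint_near; apply: near_energy_mono => //; first by rewrite mulr_gt0.
    by rewrite ler_pM2r// -addrA lerDl addr_ge0// ltW.
  apply: near_energy_mono => //; first by rewrite ler_peMl ?(ltW e0)// ler1n.
  by rewrite ler_peMl ?(ltW K0)// -addrA addrCA lerDl addr_ge0 ?(ltW Cq0) ?(ltW p0).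
have QK0 : 0 < qint_scale * K by rewrite !mulr_gt0.
have kk : k <= qint_scale * K * e `^ s / 2.
  rewrite /k [n%:R * (3 * e)]mulrA (@powRM _ (n%:R * 3)) ?mulr_ge0 ?(ltW e0)// /qint_scale.
  have -> : 2 * (Cq + 1 + (n%:R * 3) `^ s) * K * e `^ s / 2 = (Cq + 1 + (n%:R * 3) `^ s) * (K * e `^ s) by field.
  by rewrite mulrCA ler_pM2r ?mulr_gt0// lerDr addr_ge0// ltW.
have := energy_of_near s01 youngM (measurable_funB mq mu) e0 QK0 k0 kk H1 qint_amod.
move=> H; apply: le_trans H _.
move: NE0; generalize (near_energy s M (3 * e) K u) => -[x|_|//]; last first.
  by rewrite [leRHS]gt0_muley ?leey// lte_fin ltr_wpDl// mulr_ge0// addr_ge0.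
rewrite lee_fin => x0; set c := (n%:R * 3 / 2) ^+ n in c0 *.
rewrite -[leLHS]/((2^-1 * (kernel_const n (1 - s) * c * x + x) + kernel_const n s * (c * x))%:E).
rewrite -[leRHS]/((qint_const * x)%:E) lee_fin /qint_const -/c.
have : 0 <= kernel_const n (1 - s) * c * x by rewrite mulr_ge0 // mulr_ge0.
by lra.
Qed.

End quasi_interpolant.

End SmoothEnergies.
Import SmoothEnergies.

Module CubeAverages.

(** * Convergence theorems for modulars *)

Section convergence.
Context d (T : measurableType d) (R : realType) (mu : {measure set T -> \bar R}).

Lemma fatou_le (f_ : nat -> T -> R) (f : T -> R) (C : \bar R) :
  (forall k, measurable_fun setT (f_ k)) -> measurable_fun setT f -> (forall k x, 0 <= f_ k x) ->
  {ae mu, forall x, f_ k x @[k --> \oo] --> f x} ->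
  (forall k, \int[mu]_x (f_ k x)%:E <= C)%E -> (\int[mu]_x (f x)%:E <= C)%E.
Proof.
move=> mf_ mf f_0 cf fC; pose F k x := (f_ k x)%:E.
have mF k : measurable_fun setT (F k) by exact/measurable_EFinP.
have mL : measurable_fun setT (fun x => limn_einf (F^~ x)).
  rewrite /limn_einf; apply: measurableT_comp => //.
  by apply: measurable_fun_limn_esup => k; exact: measurableT_comp.
have -> : (\int[mu]_x (f x)%:E = \int[mu]_x limn_einf (F^~ x))%E.
  apply: ae_eq_integral => //; first exact/measurable_EFinP.
  apply: filterS cf => x cx _; have : F k x @[k --> \oo] --> (f x)%:E.
    by apply: cvg_EFin; [exact: nearW|exact: cx].
  by move=> /cvg_limn_einf_sup[->].
apply: le_trans (fatou mu measurableT mF _) _; first by move=> k x _; rewrite lee_fin.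
rewrite limn_einf_lim; apply: lime_le; first exact: is_cvg_einfs.
apply: nearW => k; apply: le_trans (fC k); apply: ereal_inf_lbound; exists k => //=.
Qed.

(** Truncate at [Phi]: the minimum of [h k] and [Phi] converges by domination, and the excess is at
    most [psi k]. *)
Lemma vitali (h : nat -> T -> R) : (forall k, measurable_fun setT (h k)) ->
  (forall k x, 0 <= h k x) -> {ae mu, forall x, h k x @[k --> \oo] --> 0} ->
  (forall e, 0 < e -> exists (Phi : T -> R) (psi : nat -> T -> R),
    [/\ measurable_fun setT Phi, forall x, 0 <= Phi x, (\int[mu]_x (Phi x)%:E < +oo)%E,
        forall k, measurable_fun setT (psi k) & forall k x, 0 <= psi k x] /\
    (forall k x, h k x <= Phi x + psi k x) /\ exists N : nat, forall k, (N <= k)%N ->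
       (\int[mu]_x (psi k x)%:E <= e%:E)%E) ->
  forall e, 0 < e -> exists N : nat, forall k, (N <= k)%N -> (\int[mu]_x (h k x)%:E <= e%:E)%E.
Proof.
move=> mh h0 hc H e e0; have e20 : 0 < e / 2 by rewrite divr_gt0.
have [Phi [psi [[mPhi Phi0 IPhi mpsi psi0] [hP [N HN]]]]] := H _ e20.
pose m k x := Num.min (h k x) (Phi x).
have m0 k x : 0 <= m k x by rewrite le_min h0 Phi0.
have mm k : measurable_fun setT (m k) by apply: measurable_minr.
have [] := @dominated_convergence _ _ _ mu setT measurableT (fun k => EFin \o m k) (cst 0%E) (EFin \o Phi).
- by move=> k; exact/measurable_EFinP.
- exact: measurable_cst.
- apply: filterS hc => x hx _; apply: cvg_EFin; first by apply: nearW.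
  apply: (@squeeze_cvgr _ _ _ _ (fun=> 0) (h^~ x)) => //; last exact: cvg_cst.
  by apply: nearW => k; rewrite m0 /= ge_min lexx.
- apply/integrableP; split; first exact/measurable_EFinP.
  by under eq_integral do rewrite /= ger0_norm//.
- by apply: aeW => x k _; rewrite /= lee_fin ger0_norm ?m0// ge_min lexx orbT.
move=> _ _; rewrite integral0 => /fine_cvgP[[N1 _ HN1] /cvgrPdist_lt/(_ _ e20)[N2 _ HN2]].
exists (maxn N (maxn N1 N2)) => k; rewrite !geq_max => /and3P[k0 k1 k2].
apply: (@le_trans _ _ (\int[mu]_x (m k x + psi k x)%:E)%E).
  apply: int_le => // [|x]; first exact: measurable_funD.
  by rewrite /m minElt; case: ifP => // _; rewrite lerDl.
rewrite intD// [e]splitr EFinD; apply: leeD; last exact: HN.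
have fin := HN1 k k1; rewrite -[leLHS](fineK fin) lee_fin ltW//.
by apply: le_lt_trans (HN2 k k2); rewrite /= sub0r normrN; exact: ler_norm.
Qed.

Section pair.
Variables P Q : R -> R.
Hypothesis P0 : forall t, 0 <= P t.
Hypothesis Q0 : forall t, 0 <= Q t.
Hypothesis cP : continuous P.
Hypothesis mQ : measurable_fun setT Q.
Hypothesis PQ : forall x t, `|x * t| <= P x + Q t.

Let mP : measurable_fun setT P. Proof. exact: continuous_measurable_fun. Qed.

(** [P] and [Q] are a Young function and its complementary function, in either order. A small [dl]
    makes the first term uniformly small and puts the burden on large multiples of [t], which is why
    that factor is asked to have a finite modular at every scale. *)
Lemma pair_bound (K dl x t : R) : 0 < K -> 0 < dl -> `|x * t| <= dl * P (x / K) + dl * Q (K / dl * t).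
Proof.
move=> K0 dl0; rewrite -mulrDr; have -> : x * t = dl * (x / K * (K / dl * t)) by field; rewrite !gt_eqF.
by rewrite normrM gtr0_norm// ler_pM2l.
Qed.

Lemma pair_integrable (K : R) (f eta : T -> R) : 0 < K -> measurable_fun setT f ->
  measurable_fun setT eta -> (\int[mu]_x (P (f x / K))%:E < +oo)%E ->
  (forall k, 0 < k -> (\int[mu]_x (Q (k * eta x))%:E < +oo)%E) ->
  mu.-integrable setT (EFin \o (fun x => f x * eta x)).
Proof.
move=> K0 mf me If Ie.
have m1 : measurable_fun setT (fun x => P (f x / K)) by apply: (measurableT_comp mP); exact: measurable_funM.
have m2 : measurable_fun setT (fun x => Q (K / 1 * eta x)) by apply: (measurableT_comp mQ); exact: measurable_funM.
apply/integrableP; split; first by apply/measurable_EFinP; exact: measurable_funM.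
apply: (@le_lt_trans _ _ (\int[mu]_x (P (f x / K) + Q (K / 1 * eta x))%:E)%E).
  apply: int_le => //; [by apply: measurableT_comp => //; exact: measurable_funM|exact: measurable_funD|].
  by move=> x; have := pair_bound (f x) (eta x) K0 ltr01; rewrite !mul1r.
by rewrite intD// lte_add_pinfty// Ie// divr_gt0.
Qed.

Lemma pair_cvg (K : R) (C : R) (f_ : nat -> T -> R) (f eta : T -> R) : 0 < K ->
  (forall k, measurable_fun setT (f_ k)) -> measurable_fun setT f -> measurable_fun setT eta ->
  {ae mu, forall x, f_ k x @[k --> \oo] --> f x} ->
  (forall k, \int[mu]_x (P (f_ k x / K))%:E <= C%:E)%E ->
  (forall k, 0 < k -> (\int[mu]_x (Q (k * eta x))%:E < +oo)%E) ->
  forall e, 0 < e -> exists N : nat, forall k, (N <= k)%N ->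
    (\int[mu]_x (`|(f_ k x - f x) * eta x|)%:E <= e%:E)%E.
Proof.
move=> K0 mf_ mf me cf IC Ie.
have mPf (g : T -> R) : measurable_fun setT g -> measurable_fun setT (fun x => P (g x / K)).
  by move=> mg; apply: (measurableT_comp mP); exact: measurable_funM.
have IfC : (\int[mu]_x (P (f x / K))%:E <= C%:E)%E.
  apply: (fatou_le (f_ := fun k x => P (f_ k x / K))) => //; try by move=> *; exact: mPf.
  apply: filterS cf => x cx; apply: (@cvg_comp _ _ _ (fun k => f_ k x / K) P _ (nbhs (f x / K))); last exact: cP.
  by apply: cvgM => //; exact: cvg_cst.
have C0 : 0 <= C by rewrite -lee_fin; apply: le_trans IfC; exact: int_ge0.
apply: vitali.
- by move=> k; apply: measurableT_comp => //; apply: measurable_funM => //; exact: measurable_funB.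
- by [].
- apply: filterS cf => x cx; rewrite -(normr0 R) -(mul0r (eta x)) -(subrr (f x)).
  by apply: cvg_norm; apply: cvgM; [apply: cvgB => //; exact: cvg_cst|exact: cvg_cst].
move=> e e0; pose dl := e / (C + 1).
have dl0 : 0 < dl by rewrite divr_gt0// ltr_wpDl.
have mQe : measurable_fun setT (fun x => Q (K / dl * eta x)) by apply: (measurableT_comp mQ); exact: measurable_funM.
exists (fun x => dl * P (f x / K) + 2 * (dl * Q (K / dl * eta x))), (fun k x => dl * P (f_ k x / K)); split; [split|split].
- by apply: measurable_funD; apply: measurable_funM => //; [exact: mPf|exact: measurable_funM].
- by move=> x; apply: addr_ge0; last apply: mulr_ge0 => //; apply: mulr_ge0; rewrite ?(ltW dl0).
- rewrite intD//; [|by apply: measurable_funM => //; exact: mPf|by apply: measurable_funM => //; exact: measurable_funM|by move=> x; rewrite mulr_ge0 ?(ltW dl0)|by move=> x; apply: mulr_ge0 => //; apply: mulr_ge0; rewrite ?(ltW dl0)].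
  have dQ0 x : 0 <= dl * Q (K / dl * eta x) by rewrite mulr_ge0 ?(ltW dl0).
  rewrite (intZ mu (mPf _ mf) (fun x => P0 _) (ltW dl0)).
  rewrite (intZ mu (measurable_funM (measurable_cst dl) mQe) dQ0 (ler0n _ 2)).
  rewrite (intZ mu mQe (fun x => Q0 _) (ltW dl0)).
  apply: lte_add_pinfty; first by apply: lte_mul_pinfty; rewrite ?lee_fin ?(ltW dl0)//; apply: le_lt_trans IfC _; rewrite ltry.
  apply: lte_mul_pinfty; rewrite ?lee_fin//; apply: lte_mul_pinfty; rewrite ?lee_fin ?(ltW dl0)//.
  by apply: Ie; rewrite divr_gt0.
- by move=> k; apply: measurable_funM => //; exact: mPf.
- by move=> k x; rewrite mulr_ge0 ?(ltW dl0).
- move=> k x; rewrite mulrBl; apply: le_trans (ler_normB _ _) _.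
  have := pair_bound (f x) (eta x) K0 dl0; have := pair_bound (f_ k x) (eta x) K0 dl0; lra.
exists 0 => k _; rewrite intZ ?(ltW dl0)//; last exact: mPf.
apply: (@le_trans _ _ (dl%:E * C%:E)%E); first by rewrite lee_wpmul2l// lee_fin ltW.
by rewrite -EFinM lee_fin /dl mulrAC ler_pdivrMr ?ltr_wpDl// ler_pM2l// lerDl.
Qed.

End pair.

(** The modulars of the increments, magnified by [2 ^ k], have a finite sum a.e. Since [M] is
    superlinear, bounded values of [M] come from bounded arguments, so the increments are dominated
    by a geometric series. *)
Lemma ae_cvg_summable (M : R -> R) (v : nat -> T -> R) : young M ->
  (forall k, measurable_fun setT (v k)) ->
  (forall k, \int[mu]_x (M (2 ^+ k * (v k.+1 x - v k x)))%:E <= (2^-1 ^+ k)%:E)%E ->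
  {ae mu, forall x, cvg (v k x @[k --> \oo])}.
Proof.
move=> youngM mv Iv; pose F k x := (M (2 ^+ k * (v k.+1 x - v k x)))%:E.
have mF k : measurable_fun setT (F k).
  apply/measurable_EFinP; apply: (measurableT_comp (measurable_young youngM)).
  by apply: measurable_funM => //; exact: measurable_funB.
have F0 k x : (0 <= F k x)%E by rewrite lee_fin young_ge0.
have mS : measurable_fun setT (fun x => \sum_(0 <= k <oo) F k x)%E by apply: ge0_emeasurable_sum => // k x _ _; exact: F0.
have I : mu.-integrable setT (fun x => \sum_(0 <= k <oo) F k x)%E.
  apply/integrableP; split => //.
  under eq_integral do rewrite gee0_abs ?nneseries_ge0//.
  rewrite integral_nneseries//.
  have S j : (\sum_(0 <= k < j) \int[mu]_x F k x <= 2%:E)%E.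
    apply: (@le_trans _ _ (\sum_(0 <= k < j) 2^-1 ^+ k)%:E).
      by rewrite -sumEFin; apply: lee_sum => k _; exact: Iv.
    rewrite lee_fin; have -> : \sum_(0 <= k < j) 2^-1 ^+ k = 2 - 2 * 2^-1 ^+ j :> R.
      elim: j => [|j IH]; first by rewrite big_geq// expr0; ring.
      by rewrite big_nat_recr//= IH exprS; field.
    by rewrite gerBl mulr_ge0// exprn_ge0// invr_ge0.
  apply: (@le_lt_trans _ _ 2%:E); last exact: ltry.
  apply: lime_le; first by apply: is_cvg_nneseries => k _ _; apply: integral_ge0.
  by apply: nearW => j; exact: S.
have := integrable_ae measurableT I; apply: filterS => x /(_ Logic.I) fx.
set S := fine (\sum_(0 <= k <oo) F k x)%E.
have MS k : M (2 ^+ k * (v k.+1 x - v k x)) <= S.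
  rewrite -lee_fin (fineK fx); apply: (@le_trans _ _ (\sum_(0 <= j < k.+1) F j x)%E).
    by rewrite big_nat_recr//= leeDr// sume_ge0.
  exact: nneseries_lim_ge.
have [T0 T00 HT] := young_superlinear youngM 1.
have dk k : `|v k.+1 x - v k x| <= Num.max T0 S * 2^-1 ^+ k.
  have p0 : 0 < 2 ^+ k :> R by rewrite exprn_gt0.
  rewrite exprVn ler_pdivlMr// mulrC -[X in X * _](gtr0_norm p0) -normrM.
  have [H|/ltW tT] := leP `|2 ^+ k * (v k.+1 x - v k x)| T0; first by rewrite le_max H.
  by rewrite le_max; apply/orP; right; apply: le_trans (MS k); rewrite -(young_abs youngM) -[leLHS]mul1r; exact: HT.
have cs : cvgn (series (telescope (v^~ x))).
  apply: normed_cvg; apply: (@series_le_cvg _ _ (geometric (Num.max T0 S) 2^-1)) => //.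
  - by move=> k; exact: normr_ge0.
  - by move=> k; rewrite /geometric /= mulr_ge0 ?exprn_ge0 ?invr_ge0// le_max (ltW T00).
  - by apply: is_cvg_geometric_series; rewrite ger0_norm ?invr_ge0// invf_lt1// ltr1n.
have -> : (fun k => v k x) = (fun k => series (telescope (v^~ x)) k + v 0 x).
  by rewrite telescopeK; apply/funext => k /=; rewrite subrK.
by apply: is_cvgD => //; exact: is_cvg_cst.
Qed.

End convergence.

(** Take a cluster point in a product of segments (Tychonoff); its neighborhoods that control the
    first [k + 1] coordinates give the subsequence. *)
Lemma diagonal_extraction (R : realType) (a : nat -> nat -> R) (C : nat -> R) :
  (forall j i, `|a j i| <= C i) ->
  exists (phi : nat -> nat) (x : nat -> R), (forall k, (k <= phi k)%N) /\
    forall k i, (i <= k)%N -> `|a (phi k) i - x i| < k.+1%:R^-1.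
Proof.
move=> aC.
have [//|x [_ clx]] := @tychonoff nat (fun=> R) (fun i => `[- C i, C i]%classic)
    (fun i => @segment_compact R _ _) (fmap (a : nat -> (forall i : nat, (fun=> R) i)) \oo) _.
  by exists 0 => // j _ i /=; rewrite in_itv /= -ler_norml.
have near_x m (e : R) : 0 < e -> nbhs x [set f : forall i : nat, (fun=> R : topologicalType) i | forall i, (i < m)%N -> `|f i - x i| < e].
  move=> e0; elim: m => [|m IH]; first by apply: filterS filterT => f _ i.
  have := @proj_continuous nat (fun=> R : topologicalType) m x.
  move=> /(_ _ (nbhsx_ballx _ _ e0)) H.
  apply: filterS2 IH H => f Hf fm i; rewrite ltnS leq_eqVlt => /predU1P[->|]; last exact: Hf.
  by rewrite distrC; exact: fm.
have H k : exists j, (k <= j)%N /\ forall i, (i <= k)%N -> `|a j i - x i| < k.+1%:R^-1.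
  have A : fmap (a : nat -> (forall i : nat, (fun=> R) i)) \oo [set f | exists2 j, (k <= j)%N & f = a j].
    by exists k => // j /= kj; exists j.
  have k0 : (0 : R) < k.+1%:R^-1 by rewrite invr_gt0.
  have [f [[j kj ->] Hj]] := clx _ _ A (near_x k.+1 _ k0).
  by exists j; split => // i ik; apply: Hj; rewrite ltnS.
have [phi Hphi] := choice H; exists phi, x; split => [k|k i ik]; first by case: (Hphi k).
by case: (Hphi k) => _; exact.
Qed.

End CubeAverages.
Import CubeAverages.

Module Compactness.

Section null_transfer.
Context (R : realType) (n : nat).
Local Notation la := (lebesgue_rV R n).
Local Notation X := 'rV[R]_n.

Lemma ae_dx (P : X -> Prop) : {ae la, forall x, P x} -> {ae (@dx R n), forall x, P x}.
Proof.
move=> [A [mA A0 PA]]; exists A; split => //; first exact: borel_caratheodory.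
by rewrite -[LHS]/(@completed_measure_extension _ _ _ la A) completed_measureE.
Qed.

Lemma ae_prod (P : X -> Prop) : {ae la, forall x, P x} -> {ae (la \x la)%E, forall z, P z.1 /\ P z.2}.
Proof.
move=> [A [mA A0 PA]].
have m1 : measurable (A `*` [set: X]) by exact: measurableX.
have m2 : measurable ([set: X] `*` A) by exact: measurableX.
exists (A `*` [set: X] `|` [set: X] `*` A); split; first exact: measurableU.
  apply/eqP; rewrite eq_le measure_ge0 andbT; apply: le_trans (measureU2 _ _ _) _ => //.
  rewrite [X in (X + _)%E](@product_measure1E _ _ _ _ _ la la)// [X in (_ + X)%E](@product_measure1E _ _ _ _ _ la la)//.
  by rewrite [X in (X * _ + _)%E](_ : _ = 0%E)// mul0e add0e [X in (_ * X)%E](_ : _ = 0%E)// mule0.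
move=> z; have [P1|P1] := pselect (P z.1); last by left; split => //; exact: PA.
have [P2|P2] := pselect (P z.2); last by right; split => //; exact: PA.
by move=> H; exfalso; apply: H; split.
Qed.

Lemma ae_dxdy (P : X * X -> Prop) : {ae (la \x la)%E, forall z, P z} -> {ae (@dxdy R n), forall z : Rnn R n, P z}.
Proof.
move=> [A [mA A0 PA]]; exists A; split => //; first exact: borel_caratheodory.
by rewrite -[LHS]/(@completed_measure_extension _ _ _ (la \x la)%E A) completed_measureE.
Qed.

Lemma ae_nu (P : Rnn R n -> Prop) : {ae (@dxdy R n), forall z, P z} -> {ae (@nu R n), forall z, P z}.
Proof.
move=> [A [mA A0 PA]]; exists A; split => //; rewrite /nu.
by apply: null_set_integral => //; apply: measurable_funTS; exact: measurable_kernc.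
Qed.

End null_transfer.

(** * Modular compactness *)

Section compactness.
Context (R : realType) (n : nat) (s : R) (M : R -> R).
Hypothesis n0 : (0 < n)%N.
Hypothesis s01 : 0 < s < 1.
Hypothesis youngM : young M.
Local Notation la := (lebesgue_rV R n).
Local Notation X := 'rV[R]_n.
Local Notation M0 := (young0 youngM).
Local Notation M_ge0 := (young_ge0 youngM).
Local Notation energy := (@energy R n s M).
Local Notation amod := (@amod R n M).
Let s0 : 0 < s. Proof. by case/andP: s01. Qed.

Context (b : nat).

Definition mesh l : R := l.+1%:R^-1.
(** The number of points makes the grid fill the box of radius [b + 1], one unit beyond the
    supports, whatever the mesh. *)
Definition Q l (u : X -> R) := qint (b.+1 * l.+1) (mesh l) u.

Lemma mesh_gt0 l : 0 < mesh l. Proof. by rewrite /mesh invr_gt0. Qed.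
Lemma mesh_le1 l : mesh l <= 1. Proof. by rewrite /mesh invf_le1// ler1n. Qed.
Lemma mesh_box l : mesh l * (b.+1 * l.+1)%:R = b.+1%:R.
Proof. by rewrite natrM mulrCA mulVf ?mulr1// pnatr_eq0. Qed.

Definition admissible K (u : X -> R) :=
  [/\ measurable_fun setT u, forall x, b%:R < `|x| -> u x = 0 & (energy K u < +oo)%E].

Lemma admissible_amod K u : 0 < K -> admissible K u -> exists2 k, 0 < k & (amod k u < +oo)%E.
Proof.
move=> K0 [mu ub Eu]; exists (K * (n%:R * (2 * b%:R + 3)) `^ s).
  by rewrite mulr_gt0// powR_gt0// mulr_gt0 ?ltr0n// ltr_wpDl// mulr_ge0.
apply: le_lt_trans (poincare n0 s01 youngM mu _ K0 ub) _ => //.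
rewrite lte_mul_pinfty// lee_fin divr_ge0 ?exprn_ge0// mulr_ge0// addr_ge0// mulr_ge0.
Qed.

Lemma admissible_integrable K u (c : X) r : 0 < K -> admissible K u -> 0 <= r ->
  la.-integrable (cube c r) (EFin \o u).
Proof.
move=> K0 au r0; have [k k0 Ik] := admissible_amod K0 au; case: au => mu _ _.
exact: amod_fin_integrable_cube Ik r0.
Qed.

Lemma admissible_supp K u l x : admissible K u ->
  mesh l * (b.+1 * l.+1)%:R - mesh l < `|x| -> u x = 0.
Proof.
move=> [_ ub _]; rewrite mesh_box => H; apply: ub; apply: le_lt_trans H.
by rewrite -natr1 -addrA lerDl subr_ge0 mesh_le1.
Qed.

Lemma amod_scale k th u : 0 < k -> 0 < th <= 1 -> measurable_fun setT u ->
  (amod k u <= th%:E * amod (th * k) u)%E.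
Proof.
move=> k0 /andP[th0 th1] mu; rewrite /amod -(intZ la (measurable_M_div youngM (th * k) mu) (fun x => M_ge0 _) (ltW th0)).
apply: int_le => [||x|x]; [exact: measurable_M_div| |exact: M_ge0|].
  by apply: measurable_funM => //; exact: measurable_M_div.
have -> : u x / k = th * (u x / (th * k)) by field; rewrite !gt_eqF.
by apply: young_scale => //; rewrite (ltW th0).
Qed.

(** The error is bounded at the scale [K (3 n mesh) ^ s], which tends to 0. Once this is below
    [th * k], convexity gives the factor [th] at scale [k]: a single energy bound controls all
    scales, uniformly in [u]. This takes the place of a Delta_2-condition. *)
Lemma Q_small (K C k eta : R) : 0 < K -> 0 <= C -> 0 < k -> 0 < eta -> exists l0, forall l u, (l0 <= l)%N ->
  admissible K u -> (energy K u <= C%:E)%E -> (amod k (fun x => Q l u x - u x)%R <= eta%:E)%E.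
Proof.
move=> K0 C0 k0 eta0; pose c := (n%:R * 3 / 2) ^+ n * C + 1.
have c0 : 0 < c by rewrite ltr_wpDl// mulr_ge0// exprn_ge0// divr_ge0// mulr_ge0.
pose th := Num.min 1 (eta / c).
have th0 : 0 < th by rewrite lt_min ltr01 divr_gt0.
have th1 : 0 < th <= 1 by rewrite th0 ge_min lexx.
pose D : R := K * (n%:R * 3) `^ s.
have D0 : 0 < D by rewrite mulr_gt0// powR_gt0// mulr_gt0// ltr0n.
(* The mesh at which the scale of the error equals [th * k]. *)
pose q := (th * k / D) `^ s^-1.
have q0 : 0 < q by rewrite powR_gt0// divr_gt0// mulr_gt0.
have [l0 _ Hl0] := near_infty_natSinv_lt (PosNum q0).
exists l0 => l u l0l au Eu; have [mu _ _] := au.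
have mq : measurable_fun setT (Q l u) by exact: measurable_qint.
have lq : mesh l <= q by apply/ltW/Hl0.
have Kk : K * (n%:R * (3 * mesh l)) `^ s <= th * k.
  rewrite mulrA (@powRM _ (n%:R * 3)) ?mulr_ge0 ?(ltW (mesh_gt0 l))// mulrA -/D.
  rewrite -ler_pdivlMl// mulrC.
  have q'0 : 0 <= th * k / D by exact: (divr_ge0 (mulr_ge0 (ltW th0) (ltW k0)) (ltW D0)).
  have -> : th * k / D = q `^ s by rewrite /q -powRrM mulVf ?gt_eqF// powRr1.
  by apply: ge0_ler_powR; rewrite ?nnegrE ?(ltW s0) ?(ltW q0) ?(ltW (mesh_gt0 l)).
have K0' : 0 < K * (n%:R * (3 * mesh l)) `^ s by rewrite mulr_gt0// powR_gt0// !mulr_gt0 ?mesh_gt0// ltr0n.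
apply: le_trans (amod_scale k0 th1 (measurable_funB mq mu)) _.
apply: (@le_trans _ _ (th%:E * (c%:E))%E); last first.
  by rewrite -EFinM lee_fin -ler_pdivlMr// ge_min lexx orbT.
rewrite lee_wpmul2l ?lee_fin ?(ltW th0)//; apply: le_trans (amod_le youngM (measurable_funB mq mu) K0' Kk) _.
apply: le_trans (qint_amod n0 s01 youngM (mesh_gt0 l) K0 mu _ _) _.
- by move=> x; apply: (admissible_integrable x K0 au); rewrite ltW ?mesh_gt0.
- by move=> x; exact: admissible_supp au.
apply: (@le_trans _ _ (((n%:R * 3 / 2) ^+ n)%:E * C%:E)%E).
  rewrite lee_wpmul2l ?lee_fin ?exprn_ge0 ?divr_ge0 ?mulr_ge0//.
  by apply: le_trans Eu; exact: near_energy_le.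
by rewrite -EFinM lee_fin /c lerDl.
Qed.

Lemma Q_bounded l u x : `|Q l u x| <= \sum_(z : grid n (b.+1 * l.+1)) `|avg (gpt (mesh l) z) (mesh l) u|.
Proof.
apply: le_trans (ler_norm_sum _ _ _) _; apply: ler_sum => z _.
by rewrite normrM ler_piMl// ger0_norm ?bump_ge0 ?bump_le1.
Qed.

Lemma Q_diff_bound l u v dl x : 0 <= dl ->
  (forall z : grid n (b.+1 * l.+1), `|avg (gpt (mesh l) z) (mesh l) u - avg (gpt (mesh l) z) (mesh l) v| <= dl) ->
  `|Q l u x - Q l v x| <= dl.
Proof.
move=> dl0 H; rewrite /Q /qint -sumrB; under eq_bigr do rewrite -mulrBr.
apply: le_trans (ler_norm_sum _ _ _) _.
apply: (@le_trans _ _ (\sum_(z : grid n (b.+1 * l.+1)) bump (gpt (mesh l) z) (mesh l) x * dl)).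
  by apply: ler_sum => z _; rewrite normrM ger0_norm ?bump_ge0// ler_wpM2l ?bump_ge0.
by rewrite -mulr_suml ler_piMl//; exact: grid_sum_le1 (mesh_gt0 l) _.
Qed.

Lemma gpt_norm l (z : grid n (b.+1 * l.+1)) : `|gpt (mesh l) z| <= b.+1%:R.
Proof.
apply: norm_le_coord => // i; rewrite mxE normrM (gtr0_norm (mesh_gt0 l)) -(mesh_box l).
rewrite ler_pM2l ?mesh_gt0// ler_norml.
have H0 : (z i <= (b.+1 * l.+1).*2)%N by rewrite -ltnS ltn_ord.
have H : (z i)%:R <= (b.+1 * l.+1)%:R + (b.+1 * l.+1)%:R :> R by rewrite -natrD ler_nat addnn.
by have : (0 : R) <= (z i)%:R by []; move=> ?; apply/andP; split; lra.
Qed.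

Lemma Q_supp l u x : b.+2%:R < `|x| -> Q l u x = 0.
Proof.
move=> xb; rewrite /Q /qint big1// => z _; apply/eqP; rewrite mulf_eq0; apply/orP; left.
apply/negPn/negP => /(bump_support (mesh_gt0 l)) H; move: xb; apply/negP; rewrite -leNgt.
rewrite -(subrK (gpt (mesh l) z) x); apply: le_trans (ler_normD _ _) _.
have := gpt_norm z; have := mesh_le1 l; rewrite -[b.+2%:R]natr1; lra.
Qed.

Lemma amod_bounded (k B : R) (w : X -> R) : measurable_fun setT w -> (forall x, `|w x| <= B) ->
  (forall x, b.+2%:R < `|x| -> w x = 0) -> (amod k w <= (M (B / k) * (2 * b.+2%:R) ^+ n)%:E)%E.
Proof.
move=> mw wB wb; pose E := cube (0 : X) b.+2%:R.
have mE : measurable E by exact: measurable_cube.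
apply: (@le_trans _ _ (\int[la]_x (M (B / k) * \1_E x)%:E)%E).
  apply: int_le => [||x|x]; [exact: measurable_M_div| |exact: M_ge0|].
    by apply: measurable_funM => //; exact: measurable_indic.
  rewrite indicE; have [xE|xE] := pselect (E x).
    rewrite mem_set// mulr1; apply: (young_le youngM); rewrite !normrM ler_wpM2r//.
    exact: le_trans (wB x) (ler_norm _).
  rewrite wb ?mul0r ?M0 ?mulr_ge0 ?M_ge0// ltNge; apply/negP => H; apply: xE.
  by rewrite /E /cube /= subr0.
rewrite intZ ?M_ge0//.
rewrite integral_indic// setIT EFinM lee_wpmul2l ?lee_fin ?M_ge0//.
by rewrite [X in (X <= _)%E](lebesgue_cube (0 : X) (ler0n _ _)).
Qed.

Lemma amod3 k (u v w : X -> R) : measurable_fun setT u -> measurable_fun setT v -> measurable_fun setT w ->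
  (amod k (fun x => u x + v x + w x)%R <= (2^-1)%:E * (amod (k / 4) u + amod (k / 4) v + amod (k / 2) w))%E.
Proof.
move=> mu mv mw; rewrite /amod -!intD//.
- rewrite -intZ ?invr_ge0//.
  + apply: int_le => [||x|x]; [by apply: measurable_M_div => //; apply: measurable_funD => //; exact: measurable_funD| |exact: M_ge0|].
      by apply: measurable_funM => //; repeat apply: measurable_funD; exact: measurable_M_div.
    rewrite !mulrDl; apply: le_trans (young_third youngM _ _ _) _.
    have E4 (t : R) : 4 * (t / k) = t / (k / 4) by rewrite invfM invrK; ring.
    have E2 (t : R) : 2 * (t / k) = t / (k / 2) by rewrite invfM invrK; ring.
    by rewrite !E4 E2 mulrC.
  + by repeat apply: measurable_funD; exact: measurable_M_div.
  + by move=> x; rewrite !addr_ge0 ?M_ge0.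
- by apply: measurable_funD; exact: measurable_M_div.
- exact: measurable_M_div.
- by move=> x; rewrite addr_ge0 ?M_ge0.
- by move=> x; exact: M_ge0.
- exact: measurable_M_div.
- exact: measurable_M_div.
- by move=> x; exact: M_ge0.
- by move=> x; exact: M_ge0.
Qed.

(** [u] differs from a bounded function of bounded support, its quasi-interpolant, by an error that
    is small at any prescribed scale: finite energy at one scale puts [u] in the class [E_M]. *)
Lemma admissible_EM K u k : 0 < K -> 0 < k -> admissible K u -> (amod k u < +oo)%E.
Proof.
move=> K0 k0 au; have [mu ub Eu] := au.
have [C C0 EC] : exists2 C, 0 <= C & (energy K u <= C%:E)%E.
  have E0 : (0 <= energy K u)%E by apply: int_ge0 => z; exact: dmod_ge0.
  exists (fine (energy K u)); first exact: fine_ge0.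
  by rewrite fineK// ge0_fin_numE.
have k20 : 0 < k / 2 by rewrite divr_gt0.
have [l /(_ l u (leqnn l) au EC) Hl] := Q_small K0 C0 k20 ltr01.
have mq : measurable_fun setT (Q l u) by exact: measurable_qint.
have -> : u = (fun x => Q l u x - (Q l u x - u x)) by apply/funext => x; ring.
have -> : k = 2 * (k / 2) by field.
apply: le_lt_trans (amodB youngM _ mq (measurable_funB mq mu)) _.
apply: lte_mul_pinfty; rewrite ?lee_fin ?invr_ge0//; apply: lte_add_pinfty.
  apply: le_lt_trans (amod_bounded _ mq (Q_bounded l u) (@Q_supp l u)) _; exact: ltry.
by apply: le_lt_trans Hl _; exact: ltry.
Qed.

Lemma avg_bound K C l u (z : grid n (b.+1 * l.+1)) : 0 < K -> admissible K u -> (energy K u <= C%:E)%E ->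
  `|avg (gpt (mesh l) z) (mesh l) u| <= ((2 * mesh l) ^+ n)^-1 *
    (K * (n%:R * (2 * b%:R + 3)) `^ s * (complementary M 1 * (2 * mesh l) ^+ n + (n%:R * (2 * b%:R + 3)) ^+ n / 2 ^+ n * C)).
Proof.
move=> K0 au Eu; have [mu ub _] := au; have e0 := mesh_gt0 l.
set k := K * _ `^ s; set P := _ / 2 ^+ n.
have k0 : 0 < k by rewrite mulr_gt0// powR_gt0// mulr_gt0 ?ltr0n// ltr_wpDl// mulr_ge0.
have P0 : 0 <= P by rewrite divr_ge0 ?exprn_ge0// mulr_ge0// addr_ge0// mulr_ge0.
have V0 : 0 < (2 * mesh l) ^+ n by rewrite exprn_gt0// mulr_gt0.
have A : (amod k u <= (P * C)%:E)%E.
  apply: le_trans (poincare n0 s01 youngM mu _ K0 ub) _ => //.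
  by rewrite -/P [(P * C)%:E]EFinM lee_wpmul2l// lee_fin.
rewrite /avg normrM gtr0_norm ?invr_gt0// ler_pM2l ?invr_gt0//.
set E := cube _ _; have mE : measurable E by exact: measurable_cube.
have iu : la.-integrable E (EFin \o u) by apply: admissible_integrable K0 au _; exact: ltW.
have LE : la E = ((2 * mesh l) ^+ n)%:E by exact: (lebesgue_cube _ (ltW e0)).
apply: le_trans (le_normr_Rintegral mE iu) _.
rewrite -lee_fin -[leLHS]/((fine _)%:E) fineK; last first.
  by apply: integrable_fin_num => //; exact: integrable_norm.
apply: (@le_trans _ _ (\int[la]_x (k * (complementary M 1 * \1_E x + M (u x / k)))%:E)%E).
  rewrite integral_mkcond; apply: ge0_le_integral => //.
  - by move=> x _; rewrite /patch; case: ifP => // _; rewrite lee_fin.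
  - apply/(measurable_restrictT _ mE); apply: measurable_funTS; apply/measurable_EFinP.
    exact: measurableT_comp.
  - apply/measurable_EFinP; apply: measurable_funM => //; apply: measurable_funD; last exact: measurable_M_div.
    by apply: measurable_funM => //; exact: measurable_indic.
  move=> x _; rewrite /patch indicE; case: ifPn => xE; last first.
    by rewrite lee_fin mulr_ge0 ?(ltW k0)// mulr0 add0r M_ge0.
  rewrite lee_fin mulr1; have := abs_le_young youngM (u x) (_ : 0 < k^-1).
  by rewrite invrK invr_gt0 [u x / k]mulrC; apply.
have c0 : 0 <= complementary M 1 by exact: complementary_ge0.
have mI : measurable_fun setT (fun x => complementary M 1 * \1_E x) by apply: measurable_funM => //; exact: measurable_indic.
have mMu : measurable_fun setT (fun x => M (u x / k)) by exact: measurable_M_div.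
rewrite intZ ?(ltW k0)//; [|exact: measurable_funD|by move=> x; rewrite addr_ge0 ?mulr_ge0 ?M_ge0].
rewrite intD//; [|by move=> x; rewrite mulr_ge0|by move=> x; exact: M_ge0].
rewrite intZ//.
rewrite integral_indic// setIT [X in (_ * (_ * X + _))%E]LE.
by rewrite !EFinM EFinD lee_wpmul2l ?lee_fin ?(ltW k0)// leeD// ?EFinM.
Qed.

(* Averages over the cubes of all meshes converge along a subsequence; the
   corresponding quasi-interpolants are then uniformly convergent. *)
Lemma compact_extraction (K C : R) (u : nat -> X -> R) : 0 < K -> 0 <= C ->
  (forall j, admissible K (u j)) -> (forall j, energy K (u j) <= C%:E)%E ->
  exists phi : nat -> nat, (forall k, (k <= phi k)%N) /\
    forall k eta, 0 < k -> 0 < eta -> exists N, forall i j, (N <= i)%N -> (N <= j)%N ->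
      (amod k (fun x => u (phi i) x - u (phi j) x)%R <= eta%:E)%E.
Proof.
move=> K0 C0 au Eu.
pose idx := {l : nat & grid n (b.+1 * l.+1)}.
pose av (p : idx) (v : X -> R) := avg (gpt (mesh (tag p)) (tagged p)) (mesh (tag p)) v.
pose bd (p : idx) := ((2 * mesh (tag p)) ^+ n)^-1 *
    (K * (n%:R * (2 * b%:R + 3)) `^ s * (complementary M 1 * (2 * mesh (tag p)) ^+ n + (n%:R * (2 * b%:R + 3)) ^+ n / 2 ^+ n * C)).
pose a j i := if (unpickle i : option idx) is Some p then av p (u j) else 0.
pose Cb i := if (unpickle i : option idx) is Some p then bd p else 0.
have aC j i : `|a j i| <= Cb i.
  by rewrite /a /Cb; case: unpickle => [p|]; [exact: avg_bound|rewrite normr0].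
have [phi [x [kphi Hphi]]] := diagonal_extraction aC; exists phi; split => // k eta k0 eta0.
have k40 : 0 < k / 4 by rewrite divr_gt0.
have eta40 : 0 < eta / 4 by rewrite divr_gt0.
have [l Hl'] := Q_small K0 C0 k40 eta40; have Hl v := Hl' l v (leqnn l).
pose V : R := (2 * b.+2%:R) ^+ n.
have V0 : 0 < V by rewrite exprn_gt0// mulr_gt0.
have k20 : 0 < k / 2 by rewrite divr_gt0.
have [dl dl0 Hdl] : exists2 dl, 0 < dl & M (dl / (k / 2)) <= eta / V.
  have : M t @[t --> (0 : R)] --> M 0 by exact: (young_continuous youngM).
  rewrite M0 => /cvgrPdist_lt/(_ _ (divr_gt0 eta0 V0)) [r /= r0 Hr].
  exists (r / 2 * (k / 2)); first by rewrite mulr_gt0 ?divr_gt0.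
  rewrite mulfK ?gt_eqF//.
  have tr : `|0 - r / 2| < r by rewrite sub0r normrN gtr0_norm ?divr_gt0//; lra.
  by have := Hr _ tr; rewrite /= sub0r normrN ger0_norm ?M_ge0// => /ltW.
(* Beyond [N1] the extraction controls the averages over all the finitely many cubes of mesh number
   [l]. *)
pose N1 := (\max_(z : grid n (b.+1 * l.+1)) pickle (existT _ l z : idx))%N.
have HN1 z : (pickle (existT _ l z : idx) <= N1)%N by exact: (leq_bigmax z).
have dl20 : 0 < dl / 2 by rewrite divr_gt0.
have [N2 _ HN2] := near_infty_natSinv_lt (PosNum dl20).
exists (maxn N1 N2) => i j; rewrite !geq_max => /andP[i1 i2] /andP[j1 j2].
have close z : `|av (existT _ l z) (u (phi i)) - av (existT _ l z) (u (phi j))| <= dl.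
  have D p (pN : (N1 <= p)%N) (pN2 : (N2 <= p)%N) : `|av (existT _ l z) (u (phi p)) - x (pickle (existT _ l z : idx))| < dl / 2.
    have := Hphi p (pickle (existT _ l z : idx)) (leq_trans (HN1 z) pN); rewrite /a pickleK => H.
    by apply: lt_trans H _; exact: HN2.
  have Di := D i i1 i2; have Dj := D j j1 j2.
  rewrite -(subrK (x (pickle (existT _ l z : idx))) (av _ (u (phi i)))) -addrA.
  apply: le_trans (ler_normD _ _) _; rewrite [X in _ + X <= _]distrC; lra.
have [mi _ _] := au (phi i); have [mj _ _] := au (phi j).
have mqi : measurable_fun setT (Q l (u (phi i))) by exact: measurable_qint.
have mqj : measurable_fun setT (Q l (u (phi j))) by exact: measurable_qint.
have -> : (fun x => u (phi i) x - u (phi j) x) = (fun x => (- (Q l (u (phi i)) x - u (phi i) x)) +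
    (Q l (u (phi j)) x - u (phi j) x) + (Q l (u (phi i)) x - Q l (u (phi j)) x)).
  by apply/funext => y; ring.
have m1 := measurable_funB mqi mi; have m2 := measurable_funB mqj mj; have m3 := measurable_funB mqi mqj.
apply: le_trans (amod3 k _ m2 m3) _; first by apply: measurableT_comp => //.
have A1 : (amod (k / 4) (fun x => - (Q l (u (phi i)) x - u (phi i) x))%R <= (eta / 4)%:E)%E.
  apply: le_trans (Hl _ (au (phi i)) (Eu (phi i))); rewrite le_eqVlt; apply/orP; left; apply/eqP.
  by apply: eq_integral => y _; rewrite mulNr (young_even youngM).
have A2 := Hl _ (au (phi j)) (Eu (phi j)).
have A3 : (amod (k / 2) (fun x => Q l (u (phi i)) x - Q l (u (phi j)) x)%R <= eta%:E)%E.
  apply: le_trans (amod_bounded (B := dl) _ m3 _ _) _.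
  - by move=> y; apply: Q_diff_bound; [exact: ltW|exact: close].
  - by move=> y yb /=; rewrite !Q_supp// subrr.
  by rewrite lee_fin -/V -ler_pdivlMr.
apply: (@le_trans _ _ ((2^-1)%:E * ((eta / 4)%:E + (eta / 4)%:E + eta%:E))%E).
  by rewrite lee_wpmul2l ?lee_fin ?invr_ge0//; apply: leeD => //; exact: leeD.
by rewrite -!EFinD -EFinM lee_fin; lra.
Qed.

(** Along a fast subsequence [ae_cvg_summable] gives a pointwise limit. Fatou's lemma carries over
    the energy bound and turns the Cauchy estimate at each scale into convergence. *)
Lemma compact_limit (K C : R) (u : nat -> X -> R) : 0 < K -> 0 <= C ->
  (forall j, admissible K (u j)) -> (forall j, energy K (u j) <= C%:E)%E ->
  exists (phi : nat -> nat) (U : X -> R),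
    [/\ forall k, (k <= phi k)%N, admissible K U, (energy K U <= C%:E)%E,
        {ae la, forall x, u (phi k) x @[k --> \oo] --> U x} &
        forall k eta, 0 < k -> 0 < eta -> exists N, forall j, (N <= j)%N ->
          (amod k (fun x => u (phi j) x - U x)%R <= eta%:E)%E].
Proof.
move=> K0 C0 au Eu; have [phi0 [phi0k H0]] := compact_extraction K0 C0 au Eu.
have p0 k : (0 : R) < 2^-1 ^+ k by rewrite exprn_gt0 ?invr_gt0.
have [N HN] := choice (fun k => H0 _ _ (p0 k) (p0 k)).
pose m k := (k + \sum_(i < k.+1) N i)%N.
have mk k : (k <= m k)%N by exact: leq_addr.
have Nm k : (N k <= m k)%N by rewrite /m (bigD1 ord_max)//= addnCA leq_addr.
have mS k : (m k <= m k.+1)%N by rewrite /m leq_add// [leqRHS]big_ord_recr /= leq_addr.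
pose v k := u (phi0 (m k)).
have mv k : measurable_fun setT (v k) by case: (au (phi0 (m k))).
have cv : {ae la, forall x, cvg (v k x @[k --> \oo])}.
  apply: (ae_cvg_summable youngM) => // k; apply: le_trans (HN k _ _ (leq_trans (Nm k) (mS k)) (Nm k)).
  rewrite le_eqVlt; apply/orP; left; apply/eqP; apply: eq_integral => x _.
  by rewrite exprVn invrK mulrC.
(* An upper limit is measurable and defined everywhere, and it is 0 wherever all the [v k] are. *)
pose U x := fine (limn_esup (fun k => (v k x)%:E)).
have mU : measurable_fun setT U.
  apply: measurableT_comp => //; apply: measurable_fun_limn_esup => k.
  by apply/measurable_EFinP.
have vU : {ae la, forall x, v k x @[k --> \oo] --> U x}.
  apply: filterS cv => x cx; have : (v k x)%:E @[k --> \oo] --> (lim (v k x @[k --> \oo]))%:E.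
    by apply: cvg_EFin; [exact: nearW|exact: cx].
  by move=> /cvg_limn_einf_sup[_ E]; rewrite /U E /=; exact: cx.
have EU : (energy K U <= C%:E)%E.
  apply: (fatou_le (f_ := fun k => dmod s M K (v k))).
  - by move=> k; exact: measurable_dmod.
  - exact: measurable_dmod.
  - by move=> k z; exact: dmod_ge0.
  - apply: filterS (ae_prod vU) => z [z1 z2]; rewrite /dmod; apply: cvgM; last exact: cvg_cst.
    apply: (@cvg_comp _ _ _ (fun k => @Ds R n s (v k) z / K) M _ (nbhs (@Ds R n s U z / K))); last exact: (young_continuous youngM).
    by apply: cvgM; last exact: cvg_cst; apply: cvgM; [exact: cvgB|exact: cvg_cst].
  - by move=> k; exact: Eu.
exists (phi0 \o m), U; split => //.
- by move=> k; apply: leq_trans (mk k) (phi0k (m k)).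
- split => // [x xb|]; last by apply: le_lt_trans EU _; rewrite ltry.
  rewrite /U (_ : (fun k => _) = fun=> 0%E); last first.
    by apply/funext => k; rewrite /v; have [_ -> ] := au (phi0 (m k)).
  by have [_ ->] := cvg_limn_einf_sup (cvg_cst (0%E : \bar R) : (0%E : \bar R) @[k --> \oo] --> (0%E : \bar R)).
move=> k eta k0 eta0; have [N1 HN1] := H0 k eta k0 eta0.
exists N1 => j Nj.
apply: (fatou_le (f_ := fun i x => M ((v j x - v (i + N1)%N x) / k))).
- by move=> i; apply: measurable_M_div => //; exact: measurable_funB.
- by apply: measurable_M_div => //; apply: measurable_funB => //; exact: mv.
- by move=> i x; exact: M_ge0.
- apply: filterS vU => x cx.
  apply: (@cvg_comp _ _ _ (fun i => (v j x - v (i + N1)%N x) / k) M _ (nbhs ((v j x - U x) / k))); last exact: (young_continuous youngM).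
  apply: cvgM; last exact: cvg_cst; apply: cvgB; first exact: cvg_cst.
  by move: cx; rewrite -(cvg_shiftn N1).
move=> i; apply: HN1; first exact: leq_trans Nj (mk j).
by apply: leq_trans (mk _); exact: leq_addl.
Qed.

End compactness.

End Compactness.
Import Compactness.

Module Density.

(** * Density of finite combinations of bumps *)

Section compact_sequences.
Context (R : realType) (n : nat).
Local Notation X := 'rV[R]_n.

Lemma compact_cluster_seq (K : set X) (x_ : nat -> X) : compact K -> (forall k, K (x_ k)) ->
  exists2 x, K x & forall e N, 0 < e -> exists2 k, (N <= k)%N & `|x_ k - x| < e.
Proof.
move=> cK Kx; have FK : (x_ @ \oo) K by exists 0 => // k _; exact: Kx.
have [x [Kx' clx]] := cK _ _ FK.
exists x => // e N e0.
have A : (x_ @ \oo) [set y | exists2 k, (N <= k)%N & y = x_ k] by exists N => // k /= Nk; exists k.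
have [y [[k Nk ->] /= Hy]] := clx _ _ A (nbhsx_ballx x e e0); exists k => //.
by rewrite distrC; move: Hy; rewrite -ball_normE.
Qed.

Lemma compact_open_thickening (K U : set X) : compact K -> open U -> K `<=` U ->
  exists2 r, 0 < r & forall x y, K x -> `|y - x| <= r -> U y.
Proof.
move=> cK oU KU; apply: contrapT => H.
have P k : exists p : X * X, [/\ K p.1, `|p.2 - p.1| <= k.+1%:R^-1 & ~ U p.2].
  apply: contrapT => Hk; apply: H; exists k.+1%:R^-1; first by rewrite invr_gt0.
  by move=> x y Kx xy; apply: contrapT => Uy; apply: Hk; exists (x, y).
have [p Hp] := choice P.
have [x Kx Hx] := compact_cluster_seq (x_ := fun k => (p k).1) cK (fun k => let: And3 H _ _ := Hp k in H).
have /nbhs_ballP[r /= r0 Hr] := oU _ (KU _ Kx); have r20 : 0 < r / 2 by rewrite divr_gt0.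
have [N _ HN] := near_infty_natSinv_lt (PosNum r20).
have [k Nk Hk] := Hx _ N r20; have [_ pk] := Hp k; apply; apply: Hr.
have := HN k Nk; rewrite /= -ball_normE /= => kr.
rewrite distrC -(subrK (p k).1 (p k).2) -addrA; apply: le_lt_trans (ler_normD _ _) _.
by rewrite (splitr r); apply: ler_ltD => //; exact: le_trans pk (ltW kr).
Qed.

(** A Lebesgue number for the segment property, points of [Omega] being given the direction 0. If no
    radius worked, the property would fail at a cluster point of the counterexamples. *)
Lemma segment_radius (Omega : set X) : open Omega -> segment_property Omega -> compact (closure Omega) ->
  exists2 r, 0 < r & forall x, closure Omega x -> exists y : X, forall z, closure Omega z -> `|z - x| <= r ->
    forall t : R, 0 < t < 1 -> Omega (z + t *: y).
Proof.
move=> oO sO cO; apply: contrapT => H.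
have P k : exists x : X, closure Omega x /\ ~ exists y : X, forall z, closure Omega z -> `|z - x| <= k.+1%:R^-1 ->
    forall t : R, 0 < t < 1 -> Omega (z + t *: y).
  apply: contrapT => Hk; apply: H; exists k.+1%:R^-1; first by rewrite invr_gt0.
  by move=> x Kx; apply: contrapT => Uy; apply: Hk; exists x.
have [p Hp] := choice P.
have [x Kx Hx] := compact_cluster_seq cO (fun k => (Hp k).1).
have [r [y [r0 Hr]]] : exists r (y : X), 0 < r /\ forall z, closure Omega z -> `|z - x| < r ->
    forall t : R, 0 < t < 1 -> Omega (z + t *: y).
  have [Ox|Ox] := pselect (Omega x).
    have /nbhs_ballP[r /= r0 Hr] := oO _ Ox; exists r, 0; split => // z _ zx t _.
    by rewrite scaler0 addr0; apply: Hr; rewrite -ball_normE /= distrC.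
  have [|U [y [oU Ux _ HU]]] := sO x.
    by split => // /interior_subset.
  have /nbhs_ballP[r /= r0 Hr] := oU _ Ux; exists r, y; split => // z Kz zx t t01.
  by apply: HU => //; split => //; apply: Hr; rewrite -ball_normE /= distrC.
have r20 : 0 < r / 2 by rewrite divr_gt0.
have [N _ HN] := near_infty_natSinv_lt (PosNum r20).
have [k Nk Hk] := Hx _ N r20; have [_] := Hp k; apply; exists y => z Kz zk t t01.
apply: Hr => //; have := HN k Nk; rewrite /= => kr.
rewrite -(subrK (p k) z) -addrA; apply: le_lt_trans (ler_normD _ _) _.
by rewrite (splitr r); apply: ler_ltD => //; exact: le_trans zk (ltW kr).
Qed.

End compact_sequences.

Section density.
Context (R : realType) (n : nat) (s : R) (M : R -> R).
Hypothesis n0 : (0 < n)%N.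
Hypothesis s01 : 0 < s < 1.
Hypothesis youngM : young M.
Local Notation la := (lebesgue_rV R n).
Local Notation X := 'rV[R]_n.
Local Notation M0 := (young0 youngM).
Local Notation M_ge0 := (young_ge0 youngM).
Local Notation energy := (@energy R n s M).
Local Notation near_energy := (@near_energy R n s M).
Local Notation amod := (@amod R n M).
Context (b : nat) (Omega : set X).
Hypothesis Omega_b : forall x, Omega x -> `|x| <= b%:R.
Hypothesis Omega_open : open Omega.
Hypothesis Omega_segment : segment_property Omega.
Local Notation admissible := (admissible s M b).
Local Notation Q := (@Q R n b).
Implicit Types u v w : X -> R.

Let s0 : 0 < s. Proof. by case/andP: s01. Qed.
Let nR0 : 0 < n%:R :> R. Proof. by rewrite ltr0n. Qed.

Definition gidx := {l : nat & grid n (b.+1 * l.+1)}.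

(** The bumps of all meshes whose cube lies in [Omega], in one sequence. A code that names no such
    bump gives the zero function, and no linear independence is claimed. *)
Definition phi (j : nat) : X -> R :=
  if (unpickle j : option gidx) is Some p then
    if `[< cube (gpt (mesh R (tag p)) (tagged p)) (mesh R (tag p)) `<=` Omega >]
    then bump (gpt (mesh R (tag p)) (tagged p)) (mesh R (tag p)) else fun=> 0
  else fun=> 0.

Definition comb k (c : nat -> R) (x : X) : R := \sum_(j < k) c j * phi j x.

Definition spanned (w : X -> R) := exists k (c : nat -> R),
  (forall j, (k <= j)%N -> c j = 0) /\ forall x, w x = comb k c x.

Lemma comb_widen k k' c : (k <= k')%N -> (forall j, (k <= j)%N -> c j = 0) -> comb k' c = comb k c.
Proof.
move=> kk ck; apply/funext => x; rewrite /comb -(big_mkord predT (fun j => c j * phi j x)).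
rewrite (big_cat_nat (n := k))//= big_mkord [X in _ + X]big1_seq ?addr0// => j.
by rewrite mem_index_iota => /andP[_ /andP[kj _]]; rewrite ck// mul0r.
Qed.

Lemma spanned0 : spanned (fun=> 0).
Proof. by exists 0, (fun=> 0); split => // x; rewrite /comb big_ord0. Qed.

Lemma spannedD u v : spanned u -> spanned v -> spanned (fun x => u x + v x).
Proof.
move=> [k [c [ck uc]]] [l [d [dl vd]]]; exists (maxn k l), (fun j => c j + d j); split.
  by move=> j; rewrite geq_max => /andP[kj lj]; rewrite ck// dl// addr0.
move=> x; rewrite uc vd -(comb_widen (leq_maxl k l) ck) -(comb_widen (leq_maxr k l) dl).
by rewrite /comb -big_split /=; apply: eq_bigr => j _; rewrite mulrDl.
Qed.

Lemma spannedZ t u : spanned u -> spanned (fun x => t * u x).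
Proof.
move=> [k [c [ck uc]]]; exists k, (fun j => t * c j); split; first by move=> j kj; rewrite ck// mulr0.
by move=> x; rewrite uc /comb mulr_sumr; apply: eq_bigr => j _; rewrite mulrA.
Qed.

Lemma spanned_phi j : spanned (phi j).
Proof.
exists j.+1, (fun i => (i == j)%:R); split; first by move=> i; case: eqP => // ->; rewrite ltnn.
move=> x; rewrite /comb big_ord_recr /= eqxx mul1r big1 ?add0r// => i _.
by rewrite (ltn_eqF (ltn_ord i)) mul0r.
Qed.

Lemma spanned_sum (I : finType) (F : I -> X -> R) : (forall i, spanned (F i)) ->
  spanned (fun x => \sum_i F i x).
Proof.
move=> H; suff: forall r : seq I, spanned (fun x => \sum_(i <- r) F i x) by apply.
elim=> [|i r IH]; first by under eq_fun do rewrite big_nil; exact: spanned0.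
by under eq_fun do rewrite big_cons; exact: spannedD.
Qed.

Lemma spanned_Q l u : (forall z : grid n (b.+1 * l.+1),
    ~ (cube (gpt (mesh R l) z) (mesh R l) `<=` Omega) -> avg (gpt (mesh R l) z) (mesh R l) u = 0) ->
  spanned (Q l u).
Proof.
move=> H; apply: spanned_sum => z.
under eq_fun do rewrite mulrC.
have [zO|zO] := pselect (cube (gpt (mesh R l) z) (mesh R l) `<=` Omega); last first.
  by under eq_fun do rewrite H// mul0r; exact: spanned0.
apply: spannedZ; have := spanned_phi (pickle (existT _ l z : gidx)).
by rewrite /phi pickleK /= asboolT.
Qed.

Lemma energyD K u v : measurable_fun setT u -> measurable_fun setT v ->
  (energy (2 * K) (fun x => u x + v x)%R <= (2^-1)%:E * (energy K u + energy K v))%E.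
Proof.
move=> mu mv; have mB : measurable_fun setT (fun x => u x + v x) by exact: measurable_funD.
have m1 := measurable_dmod s youngM K mu; have m2 := measurable_dmod s youngM K mv.
rewrite /energy -intD// -?intZ//; [|exact: measurable_funD|by move=> z; rewrite addr_ge0 ?dmod_ge0|by move=> z; exact: dmod_ge0|by move=> z; exact: dmod_ge0].
apply: int_le => [||z|z].
- exact: measurable_dmod.
- by apply: measurable_funM => //; exact: measurable_funD.
- exact: dmod_ge0.
rewrite /dmod -mulrDl mulrA ler_wpM2r ?invpow_ge0//.
have -> : @Ds R n s (fun x => u x + v x) z = @Ds R n s u z - - @Ds R n s v z by rewrite /Ds; ring.
by have := M_half_div youngM K (@Ds R n s u z) (- @Ds R n s v z); rewrite mulNr (young_even youngM).
Qed.

Lemma amodD K u v : measurable_fun setT u -> measurable_fun setT v ->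
  (amod (2 * K) (fun x => u x + v x)%R <= (2^-1)%:E * (amod K u + amod K v))%E.
Proof.
move=> mu mv; have mN : measurable_fun setT (fun x => - v x) by apply: measurableT_comp.
have := amodB youngM K mu mN; have -> : (fun x => u x - (- v x)) = (fun x => u x + v x) by apply/funext => x; rewrite opprK.
move=> H; apply: le_trans H _; rewrite lee_wpmul2l ?lee_fin ?invr_ge0// leeD2l// le_eqVlt; apply/orP; left.
by apply/eqP; apply: eq_integral => x _; rewrite /= mulNr (young_even youngM).
Qed.

Lemma energy_le K K' u : measurable_fun setT u -> 0 < K -> K <= K' -> (energy K' u <= energy K u)%E.
Proof.
move=> mu K0 KK; apply: int_le => [||z|z]; [exact: measurable_dmod|exact: measurable_dmod|exact: dmod_ge0|].
by rewrite ler_wpM2r ?invpow_ge0 ?M_div_le.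
Qed.

Lemma measurable_phi j : measurable_fun setT (phi j).
Proof.
rewrite /phi; case: unpickle => [p|]; last exact: measurable_cst.
case: ifP => _; last exact: measurable_cst.
by apply: continuous_measurable_rV; exact: continuous_bump.
Qed.

Lemma measurable_comb k c : measurable_fun setT (comb k c).
Proof. by apply: measurable_sum => j; apply: measurable_funM => //; exact: measurable_phi. Qed.

Lemma measurable_spanned w : spanned w -> measurable_fun setT w.
Proof. by move=> [k [c [_ wc]]]; rewrite (_ : w = comb k c); [exact: measurable_comb|exact/funext]. Qed.

(** The scale may depend on [u] but not on the accuracy. Two scales merge into twice the larger one,
    so the class is closed under sums. *)
Definition approx u := measurable_fun setT u /\ exists2 K, 0 < K & forall eta, 0 < eta ->
  exists w, [/\ spanned w, (amod K (fun x => w x - u x)%R <= eta%:E)%E & (energy K (fun x => w x - u x)%R <= eta%:E)%E].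

Lemma approx0 : approx (fun=> 0).
Proof.
split; first exact: measurable_cst.
exists 1 => // eta eta0; exists (fun=> 0); split; first exact: spanned0.
  by rewrite /Energies.amod; under eq_integral do rewrite subrr mul0r M0; rewrite integral0 lee_fin ltW.
rewrite /Energies.energy /dmod /Ds; under eq_integral do rewrite !subrr !mul0r M0 mul0r.
by rewrite integral0 lee_fin ltW.
Qed.

Lemma approxD u v : approx u -> approx v -> approx (fun x => u x + v x).
Proof.
move=> [mu [K K0 Hu]] [mv [L L0 Hv]]; split; first exact: measurable_funD.
exists (2 * Num.max K L); first by rewrite mulr_gt0// lt_max K0.
move=> eta eta0; have [w [sw w1 w2]] := Hu _ eta0; have [w' [sw' w1' w2']] := Hv _ eta0.
have mw := measurable_spanned sw; have mw' := measurable_spanned sw'.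
exists (fun x => w x + w' x); split; first exact: spannedD.
  have -> : (fun x => w x + w' x - (u x + v x)) = (fun x => (w x - u x) + (w' x - v x)) by apply/funext => x; ring.
  apply: le_trans (amodD _ (measurable_funB mw mu) (measurable_funB mw' mv)) _.
  apply: (@le_trans _ _ ((2^-1)%:E * (eta%:E + eta%:E))%E).
    rewrite lee_wpmul2l ?lee_fin ?invr_ge0//; apply: leeD.
      by apply: le_trans w1; apply: (amod_le youngM (measurable_funB mw mu)) => //; rewrite le_max lexx.
    by apply: le_trans w1'; apply: (amod_le youngM (measurable_funB mw' mv)) => //; rewrite le_max lexx orbT.
  by rewrite -EFinD -EFinM lee_fin; lra.
have -> : (fun x => w x + w' x - (u x + v x)) = (fun x => (w x - u x) + (w' x - v x)) by apply/funext => x; ring.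
apply: le_trans (energyD _ (measurable_funB mw mu) (measurable_funB mw' mv)) _.
apply: (@le_trans _ _ ((2^-1)%:E * (eta%:E + eta%:E))%E).
  rewrite lee_wpmul2l ?lee_fin ?invr_ge0//; apply: leeD.
    by apply: le_trans w2; apply: (energy_le (measurable_funB mw mu)) => //; rewrite le_max lexx.
  by apply: le_trans w2'; apply: (energy_le (measurable_funB mw' mv)) => //; rewrite le_max lexx orbT.
by rewrite -EFinD -EFinM lee_fin; lra.
Qed.

Lemma approx_sum (I : finType) (F : I -> X -> R) : (forall i, approx (F i)) ->
  approx (fun x => \sum_i F i x).
Proof.
move=> H; suff: forall r : seq I, approx (fun x => \sum_(i <- r) F i x) by apply.
elim=> [|i r IH]; first by under eq_fun do rewrite big_nil; exact: approx0.
by under eq_fun do rewrite big_cons; exact: approxD.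
Qed.

Lemma le_sum4 (p q r t : R) : 0 <= p -> 0 <= q -> 0 <= r -> 0 <= t ->
  [/\ p <= p + q + r + t, q <= p + q + r + t, r <= p + q + r + t & t <= p + q + r + t].
Proof. by move=> *; split; lra. Qed.

Lemma small_scaled (C e : R) (x : \bar R) : 0 <= C -> (x <= (e / (C + 1))%:E)%E -> 0 < e -> (C%:E * x <= e%:E)%E.
Proof.
move=> C0 xe e0; apply: (@le_trans _ _ (C%:E * (e / (C + 1))%:E)%E); first by rewrite lee_wpmul2l.
by rewrite -EFinM lee_fin mulrCA ler_piMr ?(ltW e0)// ler_pdivrMr ?ltr_wpDl// mul1r lerDl.
Qed.

(* A function which can be pushed into [Omega] by small translations is
   approximated by quasi-interpolants of its translates. *)
Lemma approx_shift K u (F : set X) (y : X) : 0 < K -> admissible K u -> compact F ->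
  (forall x, ~ F x -> u x = 0) -> (forall z, F z -> forall t : R, 0 < t < 1 -> Omega (z + t *: y)) -> approx u.
Proof.
move=> K0 au cF uF Fy; have [mu ub Eu] := au; split => //.
have [L L0 HL] := bump_lipschitz R n.
pose As := qint_scale n s L; pose Ac := qint_const n s.
pose Bs := 2 + 4 * (n%:R * 2) `^ s; pose Bc := 1 + kernel_const n s * n%:R ^+ n.
have As0 : 0 < As.
  by rewrite /As /qint_scale mulr_gt0// addr_gt0 ?powR_gt0 ?mulr_gt0// addr_gt0// !mulr_gt0 ?exprn_gt0 ?powR_gt0 ?mulr_gt0.
have Bs0 : 0 < Bs by rewrite /Bs ltr_pwDl// mulr_ge0// powR_ge0.
have q30 : 0 < (n%:R * 3) `^ s by rewrite powR_gt0// mulr_gt0.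
have q20 : 0 < 2 * (n%:R * 2) `^ s by rewrite mulr_gt0// powR_gt0// mulr_gt0.
(* One summand for each of the four estimates: energy of the interpolation error, energy of the
   translation error, and the same two in [L_M]. The constant [C] below is composed in the same
   way. *)
pose K1 := K * (As + Bs + (n%:R * 3) `^ s + 2 * (n%:R * 2) `^ s).
have S0 : 0 < As + Bs + (n%:R * 3) `^ s + 2 * (n%:R * 2) `^ s by exact: addr_gt0 (addr_gt0 (addr_gt0 As0 Bs0) q30) q20.
have [SKA SKB SK3 SK2] := le_sum4 (ltW As0) (ltW Bs0) (ltW q30) (ltW q20).
have K10 : 0 < K1 by rewrite mulr_gt0.
have kc0 : 0 <= kernel_const n s by exact: kernel_const_ge0.
have kc1 : 0 <= kernel_const n (1 - s) by apply: kernel_const_ge0; rewrite subr_gt0; case/andP: s01.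
have c30 : (0 : R) <= (n%:R * 3 / 2) ^+ n by rewrite exprn_ge0// divr_ge0// mulr_ge0.
have Ac0 : 0 <= Ac by rewrite addr_ge0// mulr_ge0// addr_ge0.
have Bc0 : 0 <= Bc by rewrite addr_ge0// mulr_ge0// exprn_ge0.
exists (2 * K1); first by rewrite mulr_gt0.
move=> eta eta0; pose C := Ac + Bc + (n%:R * 3 / 2) ^+ n + n%:R ^+ n.
have C0 : 0 <= C by exact: addr_ge0 (addr_ge0 (addr_ge0 Ac0 Bc0) c30) (exprn_ge0 _ (ltW nR0)).
have [CA CB C3 CN] := le_sum4 Ac0 Bc0 c30 (exprn_ge0 n (ltW nR0)).
have e0 : 0 < eta / (C + 1) by rewrite divr_gt0// ltr_wpDl.
have [r r0 Hr] := near_energy_small youngM mu e0 Eu.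
pose rr := Num.min 1 (r / 2); have rr0 : 0 < rr by rewrite lt_min ltr01 divr_gt0.
have rr1 : rr <= 1 by rewrite ge_min lexx.
have rr2 : 2 * rr <= r by rewrite mulrC -ler_pdivlMr// ge_min lexx orbT.
pose t := Num.min (1 / 2) (rr / (`|y| + 1)).
have y10 : 0 < `|y| + 1 by rewrite ltr_wpDl.
have t0 : 0 < t by rewrite lt_min !divr_gt0.
have t1 : t < 1 by rewrite gt_min; apply/orP; left; lra.
have ty : `|t *: y| <= rr.
  rewrite normrZ gtr0_norm//; apply: (@le_trans _ _ (rr / (`|y| + 1) * (`|y| + 1))); last by rewrite divfK// gt_eqF.
  by apply: ler_pM; rewrite ?(ltW t0)// ?lerDl// ge_min lexx orbT.
pose h := - (t *: y); have hr : `|h| <= rr by rewrite normrN.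
pose v x := u (x + h).
have mv : measurable_fun setT v by apply: measurableT_comp mu _; exact: measurable_rV_add.
pose Ft := [set x | F (x + h)].
have cFt : compact Ft.
  have -> : Ft = (fun x => x + t *: y) @` F.
    apply/seteqP; split => [x Fx|_ [x Fx <-]]; last by rewrite /Ft /= addrK.
    by exists (x + h) => //; rewrite subrK.
  apply: continuous_compact => //; apply: continuous_subspaceT => x.
  by apply: (@cvgD _ _ _ (nbhs x)); [exact: cvg_id|exact: cvg_cst].
have FtO : Ft `<=` Omega.
  by move=> x Fx; rewrite -[x](subrK (t *: y)); apply: Fy => //; rewrite t0.
have [d d0 Hd] := compact_open_thickening cFt Omega_open FtO.
(* A mesh below [d / 2] puts every cube that meets the translated support inside [Omega]; below
   [r / 3], the interpolation error only involves pairs at distance at most [r]. *)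
pose q := Num.min (Num.min (d / 2) (r / 3)) 1.
have q0 : 0 < q by rewrite !lt_min !divr_gt0 ?ltr01.
have [l _ Hl] := near_infty_natSinv_lt (PosNum q0).
have lq : mesh R l <= q by apply/ltW/Hl => /=.
have : q <= q by []; rewrite {2}/q !le_min => /andP[/andP[qd qr] _].
have l0 := mesh_gt0 R l.
have vF x : ~ Ft x -> v x = 0 by move=> H; exact: uF.
have Ev : (energy K v < +oo)%E.
  have -> : energy K v = energy K u; last exact: Eu.
  rewrite /Energies.energy -(integral_translation2 h (f := EFin \o dmod s M K u)).
  - by apply: eq_integral => z _; rewrite /= /dmod /Ds /v /= opprD addrACA subrr addr0.
  - by apply/measurable_EFinP; exact: measurable_dmod.
  - by move=> z; rewrite lee_fin dmod_ge0.
have av : admissible K v.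
  by split => // x xb; apply: vF => /FtO /Omega_b; rewrite leNgt xb.
have mq : measurable_fun setT (Q l v) by exact: measurable_qint.
exists (Q l v); split.
- apply: spanned_Q => z zO; rewrite /avg (_ : \int[la]_(p in _) _ = 0) ?mulr0//.
  rewrite /Rintegral (_ : (\int[la]_(p in _) _ = 0)%E)//; apply: integral0_eq => p zp.
  rewrite vF// => Fp; apply: zO => p' zp'; apply: (Hd p) => //.
  rewrite -(subrK (gpt (mesh R l) z) p') -addrA; apply: le_trans (ler_normD _ _) _.
  by move: zp zp'; rewrite /cube /= => zp zp'; rewrite [X in _ + X <= _]distrC; lra.
- have -> : (fun x => Q l v x - u x) = (fun x => (Q l v x - v x) + (v x - u x)) by apply/funext => x; ring.
  apply: le_trans (amodD _ (measurable_funB mq mv) (measurable_funB mv mu)) _.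
  have H1 : (amod K1 (fun x => Q l v x - v x)%R <= eta%:E)%E.
    apply: (@le_trans _ _ (amod (K * (n%:R * (3 * mesh R l)) `^ s) (fun x => Q l v x - v x)%R)).
      apply: (amod_le youngM (measurable_funB mq mv)); first by rewrite mulr_gt0// powR_gt0// !mulr_gt0.
      rewrite ler_pM2l//; apply: (@le_trans _ _ ((n%:R * 3) `^ s)).
        apply: ge0_ler_powR; rewrite ?nnegrE ?(ltW s0) ?mulr_ge0 ?(ltW l0)// ler_pM2l//.
        by rewrite ler_piMr// mesh_le1.
      exact: SK3.
    apply: le_trans (qint_amod n0 s01 youngM l0 K0 mv _ _) _.
    + by move=> x; apply: (admissible_integrable n0 s01 youngM x K0 av); exact: ltW.
    + by move=> x; exact: admissible_supp av.
    apply: small_scaled => //; rewrite near_energy_translation//.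
    apply: le_trans (near_energy_mono s youngM mu _ K0 (lexx K)) _; last first.
      apply: le_trans Hr _; rewrite lee_fin ler_pM2l// lef_pV2 ?posrE ?ltr_wpDl//.
      by rewrite lerD2r.
    by lra.
  have H2 : (amod K1 (fun x => v x - u x)%R <= eta%:E)%E.
    apply: (@le_trans _ _ (amod (2 * (K * (n%:R * (2 * rr)) `^ s)) (fun x => v x - u x)%R)).
      apply: (amod_le youngM (measurable_funB mv mu)); first by rewrite !mulr_gt0// powR_gt0// !mulr_gt0.
      rewrite mulrCA ler_pM2l//; apply: (@le_trans _ _ (2 * (n%:R * 2) `^ s)).
        rewrite ler_pM2l//.
        apply: ge0_ler_powR; rewrite ?nnegrE ?(ltW s0) ?mulr_ge0 ?(ltW rr0)// ler_pM2l//.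
        by rewrite ler_piMr.
      exact: SK2.
    apply: le_trans (translation_amod n0 s01 youngM mu rr0 hr K0) _.
    apply: small_scaled => //.
    apply: le_trans (near_energy_mono s youngM mu rr2 K0 (lexx K)) _.
    apply: le_trans Hr _; rewrite lee_fin ler_pM2l// lef_pV2 ?posrE ?ltr_wpDl ?exprn_ge0//.
    by rewrite lerD2r.
  apply: (@le_trans _ _ ((2^-1)%:E * (eta%:E + eta%:E))%E).
    by rewrite lee_wpmul2l ?lee_fin ?invr_ge0// leeD.
  by rewrite -EFinD -EFinM lee_fin; lra.
have -> : (fun x => Q l v x - u x) = (fun x => (Q l v x - v x) + (v x - u x)) by apply/funext => x; ring.
apply: le_trans (energyD _ (measurable_funB mq mv) (measurable_funB mv mu)) _.
have H1 : (energy K1 (fun x => Q l v x - v x)%R <= eta%:E)%E.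
  apply: (@le_trans _ _ (energy (As * K) (fun x => Q l v x - v x)%R)).
    apply: (energy_le (measurable_funB mq mv)); first by rewrite mulr_gt0.
    by rewrite mulrC ler_pM2l// -!addrA lerDl !addr_ge0// ltW.
  apply: le_trans (qint_energy n0 s01 youngM L0 HL l0 K0 mv _ _) _.
  + by move=> x; apply: (admissible_integrable n0 s01 youngM x K0 av); exact: ltW.
  + by move=> x; exact: admissible_supp av.
  apply: small_scaled => //; rewrite near_energy_translation//.
  apply: le_trans (near_energy_mono s youngM mu _ K0 (lexx K)) _; last first.
    apply: le_trans Hr _; rewrite lee_fin ler_pM2l// lef_pV2 ?posrE ?ltr_wpDl//.
    by rewrite lerD2r.
  by lra.
have H2 : (energy K1 (fun x => v x - u x)%R <= eta%:E)%E.
  apply: (@le_trans _ _ (energy (K * Bs) (fun x => v x - u x)%R)).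
    apply: (energy_le (measurable_funB mv mu)); first by rewrite mulr_gt0.
    by rewrite ler_pM2l.
  apply: le_trans (translation_energy n0 s01 youngM mu rr0 hr K0) _.
  apply: small_scaled => //; apply: le_trans (near_energy_mono s youngM mu rr2 K0 (lexx K)) _.
  apply: le_trans Hr _; rewrite lee_fin ler_pM2l// lef_pV2 ?posrE ?ltr_wpDl//.
  by rewrite lerD2r.
apply: (@le_trans _ _ ((2^-1)%:E * (eta%:E + eta%:E))%E).
  by rewrite lee_wpmul2l ?lee_fin ?invr_ge0// leeD.
by rewrite -EFinD -EFinM lee_fin; lra.
Qed.

Lemma compact_closure_Omega : compact (closure Omega).
Proof.
apply: (subclosed_compact _ (@compact_cube R n 0 b%:R n0)); first exact: closed_closure.
rewrite (closure_id (cube 0 b%:R)).1; last exact: closed_cube.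
by apply: closure_subset => x /Omega_b; rewrite /cube /= subr0.
Qed.

(** A partition of unity, fine with respect to the radius of [segment_radius], localizes [v]; each
    piece is then pushed into [Omega] along its own direction. *)
Lemma density K v : 0 < K -> admissible K v -> (forall x, ~ Omega x -> v x = 0) -> approx v.
Proof.
move=> K0 av vO; have [mv vb Ev] := av.
have [r r0 Hr] := segment_radius Omega_open Omega_segment compact_closure_Omega.
have r20 : 0 < r / 2 by rewrite divr_gt0.
have [l _ /(_ l (leqnn l)) /= Hl] := near_infty_natSinv_lt (PosNum r20).
have l0 := mesh_gt0 R l; have lr : 2 * mesh R l <= r by rewrite mulrC -ler_pdivlMr// ltW.
have -> : v = (fun x => \sum_(z : grid n (b.+1 * l.+1)) bump (gpt (mesh R l) z) (mesh R l) x * v x).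
  apply/funext => x; rewrite -mulr_suml; have [xb|/vb ->] := leP `|x| b%:R; last by rewrite mulr0.
  by rewrite grid_sum1 ?mul1r// mesh_box -natr1; lra.
apply: approx_sum => z; set c := gpt _ z; set p := fun x => _.
have [L L0 HL] := bump_lipschitz R n.
have mb : measurable_fun setT (bump c (mesh R l)) by apply: continuous_measurable_rV; exact: continuous_bump.
have mp : measurable_fun setT p by exact: measurable_funM.
pose L1 := L / mesh R l + 1.
have L10 : 0 < L1 by rewrite ltr_wpDl// divr_ge0// ltW.
have ap : admissible (2 * K) p.
  split => // [x /vb|]; first by rewrite /p => ->; rewrite mulr0.
  apply: le_lt_trans (energyM s01 youngM mb mv K0 L10 _ _ _) _.
  - by move=> x; rewrite ger0_norm ?bump_ge0 ?bump_le1.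
  - move=> x y; apply: (@le_trans _ _ 1); last by rewrite lerDr divr_ge0// ltW.
    rewrite ler_norml; have := @bump_ge0 R n c (mesh R l) x; have := @bump_ge0 R n c (mesh R l) y.
    have := @bump_le1 R n c (mesh R l) x; have := @bump_le1 R n c (mesh R l) y.
    by move=> *; apply/andP; split; lra.
  - move=> x y; apply: le_trans (HL _ _ _ _ l0) _; rewrite mulrCA mulrC ler_wpM2r// lerDl//.
  apply: lte_mul_pinfty; rewrite ?lee_fin ?invr_ge0//; apply: lte_add_pinfty => //.
  apply: lte_mul_pinfty; rewrite ?lee_fin ?cut_const_ge0//.
  by apply: (admissible_EM n0 s01 youngM K0 _ av); rewrite divr_gt0.
have K20 : 0 < 2 * K by rewrite mulr_gt0.
pose F := closure Omega `&` cube c (mesh R l).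
have cF : compact F.
  by apply: compact_closedI; [exact: compact_closure_Omega|exact: closed_cube].
have pF x : ~ F x -> p x = 0.
  move=> H; rewrite /p; have [xO|/vO ->] := pselect (Omega x); last by rewrite mulr0.
  have [->|/(bump_support l0) xc] := eqVneq (bump c (mesh R l) x) 0; first by rewrite mul0r.
  by exfalso; apply: H; split; [exact: subset_closure|exact: ltW].
have [[x0 [x0O x0c]]|F0] := pselect (F !=set0); last first.
  have -> : p = fun=> 0 by apply/funext => x; apply: pF => Fx; apply: F0; exists x.
  exact: approx0.
have [y Hy] := Hr _ x0O.
apply: (approx_shift (y := y) K20 ap cF pF) => x [xO xc] t t01; apply: Hy => //.
move: x0c xc; rewrite /cube /= => x0c xc.
rewrite -(subrK c x) -addrA; apply: le_trans (ler_normD _ _) _.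
by rewrite [X in _ + X <= _]distrC; lra.
Qed.

End density.

End Density.
Import Density.

Module NullSets.

Section null_inverse.
Context (R : realType) (n : nat).
Local Notation la := (lebesgue_rV R n).
Local Notation X := 'rV[R]_n.

Lemma ae_dx_inv (P : X -> Prop) : {ae (@dx R n), forall x, P x} -> {ae la, forall x, P x}.
Proof.
move=> [A [mA A0 PA]]; have [B [mB B0 AB]] := completed_null (mu := la) mA A0.
by exists B; split => //; exact: subset_trans AB.
Qed.

Lemma ae_nu_prod (P : X -> Prop) : {ae (@dx R n), forall x, P x} ->
  {ae (@nu R n), forall z : Rnn R n, P z.1 /\ P z.2}.
Proof. by move=> /ae_dx_inv /ae_prod H; apply: ae_nu; exact: ae_dxdy H. Qed.

Lemma ae_setT (d : measure_display) (T : measurableType d) (mu : {measure set T -> \bar R}) (P : T -> Prop) :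
  {ae mu, forall x, P x} -> exists N, [/\ measurable N, mu N = 0%E & forall x, ~ N x -> P x].
Proof. by move=> [N [mN N0 PN]]; exists N; split => // x Nx; apply: contrapT => /PN. Qed.

Lemma ae_imp (d : measure_display) (T : measurableType d) (mu : {measure set T -> \bar R}) (P Q : T -> Prop) :
  (forall x, P x -> Q x) -> {ae mu, forall x, P x} -> {ae mu, forall x, Q x}.
Proof. by move=> PQ; apply: filterS. Qed.

Lemma ae_imp2 (d : measure_display) (T : measurableType d) (mu : {measure set T -> \bar R}) (P Q S : T -> Prop) :
  (forall x, P x -> Q x -> S x) -> {ae mu, forall x, P x} -> {ae mu, forall x, Q x} -> {ae mu, forall x, S x}.
Proof. by move=> PQ; apply: filterS2. Qed.

Lemma Rintegral_eq0 (d : measure_display) (T : measurableType d) (mu : {measure set T -> \bar R}) (f : T -> R) :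
  (forall x, f x = 0) -> \int[mu]_x f x = 0.
Proof. by move=> f0; rewrite /Rintegral integral0_eq// => x _; rewrite f0. Qed.

End null_inverse.

(** * The space W^s_0 L_M and Borel representatives *)

Section sobolev.
Context (R : realType) (n : nat) (s : R) (M : R -> R).
Hypothesis n0 : (0 < n)%N.
Hypothesis s01 : 0 < s < 1.
Hypothesis youngM : young M.
Local Notation la := (lebesgue_rV R n).
Local Notation X := 'rV[R]_n.
Local Notation Mbar := (complementary M).
Local Notation M0 := (young0 youngM).
Local Notation M_ge0 := (young_ge0 youngM).
Local Notation energy := (@energy R n s M).
Local Notation amod := (@amod R n M).
Context (b : nat) (Omega : set X).
Hypothesis Omega_b : forall x, Omega x -> `|x| <= b%:R.
Hypothesis Omega_open : open Omega.
Local Notation admissible := (admissible s M b).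

Definition pairing (f : Rn R n -> R) (F : Rnn R n -> R) (u : Rn R n -> R) : R :=
  \int[dx]_x (u x * f x) + \int[nu]_z (@Ds R n s u z * F z).

Let S := sigma_topology n s M.

Lemma continuous_pairing f F : orliczE dx Mbar f -> orliczE nu Mbar F ->
  continuous (pairing f F : S -> R).
Proof.
move=> fE FE.
pose p : orliczE (@dx R n) Mbar `*` orliczE (@nu R n) Mbar := exist _ (f, F) (mem_set (conj fE FE)).
pose h : (Rn R n -> R) -> {ptws (orliczE (@dx R n) Mbar `*` orliczE (@nu R n) Mbar) -> R} :=
  fun u q => duality (val q) (u, Ds s u).
have ch : continuous (h : S -> _) by exact: initial_continuous.
have -> : pairing f F = (fun g : {ptws (orliczE (@dx R n) Mbar `*` orliczE (@nu R n) Mbar) -> R} => g p) \o h.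
  apply/funext => u; rewrite /pairing /h /duality /=.
  by congr (_ + _); apply: eq_Rintegral => x _; rewrite mulrC.
move=> u; apply: (@continuous_comp S _ _ h (fun g => g p)); first exact: ch.
exact: (@proj_continuous _ (fun=> R : topologicalType) p).
Qed.

Lemma pairing_closure f F v : orliczE dx Mbar f -> orliczE nu Mbar F ->
  (forall w, test_functions Omega w -> pairing f F w = 0) ->
  closure (test_functions Omega : set S) v -> pairing f F v = 0.
Proof.
move=> fE FE Hw cv.
have cZ : closed [set u : S | pairing f F u = 0].
  apply: (@closed_comp _ _ (pairing f F : S -> R) [set 0]) => [x _|]; first exact: continuous_pairing.
  exact: closed_eq.
suff : closure [set u : S | pairing f F u = 0] v by rewrite -(closure_id _).1.
by apply: closure_subset cv => w /Hw.
Qed.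

(** Convergence of all the pairings is convergence in the initial topology, so the weak limit of a
    sequence of test functions lies in their weak closure. *)
Lemma closure_of_limit (w : nat -> Rn R n -> R) u : (forall k, test_functions Omega (w k)) ->
  (forall f F, orliczE dx Mbar f -> orliczE nu Mbar F ->
    pairing f F (w k) @[k --> \oo] --> pairing f F u) ->
  closure (test_functions Omega : set S) u.
Proof.
move=> tw Hw B; rewrite nbhsE => -[U [oU Uu] UB].
pose h : (Rn R n -> R) -> {ptws (orliczE (@dx R n) Mbar `*` orliczE (@nu R n) Mbar) -> R} :=
  fun u q => duality (val q) (u, Ds s u).
have [A oA AU] := oU.
have hw : h (w k) @[k --> \oo] --> (h u : {ptws _ -> R}).
  apply/cvg_sup => -[[f F] fF] W [/= _ [[V /= oV <- /= Vfx]]] /filterS; apply.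
  have [fE FE] := set_mem fF.
  have E v : h v (exist _ (f, F) fF) = pairing f F v.
    rewrite /pairing /h /duality /=.
    by congr (_ + _); apply: eq_Rintegral => x _; rewrite mulrC.
  have HV : nbhs (pairing f F u) V by apply: open_nbhs_nbhs; split => //; rewrite -E.
  have [N _ HN] := Hw _ _ fE FE _ HV; exists N => // k Nk /=.
  by rewrite E; exact: HN.
have Au : nbhs (h u : {ptws _ -> R}) A.
  by apply: open_nbhs_nbhs; split => //; move: Uu; rewrite -AU.
have [N _ HN] := hw _ Au.
exists (w N); split; first exact: tw.
by apply: UB; rewrite -AU; exact: HN (leqnn N).
Qed.

Lemma orliczE0 d (U : measurableType d) (mu : {measure set U -> \bar R}) : orliczE mu Mbar (fun=> 0).
Proof.
split; first exact: measurable_cst.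
by move=> k _; under eq_integral do rewrite mul0r complementary0//; rewrite integral0 ltry.
Qed.

(** The sign of [v] on a bounded part [E] of the complement of [Omega] is a function of the class
    [E] that annihilates test functions, hence [v] by weak continuity; but its pairing with [v] is
    the integral of [|v|] over that part. *)
Lemma Ws0L_zero_outside v : Ws0L s M Omega v -> {ae (@dx R n), forall x : Rn R n, ~ Omega x -> v x = 0}.
Proof.
move=> [[[mv Lv] _] cv].
have [g [B [mg mB B0 gv]]] := completed_measurable_fun (mu := la) mv.
have mO : measurable (~` Omega) by apply: measurableC; exact: open_measurable_rV.
suff H k : {ae (@dx R n), forall x : Rn R n, (~` Omega `&` cube 0 k%:R) x -> v x = 0}.
  have [A HA] := choice (fun k => ae_setT (H k)).
  apply: filterS (ae_foralln (fun k => H k)) => x Hx xO.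
  have [k kx] : exists k : nat, `|x : X| <= k%:R.
    by exists (Num.bound `|x : X|); rewrite ltW// (le_lt_trans _ (archi_boundP _))// ler_norm.
  by apply: (Hx k); split => //; rewrite /cube /= subr0.
pose E : set X := ~` Omega `&` cube 0 k%:R.
have mE : measurable E by apply: measurableI => //; exact: measurable_cube.
pose f (x : X) : R := Num.sg (g x) * \1_E x.
have mf : measurable_fun setT f.
  apply: measurable_funM; last exact: measurable_indic.
  apply: (measurableT_comp (f := @Num.sg R)) => //.
  rewrite (_ : @Num.sg R = fun t => if t == 0 then 0 else if t < 0 then -1 else 1); last first.
    by apply/funext => t; rewrite sgr_def; case: eqP => _; case: (t < 0); rewrite ?mulr0n ?mulr1n ?expr0 ?expr1.
  apply: measurable_fun_ifT => //; first exact: measurable_fun_eqr.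
  by apply: measurable_fun_ifT => //; exact: measurable_fun_ltr.
have mfc : measurable_fun setT (f : Rn R n -> R) := measurable_fun_completed (mu := la) mf.
have fE : orliczE dx Mbar f.
  split => // j j0.
  have mfj : measurable_fun setT (fun x => (Mbar (f x / j))%:E).
    by apply/measurable_EFinP; apply: (measurableT_comp (measurable_complementary youngM)); exact: measurable_funM.
  rewrite (ge0_integral_dx mfj); last by move=> x; rewrite lee_fin complementary_ge0.
  apply: (@le_lt_trans _ _ (\int[la]_x (Mbar (1 / j) * \1_E x)%:E)%E).
    apply: int_le => [||x|x]; [exact/measurable_EFinP| |exact: complementary_ge0|].
      by apply: measurable_funM => //; exact: measurable_indic.
    rewrite /f indicE; case: (x \in E); last by rewrite !(mulr0, mul0r) complementary0.
    rewrite !mulr1; apply: complementary_le => //; rewrite !normrM normr1 ler_wpM2r// normr_sg.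
    by case: eqP.
  rewrite (intZ la (c := Mbar (1 / j)) _ (f := \1_E)) ?complementary_ge0//.
  rewrite integral_indic// setIT; apply: lte_mul_pinfty; rewrite ?lee_fin ?complementary_ge0//.
  apply: le_lt_trans (le_measure _ _ _ (@subIsetr _ _ _)) _; rewrite ?inE//; first exact: measurable_cube.
  by rewrite [X in (X < _)%E](lebesgue_cube 0 (ler0n _ _)) ltry.
have p0 : pairing f (fun=> 0) v = 0.
  apply: pairing_closure cv => //; first exact: orliczE0.
  move=> w [_ _ sw]; rewrite /pairing [X in X + _](_ : _ = 0) ?add0r; last first.
    apply: Rintegral_eq0 => x.
    rewrite /f indicE; have [xE|_] := boolP ((x : X) \in E); last by rewrite !mulr0.
    have [xO _] := set_mem xE; suff -> : w x = 0 by rewrite mul0r.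
    apply: contrapT => /eqP wx; apply: xO; apply: sw; exact: subset_closure.
  by apply: Rintegral_eq0 => x; rewrite mulr0.
pose h (x : X) : R := `|g x| * \1_E x.
have mh : measurable_fun setT h.
  by apply: measurable_funM; [exact: measurableT_comp|exact: measurable_indic].
have h0 x : 0 <= h x by rewrite mulr_ge0.
have vg : {ae (@dx R n), forall x : Rn R n, g x = v x}.
  by apply: ae_dx; exists B; split => // x /= Hx; apply: contrapT => /gv.
have Ih : \int[dx]_x h x = 0.
  rewrite -p0 /pairing [X in _ + X](_ : _ = 0) ?addr0; last first.
    by apply: Rintegral_eq0 => x; rewrite mulr0.
  rewrite /Rintegral; congr fine; apply: (@ae_eq_integral _ _ _ (@dx R n) setT (fun x => (v x * f x)%:E) (fun x => (h x)%:E) measurableT).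
  - by apply/measurable_EFinP; exact: (measurable_fun_completed (mu := la) mh).
  - by apply/measurable_EFinP; exact: measurable_funM.
  - apply: filterS vg => x vx _; rewrite -vx /h /f mulrA; congr (_ * _)%:E.
    by rewrite mulrC -normrEsg.
have [m m0 Im] := Lv.
(* A real-valued integral equal to 0 could stand for an infinite one, so finiteness is established
   before concluding that [h] is null. *)
have Ihfin : (\int[dx]_x (h x)%:E < +oo)%E.
  pose G (x : X) : R := m * (Mbar 1 * \1_E x + M (g x / m)).
  have mI : measurable_fun setT (fun x : X => Mbar 1 * \1_E x) by apply: measurable_funM => //; exact: measurable_indic.
  have mMg : measurable_fun setT (fun x : X => M (g x / m)) by exact: measurable_M_div.
  rewrite (ge0_integral_dx (f := fun x => (h x)%:E)); [|exact/measurable_EFinP|by move=> x; rewrite lee_fin].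
  apply: (@le_lt_trans _ _ (\int[la]_x (G x)%:E)%E).
    apply: int_le => // [|x]; first by apply: measurable_funM => //; exact: measurable_funD.
    rewrite /h /G indicE; case: (x \in E); rewrite !(mulr1, mulr0); last first.
      by rewrite add0r mulr_ge0 ?(ltW m0)// M_ge0.
    have := abs_le_young youngM (g x) (_ : 0 < m^-1); rewrite invrK invr_gt0 [g x / m]mulrC; exact.
  rewrite intZ ?(ltW m0)//; [|exact: measurable_funD|by move=> x; rewrite addr_ge0 ?mulr_ge0 ?M_ge0 ?complementary_ge0].
  rewrite intD//; [|by move=> x; rewrite mulr_ge0 ?complementary_ge0|by move=> x; exact: M_ge0].
  apply: lte_mul_pinfty; rewrite ?lee_fin ?(ltW m0)//; apply: lte_add_pinfty.
    rewrite (intZ la (c := Mbar 1) _ (f := \1_E)) ?complementary_ge0//.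
    rewrite integral_indic// setIT; apply: lte_mul_pinfty; rewrite ?lee_fin ?complementary_ge0//.
    apply: le_lt_trans (le_measure _ _ _ (@subIsetr _ _ _)) _; rewrite ?inE//; first exact: measurable_cube.
    by rewrite [X in (X < _)%E](lebesgue_cube 0 (ler0n _ _)) ltry.
  apply: le_lt_trans Im; rewrite le_eqVlt; apply/orP; left; apply/eqP.
  rewrite -(ge0_integral_dx (f := fun x => (M (g x / m))%:E)); [|exact/measurable_EFinP|by move=> x; rewrite lee_fin M_ge0].
  apply: (@ae_eq_integral _ _ _ (@dx R n) setT (fun x => (M (v x / m))%:E) (fun x => (M (g x / m))%:E) measurableT).
  - by apply/measurable_EFinP; exact: (measurable_fun_completed (mu := la) mMg).
  - by apply/measurable_EFinP; apply: measurable_M_div.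
  - by apply: filterS vg => x -> _.
have Ih0 : (\int[dx]_x `|(h x)%:E| = 0)%E.
  under eq_integral do rewrite gee0_abs ?lee_fin//.
  by rewrite -(@fineK _ (\int[dx]_x (h x)%:E)%E) ?[fine _]Ih// ge0_fin_numE//; exact: int_ge0.
have mhE : measurable_fun setT (fun x : Rn R n => (h x)%:E).
  by apply/measurable_EFinP; exact: (measurable_fun_completed (mu := la) mh).
have := (ae_eq_integral_abs (@dx R n) measurableT mhE).1 Ih0.
move=> H; apply: filterS2 H vg => x /(_ Logic.I) /= [hx] <- xE.
by apply/eqP; rewrite -normr_eq0 -[`|_|]mulr1; move: hx; rewrite /h indicE (mem_set (A := E) (u := x : X) xE) => ->.
Qed.

(** Take a Borel version and set it to 0 off [Omega], where [v] vanishes a.e.; null sets of [dx]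
    give null sets of pairs for [nu], so the energy is the same. *)
Lemma Ws0L_borel v : Ws0L s M Omega v -> exists (w : X -> R) (K : R),
  [/\ 0 < K, admissible K w, forall x, ~ Omega x -> w x = 0 & {ae (@dx R n), forall x : Rn R n, w x = v x}].
Proof.
move=> Wv; have vO := Ws0L_zero_outside Wv; have [[[mv Lv] [mD [K K0 IK]]] _] := Wv.
have [g [B [mg mB B0 gv]]] := completed_measurable_fun (mu := la) mv.
have mO : measurable Omega by exact: open_measurable_rV.
pose w (x : X) : R := g x * \1_Omega x.
have mw : measurable_fun setT w by apply: measurable_funM => //; exact: measurable_indic.
have w0 x : ~ Omega x -> w x = 0 by move=> xO; rewrite /w indicE memNset// mulr0.
have vg : {ae (@dx R n), forall x : Rn R n, g x = v x}.
  by apply: ae_dx; exists B; split => // x /= Hx; apply: contrapT => /gv.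
have wv : {ae (@dx R n), forall x : Rn R n, w x = v x}.
  apply: (ae_imp2 (mu := @dx R n) _ vO vg) => x H gx; have [xO|xO] := pselect (Omega x).
    by rewrite /w indicE mem_set// mulr1.
  by rewrite w0// H.
exists w, K; split => //; split => //.
  by move=> x xb; apply: w0 => /Omega_b; rewrite leNgt xb.
have mDw := measurable_Ds s mw.
have mMw : measurable_fun setT (fun z : X * X => (M (@Ds R n s w z / K))%:E).
  by apply/measurable_EFinP; exact: measurable_M_div.
have -> : energy K w = (\int[nu]_z (M (@Ds R n s w z / K))%:E)%E.
  by rewrite (ge0_integral_nuE mMw)// => z; rewrite lee_fin M_ge0.
apply: le_lt_trans IK; rewrite le_eqVlt; apply/orP; left; apply/eqP.
apply: (@ae_eq_integral _ _ _ (@nu R n) setT (fun z => (M (Ds s v z / K))%:E) (fun z => (M (Ds s w z / K))%:E) measurableT).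
- exact: (measurable_fun_completed (mu := (la \x la)%E) mMw).
- by apply/measurable_EFinP; exact: measurable_M_div.
- by apply: filterS (ae_nu_prod wv) => z [z1 z2] _; rewrite /Ds z1 z2.
Qed.

Lemma CkD k (f g : X -> R) : Ck k f -> Ck k g -> Ck k (fun x => f x + g x).
Proof.
elim: k f g => [|k IH] f g [cf Hf] [cg Hg]; (split; first by move=> x; apply: (@cvgD _ _ _ (nbhs x)); [exact: cf|exact: cg]) => // i.
have [df Cf] := Hf i; have [dg Cg] := Hg i; split => [x|]; first exact: derivableD.
rewrite (_ : 'D_(delta_mx ord0 i) _ = (fun x => 'D_(delta_mx ord0 i) f x + 'D_(delta_mx ord0 i) g x)); first exact: IH.
by apply/funext => x; rewrite deriveD.
Qed.

Lemma CkZ k (c : R) (f : X -> R) : Ck k f -> Ck k (fun x => c * f x).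
Proof.
elim: k f => [|k IH] f [cf Hf]; (split; first by move=> x; apply: (@cvgM _ _ (nbhs x)); [exact: cvg_cst|exact: cf]) => // i.
have [df Cf] := Hf i; split => [x|]; first exact: derivableZ.
rewrite (_ : 'D_(delta_mx ord0 i) _ = (fun x => c * 'D_(delta_mx ord0 i) f x)); first exact: IH.
by apply/funext => x; rewrite deriveZ.
Qed.

Lemma test_functionsD (f g : X -> R) : test_functions Omega f -> test_functions Omega g ->
  test_functions Omega (fun x => f x + g x).
Proof.
move=> [Cf cf sf] [Cg cg sg].
have sub : closure [set x | f x + g x != 0] `<=` closure [set x | f x != 0] `|` closure [set x | g x != 0].
  rewrite -closureU; apply: closure_subset => x /=; apply: contraPP => /not_orP[/negP + /negP].
  by rewrite !negbK => /eqP -> /eqP ->; rewrite addr0 eqxx.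
split; first by move=> k; exact: CkD.
  by apply: subclosed_compact sub; [exact: closed_closure|exact: compactU].
by apply: subset_trans sub _ => x [/sf|/sg].
Qed.

Lemma test_functionsZ (c : R) (f : X -> R) : test_functions Omega f -> test_functions Omega (fun x => c * f x).
Proof.
move=> [Cf cf sf].
have sub : closure [set x | c * f x != 0] `<=` closure [set x | f x != 0].
  by apply: closure_subset => x /=; rewrite mulf_eq0 negb_or => /andP[].
split; first by move=> k; exact: CkZ.
  by apply: subclosed_compact sub => //; exact: closed_closure.
exact: subset_trans sub _.
Qed.

Lemma test_functions0 : test_functions Omega (fun=> 0 : R).
Proof.
have E : [set x : X | (0 : R) != 0] = set0 by apply/seteqP; split => x //=; rewrite eqxx.
split; rewrite ?E ?closure0//; last exact: compact0.
elim=> [|k IH]; (split; first by move=> x; exact: cst_continuous) => // i.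
split => [x|]; first exact: derivable_cst.
by rewrite (_ : 'D_(delta_mx ord0 i) _ = (fun=> 0)) ?funeqE// => x; rewrite derive_cst.
Qed.

Lemma test_functions_comb k c : test_functions Omega (comb b Omega k c).
Proof.
have tphi j : test_functions Omega (phi b Omega j).
  rewrite /phi; case: unpickle => [p|]; last exact: test_functions0.
  case: ifPn => [/asboolP H|_]; last exact: test_functions0.
  by apply: bump_test_function => //; exact: mesh_gt0.
rewrite /comb; elim: k => [|k IH].
  rewrite (_ : (fun _ => _) = (fun=> 0)); first exact: test_functions0.
  by apply/funext => x; rewrite big_ord0.
rewrite (_ : (fun _ => _) = (fun x => \sum_(j < k) c j * phi b Omega j x + c k * phi b Omega k x)); last first.
  by apply/funext => x; rewrite big_ord_recr.
by apply: test_functionsD => //; exact: test_functionsZ.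
Qed.

Lemma comb_zero_outside k c x : ~ Omega x -> comb b Omega k c x = 0.
Proof.
move=> xO; have [_ _ H] := test_functions_comb k c; apply: contrapT => /eqP wx; apply: xO; apply: H.
exact: subset_closure.
Qed.

Lemma energy_phi j K : 0 < K -> (energy K (phi b Omega j) < +oo)%E.
Proof.
move=> K0; rewrite /phi.
have E0 : (energy K (fun=> 0%R) < +oo)%E.
  rewrite /Energies.energy /dmod /Ds; under eq_integral do rewrite !subrr !mul0r M0 mul0r.
  by rewrite integral0 ltry.
case: unpickle => [p|//]; case: ifP => _ //.
have [L L0 HL] := bump_lipschitz R n; set c := gpt _ _; set e := mesh _ _.
have e0 : 0 < e by exact: mesh_gt0.
apply: (@energy_fin_cube _ _ _ _ s01 youngM (L / e + 1) K _ c e) => //.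
- by apply: continuous_measurable_rV; exact: continuous_bump.
- exact: ltW.
- by rewrite ltr_wpDl// divr_ge0// ltW.
- move=> x y; apply: (@le_trans _ _ 1); last by rewrite lerDr divr_ge0// ltW.
  rewrite ler_norml; have := @bump_ge0 R n c e x; have := @bump_ge0 R n c e y.
  have := @bump_le1 R n c e x; have := @bump_le1 R n c e y.
  by move=> *; apply/andP; split; lra.
- by move=> x y; apply: le_trans (HL _ _ _ _ e0) _; rewrite mulrCA mulrC ler_wpM2r// lerDl.
- move=> x xc; apply: contrapT => /eqP /(bump_support e0) H; apply: xc; exact: ltW.
Qed.

Lemma phi_bounds j x : 0 <= phi b Omega j x <= 1.
Proof.
rewrite /phi; case: unpickle => [p|]; last by rewrite lexx ler01.
by case: ifP => _; rewrite ?lexx ?ler01// bump_ge0 bump_le1.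
Qed.

End sobolev.

End NullSets.
Import NullSets.

Module Superposition.

(** * Superposition operators and their potentials *)

Section primitive.
Context (R : realType) (h : R -> R).
Hypothesis h_odd : forall t, h (- t) = - h t.
Hypothesis h_cont : continuous h.

Definition prim (x : R) : R := \int[lebesgue_measure]_(t in `[0, `|x|]) h t.

Let ih (a c : R) : lebesgue_measure.-integrable `[a, c]%classic (EFin \o h).
Proof.
by apply: continuous_compact_integrable; [exact: segment_compact|apply: continuous_subspaceT; exact: h_cont].
Qed.

Lemma odd0 : h 0 = 0.
Proof. by have := h_odd 0; rewrite oppr0; lra. Qed.

Lemma prim0 : prim 0 = 0.
Proof. by rewrite /prim normr0 set_itv1 Rintegral_set1. Qed.

Lemma primN x : prim (- x) = prim x.
Proof. by rewrite /prim normrN. Qed.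

Let prim_pos (x y m1 m2 : R) : 0 <= x -> x <= y -> (forall t, x <= t <= y -> m1 <= h t <= m2) ->
  m1 * (y - x) <= prim y - prim x <= m2 * (y - x).
Proof.
move=> x0 xy H; have y0 := le_trans x0 xy.
have Ic (c : R) : \int[lebesgue_measure]_(t in `[x, y]) (fun=> c) t = c * (y - x).
  rewrite Rintegral_cst//= lebesgue_measure_itv /= lte_fin.
  by move: xy; rewrite le_eqVlt => /predU1P[->|->]; rewrite ?ltxx ?subrr.
have icst (c : R) : lebesgue_measure.-integrable `[x, y]%classic (EFin \o (fun=> c)).
  by apply: continuous_compact_integrable; [exact: segment_compact|apply: continuous_subspaceT => z; exact: cst_continuous].
have -> : prim y - prim x = \int[lebesgue_measure]_(t in `[x, y]) h t.
  rewrite /prim !ger0_norm// (Rintegral_itvB (ih 0 y)) ?bnd_simp//.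
  apply: Rintegral_itv_obnd_cbnd; apply: integrableS (ih x y) => //.
  by move=> t /=; rewrite !in_itv/= => /andP[/ltW -> ->].
rewrite -!Ic; apply/andP; split; apply: le_Rintegral => //; move=> t /=; rewrite in_itv/= => tI; by case/andP: (H t tI).
Qed.

Lemma prim_between (x y m1 m2 : R) : x <= y -> (forall t, x <= t <= y -> m1 <= h t <= m2) ->
  m1 * (y - x) <= prim y - prim x <= m2 * (y - x).
Proof.
move=> xy H; have [x0|x0] := leP 0 x; first exact: prim_pos.
have H' (u v : R) : x <= - v -> - u <= y -> forall t, u <= t <= v -> - m2 <= h t <= - m1.
  move=> xv uy t /andP[ut tv]; rewrite -[t]opprK h_odd !lerN2 andbC; apply: H.
  by rewrite (le_trans xv) ?lerN2// (le_trans _ uy)// lerN2.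
have [y0|y0] := leP y 0.
  have := @prim_pos (- y) (- x) (- m2) (- m1) _ _ _; rewrite !primN oppr_ge0 lerN2.
  move=> /(_ y0 xy (H' _ _ _ _)); rewrite !opprK => /(_ (lexx _) (lexx _)) /andP[h1 h2].
  by apply/andP; split; lra.
have := @prim_pos 0 y m1 m2 (lexx 0) (ltW y0) _; rewrite prim0.
move=> /(_ _)/andP[|h1 h2]; first by move=> t /andP[t0 ty]; apply: H; rewrite ty andbT (le_trans _ t0)// ltW.
have := @prim_pos 0 (- x) (- m2) (- m1) (lexx 0) _ _; rewrite primN prim0 oppr_ge0.
move=> /(_ (ltW x0) (H' _ _ _ _)); rewrite opprK oppr0 => /(_ (lexx _) (ltW y0)) /andP[h3 h4].
by apply/andP; split; lra.
Qed.

Section monotone.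
Hypothesis h_mono : forall x y, x <= y -> h x <= h y.

Lemma prim_sub x y : prim x + h x * (y - x) <= prim y.
Proof.
have [xy|/ltW yx] := leP x y.
  have := @prim_between x y (h x) (h y) xy _ => /(_ _)/andP[|]; last by move=> + _; lra.
  by move=> t /andP[xt ty]; rewrite !h_mono.
have := @prim_between y x (h y) (h x) yx _ => /(_ _)/andP[|]; last by move=> _; lra.
by move=> t /andP[xt ty]; rewrite !h_mono.
Qed.

Lemma prim_le x : prim x <= h x * x.
Proof. by have := prim_sub x 0; rewrite prim0; lra. Qed.

Lemma prim_ge0 x : 0 <= prim x.
Proof. by have := prim_sub 0 x; rewrite prim0 odd0; lra. Qed.

(** The subgradient inequality at [x / 2]; it transfers coercivity from the kernel to its primitive
    at the cost of halving the argument. *)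
Lemma prim_half x : h (x / 2) * (x / 2) <= prim x.
Proof. by have := prim_sub (x / 2) x; have := prim_ge0 (x / 2); set a := h _; lra. Qed.

(** Left Riemann sums of the primitive. For a kernel depending on [z] they are visibly measurable in
    [z], and so is their limit. *)
Definition riemann_sum (k : nat) (x : R) : R :=
  \sum_(i < k.+1) h (i%:R / k.+1%:R * x) * (x / k.+1%:R).

Lemma riemann_sum_bounds k x :
  riemann_sum k x <= prim x <= riemann_sum k x + h x * x / k.+1%:R.
Proof.
pose p (i : nat) := i%:R / k.+1%:R * x.
have k0 : k.+1%:R != 0 :> R by rewrite pnatr_eq0.
have pS i : p i.+1 - p i = x / k.+1%:R by rewrite /p -natr1; field.
suff H m : \sum_(i < m) h (p i) * (x / k.+1%:R) <= prim (p m) <=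
    \sum_(i < m) h (p i) * (x / k.+1%:R) + h (p m) * (x / k.+1%:R).
  by have := H k.+1; rewrite /p divff// mul1r mulrA.
elim: m => [|m /andP[IH1 IH2]]; first by rewrite big_ord0 /p !mul0r prim0 odd0 mul0r addr0 lexx.
have := prim_sub (p m) (p m.+1); have := prim_sub (p m.+1) (p m).
rewrite big_ord_recr /= -(opprB (p m.+1)) !pS.
set t := x / _ in IH1 IH2 *; set S := \sum_(i < m) _ in IH1 IH2 *; move=> h1 h2.
by apply/andP; split; lra.
Qed.

Lemma riemann_sum_cvg x : riemann_sum k x @[k --> \oo] --> prim x.
Proof.
have c0 : h x * x / k.+1%:R @[k --> \oo] --> 0.
  by rewrite -(mulr0 (h x * x)); apply: cvgM; [exact: cvg_cst|exact: cvg_harmonic].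
apply: (@squeeze_cvgr _ _ _ _ (fun k => prim x - h x * x / k.+1%:R) (fun=> prim x)).
- by apply: nearW => k; have /andP[h1 h2] := riemann_sum_bounds k x; rewrite h1 lerBlDr h2.
- by rewrite -{2}(subr0 (prim x)); apply: cvgB => //; exact: cvg_cst.
- exact: cvg_cst.
Qed.

End monotone.
End primitive.

Section caratheodory.
Context d (T : measurableType d) (R : realType) (al : T -> R -> R).
Hypothesis al_m : forall xi, measurable_fun setT (al^~ xi).
Hypothesis al_c : forall z, continuous (al z).

(** Rounding [f] down to multiples of [1 / (k + 1)] leaves countably many values, for which
    measurability at fixed [xi] suffices; continuity in [xi] passes to the limit. *)
Lemma measurable_superposition (f : T -> R) : measurable_fun setT f -> measurable_fun setT (fun z => al z (f z)).
Proof.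
move=> mf; pose fl (k : nat) z : R := (Num.floor (k.+1%:R * f z))%:~R / k.+1%:R.
apply: (@measurable_fun_cvg _ _ _ _ (fun k z => al z (fl k z))) => [k|z _]; last first.
  apply: (@cvg_comp _ _ _ (fun k => fl k z) (al z) _ (nbhs (f z))); last exact: al_c.
  apply: (@squeeze_cvgr _ _ _ _ (fun k => f z - k.+1%:R^-1) (fun=> f z)); last exact: cvg_cst.
    apply: nearW => k; have /andP[h1 h2] := floor_itv (k.+1%:R * f z).
    have k0 : 0 < k.+1%:R :> R by [].
    rewrite /fl ler_pdivrMr// [f z * _]mulrC h1 andbT ler_pdivlMr// mulrBl mulVf ?gt_eqF// mulrC.
    by rewrite lerBlDr ltW//; move: h2; rewrite intrD.
  by rewrite -{2}(subr0 (f z)); apply: cvgB; [exact: cvg_cst|exact: cvg_harmonic].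
move=> _ Y mY; rewrite setTI.
pose q (i : nat) : int := odflt 0 (unpickle i).
pose E i := [set z | (q i)%:~R <= k.+1%:R * f z < (q i + 1)%:~R].
have -> : (fun z => al z (fl k z)) @^-1` Y = \bigcup_i (E i `&` (al^~ ((q i)%:~R / k.+1%:R)) @^-1` Y).
  apply/seteqP; split => [z Yz|z [i _ [Ei Yi]]].
    exists (pickle (Num.floor (k.+1%:R * f z))) => //; rewrite /E /q /= pickleK /=; split => //.
    exact: floor_itv.
  by rewrite /preimage /= /fl (floor_def Ei).
apply: bigcupT_measurable => i; apply: measurableI; last by rewrite -[X in measurable X]setTI; exact: al_m.
have mkf : measurable_fun setT (fun z => k.+1%:R * f z) by exact: measurable_funM.
have -> : E i = (fun z => k.+1%:R * f z) @^-1` `[(q i)%:~R, (q i + 1)%:~R[%classic.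
  by apply/seteqP; split => z; rewrite /E /= in_itv.
by rewrite -[X in measurable X]setTI; apply: mkf.
Qed.

End caratheodory.

Section parametric.
Context d (T : measurableType d) (R : realType) (mu : {measure set T -> \bar R}).

Lemma integrable_dominated (f G : T -> R) : measurable_fun setT f -> measurable_fun setT G ->
  (\int[mu]_z (G z)%:E < +oo)%E -> (forall z, `|f z| <= G z) -> mu.-integrable setT (EFin \o f).
Proof.
move=> mf mG IG fG; apply/integrableP; split; first exact/measurable_EFinP.
by apply: le_lt_trans IG; apply: int_le => //; exact: measurableT_comp.
Qed.

Lemma ge0_Rintegral_fin (f : T -> R) : measurable_fun setT f -> (forall z, 0 <= f z) ->
  (\int[mu]_z (f z)%:E < +oo)%E -> (\int[mu]_z f z)%:E = (\int[mu]_z (f z)%:E)%E.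
Proof.
by move=> mf f0 If; rewrite /Rintegral fineK// ge0_fin_numE//; apply: int_ge0.
Qed.

Lemma parametric_continuous (V : normedModType R) (h : V -> T -> R) :
  (forall c, measurable_fun setT (h c)) -> (forall z, continuous (h^~ z)) ->
  (forall r : R, exists G : T -> R, [/\ measurable_fun setT G, (\int[mu]_z (G z)%:E < +oo)%E &
    forall c z, `|c| <= r -> `|h c z| <= G z]) ->
  continuous (fun c => \int[mu]_z h c z).
Proof.
move=> mh ch H c; apply/cvgrPdist_lt => e e0; apply: contrapT => N.
have Hk (k : nat) : exists u : V, `|c - u| < k.+1%:R^-1 /\ e <= `|\int[mu]_z h c z - \int[mu]_z h u z|.
  apply: contrapT => Nk; apply: N.
  have k0 : 0 < k.+1%:R^-1 :> R by rewrite invr_gt0.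
  have : \forall u \near c, `|c - u| < k.+1%:R^-1.
    by apply: (@cvgr_dist_lt _ _ _ (nbhs c) _ id) => //; exact: cvg_id.
  apply: filterS => u uk; rewrite ltNge; apply/negP => ge; apply: Nk.
  by exists u.
have [u Hu] := choice Hk.
have cu : u @ \oo --> c.
  apply/cvgrPdist_lt => r r0; have [N1 _ HN] := near_infty_natSinv_lt (PosNum r0).
  exists N1 => // k Nk; have [uk _] := Hu k; apply: lt_trans uk _; exact: (HN k Nk).
have [G [mG IG GP]] := H (`|c| + 1).
have G0 z : 0 <= G z by apply: le_trans (GP c z _); rewrite ?lerDl.
have uc k : `|u k| <= `|c| + 1.
  have [uk _] := Hu k; rewrite -[u k](subrK c); apply: le_trans (ler_normD _ _) _.
  rewrite addrC lerD2l distrC; apply: le_trans (ltW uk) _.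
  by rewrite invf_le1// ler1n.
have [] := @dominated_convergence _ _ _ mu setT measurableT (fun k => EFin \o h (u k)) (EFin \o h c) (EFin \o G).
- by move=> k; exact/measurable_EFinP.
- exact/measurable_EFinP.
- apply: aeW => z _; apply: cvg_EFin; first exact: nearW.
  apply: (@cvg_comp _ _ _ u (h^~ z) _ (nbhs c)) => //; exact: ch.
- by apply/integrableP; split; [exact/measurable_EFinP|under eq_integral do rewrite /= ger0_norm//].
- by apply: aeW => z k _; rewrite /= lee_fin; exact: GP.
move=> ic _.
have fin : (\int[mu]_z (h c z)%:E)%E \is a fin_num by exact: integrable_fin_num.
have -> : (\int[mu]_z (EFin \o h c) z = (\int[mu]_z h c z)%:E)%E by rewrite /Rintegral fineK.
move=> /fine_cvg/cvgrPdist_lt/(_ _ e0)[N2 _ HN2].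
have [_ He] := Hu N2; have := HN2 N2 (leqnn N2).
by rewrite /= -/(Rintegral mu setT (h (u N2))) ltNge He.
Qed.

End parametric.

Section operator.
Context d (T : measurableType d) (R : realType) (mu : {measure set T -> \bar R}) (M : R -> R).
Hypothesis youngM : young M.
Local Notation Mbar := (complementary M).
Local Notation Minv := (complementary_inv M).
Local Notation M_ge0 := (young_ge0 youngM).

Definition EM (f : T -> R) := measurable_fun setT f /\
  forall k, 0 < k -> (\int[mu]_z (M (k * f z))%:E < +oo)%E.

Let mM (f : T -> R) k : measurable_fun setT f -> measurable_fun setT (fun z => M (k * f z)).
Proof. by move=> mf; apply: (measurableT_comp (measurable_young youngM)); exact: measurable_funM. Qed.

Lemma EM0 : EM (fun=> 0).
Proof.
split; first exact: measurable_cst.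
by move=> k _; under eq_integral do rewrite mulr0 young0//; rewrite integral0 ltry.
Qed.

Lemma EM_le (f g : T -> R) : measurable_fun setT f -> EM g -> (forall z, `|f z| <= `|g z|) -> EM f.
Proof.
move=> mf [mg Ig] fg; split => // k k0; apply: le_lt_trans (Ig k k0).
apply: int_le => [||z|z]; [exact: mM|exact: mM|exact: M_ge0|].
by apply: young_le => //; rewrite !normrM ler_wpM2l.
Qed.

Lemma EM_abs (f : T -> R) : EM f -> EM (fun z => `|f z|).
Proof. by move=> ef; apply: EM_le (ef) _ => [|z]; rewrite ?normr_id//; apply: measurableT_comp => //; case: ef. Qed.

Lemma EMD (f g : T -> R) : EM f -> EM g -> EM (fun z => f z + g z).
Proof.
move=> [mf If] [mg Ig]; split; first exact: measurable_funD.
move=> k k0; have k20 : 0 < 2 * k by rewrite mulr_gt0.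
apply: (@le_lt_trans _ _ (\int[mu]_z (M (2 * k * f z) + M (2 * k * g z))%:E)%E).
  apply: int_le => [||z|z]; [by apply: mM; exact: measurable_funD|by apply: measurable_funD; exact: mM|exact: M_ge0|].
  rewrite mulrDr; apply: le_trans (young_half youngM _ _) _; rewrite !mulrA.
  by have := M_ge0 (2 * k * f z); have := M_ge0 (2 * k * g z); lra.
rewrite intD//; [|exact: mM|exact: mM|by move=> z; exact: M_ge0|by move=> z; exact: M_ge0].
by rewrite lte_add_pinfty ?If ?Ig.
Qed.

Lemma EMZ (a : R) (f : T -> R) : EM f -> EM (fun z => a * f z).
Proof.
move=> [mf If]; split; first exact: measurable_funM.
move=> k k0; have k1 : 0 < k * (`|a| + 1) by rewrite mulr_gt0// ltr_wpDl.
apply: le_lt_trans (If _ k1); apply: int_le => [||z|z]; [by apply: mM; exact: measurable_funM|exact: mM|exact: M_ge0|].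
apply: young_le => //; rewrite !normrM !(ger0_norm (ltW k0)) mulrA ler_wpM2r// ler_pM2l//.
by rewrite [leRHS]ger0_norm ?addr_ge0// lerDl.
Qed.

Lemma EM_sum (k : nat) (F : 'I_k -> T -> R) : (forall i, EM (F i)) -> EM (fun z => \sum_i F i z).
Proof.
move=> H; suff: forall r : seq 'I_k, EM (fun z => \sum_(i <- r) F i z) by apply.
elim=> [|i r IH]; first by under eq_fun do rewrite big_nil; exact: EM0.
by under eq_fun do rewrite big_cons; exact: EMD.
Qed.

Variables (al : T -> R -> R) (D : T -> R) (b0 c0 : R).
Hypothesis al_m : forall xi, measurable_fun setT (al^~ xi).
Hypothesis al_c : forall z, continuous (al z).
Hypothesis al_odd : forall z xi, al z (- xi) = - al z xi.
Hypothesis al_mono : forall z x y, x <= y -> al z x <= al z y.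
Hypothesis b00 : 0 < b0.
Hypothesis c00 : 0 < c0.
Hypothesis mD : measurable_fun setT D.
Hypothesis ID : (\int[mu]_z (Mbar (D z))%:E < +oo)%E.
Hypothesis al_le : forall z xi, `|al z xi| <= D z + b0 * Minv (M (c0 * xi)).

Let mal f : measurable_fun setT f -> measurable_fun setT (fun z => al z (f z)).
Proof. exact: measurable_superposition. Qed.

Let mDb : measurable_fun setT (fun z => Mbar (D z)).
Proof. exact: (measurableT_comp (measurable_complementary youngM)). Qed.

(** What Young's inequality gives for [al z xi * t] from the two terms of the growth condition; it
    is the dominating function for everything on finite spans. *)
Definition op_bound (z : T) (xi t : R) := Mbar (D z) + ((1 + b0) * M t + b0 * M (c0 * xi)).

Lemma op_boundP (z : T) (xi t : R) : `|al z xi * t| <= op_bound z xi t.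
Proof.
have h1 := young_ineq youngM t (D z).
have h2 := complementary_inv_ineq youngM t (M_ge0 (c0 * xi)).
rewrite normrM; apply: le_trans (ler_wpM2r (normr_ge0 t) (al_le z xi)) _.
rewrite mulrDl /op_bound; have h3 : D z * `|t| <= M t + Mbar (D z).
  by apply: le_trans h1; rewrite normrM mulrC ler_wpM2l// ler_norm.
have h4 : b0 * Minv (M (c0 * xi)) * `|t| <= b0 * (M t + M (c0 * xi)).
  by rewrite -mulrA ler_pM2l// mulrC.
lra.
Qed.

Lemma op_bound_int (f eta : T -> R) : EM f -> EM eta -> measurable_fun setT (fun z => op_bound z (f z) (eta z)) /\
  (\int[mu]_z (op_bound z (f z) (eta z))%:E < +oo)%E.
Proof.
move=> [mf If] [me Ie].
have m1 : measurable_fun setT (fun z => (1 + b0) * M (eta z)).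
  by apply: measurable_funM => //; have := mM 1 me; under eq_fun do rewrite mul1r.
have m2 : measurable_fun setT (fun z => b0 * M (c0 * f z)) by apply: measurable_funM => //; exact: mM.
have p1 z : 0 <= (1 + b0) * M (eta z) by rewrite mulr_ge0 ?M_ge0// addr_ge0// ltW.
have p2 z : 0 <= b0 * M (c0 * f z) by rewrite mulr_ge0 ?M_ge0// ltW.
split; first by apply: measurable_funD => //; exact: measurable_funD.
rewrite intD//; [|exact: measurable_funD|by move=> z; exact: complementary_ge0|by move=> z; exact: addr_ge0].
apply: lte_add_pinfty => //; rewrite intD//; apply: lte_add_pinfty.
  have me1 : measurable_fun setT (fun z => M (eta z)) by have := mM 1 me; under eq_fun do rewrite mul1r.
  rewrite (intZ mu me1 (fun z => M_ge0 _) (addr_ge0 ler01 (ltW b00))).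
  apply: lte_mul_pinfty; rewrite ?lee_fin ?addr_ge0 ?(ltW b00)//.
  by have := Ie 1 ltr01; under eq_integral do rewrite mul1r.
rewrite (intZ mu (mM c0 mf) (fun z => M_ge0 _) (ltW b00)).
by apply: lte_mul_pinfty; rewrite ?lee_fin ?(ltW b00)// If.
Qed.

Lemma op_integrable (f eta : T -> R) : EM f -> EM eta -> mu.-integrable setT (EFin \o (fun z => al z (f z) * eta z)).
Proof.
move=> ef ee; have [m1 I1] := op_bound_int ef ee.
apply: integrable_dominated m1 I1 _ => [|z]; last exact: op_boundP.
by apply: measurable_funM; [apply: mal; case: ef|case: ee].
Qed.

Definition potential (f : T -> R) : R := \int[mu]_z prim (al z) (f z).

Let al0 z xi : 0 <= prim (al z) xi.
Proof. exact: (prim_ge0 (al_odd z) (@al_c z) (@al_mono z)). Qed.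

Let alle z xi : prim (al z) xi <= al z xi * xi.
Proof. exact: (prim_le (al_odd z) (@al_c z) (@al_mono z)). Qed.

Lemma measurable_prim f : measurable_fun setT f -> measurable_fun setT (fun z => prim (al z) (f z)).
Proof.
move=> mf; apply: (@measurable_fun_cvg _ _ _ _ (fun k z => riemann_sum (al z) k (f z))) => [k|z _]; last first.
  exact: (riemann_sum_cvg (al_odd z) (@al_c z) (@al_mono z)).
apply: measurable_sum => i; apply: measurable_funM; last exact: measurable_funM.
by apply: mal; exact: measurable_funM.
Qed.

Lemma potential_integrable f : EM f -> mu.-integrable setT (EFin \o (fun z => prim (al z) (f z))).
Proof.
move=> ef; have [m1 I1] := op_bound_int ef ef.
apply: integrable_dominated m1 I1 _ => [|z]; first by apply: measurable_prim; case: ef.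
rewrite (ger0_norm (al0 _ _)); apply: le_trans (alle _ _) _; apply: le_trans (ler_norm _) _; exact: op_boundP.
Qed.

(** The pointwise subgradient inequality integrated; all integrals are finite because [f] and [g]
    have finite modulars at every scale. *)
Lemma potential_sub (f g : T -> R) : EM f -> EM g ->
  potential f + \int[mu]_z (al z (f z) * (g z - f z)) <= potential g.
Proof.
move=> ef eg; have egf : EM (fun z => g z - f z).
  by have := EMD eg (EMZ (-1) ef); under eq_fun do rewrite mulN1r.
rewrite -RintegralD//; [|exact: potential_integrable|exact: op_integrable].
apply: le_Rintegral => //; [|exact: potential_integrable|].
  rewrite (_ : _ \o _ = (EFin \o (fun z => prim (al z) (f z))) \+ (EFin \o (fun z => al z (f z) * (g z - f z))))//.
  by apply: integrableD => //; [exact: potential_integrable|exact: op_integrable].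
by move=> z _; exact: (prim_sub (al_odd z) (@al_c z) (@al_mono z)).
Qed.

Lemma potential0 : potential (fun=> 0) = 0.
Proof. by rewrite /potential; under eq_Rintegral do rewrite prim0; rewrite /Rintegral integral0. Qed.

Lemma potentialN f : potential (fun z => - f z) = potential f.
Proof. by rewrite /potential; under eq_Rintegral do rewrite primN. Qed.

Lemma potential_coercive (f : T -> R) (th c1 : R) : EM f -> 0 < th -> 0 < c1 ->
  {ae mu, forall z, forall xi, th * M (c1 * xi) <= al z xi * xi} ->
  (\int[mu]_z (th * M (c1 / 2 * f z))%:E <= (potential f)%:E)%E.
Proof.
move=> ef th0 c10 H; have [mf _] := ef.
have mp := measurable_prim mf.
have Ip : (\int[mu]_z (prim (al z) (f z))%:E < +oo)%E.
  have /integrableP[_] := potential_integrable ef.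
  by under eq_integral do rewrite /= (ger0_norm (al0 _ _)).
rewrite /potential ge0_Rintegral_fin//; apply: ae_ge0_le_integral => //.
- by move=> z _; rewrite lee_fin mulr_ge0 ?(ltW th0)// M_ge0.
- by apply/measurable_EFinP; apply: measurable_funM => //; exact: mM.
- by move=> z _; rewrite lee_fin.
- exact/measurable_EFinP.
- apply: filterS H => z Hz _; rewrite lee_fin; have -> : c1 / 2 * f z = c1 * (f z / 2) by field.
  by apply: le_trans (Hz _) _; exact: (prim_half (al_odd z) (@al_c z) (@al_mono z)).
Qed.

Section coordinates.
Context (k : nat) (psi : 'I_k -> T -> R).
Hypothesis psi_EM : forall j, EM (psi j).
Local Notation V := 'rV[R]_k.

Definition lincomb (c : V) z : R := \sum_j c ord0 j * psi j z.

Lemma lincomb_EM c : EM (lincomb c).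
Proof. by apply: EM_sum => j; apply: EMZ. Qed.

Lemma continuous_lincomb z : continuous (lincomb^~ z).
Proof.
move=> c; apply: (@cvg_big R _ +%R 0 predT add_continuous _ (nbhs c)) => j _.
by apply: (@cvgM _ _ (nbhs c)); [exact: coord_continuous|exact: cvg_cst].
Qed.

Lemma lincomb_le (r : R) c z : `|c| <= r -> `|lincomb c z| <= r * \sum_j `|psi j z|.
Proof.
move=> cr; apply: le_trans (ler_norm_sum _ _ _) _; rewrite mulr_sumr; apply: ler_sum => j _.
by rewrite normrM ler_wpM2r// (le_trans _ cr)// coord_le_norm.
Qed.

Let Psi z : R := \sum_j `|psi j z|.
Let Psi_EM : EM Psi. Proof. by apply: EM_sum => j; exact: EM_abs. Qed.
Let Psi0 z : 0 <= Psi z. Proof. exact: sumr_ge0. Qed.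

Let dominated (r : R) c z t : `|c| <= r -> op_bound z (lincomb c z) t <= op_bound z (r * Psi z) t.
Proof.
move=> cr; rewrite /op_bound !lerD2l ler_pM2l//; apply: young_le => //.
rewrite !normrM ler_wpM2l//; apply: le_trans (lincomb_le _ cr) _.
by rewrite (ger0_norm (Psi0 z)); apply: ler_wpM2r; [exact: Psi0|exact: ler_norm].
Qed.

Lemma op_continuous (eta : T -> R) : EM eta -> continuous (fun c : V => \int[mu]_z (al z (lincomb c z) * eta z)).
Proof.
move=> ee; apply: parametric_continuous => [c|z c|r].
- by apply: measurable_funM; [apply: mal; case: (lincomb_EM c)|case: ee].
- apply: (@cvgM _ _ (nbhs c)); last exact: cvg_cst.
  apply: (@cvg_comp _ _ _ (lincomb^~ z) (al z) (nbhs c) (nbhs (lincomb c z))); last exact: al_c.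
  exact: continuous_lincomb.
- have [m1 I1] := op_bound_int (EMZ r Psi_EM) ee.
  exists (fun z => op_bound z (r * Psi z) (eta z)); split => // c z cr.
  by apply: le_trans (op_boundP _ _ _) (dominated _ _ cr).
Qed.

Lemma continuous_prim z : continuous (prim (al z)).
Proof.
have H x y : `|prim (al z) y - prim (al z) x| <= (`|al z x| + `|al z y|) * `|y - x|.
  have h1 := prim_sub (al_odd z) (@al_c z) (@al_mono z) x y.
  have h2 := prim_sub (al_odd z) (@al_c z) (@al_mono z) y x.
  have p1 : al z x * (y - x) >= - (`|al z x| * `|y - x|) by rewrite lerNl -normrM -mulNr -normrN -mulNr ler_norm.
  have p2 : al z y * (x - y) >= - (`|al z y| * `|y - x|).
    by rewrite [`|y - x|]distrC lerNl -normrM -mulNr -normrN -mulNr ler_norm.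
  have q1 := mulr_ge0 (normr_ge0 (al z x)) (normr_ge0 (y - x)).
  have q2 := mulr_ge0 (normr_ge0 (al z y)) (normr_ge0 (y - x)).
  by rewrite ler_norml mulrDl; apply/andP; split; lra.
move=> x; apply: (@cvg_zero _ _ _ (nbhs x)).
apply/norm_cvg0P; apply: (@squeeze_cvgr _ _ _ _ (fun=> 0) (fun y => (`|al z x| + `|al z y|) * `|y - x|)).
- by apply: nearW => y; rewrite normr_ge0 /=; exact: H.
- exact: cvg_cst.
- rewrite -(mulr0 (`|al z x| + `|al z x|)); apply: (@cvgM _ _ (nbhs x)).
    apply: (@cvgD _ _ _ (nbhs x)); [exact: cvg_cst|].
    by apply: (@cvg_comp _ _ _ (al z) (fun t => `|t|) _ (nbhs (al z x))); [exact: al_c|exact: norm_continuous].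
  rewrite -(normr0 R) -(subrr x); apply: (@cvg_norm _ _ _ (nbhs x)).
  by apply: (@cvgB _ _ _ (nbhs x)); [exact: cvg_id|exact: cvg_cst].
Qed.

Lemma potential_continuous : continuous (fun c : V => potential (lincomb c)).
Proof.
apply: parametric_continuous => [c|z c|r].
- by apply: measurable_prim; case: (lincomb_EM c).
- apply: (@cvg_comp _ _ _ (lincomb^~ z) (prim (al z)) (nbhs c) (nbhs (lincomb c z))); last exact: continuous_prim.
  exact: continuous_lincomb.
- have [m1 I1] := op_bound_int (EMZ r Psi_EM) (EMZ r Psi_EM).
  exists (fun z => op_bound z (r * Psi z) (r * Psi z)); split => // c z cr.
  rewrite (ger0_norm (al0 _ _)); apply: le_trans (alle _ _) _; apply: le_trans (ler_norm _) _.
  apply: le_trans (op_boundP _ _ _) _; apply: le_trans (dominated _ _ cr) _.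
  rewrite /op_bound lerD2l lerD2r ler_wpM2l ?addr_ge0 ?(ltW b00)//; apply: young_le => //.
  apply: le_trans (lincomb_le _ cr) _; exact: ler_norm.
Qed.

End coordinates.
End operator.

Section dot_integral.
Context d (T : measurableType d) (R : realType) (mu : {measure set T -> \bar R}).

Lemma dotv_integral (D : set T) (k : nat) (psi : 'I_k -> T -> R) (F : T -> R) (w : 'rV[R]_k) : measurable D ->
  (forall j, mu.-integrable D (EFin \o (fun z => F z * psi j z))) ->
  dotv (\row_j \int[mu]_(z in D) (F z * psi j z)) w = \int[mu]_(z in D) (F z * lincomb psi w z).
Proof.
move=> mD iF; rewrite /dotv.
have iZ j : mu.-integrable D (EFin \o (fun z => w ord0 j * (F z * psi j z))).
  exact: (integrableZl mD (w ord0 j) (iF j)).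
have -> : (fun z => F z * lincomb psi w z) = (fun z => \sum_j w ord0 j * (F z * psi j z)).
  by apply/funext => z; rewrite /lincomb mulr_sumr; apply: eq_bigr => j _; rewrite mulrCA.
rewrite (_ : \int[mu]_(z in D) (\sum_j w ord0 j * (F z * psi j z)) =
    \sum_j \int[mu]_(z in D) (w ord0 j * (F z * psi j z))); last first.
  elim: (index_enum _) => [|i r IH].
    by under eq_Rintegral do rewrite big_nil; rewrite /Rintegral integral0 big_nil.
  under eq_Rintegral do rewrite big_cons; rewrite RintegralD// ?IH ?big_cons//.
  rewrite (_ : _ \o _ = (fun z => \sum_(j <- r) (w ord0 j * (F z * psi j z))%:E)%E).
    by apply: integrable_sum => // j _; exact: iZ.
  by apply/funext => z; rewrite /= sumEFin.
by apply: eq_bigr => j _; rewrite mxE RintegralZl// mulrC.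
Qed.

End dot_integral.

End Superposition.
Import Superposition.

Module Sources.

Section integral_convergence.
Context d (T : measurableType d) (R : realType) (mu : {measure set T -> \bar R}).

Lemma Rintegral_cvg (h_ : nat -> T -> R) (h : T -> R) : (forall k, measurable_fun setT (h_ k)) ->
  mu.-integrable setT (EFin \o h) ->
  (forall e, 0 < e -> exists N : nat, forall k, (N <= k)%N -> (\int[mu]_x (`|h_ k x - h x|)%:E <= e%:E)%E) ->
  \int[mu]_x h_ k x @[k --> \oo] --> \int[mu]_x h x.
Proof.
move=> mh_ ih H; have /integrableP[/measurable_EFinP mh Ih] := ih.
have mB k : measurable_fun setT (fun x => h_ k x - h x) by exact: measurable_funB.
apply/cvgrPdist_le => e e0; have [N HN] := H e e0; exists N => // k Nk.
have IB : mu.-integrable setT (EFin \o (fun x => h_ k x - h x)).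
  by apply/integrableP; split; [exact/measurable_EFinP|apply: le_lt_trans (HN k Nk) (ltry _)].
have ik : mu.-integrable setT (EFin \o h_ k).
  have := integrableD measurableT IB ih; congr (integrable _ _ _).
  by apply/funext => x; rewrite /= -EFinD subrK.
rewrite distrC -RintegralB//; apply: le_trans (le_normr_Rintegral measurableT IB) _.
rewrite -lee_fin ge0_Rintegral_fin//; first exact: HN.
- exact: measurableT_comp.
- by apply: le_lt_trans (HN k Nk) (ltry _).
Qed.

Lemma ge0_Rintegral_eq0 (f : T -> R) : mu.-integrable setT (EFin \o f) -> (forall x, 0 <= f x) ->
  \int[mu]_x f x <= 0 -> {ae mu, forall x, f x = 0}.
Proof.
move=> iF f0 I0; have /integrableP[mf If] := iF.
have If0 : (\int[mu]_x `|(EFin \o f) x| = 0)%E.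
  have E : (\int[mu]_x `|(EFin \o f) x| = \int[mu]_x (f x)%:E)%E.
    by apply: eq_integral => x _; rewrite /= ger0_norm.
  rewrite E; apply/eqP; rewrite eq_le; apply/andP; split; last by apply: integral_ge0 => x _; rewrite lee_fin.
  rewrite -ge0_Rintegral_fin// ?lee_fin//; first exact/measurable_EFinP.
  by rewrite -E.
have := (ae_eq_integral_abs mu measurableT mf).1 If0.
by apply: ae_imp => x /(_ Logic.I) /= [].
Qed.

Lemma young_cvg0 (M : R -> R) (u : nat -> R) : young M -> M (u k) @[k --> \oo] --> 0 -> u k @[k --> \oo] --> 0.
Proof.
move=> youngM /cvgrPdist_lt H; apply/cvgrPdist_lt => e e0.
have Me : 0 < M e by apply: young_gt0; rewrite ?gt_eqF.
have [N _ HN] := H _ Me; exists N => // k /HN /=; rewrite !sub0r !normrN => Hk.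
rewrite ltNge; apply/negP => ue; move: Hk; rewrite ltNge => /negP; apply.
by apply: le_trans (ler_norm _); apply: young_le => //; rewrite gtr0_norm.
Qed.

Lemma ae_cvg0_summable (M : R -> R) (u : nat -> T -> R) : young M -> (forall k, measurable_fun setT (u k)) ->
  (forall k, \int[mu]_x (M (u k x))%:E <= (2^-1 ^+ k)%:E)%E -> {ae mu, forall x, u k x @[k --> \oo] --> 0}.
Proof.
move=> youngM mu_ Iu; pose F k x := (M (u k x))%:E.
have mF k : measurable_fun setT (F k).
  by apply/measurable_EFinP; exact: (measurableT_comp (measurable_young youngM)).
have F0 k x : (0 <= F k x)%E by rewrite lee_fin young_ge0.
have mS : measurable_fun setT (fun x => \sum_(0 <= k <oo) F k x)%E by apply: ge0_emeasurable_sum => // k x _ _; exact: F0.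
have I : mu.-integrable setT (fun x => \sum_(0 <= k <oo) F k x)%E.
  apply/integrableP; split => //.
  under eq_integral do rewrite gee0_abs ?nneseries_ge0//.
  rewrite integral_nneseries//.
  have S j : (\sum_(0 <= k < j) \int[mu]_x F k x <= 2%:E)%E.
    apply: (@le_trans _ _ (\sum_(0 <= k < j) 2^-1 ^+ k)%:E).
      by rewrite -sumEFin; apply: lee_sum => k _; exact: Iu.
    rewrite lee_fin; have -> : \sum_(0 <= k < j) 2^-1 ^+ k = 2 - 2 * 2^-1 ^+ j :> R.
      elim: j => [|j IH]; first by rewrite big_geq// expr0; ring.
      by rewrite big_nat_recr//= IH exprS; field.
    by rewrite gerBl mulr_ge0// exprn_ge0// invr_ge0.
  apply: (@le_lt_trans _ _ 2%:E); last exact: ltry.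
  apply: lime_le; first by apply: is_cvg_nneseries => k _ _; apply: integral_ge0.
  by apply: nearW => j; exact: S.
have := integrable_ae measurableT I; apply: ae_imp => x /(_ Logic.I) fin.
apply: (young_cvg0 youngM); apply: (@cvg_series_cvg_0 R R^o).
apply: nondecreasing_is_cvgn.
  by apply: nondecreasing_series => k _ _; exact: young_ge0.
exists (fine (\sum_(0 <= k <oo) F k x)%E) => _ [k _ <-].
rewrite -lee_fin fineK//; apply: (@le_trans _ _ (\sum_(0 <= j < k) F j x)%E); first by rewrite /F sumEFin.
exact: nneseries_lim_ge.
Qed.

End integral_convergence.

(** * The source term *)

Section source.
Context (R : realType) (n : nat) (s : R) (M : R -> R).
Hypothesis n0 : (0 < n)%N.
Hypothesis s01 : 0 < s < 1.
Hypothesis youngM : young M.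
Local Notation la := (lebesgue_rV R n).
Local Notation X := 'rV[R]_n.
Local Notation Mbar := (complementary M).
Local Notation Minv := (complementary_inv M).
Local Notation M_ge0 := (young_ge0 youngM).
Local Notation amod := (@amod R n M).
Context (b : nat) (Omega : set X).
Hypothesis Omega_b : forall x, Omega x -> `|x| <= b%:R.
Hypothesis Omega_open : open Omega.

Lemma ae_open_point (O : set X) (x0 : X) (P : X -> Prop) : open O -> O x0 -> {ae la, forall x, P x} ->
  exists x, O x /\ P x.
Proof.
move=> oO Ox0 [N [mN N0 HN]].
have /nbhs_ballP[r r0 Hr] : nbhs x0 O by exact: open_nbhs_nbhs.
have r20 : 0 < r / 2 by rewrite divr_gt0.
apply: contrapT => H.
have cN : cube x0 (r / 2) `<=` N.
  move=> x xc; apply: HN => Px; apply: H; exists x; split => //; apply: Hr.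
  rewrite -ball_normE /=; move: xc; rewrite /cube /= distrC => xc; apply: le_lt_trans xc _.
  by rewrite ltr_pdivrMr// mulr_natr mulr2n ltrDl.
have : (la (cube x0 (r / 2)) <= la N)%E by apply: le_measure => //; rewrite inE//; exact: measurable_cube.
rewrite N0 (lebesgue_cube _ (ltW r20)) leNgt lte_fin exprn_gt0//.
by rewrite mulrCA divff ?mulr1 ?gt_eqF.
Qed.

(** The growth condition holds for almost every [x] but bounds a function of [t] alone: fixing one
    good [x] in the open set turns [e] into a constant. Young's inequality then removes the
    complementary function. *)
Lemma source_bound (g : R -> R) : admissible_source M Omega g -> Omega !=set0 ->
  exists A C, [/\ 0 < A, 0 < C & forall t t', `|g t * t'| <= C * (1 + M (A * t) + M (A * t'))].
Proof.
move=> [g_odd _ _ [a1 [a2 [a3 [e [[a10 a20 a30] _ /ae_dx_inv HNae]]]]]] [x0 Ox0].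
have [x [xO Nx]] := ae_open_point Omega_open Ox0 HNae.
have Hg : forall t : R, 0 <= t -> `|g t| <= e x + a1 * Minv (a2 * M (a3 * t)) by exact: Nx.
pose E : R := `|e x|; pose A : R := Num.max 1 a3.
have A0 : 0 < A by rewrite lt_max ltr01.
have MA t : M t <= M (A * t).
  by apply: young_le => //; rewrite normrM ler_peMl// ger0_norm ?(ltW A0)// le_max lexx.
have M3 t : M (a3 * t) <= M (A * t).
  apply: young_le => //; rewrite !normrM ler_wpM2r// !ger0_norm ?(ltW A0) ?(ltW a30)//.
  by rewrite le_max lexx orbT.
pose C : R := E * Mbar 1 + E + a1 + a1 * a2.
have c1 : (0 : R) <= E * Mbar 1 by apply: mulr_ge0; [exact: normr_ge0|exact: (complementary_ge0 youngM (1 : R))].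
have c2 : 0 <= E by rewrite /E.
have c3 : 0 < a1 * a2 by rewrite mulr_gt0.
have C0 : 0 < C by rewrite /C; lra.
exists A, C; split => // t t'.
have gt : `|g t| <= E + a1 * Minv (a2 * M (a3 * t)).
  have -> : `|g t| = `|g `|t| | by case: (ger0P t) => // _; rewrite g_odd normrN.
  have -> : M (a3 * t) = M (a3 * `|t|) by rewrite -(young_abs youngM (a3 * t)) normrM (gtr0_norm a30).
  by apply: le_trans (Hg _ (normr_ge0 t)) _; rewrite lerD2r ler_norm.
have y0 : 0 <= a2 * M (a3 * t) by rewrite mulr_ge0 ?M_ge0// ltW.
have h1 := complementary_inv_ineq youngM t' y0.
have h2 := abs_le_young youngM t' ltr01; move: h2; rewrite invr1 !mul1r => h2.
rewrite normrM; apply: le_trans (ler_wpM2r (normr_ge0 t') gt) _.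
rewrite mulrDl -mulrA [Minv _ * _]mulrC.
apply: (@le_trans _ _ (E * (Mbar 1 + M (A * t')) + a1 * (M (A * t') + a2 * M (A * t)))).
  apply: lerD; first by rewrite ler_wpM2l//; apply: le_trans h2 _; rewrite lerD2l.
  rewrite ler_pM2l//; apply: le_trans h1 _; apply: lerD => //; by rewrite ler_pM2l.
have p := M_ge0 (A * t); have p' := M_ge0 (A * t').
set m := M (A * t) in p *; set m' := M (A * t') in p' *.
have q1 := mulr_ge0 c1 p; have q2 := mulr_ge0 c1 p'; have q3 := mulr_ge0 c2 p; have q4 := mulr_ge0 (ltW a10) p.
have q5 := mulr_ge0 (ltW c3) p'.
rewrite /C; clear gt h1 h2 Hg C0 C; clearbody E m m'; lra.
Qed.

Variables (g : R -> R) (A C : R).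
Hypothesis g_odd : forall t, g (- t) = - g t.
Hypothesis g_cont : continuous g.
Hypothesis g_pos : forall t, 0 < t -> 0 < g t.
Hypothesis A0 : 0 < A.
Hypothesis C0 : 0 < C.
Hypothesis g_bound : forall t t', `|g t * t'| <= C * (1 + M (A * t) + M (A * t')).
Local Notation G := (prim g).

Lemma source_mul_gt0 t : t != 0 -> 0 < g t * t.
Proof.
move=> t0; have [tp|tn|/eqP] := ltgtP 0 t; last by rewrite eq_sym (negbTE t0).
  by rewrite mulr_gt0 ?g_pos.
by rewrite -[t]opprK g_odd mulrNN mulr_gt0 ?g_pos ?oppr_gt0.
Qed.

Lemma source_mul_ge0 t : 0 <= g t * t.
Proof. by have [->|/source_mul_gt0/ltW//] := eqVneq t 0; rewrite mulr0. Qed.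

Lemma prim_abs t : G `|t| = G t.
Proof. by rewrite /prim normr_id. Qed.

Let prim_lower (x y m : R) : x <= y -> (forall t, x <= t <= y -> m <= g t) -> m * (y - x) <= G y - G x.
Proof.
move=> xy H; have [c _ Hc] := EVT_max xy (continuous_subspaceT g_cont).
have := @prim_between _ g g_odd g_cont x y m (g c) xy _ => /(_ _)/andP[|//].
by move=> t tI; rewrite H//= Hc// in_itv.
Qed.

Lemma prim_source_mono x y : `|x| <= `|y| -> G x <= G y.
Proof.
rewrite -(prim_abs x) -(prim_abs y) => xy; rewrite -subr_ge0.
have := @prim_lower _ _ 0 xy; rewrite mul0r; apply => t /andP[xt _].
have := le_trans (normr_ge0 x) xt; rewrite le_eqVlt => /predU1P[<-|/g_pos/ltW//].
by rewrite (odd0 g_odd).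
Qed.

Lemma prim_source_ge0 t : 0 <= G t.
Proof. by rewrite -(prim0 g) prim_source_mono// normr0. Qed.

Lemma prim_source_gt0 t : t != 0 -> 0 < G t.
Proof.
move=> t0; rewrite -prim_abs; have tp : 0 < `|t| by rewrite normr_gt0.
have t2 : `|t| / 2 <= `|t| by lra.
have [c cI Hc] := EVT_min t2 (continuous_subspaceT g_cont).
have gc : 0 < g c by apply: g_pos; move: cI; rewrite in_itv/= => /andP[+ _]; lra.
have H : g c * (`|t| - `|t| / 2) <= G `|t| - G (`|t| / 2).
  by apply: prim_lower => // u uI; rewrite Hc// in_itv.
have := prim_source_ge0 (`|t| / 2).
have : 0 < g c * (`|t| - `|t| / 2) by rewrite mulr_gt0//; lra.
by move: (G _) H => a; move: (G _) => a'; move: (_ * _) => p; lra.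
Qed.

Lemma prim_source_le t : G t <= C * (1 + 2 * M (A * t)).
Proof.
rewrite -prim_abs -(young_abs youngM) normrM (gtr0_norm A0); set r := `|t|.
have [r0|r0] := eqVneq r 0.
  by rewrite r0 prim0 mulr_ge0 ?(ltW C0)// addr_ge0// mulr_ge0// M_ge0.
have rp : 0 < r by rewrite lt_neqAle eq_sym r0 /r normr_ge0.
have := @prim_between _ g g_odd g_cont 0 r (- (C * (1 + 2 * M (A * r)) / r)) (C * (1 + 2 * M (A * r)) / r) (ltW rp) _.
move=> /(_ _)/andP[|_]; last by rewrite prim0 !subr0 divfK.
move=> t' /andP[t0 tr]; rewrite -ler_norml ler_pdivlMr//.
have -> : `|g t'| * r = `|g t' * r| by rewrite normrM (gtr0_norm rp).
apply: le_trans (g_bound _ _) _; rewrite ler_pM2l//.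
have : M (A * t') <= M (A * r).
  by apply: young_le => //; rewrite !normrM ler_wpM2l// !ger0_norm// ltW.
by move=> ?; lra.
Qed.

Lemma prim_source_diff (B e : R) : 0 < e -> exists2 d, 0 < d & forall t t', `|t| <= B -> `|t' - t| <= d ->
  G t + g t * (t' - t) - e * `|t' - t| <= G t'.
Proof.
move=> e0; have cs : compact (`[- (B + 1), B + 1]%classic : set R^o) by exact: segment_compact.
have [d0 d00 Hd] := @compact_uniform_continuity R R^o R^o _ g e cs (fun x _ => @g_cont x) e0.
exists (Num.min 1 (d0 / 2)); first by rewrite lt_min ltr01 divr_gt0.
move=> t t' tB; rewrite le_min => /andP[tt1 ttd].
have tI : `[- (B + 1), B + 1]%classic t by move: tB; rewrite /= in_itv /= !ler_norml => /andP[h1 h2]; apply/andP; split; lra.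
have near u : `|u - t| <= `|t' - t| -> g t - e <= g u <= g t + e.
  move=> ut; have : `|g t - g u| <= e.
    have := Hd t u tI; rewrite [`|t - u|]distrC => H; apply/ltW/H.
    by apply: le_lt_trans ut _; apply: le_lt_trans ttd _; lra.
  by rewrite ler_norml => /andP[h1 h2]; apply/andP; split; lra.
have [tt|/ltW tt] := leP t t'.
  have := @prim_between _ g g_odd g_cont t t' (g t - e) (g t + e) tt _ => /(_ _)/andP[|h1 _].
    by move=> u /andP[u1 u2]; apply: near; rewrite !ger0_norm; lra.
  by rewrite ger0_norm ?subr_ge0//; lra.
have := @prim_between _ g g_odd g_cont t' t (g t - e) (g t + e) tt _ => /(_ _)/andP[|_ h1].
  by move=> u /andP[u1 u2]; apply: near; rewrite !ler0_norm; lra.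
by rewrite ler0_norm ?subr_le0//; lra.
Qed.

Let mO : measurable Omega. Proof. exact: open_measurable_rV. Qed.
Let mI : measurable_fun setT (\1_Omega : X -> R). Proof. exact: measurable_indic. Qed.

Lemma indic_Omega_int (c : R) : 0 <= c -> (\int[la]_x (c * \1_Omega x)%:E <= (c * (2 * b%:R) ^+ n)%:E)%E.
Proof.
move=> c_0; rewrite (intZ la mI (fun x => _) c_0)//= integral_indic// setIT EFinM lee_wpmul2l ?lee_fin//.
rewrite -(lebesgue_cube (0 : X) (ler0n R b)); apply: le_measure; rewrite ?inE//; first exact: measurable_cube.
by move=> x /Omega_b; rewrite /cube /= subr0.
Qed.

Lemma measurable_source (v : X -> R) : measurable_fun setT v -> measurable_fun setT (fun x => g (v x)).
Proof. by move=> mv; apply: (measurableT_comp _ mv); exact: continuous_measurable_fun. Qed.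

Lemma continuous_prim_source : continuous G.
Proof.
move=> t; apply/cvgrPdist_le => e e0.
have [|c1 _ Hc1] := @EVT_max R g (t - 1) (t + 1) _ (continuous_subspaceT g_cont); first by lra.
have [|c2 _ Hc2] := @EVT_min R g (t - 1) (t + 1) _ (continuous_subspaceT g_cont); first by lra.
pose m := `|g c1| + `|g c2| + 1.
have m0 : 0 < m by rewrite /m; have := normr_ge0 (g c1); have := normr_ge0 (g c2); lra.
have gm u : t - 1 <= u <= t + 1 -> - m <= g u <= m.
  move=> uI; have h1 := Hc1 u; have h2 := Hc2 u; rewrite in_itv /= in h1 h2.
  have := ler_norm (g c1); have := ler_norm (- g c2); rewrite normrN.
  by have := h1 uI; have := h2 uI; have := normr_ge0 (g c1); have := normr_ge0 (g c2); rewrite /m => *; apply/andP; split; lra.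
near=> u; have ut : `|t - u| < Num.min 1 (e / m).
  near: u; apply: (@cvgr_dist_lt _ _ _ (nbhs t) _ id); first exact: cvg_id.
  by rewrite lt_min ltr01 divr_gt0.
move: ut; rewrite lt_min => /andP[u1 ue].
have {}ue : m * `|t - u| <= e by rewrite mulrC -ler_pdivlMr// ltW.
move: u1; rewrite ltr_norml => /andP[u1 u2].
have [tu|/ltW tu] := leP t u.
  have := @prim_between _ g g_odd g_cont t u (- m) m tu _ => /(_ _)/andP[|h1 h2].
    by move=> v /andP[v1 v2]; apply: gm; apply/andP; split; lra.
  by move: ue; rewrite ler0_norm ?subr_le0// => ue; rewrite ler_norml; apply/andP; split; lra.
have := @prim_between _ g g_odd g_cont u t (- m) m tu _ => /(_ _)/andP[|h1 h2].
  by move=> v /andP[v1 v2]; apply: gm; apply/andP; split; lra.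
by move: ue; rewrite ger0_norm ?subr_ge0// => ue; rewrite ler_norml; apply/andP; split; lra.
Unshelve. all: by end_near. Qed.

Lemma measurable_prim_source (v : X -> R) : measurable_fun setT v -> measurable_fun setT (fun x => G (v x)).
Proof. by move=> mv; apply: (measurableT_comp _ mv); apply: continuous_measurable_fun; exact: continuous_prim_source. Qed.

(** Where [|v| < tau] the primitive is small and [Omega] has finite measure; elsewhere
    [M (A * v) >= M (A * tau) > 0] absorbs the constant term of [prim_source_le]. *)
Lemma prim_source_small (e : R) : 0 < e -> exists k eta, [/\ 0 < k, 0 < eta & forall v : X -> R,
  measurable_fun setT v -> (forall x, ~ Omega x -> v x = 0) -> (amod k v <= eta%:E)%E ->
  (\int[la]_x (G (v x))%:E <= e%:E)%E].
Proof.
move=> e0; pose V : R := (2 * b%:R) ^+ n + 1.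
have V0 : 0 < V by rewrite ltr_wpDl// exprn_ge0// mulr_ge0.
pose e1 := e / (2 * V); have e10 : 0 < e1 by rewrite divr_gt0// mulr_gt0.
have [tau tau0 Ht] : exists2 tau, 0 < tau & forall t, `|t| < tau -> G t <= e1.
  have /cvgrPdist_lt/(_ _ e10)/nbhs_ballP[tau tau0 H] := @continuous_prim_source 0.
  exists tau => // t tt; have := H t; rewrite -ball_normE /= sub0r normrN => /(_ tt).
  by rewrite prim0 sub0r normrN => /ltW; apply: le_trans; exact: ler_norm.
have MA : 0 < M (A * tau) by apply: young_gt0 => //; rewrite mulf_neq0 ?gt_eqF.
pose Ct := C * (1 / M (A * tau) + 2).
have Ct0 : 0 < Ct by rewrite mulr_gt0// addr_gt0// divr_gt0.
exists A^-1, (e / (2 * Ct)); split; [by rewrite invr_gt0|by apply: divr_gt0 => //; exact: mulr_gt0|].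
move=> v mv vO Iv.
have mM : measurable_fun setT (fun x => M (v x / A^-1)) by exact: measurable_M_div.
have mI1 : measurable_fun setT (fun x : X => e1 * \1_Omega x) by exact: measurable_funM.
have mC : measurable_fun setT (fun x => Ct * M (v x / A^-1)) by exact: measurable_funM.
apply: (@le_trans _ _ (\int[la]_x (e1 * \1_Omega x + Ct * M (v x / A^-1))%:E)%E).
  apply: int_le => [||x|x]; [exact: measurable_prim_source|exact: measurable_funD|exact: prim_source_ge0|].
  have [xO|xO] := pselect (Omega x); last first.
    by rewrite vO// prim0; apply: addr_ge0; apply: mulr_ge0; rewrite ?M_ge0 ?(ltW e10) ?(ltW Ct0).
  rewrite indicE mem_set// mulr1 invrK [v x * A]mulrC.
  have [vt|vt] := ltP `|v x| tau.
    by apply: le_trans (Ht _ vt) _; rewrite lerDl mulr_ge0 ?M_ge0// ltW.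
  apply: le_trans (prim_source_le _) _; rewrite ler_wpDl ?(ltW e10)// /Ct.
  have key : 1 + 2 * M (A * v x) <= (1 / M (A * tau) + 2) * M (A * v x).
    rewrite [leRHS]mulrDl lerD2r mul1r mulrC ler_pdivlMr// mul1r; apply: young_le => //.
    by rewrite !normrM ler_wpM2l// (gtr0_norm tau0).
  by apply: le_trans (ler_wpM2l (ltW C0) key) _; rewrite mulrA.
rewrite intD//; [|by move=> x; rewrite mulr_ge0 ?(ltW e10)|by move=> x; rewrite mulr_ge0 ?M_ge0// ltW].
have -> : e%:E = ((e / 2)%:E + (e / 2)%:E)%E by rewrite -EFinD -splitr.
apply: leeD.
  apply: le_trans (indic_Omega_int (ltW e10)) _; rewrite lee_fin.
  apply: (@le_trans _ _ (e1 * V)); first by rewrite ler_pM2l// lerDl.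
  by rewrite /e1 le_eqVlt; apply/orP; left; apply/eqP; field; rewrite gt_eqF.
rewrite (intZ la mM (fun x => M_ge0 _) (ltW Ct0)).
apply: (@le_trans _ _ (Ct%:E * (e / (2 * Ct))%:E)%E); first by rewrite lee_wpmul2l ?lee_fin ?(ltW Ct0).
by rewrite -EFinM lee_fin le_eqVlt; apply/orP; left; apply/eqP; field; rewrite gt_eqF.
Qed.

(** Vitali's theorem with [M (A u_k) <= M (2 A (u_k - U)) + M (2 A U)]: the last term is integrable
    since [U] has finite modulars at every scale, and the other is small by modular convergence. *)
Lemma source_cvg (u : nat -> X -> R) (U : X -> R) (h : nat -> X -> R) (H W : X -> R) (c : R) : 0 < c ->
  (forall k, measurable_fun setT (u k)) -> measurable_fun setT U ->
  (forall k, measurable_fun setT (h k)) -> measurable_fun setT H -> measurable_fun setT W ->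
  (forall x, 0 <= W x) -> (\int[la]_x (W x)%:E < +oo)%E -> {ae la, forall x, h k x @[k --> \oo] --> H x} ->
  (forall k x, `|h k x| <= c * M (A * u k x) + W x) -> (forall x, `|H x| <= c * M (A * U x) + W x) ->
  (forall k, 0 < k -> (amod k U < +oo)%E) ->
  (forall k eta, 0 < k -> 0 < eta -> exists N : nat, forall j, (N <= j)%N ->
     (amod k (fun x => u j x - U x)%R <= eta%:E)%E) ->
  \int[la]_x h k x @[k --> \oo] --> \int[la]_x H x.
Proof.
move=> c_0 mu mU mh mH mW W0 IW cvh hb Hb EU cu.
have mMA (v : X -> R) (a : R) : measurable_fun setT v -> measurable_fun setT (fun x => M (a * v x)).
  by move=> mv; apply: (measurableT_comp (measurable_young youngM)); exact: measurable_funM.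
have IU (a : R) : 0 < a -> (\int[la]_x (M (a * U x))%:E < +oo)%E.
  by move=> a0; have := EU a^-1; rewrite /Energies.amod invr_gt0 => /(_ a0); under eq_integral do rewrite invrK mulrC.
have ZI (a : R) : 0 < a -> (\int[la]_x (c * M (a * U x))%:E < +oo)%E.
  move=> a0; rewrite (intZ la (mMA _ a mU) (fun x => M_ge0 _) (ltW c_0)).
  by apply: lte_mul_pinfty; rewrite ?lee_fin ?(ltW c_0)// IU.
have mZ (v : X -> R) (a : R) : measurable_fun setT v -> measurable_fun setT (fun x => c * M (a * v x)).
  by move=> mv; apply: measurable_funM => //; exact: mMA.
have Z0 (v : X -> R) (a : R) x : 0 <= c * M (a * v x) by rewrite mulr_ge0 ?M_ge0// ltW.
have iH : la.-integrable setT (EFin \o H).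
  apply: (integrable_dominated mH (G := fun x => c * M (A * U x) + W x)) => //.
    by apply: measurable_funD => //; exact: mZ.
  by rewrite intD//; [apply: lte_add_pinfty => //; exact: ZI|exact: mZ].
apply: Rintegral_cvg => //.
have mB k : measurable_fun setT (fun x => `|h k x - H x|) by apply: measurableT_comp => //; exact: measurable_funB.
apply: vitali => [//|k x//||e e0].
  apply: filterS cvh => x cx; rewrite -(normr0 R) -(subrr (H x)); apply: cvg_norm.
  by apply: cvgB => //; exact: cvg_cst.
pose Phi x := c * M (2 * A * U x) + (c * M (A * U x) + (W x + W x)).
have WW x : 0 <= W x + W x by rewrite addr_ge0.
have mWW : measurable_fun setT (fun x => W x + W x) by exact: measurable_funD.
have m1 : measurable_fun setT (fun x => c * M (A * U x) + (W x + W x)) by apply: measurable_funD => //; exact: mZ.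
have A20 : 0 < 2 * A by rewrite mulr_gt0.
exists Phi, (fun k x => c * M (2 * A * (u k x - U x))); split; [split|split].
- by apply: measurable_funD => //; exact: mZ.
- by move=> x; rewrite addr_ge0// addr_ge0.
- rewrite /Phi intD//; [|exact: mZ|by move=> x; rewrite addr_ge0].
  apply: lte_add_pinfty; first exact: ZI.
  rewrite intD//; last exact: mZ.
  apply: lte_add_pinfty; first exact: ZI.
  by rewrite intD// lte_add_pinfty.
- by move=> k; apply: (mZ (fun x => u k x - U x)); exact: measurable_funB.
- by move=> k x; rewrite mulr_ge0 ?M_ge0// ltW.
- move=> k x; apply: le_trans (ler_normB _ _) _; apply: le_trans (lerD (hb k x) (Hb x)) _.
  have : M (A * u k x) <= M (2 * A * (u k x - U x)) + M (2 * A * U x).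
    have -> : A * u k x = A * (u k x - U x) + A * U x by ring.
    apply: le_trans (young_half youngM _ _) _; rewrite !mulrA.
    by have := M_ge0 (2 * A * (u k x - U x)); have := M_ge0 (2 * A * U x); lra.
  move=> /(ler_wpM2l (ltW c_0)); rewrite /Phi mulrDr.
  by move: (c * _) => p1; move: (c * _) => p2; move: (c * _) => p3; move: (c * _) => p4; lra.
have ec0 : 0 < e / c by rewrite divr_gt0.
have iA0 : 0 < (2 * A)^-1 by rewrite invr_gt0.
have [N HN] := cu _ _ iA0 ec0.
exists N => k Nk; rewrite (intZ la (f := fun x => M (2 * A * (u k x - U x))))//; [|by apply: (mMA (fun x => u k x - U x)); exact: measurable_funB|by move=> x; exact: M_ge0|exact: ltW].
apply: (@le_trans _ _ (c%:E * (e / c)%:E)%E).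
  rewrite lee_wpmul2l ?lee_fin ?(ltW c_0)//; apply: le_trans (HN k Nk).
  by rewrite /Energies.amod; under [leRHS]eq_integral do rewrite invrK mulrC.
by rewrite -EFinM mulrC divfK// gt_eqF.
Qed.

End source.

End Sources.
Import Sources.

Module FiniteDimension.

Section row_maps.
Context (R : realType).

Lemma continuous_rowP (V : topologicalType) (k : nat) (f : 'I_k -> V -> R) : (forall j, continuous (f j)) ->
  continuous (fun c => \row_j f j c : 'rV[R]_k).
Proof.
move=> cf c; have -> : (fun c => \row_j f j c : 'rV[R]_k) = (fun c => \sum_j f j c *: delta_mx ord0 j).
  apply/funext => v; rewrite [LHS]row_sum_delta; by apply: eq_bigr => j _; rewrite mxE.
rewrite /continuous_at; apply: (@cvg_big _ _ +%R 0 predT add_continuous _ (nbhs c)) => j _.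
by apply: (@cvgZl _ _ _ (nbhs c)); exact: cf.
Qed.

Lemma sqr_norm_le_dotv k (v : 'rV[R]_k) : `|v| ^+ 2 <= dotv v v.
Proof.
have H : `|v| <= Num.sqrt (dotv v v).
  apply: norm_le_coord => [|i]; first exact: sqrtr_ge0.
  rewrite -sqrtr_sqr; apply: ler_wsqrtr; rewrite /dotv (bigD1 i)//= -expr2 lerDl.
  by apply: sumr_ge0 => j _; rewrite -expr2 sqr_ge0.
rewrite -[leRHS]sqr_sqrtr ?dotvv_ge0//.
by rewrite ler_sqr ?nnegrE ?sqrtr_ge0.
Qed.

End row_maps.

(** * The functionals on finite spans *)

Section level.
Context (R : realType) (n : nat) (s : R) (M : R -> R).
Hypothesis n0 : (0 < n)%N.
Hypothesis s01 : 0 < s < 1.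
Hypothesis youngM : young M.
Local Notation la := (lebesgue_rV R n).
Local Notation X := 'rV[R]_n.
Local Notation Mbar := (complementary M).
Local Notation Minv := (complementary_inv M).
Local Notation M_ge0 := (young_ge0 youngM).
Local Notation energy := (@energy R n s M).
Local Notation amod := (@amod R n M).
Context (b : nat) (Omega : set X).
Hypothesis Omega_b : forall x, Omega x -> `|x| <= b%:R.
Hypothesis Omega_open : open Omega.
Hypothesis Omega_neq0 : Omega !=set0.
Local Notation admissible := (admissible s M b).
Local Notation phi := (phi b Omega).
Let psi j : Rnn R n -> R := Ds s (phi j).

Lemma measurable_phi_la j : measurable_fun setT (phi j).
Proof. exact: measurable_phi. Qed.

Lemma nu_energy (K : R) (u : X -> R) : measurable_fun setT u -> (\int[nu]_z (M (@Ds R n s u z / K))%:E = energy K u)%E.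
Proof.
move=> mu; have m : measurable_fun setT (fun z : X * X => (M (@Ds R n s u z / K))%:E).
  by apply/measurable_EFinP; apply: measurable_M_div => //; exact: measurable_Ds.
by rewrite (ge0_integral_nuE m)// => z; rewrite lee_fin M_ge0.
Qed.

Lemma measurable_Ds_nu (u : X -> R) : measurable_fun setT u -> measurable_fun setT (@Ds R n s u).
Proof.
by move=> mu; exact: (measurable_fun_completed (mu := (la \x la)%E) (measurable_Ds s mu)).
Qed.

Lemma Ds_EM (u : X -> R) : measurable_fun setT u -> (forall K, 0 < K -> (energy K u < +oo)%E) -> EM nu M (@Ds R n s u).
Proof.
move=> mu Eu; split; first exact: measurable_Ds_nu.
move=> k k0; have k10 : 0 < k^-1 by rewrite invr_gt0.
have := Eu _ k10; rewrite -nu_energy//; congr (_ < _)%E.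
by apply: eq_integral => z _; rewrite invrK mulrC.
Qed.

Lemma psi_EM j : EM nu M (psi j).
Proof.
apply: Ds_EM; first exact: measurable_phi_la.
by move=> K K0; exact: energy_phi.
Qed.

Lemma phi_out j x : ~ Omega x -> phi j x = 0.
Proof.
move=> xO; have : comb b Omega j.+1 (fun i => (i == j)%:R) x = 0 by apply: comb_zero_outside.
rewrite /comb big_ord_recr /= eqxx mul1r big1 ?add0r// => i _.
by rewrite (ltn_eqF (ltn_ord i)) mul0r.
Qed.

Section vectors.
Context (k : nat) (J : 'I_k -> nat).
Local Notation V := 'rV[R]_k.

(** The index map [J] selects either the first [k] functions, for the restricted problems, or
    finitely many separated bumps, for the comparison sphere. *)
Definition vcomb (c : V) (x : X) : R := lincomb (fun j => phi (J j)) c x.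

Lemma Ds_vcomb c z : @Ds R n s (vcomb c) z = lincomb (fun j => psi (J j)) c z.
Proof.
rewrite /Ds /vcomb /lincomb -sumrB mulr_suml; apply: eq_bigr => j _.
by rewrite /psi /Ds -mulrBr mulrA.
Qed.

Lemma vcomb_out c x : ~ Omega x -> vcomb c x = 0.
Proof.
by move=> xO; rewrite /vcomb /lincomb big1// => j _; rewrite phi_out// mulr0.
Qed.

Lemma measurable_vcomb c : measurable_fun setT (vcomb c).
Proof.
apply: measurable_sum => j; apply: measurable_funM => //; exact: measurable_phi_la.
Qed.

Lemma vcomb_energy c K : 0 < K -> (energy K (vcomb c) < +oo)%E.
Proof.
move=> K0; rewrite -nu_energy//; last exact: measurable_vcomb.
have [_ H] : EM nu M (@Ds R n s (vcomb c)).
  rewrite (_ : Ds s (vcomb c) = lincomb (fun j => psi (J j)) c); last by apply/funext => z; exact: Ds_vcomb.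
  by apply: lincomb_EM => // j; exact: psi_EM.
have := H K^-1; rewrite invr_gt0 => /(_ K0); congr (_ < _)%E.
by apply: eq_integral => z _; rewrite mulrC.
Qed.

Lemma vcomb_admissible c K : 0 < K -> admissible K (vcomb c).
Proof.
move=> K0; split; [exact: measurable_vcomb| |exact: vcomb_energy].
by move=> x xb; apply: vcomb_out => /Omega_b; rewrite leNgt xb.
Qed.

Lemma vcomb_le (r : R) c x : `|c| <= r -> `|vcomb c x| <= r * k%:R * \1_Omega x.
Proof.
move=> cr; have r0 : 0 <= r := le_trans (normr_ge0 c) cr.
have [xO|xO] := pselect (Omega x); last by rewrite vcomb_out// normr0 mulr_ge0 ?mulr_ge0.
rewrite indicE mem_set// mulr1; apply: le_trans (lincomb_le _ _ cr) _.
rewrite ler_wpM2l//; apply: (@le_trans _ _ (\sum_(j < k) 1)); last by rewrite sumr_const card_ord.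
apply: ler_sum => j _; have /andP[p0 p1] : 0 <= phi (J j) x <= 1 by apply: phi_bounds.
by rewrite ger0_norm.
Qed.

Lemma vcombB c d x : vcomb c x - vcomb d x = vcomb (c - d) x.
Proof. by rewrite /vcomb /lincomb -sumrB; apply: eq_bigr => j _; rewrite !mxE -mulrBl. Qed.

Lemma vcombN c x : vcomb (- c) x = - vcomb c x.
Proof. by rewrite /vcomb /lincomb -sumrN; apply: eq_bigr => j _; rewrite mxE mulNr. Qed.

Lemma vcombZ t c x : vcomb (t *: c) x = t * vcomb c x.
Proof. by rewrite /vcomb /lincomb mulr_sumr; apply: eq_bigr => j _; rewrite mxE mulrA. Qed.

End vectors.

Variables (g : R -> R) (A C : R).
Hypothesis g_odd : forall t, g (- t) = - g t.
Hypothesis g_cont : continuous g.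
Hypothesis g_pos : forall t, 0 < t -> 0 < g t.
Hypothesis A0 : 0 < A.
Hypothesis C0 : 0 < C.
Hypothesis g_bound : forall t t', `|g t * t'| <= C * (1 + M (A * t) + M (A * t')).
Local Notation G := (prim g).

Section mass.
Context (k : nat) (J : 'I_k -> nat).
Local Notation V := 'rV[R]_k.
Local Notation vcomb := (vcomb J).

Definition mass (c : V) : R := \int[la]_x G (vcomb c x).
Definition dmass (c : V) : V := \row_j \int[la]_x (g (vcomb c x) * phi (J j) x).

Let cst_dom (a : R) : 0 <= a -> measurable_fun setT (fun x : X => a * \1_Omega x) /\
  (\int[la]_x (a * \1_Omega x)%:E < +oo)%E.
Proof.
move=> a0; split.
  by apply: measurable_funM => //; apply: measurable_indic; exact: open_measurable_rV.
exact: le_lt_trans (indic_Omega_int Omega_b Omega_open a0) (ltry _).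
Qed.

Let vb (r : R) c x : `|c| <= r -> M (A * vcomb c x) <= M (A * (r * k%:R)).
Proof.
move=> cr; have r0 : 0 <= r := le_trans (normr_ge0 c) cr.
apply: young_le => //; rewrite !normrM ler_wpM2l//; apply: le_trans (vcomb_le J x cr) _.
rewrite -[leRHS]mulr1 (ger0_norm r0) ger0_norm// ler_wpM2l ?mulr_ge0// indicE; case: (_ \in _) => //.
Qed.

Let G_dom (r : R) c x : `|c| <= r -> `|G (vcomb c x)| <= C * (1 + 2 * M (A * (r * k%:R))) * \1_Omega x.
Proof.
move=> cr; have [xO|xO] := pselect (Omega x); last first.
  by rewrite vcomb_out// prim0 normr0 mulr_ge0// mulr_ge0 ?(ltW C0)// addr_ge0// mulr_ge0// M_ge0.
rewrite indicE mem_set// mulr1 ger0_norm; last exact: prim_source_ge0.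
apply: le_trans (prim_source_le youngM g_odd g_cont A0 C0 g_bound _) _.
by rewrite ler_pM2l// lerD2l ler_pM2l//; exact: vb.
Qed.

Let g_dom (r : R) c (w : X -> R) (B : R) x : `|c| <= r -> (forall x, `|w x| <= B * \1_Omega x) -> 0 <= B ->
  `|g (vcomb c x) * w x| <= C * (1 + M (A * (r * k%:R)) + M (A * B)) * \1_Omega x.
Proof.
move=> cr wB B0; have [xO|xO] := pselect (Omega x); last first.
  have := wB x; rewrite indicE memNset// mulr0 normr_le0 => /eqP ->.
  by rewrite mulr0 normr0 mulr_ge0// mulr_ge0 ?(ltW C0)// addr_ge0 ?M_ge0// addr_ge0 ?M_ge0.
have := wB x; rewrite indicE mem_set// !mulr1 => wx.
apply: le_trans (g_bound _ _) _; rewrite ler_pM2l//; apply: lerD; first by rewrite lerD2l; exact: vb.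
by apply: young_le => //; rewrite !normrM ler_wpM2l// (ger0_norm B0).
Qed.

Let phi1 j x : `|phi j x| <= 1 * \1_Omega x.
Proof.
have /andP[p0 p1] : 0 <= phi j x <= 1 by apply: phi_bounds.
 rewrite mul1r ger0_norm// indicE.
have [xO|xO] := boolP (x \in Omega) => //.
by rewrite phi_out// => Ox; move: xO; rewrite mem_set.
Qed.

Lemma mass_integrable c : la.-integrable setT (EFin \o (fun x => G (vcomb c x))).
Proof.
have a0 : 0 <= C * (1 + 2 * M (A * (`|c| * k%:R))) by rewrite mulr_ge0 ?(ltW C0)// addr_ge0// mulr_ge0// M_ge0.
have [m I] := cst_dom a0.
apply: integrable_dominated m I (fun x => G_dom x (lexx _)).
by apply: measurable_prim_source => //; exact: measurable_vcomb.
Qed.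

Lemma source_integrable c (w : X -> R) (B : R) : measurable_fun setT w -> 0 <= B ->
  (forall x, `|w x| <= B * \1_Omega x) -> la.-integrable setT (EFin \o (fun x => g (vcomb c x) * w x)).
Proof.
move=> mw B0 wB; have a0 : 0 <= C * (1 + M (A * (`|c| * k%:R)) + M (A * B)).
  by rewrite mulr_ge0 ?(ltW C0)// addr_ge0 ?M_ge0// addr_ge0 ?M_ge0.
have [m I] := cst_dom a0.
apply: integrable_dominated m I (fun x => g_dom x (lexx _) wB B0).
by apply: measurable_funM => //; apply: measurable_source => //; exact: measurable_vcomb.
Qed.

Lemma dmass_dotv c w : dotv (dmass c) w = \int[la]_x (g (vcomb c x) * vcomb w x).
Proof.
rewrite /dmass dotv_integral// => j.
by apply: (source_integrable _ (B := 1)); [exact: measurable_phi_la| |exact: phi1].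
Qed.

Lemma mass_continuous : continuous mass.
Proof.
apply: parametric_continuous => [c|x c|r].
- by apply: measurable_prim_source => //; exact: measurable_vcomb.
- apply: (@cvg_comp _ _ _ (vcomb^~ x) G (nbhs c) (nbhs (vcomb c x))); first exact: continuous_lincomb.
  exact: continuous_prim_source.
- have a0 : 0 <= C * (1 + 2 * M (A * (r * k%:R))) by rewrite mulr_ge0 ?(ltW C0)// addr_ge0// mulr_ge0// M_ge0.
  have [m I] := cst_dom a0; exists (fun x => C * (1 + 2 * M (A * (r * k%:R))) * \1_Omega x).
  by split => // c z cr; exact: G_dom.
Qed.

Lemma dmass_continuous : continuous dmass.
Proof.
apply: continuous_rowP => j; apply: parametric_continuous => [c|x c|r].
- apply: measurable_funM; last exact: measurable_phi_la.
  by apply: measurable_source => //; exact: measurable_vcomb.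
- apply: (@cvgM _ _ (nbhs c)); last exact: cvg_cst.
  apply: (@cvg_comp _ _ _ (vcomb^~ x) g (nbhs c) (nbhs (vcomb c x))); first exact: continuous_lincomb.
  exact: g_cont.
- have a0 : 0 <= C * (1 + M (A * (r * k%:R)) + M (A * 1)).
    by rewrite mulr_ge0 ?(ltW C0)// addr_ge0 ?M_ge0// addr_ge0 ?M_ge0.
  have [m I] := cst_dom a0; exists (fun x => C * (1 + M (A * (r * k%:R)) + M (A * 1)) * \1_Omega x).
  by split => // c z cr; apply: g_dom => // y; exact: phi1.
Qed.

Lemma dmassN c : dmass (- c) = - dmass c.
Proof.
apply/rowP => j; rewrite !mxE -mulN1r -RintegralZl//.
  by apply: eq_Rintegral => x _; rewrite vcombN g_odd mulN1r mulNr.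
by apply: (source_integrable _ (B := 1)); [exact: measurable_phi_la| |exact: phi1].
Qed.

Lemma mass_le c d : (forall x, `|vcomb c x| <= `|vcomb d x|) -> mass c <= mass d.
Proof.
move=> H; apply: le_Rintegral => //; [exact: mass_integrable|exact: mass_integrable|].
by move=> x _; exact: prim_source_mono.
Qed.

(** Bounded coefficients give bounded functions, for which the pointwise estimate of
    [prim_source_diff] is uniform; [e1] accounts for the volume of [Omega] and the number of
    terms. *)
Lemma mass_diff (r e : R) : 0 < e -> exists2 d, 0 < d & forall v w : V, `|v| <= r -> `|w - v| <= d ->
  mass v + dotv (dmass v) (w - v) - e * `|w - v| <= mass w.
Proof.
move=> e0; pose Vol : R := (2 * b%:R) ^+ n.
have Vol0 : 0 <= Vol by rewrite exprn_ge0// mulr_ge0.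
have den : 0 < k%:R * Vol + 1 :> R by rewrite ltr_wpDl// mulr_ge0.
pose e1 := e / (k%:R * Vol + 1); have e10 : 0 < e1 by rewrite divr_gt0.
have [d d0 Hd] := prim_source_diff g_odd g_cont (r * k%:R) e10.
have kp : 0 < k%:R + 1 :> R by rewrite ltr_wpDl.
exists (d / (k%:R + 1)); first by rewrite divr_gt0.
move=> v w vr wv; rewrite dmass_dotv.
have r0 : 0 <= r := le_trans (normr_ge0 v) vr.
have nI (c : X -> R) (a : R) x : 0 <= a -> a * \1_Omega x <= a.
  by move=> a0; rewrite -[leRHS]mulr1 ler_wpM2l// indicE; case: (_ \in _).
pose D := `|w - v| * k%:R.
have D0 : 0 <= D by rewrite mulr_ge0.
have mI : measurable_fun setT (fun x : X => e1 * D * \1_Omega x) by have [] := cst_dom (mulr_ge0 (ltW e10) D0).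
have iI : la.-integrable setT (EFin \o (fun x : X => e1 * D * \1_Omega x)).
  have [m I] := cst_dom (mulr_ge0 (ltW e10) D0).
  apply: (integrable_dominated m m I) => x; rewrite ger0_norm//.
  by apply: mulr_ge0 => //; apply: mulr_ge0 => //; exact: ltW.
have iS : la.-integrable setT (EFin \o (fun x => g (vcomb v x) * vcomb (w - v) x)).
  by apply: (source_integrable _ (B := D)) => //; [exact: measurable_vcomb|move=> x; exact: vcomb_le].
have le1 : \int[la]_x (e1 * D * \1_Omega x) <= e * `|w - v|.
  rewrite -lee_fin ge0_Rintegral_fin//; last 2 first.
  - by move=> x; rewrite mulr_ge0// mulr_ge0// ltW.
  - by have [] := cst_dom (mulr_ge0 (ltW e10) D0).
  apply: le_trans (indic_Omega_int Omega_b Omega_open (mulr_ge0 (ltW e10) D0)) _.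
  rewrite lee_fin -/Vol /e1 /D.
  have -> : e / (k%:R * Vol + 1) * (`|w - v| * k%:R) * Vol = (e * `|w - v|) * (k%:R * Vol) / (k%:R * Vol + 1).
    by field; rewrite gt_eqF.
  by rewrite ler_pdivrMr// ler_wpM2l ?lerDl// mulr_ge0// ltW.
apply: le_trans (_ : _ <= mass v + \int[la]_x (g (vcomb v x) * vcomb (w - v) x) - \int[la]_x (e1 * D * \1_Omega x)) _.
  by rewrite lerB.
have iGS : la.-integrable setT (EFin \o (fun x => G (vcomb v x) + g (vcomb v x) * vcomb (w - v) x)).
  have := integrableD measurableT (mass_integrable v) iS; apply: eq_ind.
  by congr (integrable _ _ _).
rewrite /mass -RintegralD//; last exact: mass_integrable.
rewrite -RintegralB//; apply: le_Rintegral => //; [|exact: mass_integrable|].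
  by have := integrableB measurableT iGS iI; apply: eq_ind; congr (integrable _ _ _).
move=> x _; have wx : vcomb (w - v) x = vcomb w x - vcomb v x by rewrite vcombB.
have vwx : `|vcomb w x - vcomb v x| <= D * \1_Omega x by rewrite -wx; exact: vcomb_le.
have h1 : `|vcomb v x| <= r * k%:R.
  by apply: le_trans (vcomb_le J x vr) _; apply: nI; rewrite ?mulr_ge0.
have h2 : `|vcomb w x - vcomb v x| <= d.
  apply: le_trans vwx _; apply: le_trans (nI (fun=> 0) _ _ D0) _.
  rewrite /D; apply: (@le_trans _ _ (d / (k%:R + 1) * (k%:R + 1))); last by rewrite divfK// gt_eqF.
  by apply: ler_pM => //; rewrite lerDl.
by apply: le_trans (Hd _ _ h1 h2); rewrite wx lerB// -mulrA ler_pM2l.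
Qed.

(** Otherwise the nonnegative function [g (u) u] would be null, hence [u] as well, and the mass
    would be 0. *)
Lemma mass_pos c : 0 < mass c -> 0 < dotv (dmass c) c.
Proof.
move=> m0; rewrite ltNge; apply/negP; rewrite dmass_dotv => I0.
have iS : la.-integrable setT (EFin \o (fun x => g (vcomb c x) * vcomb c x)).
  apply: (source_integrable _ (B := `|c| * k%:R)); [exact: measurable_vcomb|by rewrite mulr_ge0|].
  by move=> x; exact: vcomb_le.
have H := ge0_Rintegral_eq0 iS (fun x => source_mul_ge0 g_odd g_pos _) I0.
move: m0; rewrite lt_neqAle => /andP[/negP + _]; apply; apply/eqP.
rewrite /mass /Rintegral [X in fine X](_ : _ = 0%E)//.
rewrite (@ae_eq_integral _ _ _ la setT (fun=> 0%E) (fun x => (G (vcomb c x))%:E))//.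
- exact: integral0.
- by apply/measurable_EFinP; apply: measurable_prim_source => //; exact: measurable_vcomb.
- apply: ae_imp H => x Hx _; have [->|/(source_mul_gt0 g_odd g_pos)] := eqVneq (vcomb c x) 0.
    by rewrite prim0.
  by rewrite Hx ltxx.
Qed.

End mass.

(** Points spaced [t] apart on a diagonal segment inside a ball of [Omega], each replaced by a grid
    point closer than the mesh; as the mesh is below [t / 4], every bump misses the other
    centers. *)
Lemma independent_bumps m : exists (J : 'I_m.+1 -> nat) (p : 'I_m.+1 -> X), forall i i', phi (J i) (p i') = (i == i')%:R.
Proof.
have [x0 Ox0] := Omega_neq0; have /nbhs_ballP[r r0 Hr] : nbhs x0 Omega by exact: open_nbhs_nbhs.
pose t := r / 2 / m.+1%:R; have t0 : 0 < t by rewrite !divr_gt0.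
have t40 : 0 < t / 4 by rewrite divr_gt0.
have [l _ Hl] := near_infty_natSinv_lt (PosNum t40).
have lt : mesh R l < t / 4 by exact: Hl (leqnn l).
have l0 := mesh_gt0 R l.
pose x (i : 'I_m.+1) : X := x0 + const_mx (i%:R * t).
have tr : t * m.+1%:R = r / 2 by rewrite divfK// pnatr_eq0.
have tr4 : t <= r / 2 by rewrite -tr ler_peMr ?(ltW t0)// ler1n.
have xr i : `|x i - x0| <= r / 2.
  rewrite /x addrC addKr; apply: norm_le_coord => [|j]; first by rewrite divr_ge0// ltW.
  have it0 : 0 <= i%:R * t by apply: mulr_ge0 => //; exact: ltW.
  by rewrite mxE (ger0_norm it0) -tr mulrC ler_pM2l// ler_nat ltnW.
have xx i i' : i != i' -> t <= `|x i - x i'|.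
  move=> ii; have j0 : 'I_n by exact: (Ordinal n0).
  apply: le_trans (coord_le_norm (x i - x i') j0); rewrite !mxE opprD addrACA subrr add0r -mulrBl normrM (gtr0_norm t0).
  rewrite ler_peMl ?(ltW t0)//; move: ii; rewrite -val_eqE /= neq_ltn => /orP[h|h].
    by rewrite distrC ger0_norm ?subr_ge0 ?ler_nat ?(ltnW h)// -natrB ?(ltnW h)// ler1n subn_gt0.
  by rewrite ger0_norm ?subr_ge0 ?ler_nat ?(ltnW h)// -natrB ?(ltnW h)// ler1n subn_gt0.
have xO i : Omega (x i).
  by apply: Hr; rewrite -ball_normE /= distrC; apply: le_lt_trans (xr i) _; rewrite ltr_pdivrMr// mulr_natr mulr2n ltrDl.
have Hz i : exists z : grid n (b.+1 * l.+1), `|x i - gpt (mesh R l) z| < mesh R l.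
  apply: contrapT => H; have := @grid_sum1 R n (b.+1 * l.+1) (mesh R l) l0 (x i) _.
  rewrite mesh_box; have xb : `|x i| <= b.+1%:R by apply: le_trans (Omega_b (xO i)) _; rewrite ler_nat.
  move=> /(_ xb) /eqP; rewrite big1 ?(eq_sym 0) ?oner_eq0// => z _.
  apply: contrapT => /eqP /(bump_support l0) bz; apply: H; by exists z.
have [z zP] := choice Hz.
have tri (a1 a2 a3 a4 e' t' : R) : 0 < e' -> t' <= a1 -> a2 < e' -> a4 < e' -> a1 <= a2 + a3 + a4 -> e' < t' / 4 -> e' <= a3.
  by move=> *; lra.
have zz i i' : i != i' -> ~~ (`|gpt (mesh R l) (z i') - gpt (mesh R l) (z i)| < mesh R l).
  move=> ii; rewrite -leNgt; have h1 := xx _ _ ii; have h2 := zP i; have h3 := zP i'.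
  have : `|x i - x i'| <= `|x i - gpt (mesh R l) (z i)| + `|gpt (mesh R l) (z i') - gpt (mesh R l) (z i)| + `|x i' - gpt (mesh R l) (z i')|.
    have -> : x i - x i' = (x i - gpt (mesh R l) (z i)) - (gpt (mesh R l) (z i') - gpt (mesh R l) (z i)) - (x i' - gpt (mesh R l) (z i')).
      by rewrite !opprB; apply/rowP => j; rewrite !mxE; ring.
    by apply: le_trans (ler_normB _ _) _; rewrite lerD2r; exact: ler_normB.
  by move=> h; exact: (tri _ _ _ _ _ _ l0 h1 h2 h3 h lt).
exists (fun i => pickle (existT _ l (z i) : gidx n b)), (fun i => gpt (mesh R l) (z i)) => i i'.
rewrite /Density.phi pickleK /= asboolT; last first.
  move=> y yc; apply: Hr; rewrite -ball_normE /=.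
  have -> : x0 - y = - (x i - x0) + (x i - gpt (mesh R l) (z i)) - (y - gpt (mesh R l) (z i)).
    by apply/rowP => j; rewrite !mxE; ring.
  apply: le_lt_trans (ler_normB _ _) _; have h1 := ler_normD (- (x i - x0)) (x i - gpt (mesh R l) (z i)).
  rewrite normrN in h1; have h2 := xr i; have h3 := zP i; move: yc; rewrite /cube /= => yc.
  move: h1 h2 h3 yc; move: (`|_ + _|) (`|_|) (`|_|) (`|_|) => a1 a2 a3 a4; lra.
have [->|ii] := eqVneq i i'; first by rewrite bump_center.
by apply: contrapT => /eqP /(bump_support l0); apply/negP; exact: zz.
Qed.

End level.

End FiniteDimension.
Import FiniteDimension.

Module ApproximateEigenpairs.

Section reindexing.
Context d (T : measurableType d) (R : realType).

Lemma lincomb_reindex (k m : nat) (F : nat -> T -> R) (J : 'I_m -> nat) (y : 'rV[R]_m) z : (forall i, (J i < k)%N) ->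
  lincomb (fun j : 'I_k => F j) (\row_j \sum_i y ord0 i * (nat_of_ord j == J i)%:R) z =
  lincomb (fun i => F (J i)) y z.
Proof.
move=> Jk; rewrite /lincomb.
under eq_bigr => j _ do rewrite mxE mulr_suml.
rewrite exchange_big /=; apply: eq_bigr => i _.
rewrite (bigD1 (Ordinal (Jk i)))//= eqxx mulr1 big1 ?addr0// => j ji.
have /negbTE -> : nat_of_ord j != J i by apply: contraNneq ji => jJ; apply/eqP/val_inj.
by rewrite mulr0 mul0r.
Qed.

End reindexing.

(** * Critical points on finite spans *)

Section galerkin.
Context (R : realType) (n : nat) (s : R) (M : R -> R).
Hypothesis n0 : (0 < n)%N.
Hypothesis s01 : 0 < s < 1.
Hypothesis youngM : young M.
Local Notation la := (lebesgue_rV R n).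
Local Notation X := 'rV[R]_n.
Local Notation Mbar := (complementary M).
Local Notation Minv := (complementary_inv M).
Local Notation M_ge0 := (young_ge0 youngM).
Local Notation energy := (@energy R n s M).
Local Notation amod := (@amod R n M).
Context (b : nat) (Omega : set X).
Hypothesis Omega_b : forall x, Omega x -> `|x| <= b%:R.
Hypothesis Omega_open : open Omega.
Hypothesis Omega_neq0 : Omega !=set0.
Local Notation admissible := (admissible s M b).
Local Notation phi := (phi b Omega).
Variables (g : R -> R) (A C : R).
Hypothesis g_odd : forall t, g (- t) = - g t.
Hypothesis g_cont : continuous g.
Hypothesis g_pos : forall t, 0 < t -> 0 < g t.
Hypothesis A0 : 0 < A.
Hypothesis C0 : 0 < C.
Hypothesis g_bound : forall t t', `|g t * t'| <= C * (1 + M (A * t) + M (A * t')).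
Local Notation G := (prim g).
Variables (al : Rnn R n -> R -> R) (D : Rnn R n -> R) (b0 c0 th c1 : R).
Hypothesis al_m : forall xi, measurable_fun setT (al^~ xi).
Hypothesis al_c : forall z, continuous (al z).
Hypothesis al_odd : forall z xi, al z (- xi) = - al z xi.
Hypothesis al_mono : forall z x y, x <= y -> al z x <= al z y.
Hypothesis b00 : 0 < b0.
Hypothesis c00 : 0 < c0.
Hypothesis mD : measurable_fun setT D.
Hypothesis ID : (\int[nu]_z (Mbar (D z))%:E < +oo)%E.
Hypothesis al_le : forall z xi, `|al z xi| <= D z + b0 * Minv (M (c0 * xi)).
Hypothesis th0 : 0 < th.
Hypothesis c10 : 0 < c1.
Hypothesis al_coercive : {ae (@nu R n), forall z : Rnn R n, forall xi, th * M (c1 * xi) <= al z xi * xi}.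

Definition psi (j : nat) : Rnn R n -> R := Ds s (phi j).
Definition dcomb k (c : 'rV[R]_k) : Rnn R n -> R := lincomb (fun j : 'I_k => psi j) c.
(** Weight of the penalty that bounds the level sets although the [phi j] may be dependent. With
    this rate [pen k * k <= 1], which makes the comparison with a fixed sphere uniform in [k], and
    the error caused in the equation is at most [2 / (k + 1)]. *)
Definition pen (k : nat) : R := (k.+1%:R^-1) ^+ 2.
Definition Ak k (c : 'rV[R]_k) : R := potential nu al (dcomb c) + pen k * dotv c c.
Definition dAk k (c : 'rV[R]_k) : 'rV[R]_k :=
  \row_j (\int[nu]_z (al z (dcomb c z) * psi j z)) + (2 * pen k) *: c.
Local Notation vc := (@vcomb R n b Omega _ (@nat_of_ord _)).
Local Notation mass := (@mass R n b Omega g _ (@nat_of_ord _)).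
Local Notation dmass := (@dmass R n b Omega g _ (@nat_of_ord _)).

Lemma psi_EM' j : EM nu M (psi j).
Proof. exact: psi_EM. Qed.

Lemma dcomb_EM k (c : 'rV[R]_k) : EM nu M (dcomb c).
Proof. by apply: lincomb_EM => // j; exact: psi_EM'. Qed.

Lemma Ds_vc k (c : 'rV[R]_k) : Ds s (vc c) = dcomb c.
Proof. by apply/funext => z; exact: Ds_vcomb. Qed.

Lemma pen_gt0 k : 0 < pen k.
Proof. by rewrite exprn_gt0// invr_gt0. Qed.

Lemma dcombN k (c : 'rV[R]_k) z : dcomb (- c) z = - dcomb c z.
Proof. by rewrite /dcomb /lincomb -sumrN; apply: eq_bigr => j _; rewrite mxE mulNr. Qed.

Lemma dcombB k (c d : 'rV[R]_k) z : dcomb c z - dcomb d z = dcomb (c - d) z.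
Proof. by rewrite /dcomb /lincomb -sumrB; apply: eq_bigr => j _; rewrite !mxE -mulrBl. Qed.

Let int f eta (ef : EM nu M f) (ee : EM nu M eta) := op_integrable youngM al_m al_c b00 c00 mD ID al_le ef ee.

Lemma potential_ge0 f : 0 <= potential nu al f.
Proof. by apply: Rintegral_ge0 => z _; exact: (prim_ge0 (al_odd z) (@al_c z) (@al_mono z)). Qed.

Lemma dAk_dotv k (c w : 'rV[R]_k) :
  dotv (dAk c) w = \int[nu]_z (al z (dcomb c z) * dcomb w z) + 2 * pen k * dotv c w.
Proof.
rewrite /dAk dotvDl dotvZl dotv_integral// => j; apply: int; [exact: dcomb_EM|exact: psi_EM'].
Qed.

Lemma Ak_sub k (v w : 'rV[R]_k) : Ak v + dotv (dAk v) (w - v) <= Ak w.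
Proof.
have := potential_sub youngM al_m al_c al_odd al_mono b00 c00 mD ID al_le (dcomb_EM v) (dcomb_EM w).
rewrite dAk_dotv /Ak; under eq_Rintegral do rewrite dcombB.
have := dotvv_ge0 (w - v); have p := pen_gt0 k; rewrite !dotvBr !dotvBl (dotvC v w).
move: (\int[nu]_z _) (potential _ _ _) (potential _ _ _) (dotv v v) (dotv w w) (dotv w v) => I pv pw vv ww wv h1 h2.
by have := mulr_ge0 (ltW p) h1; move: (pen k) => pk; nra.
Qed.

Lemma Ak0 k : @Ak k 0 = 0.
Proof.
rewrite /Ak dotv0 mulr0 addr0 (_ : dcomb 0 = fun=> 0) ?potential0//.
by apply/funext => z; rewrite /dcomb /lincomb big1// => j _; rewrite mxE mul0r.
Qed.

Lemma Ak_le k (c : 'rV[R]_k) : Ak c <= dotv (dAk c) c.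
Proof. by have := Ak_sub c 0; rewrite Ak0 sub0r dotvNr subr_le0. Qed.

Lemma AkN k (c : 'rV[R]_k) : Ak (- c) = Ak c.
Proof.
have E1 : dotv (- c) (- c) = dotv c c by rewrite dotvNr dotvNl opprK.
have E2 : potential nu al (dcomb (- c)) = potential nu al (dcomb c).
  by rewrite -[RHS]potentialN; congr (potential _ _ _); apply/funext => z; exact: dcombN.
by rewrite /Ak E1 E2.
Qed.

Lemma dAkN k (c : 'rV[R]_k) : dAk (- c) = - dAk c.
Proof.
apply/rowP => j; rewrite !mxE.
have -> : \int[nu]_z (al z (dcomb (- c) z) * psi j z) = - \int[nu]_z (al z (dcomb c z) * psi j z).
  rewrite -mulN1r -RintegralZl//; last by apply: int; [exact: dcomb_EM|exact: psi_EM'].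
  by apply: eq_Rintegral => z _; rewrite dcombN al_odd mulN1r mulNr.
by rewrite mulrN -opprD.
Qed.

Lemma dAk_continuous k : continuous (@dAk k).
Proof.
move=> c; apply: (@cvgD _ _ _ (nbhs c)); last by apply: (@cvgZr _ _ _ (nbhs c)); exact: cvg_id.
apply: (@continuous_rowP R _ k (fun j c => \int[nu]_z (al z (dcomb c z) * psi j z))) => j {}c.
by apply: (op_continuous youngM al_m al_c b00 c00 mD ID al_le (fun j => psi_EM' j) (psi_EM' j)).
Qed.

Lemma Ak_norm k (c : 'rV[R]_k) : pen k * `|c| ^+ 2 <= Ak c.
Proof.
by rewrite /Ak ler_wpDl ?potential_ge0// ler_pM2l ?pen_gt0// sqr_norm_le_dotv.
Qed.

(** The penalty is nonnegative, so the potential is at most 1; [2 / c1] is the scale that comes out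
    of [potential_coercive]. *)
Lemma level_energy k (c : 'rV[R]_k) : Ak c = 1 -> (energy (2 / c1) (vc c) <= (th^-1)%:E)%E.
Proof.
move=> Ac; have p1 : potential nu al (dcomb c) <= 1.
  by rewrite -Ac lerDl mulr_ge0 ?dotvv_ge0// ltW// pen_gt0.
have c20 : 0 < 2 / c1 by rewrite divr_gt0.
have Ev : (energy (2 / c1) (vc c) < +oo)%E by apply: vcomb_energy.
have E0 : (0 <= energy (2 / c1) (vc c))%E by apply: int_ge0 => z; exact: dmod_ge0.
have := potential_coercive youngM al_m al_c al_odd al_mono b00 c00 mD ID al_le (dcomb_EM c) th0 c10 al_coercive.
have mv : measurable_fun setT (vc c) by exact: measurable_vcomb.
have [mdc _] := dcomb_EM c.
have mM : measurable_fun setT (fun z => M (c1 / 2 * dcomb c z)).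
  by apply: (measurableT_comp (measurable_young youngM)); exact: measurable_funM.
rewrite (intZ _ mM (fun z => M_ge0 _) (ltW th0)).
have -> : (\int[nu]_z (M (c1 / 2 * dcomb c z))%:E = energy (2 / c1) (vc c))%E.
  rewrite -(nu_energy s youngM (2 / c1) mv); apply: eq_integral => z _.
  by rewrite Ds_vc invf_div mulrC.
rewrite -(fineK (_ : energy (2 / c1) (vc c) \is a fin_num)) ?ge0_fin_numE// -EFinM !lee_fin.
move=> H; rewrite -[leRHS]mul1r ler_pdivlMr// mulrC; exact: le_trans H p1.
Qed.

(** [eps] fixes a mesh, the mesh fixes the number [m] of averages to be annihilated, and [m] fixes
    [m + 1] separated bumps. All this precedes [k], so [alpha] does not depend on it. *)
Lemma ls_level (eps : R) : 0 < eps -> exists (alpha : R) (k0 : nat), 0 < alpha /\ forall k, (k0 <= k)%N ->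
  exists (c : 'rV[R]_k) (l : R), [/\ 0 < l, Ak c = 1, dAk c = l *: dmass c & alpha <= mass c <= eps].
Proof.
move=> eps0; have e40 : 0 < eps / 4 by rewrite divr_gt0.
have [kap [eta [kap0 eta0 Hsm]]] := prim_source_small youngM Omega_b Omega_open g_odd g_cont g_pos A0 C0 g_bound e40.
have c20 : 0 < 2 / c1 by rewrite divr_gt0.
have thi0 : 0 <= th^-1 by rewrite invr_ge0 ltW.
have [l Hl] := Q_small n0 s01 youngM b c20 thi0 kap0 eta0.
pose N := (b.+1 * l.+1)%N; pose m := #|{: grid n N}|.
pose cb (i : 'I_m) := cube (gpt (mesh R l) (enum_val i)) (mesh R l).
pose P k (c : 'rV[R]_k) : 'rV[R]_m := \row_i dotv (\row_(j < k) \int[la]_(q in cb i) (1 * phi j q)) c.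
(* If all averages vanish, so does the quasi-interpolant, and [vc v] is its own interpolation error
   up to sign, hence small by [Q_small]. *)
have B_P k (v : 'rV[R]_k) : Ak v = 1 -> P k v = 0 -> mass v < eps / 2.
  move=> Av Pv; have Q0 x : Q b l (vc v) x = 0.
    rewrite /Q /qint big1// => z _; rewrite /avg.
    have /rowP/(_ (enum_rank z)) := Pv; rewrite !mxE dotv_integral ?/cb ?enum_rankK.
    - under eq_Rintegral do rewrite mul1r.
      by rewrite /vcomb => ->; rewrite !mulr0.
    - exact: measurable_cube.
    - move=> j; rewrite (_ : _ \o _ = EFin \o phi j); last by apply/funext => q; rewrite /= mul1r.
      have aj : admissible 1 (phi j).
        split; [exact: measurable_phi| |exact: energy_phi].
        by move=> x' xb; apply: phi_out => // /Omega_b; rewrite leNgt xb.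
      by apply: (admissible_integrable n0 s01 youngM _ ltr01 aj); exact/ltW/mesh_gt0.
  have mv : measurable_fun setT (vc v) by exact: measurable_vcomb.
  have av : admissible (2 / c1) (vc v) by apply: vcomb_admissible.
  have h1 : (amod kap (vc v) <= eta%:E)%E.
    apply: le_trans (Hl l _ (leqnn l) av (level_energy Av)).
    by rewrite le_eqVlt; apply/orP; left; apply/eqP; apply: eq_integral => x _; rewrite Q0 sub0r mulNr young_even.
  have vO x : ~ Omega x -> vc v x = 0 by exact: vcomb_out.
  have mG : measurable_fun setT (fun x => G (vc v x)) by exact: measurable_prim_source.
  have := Hsm _ mv vO h1; rewrite -ge0_Rintegral_fin//; last 2 first.
  - by move=> x; exact: prim_source_ge0.
  - exact: le_lt_trans (Hsm _ mv vO h1) (ltry _).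
  by rewrite lee_fin => h2; apply: le_lt_trans h2 _; lra.
have [J [p Jp]] := independent_bumps n0 Omega_b Omega_open Omega_neq0 m.
pose io k (y : 'rV[R]_m.+1) : 'rV[R]_k := \row_j \sum_i y ord0 i * (nat_of_ord j == J i)%:R.
pose W := @vcomb R n b Omega m.+1 J.
(* A bound, free of [k], for [Ak] on the span of the separated bumps; the square dominates the
   penalty. *)
pose F (y : 'rV[R]_m.+1) := potential nu al (lincomb (fun i => psi (J i)) y) + (m.+1%:R * `|y|) ^+ 2.
have cF : continuous F.
  move=> y; apply: (@cvgD _ _ _ (nbhs y)).
    exact: (potential_continuous youngM al_m al_c al_odd al_mono b00 c00 mD ID al_le (fun i => psi_EM' (J i))).
  have cn : m.+1%:R * `|z| @[z --> y] --> m.+1%:R * `|y|.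
    by apply: (@cvgM _ _ (nbhs y)); [exact: cvg_cst|apply: (@cvg_norm _ _ _ (nbhs y)); exact: cvg_id].
  by rewrite /GRing.exp /=; apply: (@cvgM _ _ (nbhs y)).
have F0 : F 0 = 0.
  rewrite /F normr0 mulr0 expr0n addr0 (_ : lincomb _ _ = fun=> 0) ?potential0//.
  by apply/funext => z; rewrite /lincomb big1// => j _; rewrite mxE mul0r.
have [r r0 Hr] : exists2 r, 0 < r & forall y, `|y| < r -> F y < 1.
  have /cvgrPdist_lt/(_ _ ltr01)/nbhs_ballP[r r0 Hr] := cF 0; exists r => // y yr.
  have := Hr y; rewrite -ball_normE /= sub0r normrN => /(_ yr); rewrite F0 sub0r normrN.
  exact: le_lt_trans (ler_norm _).
pose massJ := @FiniteDimension.mass R n b Omega g _ J.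
pose S := [set y : 'rV[R]_m.+1 | `|y| = r / 2].
have r20 : 0 < r / 2 by rewrite divr_gt0.
have cS : compact S.
  apply: (subclosed_compact _ (@compact_cube R m.+1 0 r (ltn0Sn m))).
    apply: (@closed_comp _ _ (fun y : 'rV[R]_m.+1 => `|y|) [set r / 2]); last exact: closed_eq.
    by move=> y _; exact: norm_continuous.
  by move=> y /= yr; rewrite /cube /= subr0 yr; lra.
have S0 : S !=set0.
  exists (const_mx (r / 2)); rewrite /S /=; apply/eqP; rewrite eq_le; apply/andP; split.
    by apply: norm_le_coord => [|i]; [exact: ltW|rewrite mxE gtr0_norm].
  by apply: le_trans (coord_le_norm _ ord0); rewrite mxE gtr0_norm.
have cm : continuous massJ := @mass_continuous R n M n0 youngM b Omega Omega_b Omega_open g A C g_odd g_cont g_pos A0 C0 g_bound m.+1 J.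
have [y1 /set_mem y1S Hy1] := compact_EVT_min S0 cS (continuous_subspaceT cm).
have Wp y i : W y (p i) = y ord0 i.
  rewrite /W /vcomb /lincomb (bigD1 i)//= Jp eqxx mulr1 big1 ?addr0// => i' ii.
  by rewrite Jp (negbTE ii) mulr0.
have massJ_gt0 y : y != 0 -> 0 < massJ y.
  move=> yn0; rewrite ltNge; apply/negP => I0.
  have [i yi] : exists i, y ord0 i != 0.
    apply/not_existsP => H; move/eqP: yn0; apply; apply/rowP => i; rewrite mxE.
    by apply: contrapT => /eqP; exact: H.
  have cW : continuous (W y).
    move=> x; apply: (@cvg_big R _ +%R 0 predT add_continuous _ (nbhs x)) => j _.
    apply: (@cvgM _ _ (nbhs x)); first exact: cvg_cst.
    rewrite /Density.phi; case: unpickle => [q|]; last exact: cvg_cst.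
    by case: ifP => _; [exact: continuous_bump|exact: cvg_cst].
  have H := ge0_Rintegral_eq0 (mass_integrable n0 youngM Omega_b Omega_open g_odd g_cont g_pos A0 C0 g_bound J y)
    (fun x => prim_source_ge0 g_odd g_cont g_pos _) I0.
  have oW : open (W y @^-1` [set t | t != 0]).
    by apply: open_comp => [x _|]; [exact: cW|exact: open_neq].
  have Wpi : (W y @^-1` [set t | t != 0]) (p i) by rewrite /= Wp.
  have [x [/= Wx Gx]] := ae_open_point oW Wpi H.
  by have := prim_source_gt0 g_odd g_cont g_pos Wx; rewrite Gx ltxx.
have alpha0 : 0 < massJ y1.
  by apply: massJ_gt0; rewrite -normr_gt0 y1S.
exists (massJ y1), (\max_i J i).+1; split=> // k kJ.
have Jk i : (J i < k)%N by apply: leq_trans kJ; rewrite ltnS; exact: leq_bigmax.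
have vio y x : vc (io k y) x = W y x by exact: lincomb_reindex.
have dio y : dcomb (io k y) = lincomb (fun i => psi (J i)) y by apply/funext => z; exact: lincomb_reindex.
have ioZ t y : t *: io k y = io k (t *: y).
  by apply/rowP => j; rewrite !mxE mulr_sumr; apply: eq_bigr => i _; rewrite mxE mulrA.
have massio y : mass (io k y) = massJ y by apply: eq_Rintegral => x _; rewrite vio.
have nio y : `|io k y| <= m.+1%:R * `|y|.
  apply: norm_le_coord => [|j]; first by rewrite mulr_ge0.
  rewrite mxE; apply: le_trans (ler_norm_sum _ _ _) _.
  apply: (@le_trans _ _ (\sum_(i < m.+1) `|y|)); last by rewrite sumr_const card_ord mulr_natl.
  apply: ler_sum => i _; rewrite normrM; apply: le_trans (_ : _ <= `|y| * 1) _; last by rewrite mulr1.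
  by apply: ler_pM => //; [exact: coord_le_norm|case: eqP; rewrite ?normr1 ?normr0].
have pen_k : pen k * k%:R <= 1.
  have k1 : 0 < k.+1%:R :> R by [].
  rewrite /pen exprVn mulrC ler_pdivrMr ?exprn_gt0// mul1r -natrX ler_nat.
  by rewrite expnS expn1; apply: leq_trans (leqnSn k) _; rewrite leq_pmull.
have pen_sq (q t a : R) : q * t <= 1 -> q * (t * (a * a)) <= a ^+ 2.
  by move=> h; have := sqr_ge0 a; rewrite expr2 => a2; rewrite mulrA ler_piMl.
have AF y : Ak (io k y) <= F y.
  rewrite /Ak /F dio lerD2l; apply: le_trans (_ : _ <= pen k * (k%:R * (`|io k y| * `|io k y|))) _.
    by rewrite ler_pM2l ?pen_gt0//; apply: le_trans (ler_norm _) (dotv_le _ _).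
  apply: le_trans (pen_sq _ _ _ pen_k) _.
  by rewrite ler_sqr ?nnegrE ?mulr_ge0// nio.
have hdiff : forall r0 e : R, 0 < e -> exists2 d, 0 < d & forall v w : 'rV[R]_k, `|v| <= r0 -> `|w - v| <= d ->
    mass v + dotv (dmass v) (w - v) - e * `|w - v| <= mass w.
  by move=> rr e e0; exact: (mass_diff n0 youngM Omega_b Omega_open g_odd g_cont g_pos A0 C0 g_bound _ _ e0).
have hpos (v : 'rV[R]_k) : Ak v = 1 -> massJ y1 <= mass v -> 0 < dotv (dmass v) v.
  by move=> _ av; exact: (mass_pos n0 youngM Omega_b Omega_open g_odd g_cont g_pos C0 g_bound (lt_le_trans alpha0 av)).
have hPc : continuous (P k).
  apply: (@continuous_rowP R _ m (fun i c => dotv (\row_(j < k) \int[la]_(q in cb i) (1 * phi j q)) c)) => i c.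
  apply: (@cvg_big R _ +%R 0 predT add_continuous _ (nbhs c)) => j _.
  by apply: (@cvgM _ _ (nbhs c)); [exact: cvg_cst|exact: coord_continuous].
have hPo v : P k (- v) = - P k v by apply/rowP => i; rewrite !mxE dotvNr.
have hic : continuous (io k).
  apply: (@continuous_rowP R 'rV[R]_m.+1 k (fun j (y : 'rV[R]_m.+1) => \sum_i y ord0 i * (nat_of_ord j == J i)%:R)) => j y.
  apply: (@cvg_big R _ +%R 0 predT add_continuous _ (nbhs y)) => i _.
  by apply: (@cvgM _ _ (nbhs y)); [exact: coord_continuous|exact: cvg_cst].
have hio y : io k (- y) = - io k y by rewrite -scaleN1r -ioZ scaleN1r.
have hi0 y : y != 0 -> io k y != 0.
  move=> yn0; apply: contra yn0 => /eqP iy0; apply/eqP/rowP => i; rewrite mxE -Wp -vio iy0.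
  by rewrite /vcomb /lincomb big1// => j _; rewrite mxE mul0r.
(* Since [F < 1] on the ball of radius [r], a point of the level set lies outside it; shrinking it
   to the sphere [S] can only decrease the mass. *)
have hBio y t : Ak (t *: io k y) = 1 -> massJ y1 <= mass (t *: io k y).
  rewrite ioZ massio => At; set y' := t *: y.
  have ry : r <= `|y'| by rewrite leNgt; apply/negP => /Hr; rewrite ltNge -At AF.
  have y'0 : 0 < `|y'| by exact: lt_le_trans ry.
  pose q := r / 2 / `|y'|; have q0 : 0 < q by rewrite divr_gt0.
  have qS : S (q *: y') by rewrite /S /= normrZ gtr0_norm// /q divfK// gt_eqF.
  apply: le_trans (Hy1 _ (mem_set qS)) _.
  apply: (mass_le n0 youngM Omega_b Omega_open g_odd g_cont g_pos A0 C0 g_bound) => x.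
  rewrite vcombZ normrM (gtr0_norm q0) ler_piMl// /q ler_pdivrMr// mul1r; apply: le_trans ry; lra.
have heps : eps / 2 < eps by lra.
have [c [lam [H1 H2 H3 H4]]] := @lusternik_schnirelmann R k m (@Ak k) mass (@dAk k) dmass (P k) (io k)
  (massJ y1) (eps / 2) eps (pen k)
  (@dAk_continuous k)
  (@dmass_continuous R n M n0 youngM b Omega Omega_b Omega_open g A C g_cont C0 g_bound k (@nat_of_ord k))
  (@mass_continuous R n M n0 youngM b Omega Omega_b Omega_open g A C g_odd g_cont g_pos A0 C0 g_bound k (@nat_of_ord k))
  (@AkN k) (@dAkN k)
  (dmassN n0 youngM Omega_b Omega_open g_odd g_cont C0 g_bound (@nat_of_ord k)) (Ak0 k) (@Ak_sub k) (pen_gt0 k) (@Ak_norm k)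
  hdiff hpos hPc hPo hic hio hi0 hBio (B_P k) heps.
by exists c, lam.
Qed.

End galerkin.

End ApproximateEigenpairs.
Import ApproximateEigenpairs.

Module LimitTools.

(** * Limits of duality pairings *)

Section modular_pairing.
Context d (T : measurableType d) (R : realType) (mu : {measure set T -> \bar R}) (M : R -> R).
Hypothesis youngM : young M.
Local Notation Mbar := (complementary M).
Local Notation M_ge0 := (young_ge0 youngM).
Local Notation Mbar_ge0 := (complementary_ge0 youngM).

Let young_pair (K L x t : R) : 0 < K -> 0 < L -> `|x * t| <= K * L * (Mbar (x / K) + M (t / L)).
Proof.
move=> K0 L0; have -> : x * t = K * L * (t / L * (x / K)) by field; rewrite !gt_eqF.
rewrite normrM gtr0_norm ?mulr_gt0// ler_pM2l ?mulr_gt0// [leRHS]addrC; exact: young_ineq.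
Qed.

Let mMb (F : T -> R) K : measurable_fun setT F -> measurable_fun setT (fun x => Mbar (F x / K)).
Proof. by move=> mF; apply: (measurableT_comp (measurable_complementary youngM)); exact: measurable_funM. Qed.

Let mMd (F : T -> R) K : measurable_fun setT F -> measurable_fun setT (fun x => M (F x / K)).
Proof. exact: measurable_M_div. Qed.

Lemma measurable_complementary_div (F : T -> R) K : measurable_fun setT F -> measurable_fun setT (fun x => Mbar (F x / K)).
Proof. exact: mMb. Qed.

Lemma measurable_affine (a : R) (f h : T -> R) : measurable_fun setT f -> measurable_fun setT h ->
  measurable_fun setT (fun x => a * f x + h x).
Proof. by move=> mf mh; apply: measurable_funD => //; exact: measurable_funM. Qed.

Lemma affine_integral (c : R) (f h : T -> R) : 0 <= c -> measurable_fun setT f -> measurable_fun setT h ->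
  (forall x, 0 <= f x) -> (forall x, 0 <= h x) ->
  (\int[mu]_x (c * f x + h x)%:E = c%:E * \int[mu]_x (f x)%:E + \int[mu]_x (h x)%:E)%E.
Proof.
move=> c0 mf mh f0 h0; rewrite intD//; [by rewrite intZ|exact: measurable_funM|by move=> x; rewrite mulr_ge0].
Qed.

Lemma scaled_modular (D : T -> R) (K : R) : 0 < K -> measurable_fun setT D ->
  (forall k, 0 < k -> (\int[mu]_z (Mbar (D z / k))%:E < +oo)%E) ->
  measurable_fun setT (fun z => Mbar (2 * D z / K) / 2) /\ (\int[mu]_z (Mbar (2 * D z / K) / 2)%:E < +oo)%E.
Proof.
move=> K0 mD ID; have m1 : measurable_fun setT (fun z => Mbar (2 * D z / K) / 2).
  by apply: measurable_funM => //; apply: mMb; exact: measurable_funM.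
split => //; have K20 : 0 < K / 2 by rewrite divr_gt0.
apply: le_lt_trans (ID _ K20); apply: int_le => //.
- exact: mMb.
- by move=> z; rewrite divr_ge0// Mbar_ge0.
- move=> z; have -> : 2 * D z / K = D z / (K / 2) by field; rewrite gt_eqF.
  by rewrite ler_pdivrMr// ler_peMr ?Mbar_ge0// ler1n.
Qed.

Lemma modular_integrable (F v : T -> R) (K L : R) : 0 < K -> 0 < L -> measurable_fun setT F -> measurable_fun setT v ->
  (\int[mu]_x (Mbar (F x / K))%:E < +oo)%E -> (\int[mu]_x (M (v x / L))%:E < +oo)%E ->
  mu.-integrable setT (EFin \o (fun x => F x * v x)).
Proof.
move=> K0 L0 mF mv IF Iv; have KL : 0 <= K * L by rewrite mulr_ge0// ltW.
have m1 : measurable_fun setT (fun x => Mbar (F x / K) + M (v x / L)) by apply: measurable_funD; [exact: mMb|exact: mMd].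
apply: (integrable_dominated (G := fun x => K * L * (Mbar (F x / K) + M (v x / L)))).
- exact: measurable_funM.
- exact: measurable_funM.
- rewrite (intZ mu m1 (fun x => addr_ge0 (Mbar_ge0 _) (M_ge0 _)) KL).
  rewrite intD//; [|exact: mMb|exact: mMd|by move=> x; exact: Mbar_ge0|by move=> x; exact: M_ge0].
  by apply: lte_mul_pinfty; rewrite ?lee_fin//; exact: lte_add_pinfty.
- by move=> x; exact: young_pair.
Qed.

(* Modular convergence at a single scale suffices against the dual Orlicz class,
   although neither factor need be in the small class E. *)
Lemma modular_pair_cvg (F : T -> R) (w : nat -> T -> R) (v : T -> R) (K L : R) : 0 < K -> 0 < L ->
  measurable_fun setT F -> (forall k, measurable_fun setT (w k)) -> measurable_fun setT v ->
  (\int[mu]_x (Mbar (F x / K))%:E < +oo)%E -> mu.-integrable setT (EFin \o (fun x => F x * v x)) ->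
  (forall k, \int[mu]_x (M ((w k x - v x) / L))%:E <= (2^-1 ^+ k)%:E)%E ->
  \int[mu]_x (F x * w k x) @[k --> \oo] --> \int[mu]_x (F x * v x).
Proof.
move=> K0 L0 mF mw mv IF iFv Iw; have KL : 0 < K * L by rewrite mulr_gt0.
have mwv k : measurable_fun setT (fun x => w k x - v x) by exact: measurable_funB.
have mwL k : measurable_fun setT (fun x => (w k x - v x) / L) by exact: measurable_funM.
apply: Rintegral_cvg => //; first by move=> k; exact: measurable_funM.
have cw := ae_cvg0_summable youngM mwL Iw.
apply: (@vitali _ _ _ mu (fun k x => `|F x * w k x - F x * v x|)) => [k|k x//||e e0].
- by apply: measurableT_comp => //; apply: measurable_funB; exact: measurable_funM.
- apply: ae_imp cw => x cx; have : F x * L * ((w k x - v x) / L) @[k --> \oo] --> 0.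
    by rewrite -(mulr0 (F x * L)); apply: cvgM => //; exact: cvg_cst.
  move=> /cvg_norm; rewrite normr0; apply: cvg_trans; apply: near_eq_cvg; apply: nearW => k.
  by rewrite -mulrBr -mulrA [L * _]mulrC divfK ?gt_eqF.
- exists (fun x => K * L * Mbar (F x / K)), (fun k x => K * L * M ((w k x - v x) / L)); split; [split|split].
  + by apply: measurable_funM => //; exact: mMb.
  + by move=> x; rewrite mulr_ge0 ?(ltW KL)// Mbar_ge0.
  + rewrite (intZ mu (mMb K mF) (fun x => Mbar_ge0 _) (ltW KL)).
    by apply: lte_mul_pinfty; rewrite ?lee_fin ?(ltW KL).
  + by move=> k; apply: measurable_funM => //; exact: mMd.
  + by move=> k x; rewrite mulr_ge0 ?(ltW KL)// M_ge0.
  + by move=> k x; rewrite -mulrBr -mulrDr; exact: young_pair.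
  + have [N HN] : exists N : nat, forall k, (N <= k)%N -> K * L * 2^-1 ^+ k <= e.
      have := @cvg_geometric R (K * L) 2^-1 _; rewrite ger0_norm ?invr_ge0// invf_lt1// ltr1n => /(_ isT).
      move=> /cvgrPdist_le/(_ _ e0)[N _ HN]; exists N => k /HN; rewrite /geometric /= sub0r normrN.
      exact: le_trans (ler_norm _).
    exists N => k Nk; rewrite (intZ mu (mMd L (mwv k)) (fun x => M_ge0 _) (ltW KL)).
    apply: (@le_trans _ _ ((K * L)%:E * (2^-1 ^+ k)%:E)%E); first by rewrite lee_wpmul2l ?lee_fin ?(ltW KL).
    by rewrite -EFinM lee_fin HN.
Qed.

Lemma E_pair_cvg (F : T -> R) (w : nat -> T -> R) (v : T -> R) (K B : R) : 0 < K -> orliczE mu Mbar F ->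
  (forall k, measurable_fun setT (w k)) -> measurable_fun setT v -> {ae mu, forall x, w k x @[k --> \oo] --> v x} ->
  (forall k, \int[mu]_x (M (w k x / K))%:E <= B%:E)%E ->
  \int[mu]_x (w k x * F x) @[k --> \oo] --> \int[mu]_x (v x * F x).
Proof.
move=> K0 [mF IF] mw mv cw Iw.
have IF' k : 0 < k -> (\int[mu]_x (Mbar (k * F x))%:E < +oo)%E.
  by move=> k0; have := IF k^-1; rewrite invr_gt0 => /(_ k0); under eq_integral do rewrite invrK mulrC.
have Iv : (\int[mu]_x (M (v x / K))%:E <= B%:E)%E.
  apply: (fatou_le (f_ := fun k x => M (w k x / K))) => // [k|x||].
  - exact: mMd.
  - exact: mMd.
  - by move=> *; exact: M_ge0.
  - apply: ae_imp cw => x cx; apply: (@cvg_comp _ _ _ (fun k => w k x / K) M _ (nbhs (v x / K))).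
      by apply: cvgM => //; exact: cvg_cst.
    exact: young_continuous.
have yi x t : `|x * t| <= M x + Mbar t by exact: young_ineq.
apply: Rintegral_cvg => [k||e e0]; first exact: measurable_funM.
- apply: (pair_integrable M_ge0 Mbar_ge0 (young_continuous youngM) (measurable_complementary youngM) yi K0 mv mF) => //.
  exact: le_lt_trans Iv (ltry _).
- have [N HN] := pair_cvg M_ge0 Mbar_ge0 (young_continuous youngM) (measurable_complementary youngM) yi K0 mw mv mF cw Iw IF' e0.
  by exists N => k Nk; apply: le_trans (HN k Nk); under eq_integral do rewrite -mulrBl.
Qed.

End modular_pairing.

Section limits.
Context (R : realType) (n : nat) (s : R) (M : R -> R).
Hypothesis n0 : (0 < n)%N.
Hypothesis s01 : 0 < s < 1.
Hypothesis youngM : young M.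
Local Notation la := (lebesgue_rV R n).
Local Notation X := 'rV[R]_n.
Local Notation Mbar := (complementary M).
Local Notation M_ge0 := (young_ge0 youngM).
Local Notation energy := (@energy R n s M).
Local Notation amod := (@amod R n M).
Context (b : nat) (Omega : set X).
Hypothesis Omega_b : forall x, Omega x -> `|x| <= b%:R.
Hypothesis Omega_open : open Omega.
Hypothesis Omega_segment : segment_property Omega.
Local Notation admissible := (admissible s M b).

Lemma dx_amod (K : R) (u : X -> R) : measurable_fun setT u -> (\int[dx]_x (M ((u : Rn R n -> R) x / K))%:E = amod K u)%E.
Proof.
move=> mu; rewrite (ge0_integral_dx (f := fun x => (M (u x / K))%:E))//.
- by apply/measurable_EFinP; exact: measurable_M_div.
- by move=> x; rewrite lee_fin M_ge0.
Qed.

Lemma measurable_dx (u : X -> R) : measurable_fun setT u -> measurable_fun setT (u : Rn R n -> R).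
Proof. by move=> mu; exact: (measurable_fun_completed (mu := la) mu). Qed.

Lemma dx_integral (f : X -> R) : measurable_fun setT f -> (\int[dx]_x ((f : Rn R n -> R) x)%:E = \int[la]_x (f x)%:E)%E.
Proof.
move=> mf; have mfE : measurable_fun setT (fun x => (f x)%:E) by exact/measurable_EFinP.
rewrite [LHS]integralE [RHS]integralE; congr (_ - _)%E.
  by apply: (ge0_integral_dx (f := (fun x => (f x)%:E)^\+%E)) => //; exact: measurable_funepos.
by apply: (ge0_integral_dx (f := (fun x => (f x)%:E)^\-%E)) => //; exact: measurable_funeneg.
Qed.

(** [D^s] only involves two values, so a.e. convergence of the functions is enough. *)
Lemma ae_Ds_cvg (w : nat -> X -> R) (U : X -> R) : {ae la, forall x, w k x @[k --> \oo] --> U x} ->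
  {ae (@nu R n), forall z : Rnn R n, @Ds R n s (w k) z @[k --> \oo] --> @Ds R n s U z}.
Proof.
move=> /ae_dx /ae_nu_prod; apply: ae_imp => z [z1 z2]; rewrite /Ds.
by apply: cvgM; [apply: cvgB|exact: cvg_cst].
Qed.

Lemma amod_energy (K B : R) : 0 < K -> exists k0 B', 0 < k0 /\ forall u, admissible K u -> (energy K u <= B%:E)%E ->
  (amod k0 u <= B'%:E)%E.
Proof.
move=> K0; exists (K * (n%:R * (2 * b%:R + 3)) `^ s), ((n%:R * (2 * b%:R + 3)) ^+ n / 2 ^+ n * B).
split; first by rewrite mulr_gt0// powR_gt0// mulr_gt0 ?ltr0n// ltr_wpDl// mulr_ge0.
move=> u [mu ub _] Eu; apply: le_trans (poincare n0 s01 youngM mu (ler0n _ b) K0 ub) _.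
rewrite [X in (_ <= X)%E]EFinM lee_wpmul2l// lee_fin divr_ge0 ?exprn_ge0// mulr_ge0// addr_ge0// mulr_ge0.
Qed.

Lemma pairing_cvg (K B : R) (w : nat -> X -> R) (U : X -> R) f F : 0 < K -> (forall k, admissible K (w k)) ->
  (forall k, energy K (w k) <= B%:E)%E -> measurable_fun setT U -> {ae la, forall x, w k x @[k --> \oo] --> U x} ->
  orliczE (@dx R n) Mbar f -> orliczE (@nu R n) Mbar F ->
  \int[dx]_x ((w k : Rn R n -> R) x * f x) @[k --> \oo] --> \int[dx]_x ((U : Rn R n -> R) x * f x) /\
  \int[nu]_z (@Ds R n s (w k) z * F z) @[k --> \oo] --> \int[nu]_z (@Ds R n s U z * F z).
Proof.
move=> K0 aw Ew mU cw fE FE; have mw k : measurable_fun setT (w k) by case: (aw k).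
have [k0 [B' [k00 HB]]] := amod_energy B K0.
split.
  apply: (E_pair_cvg youngM k00 fE (B := B')) => [k|||k].
  - exact: measurable_dx.
  - exact: measurable_dx.
  - exact: ae_dx cw.
  - by rewrite dx_amod//; exact: HB.
apply: (E_pair_cvg youngM K0 FE (B := B)) => [k|||k].
- exact: measurable_Ds_nu.
- exact: measurable_Ds_nu.
- exact: ae_Ds_cvg.
- by rewrite nu_energy.
Qed.

Lemma dense_sequence K v : 0 < K -> admissible K v -> (forall x, ~ Omega x -> v x = 0) ->
  exists (w : nat -> X -> R) (L : R), [/\ 0 < L, forall k, spanned b Omega (w k),
    forall k, (amod L (fun x => w k x - v x)%R <= (2^-1 ^+ k)%:E)%E &
    forall k, (energy L (fun x => w k x - v x)%R <= (2^-1 ^+ k)%:E)%E].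
Proof.
move=> K0 av vO; have [_ [L L0 H]] := density n0 s01 youngM Omega_b Omega_open Omega_segment K0 av vO.
have p2 : 0 < 2^-1 :> R by rewrite invr_gt0.
have [w Hw] := choice (fun k : nat => H (2^-1 ^+ k) (exprn_gt0 k p2)).
by exists w, L; split => // k; case: (Hw k).
Qed.

(** Take [t' = x / A] in the bound and the supremum over [x]: thus [g (u)] belongs to the dual
    Orlicz space whenever [u] has a finite modular. *)
Lemma source_complementary (g : R -> R) (A C : R) : 0 < A -> 0 < C ->
  (forall t t', `|g t * t'| <= C * (1 + M (A * t) + M (A * t'))) ->
  forall t, Mbar (g t / (A * C)) <= 1 + M (A * t).
Proof.
move=> A0 C0 gb t; apply: complementary_le_ub => // x x0.
have E : A * (x / A) = x by rewrite mulrC divfK// gt_eqF.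
have nE : `|g t * (x / A)| = `|g t| * (x / A) by rewrite normrM [X in _ * X]ger0_norm// divr_ge0// ltW.
have := gb t (x / A); rewrite E nE => H.
have -> : `|g t / (A * C)| = `|g t| / (A * C) by rewrite normrM normfV (gtr0_norm (mulr_gt0 A0 C0)).
rewrite mulrA ler_pdivrMr ?mulr_gt0//.
have -> : x * `|g t| = `|g t| * (x / A) * A by field; rewrite gt_eqF.
have -> : (1 + M (A * t) + M x) * (A * C) = C * (1 + M (A * t) + M x) * A by ring.
by rewrite ler_pM2r.
Qed.

End limits.

End LimitTools.
Import LimitTools.

Module LevelLimits.

(** * Passage to the limit in the restricted problems *)

Section level_limit.
Context (R : realType) (n : nat) (s : R) (M : R -> R).
Hypothesis n0 : (0 < n)%N.
Hypothesis s01 : 0 < s < 1.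
Hypothesis youngM : young M.
Local Notation la := (lebesgue_rV R n).
Local Notation X := 'rV[R]_n.
Local Notation Mbar := (complementary M).
Local Notation Minv := (complementary_inv M).
Local Notation M_ge0 := (young_ge0 youngM).
Local Notation energy := (@energy R n s M).
Local Notation amod := (@amod R n M).
Context (b : nat) (Omega : set X).
Hypothesis Omega_b : forall x, Omega x -> `|x| <= b%:R.
Hypothesis Omega_open : open Omega.
Hypothesis Omega_neq0 : Omega !=set0.
Hypothesis Omega_segment : segment_property Omega.
Local Notation admissible := (admissible s M b).
Local Notation phi := (phi b Omega).
Variables (g : R -> R) (A C : R).
Hypothesis g_odd : forall t, g (- t) = - g t.
Hypothesis g_cont : continuous g.
Hypothesis g_pos : forall t, 0 < t -> 0 < g t.
Hypothesis A0 : 0 < A.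
Hypothesis C0 : 0 < C.
Hypothesis g_bound : forall t t', `|g t * t'| <= C * (1 + M (A * t) + M (A * t')).
Local Notation G := (prim g).
Variables (al : Rnn R n -> R -> R) (D : Rnn R n -> R) (b0 c0 th c1 : R).
Hypothesis al_m : forall xi, measurable_fun setT (al^~ xi).
Hypothesis al_c : forall z, continuous (al z).
Hypothesis al_odd : forall z xi, al z (- xi) = - al z xi.
Hypothesis al_mono : forall z x y, x <= y -> al z x <= al z y.
Hypothesis b00 : 0 < b0.
Hypothesis c00 : 0 < c0.
Hypothesis mD : measurable_fun setT D.
Hypothesis IDk : forall k, 0 < k -> (\int[nu]_z (Mbar (D z / k))%:E < +oo)%E.
Hypothesis al_le : forall z xi, `|al z xi| <= D z + b0 * Minv (M (c0 * xi)).
Hypothesis th0 : 0 < th.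
Hypothesis c10 : 0 < c1.
Hypothesis al_coercive : {ae (@nu R n), forall z : Rnn R n, forall xi, th * M (c1 * xi) <= al z xi * xi}.
Let ID : (\int[nu]_z (Mbar (D z))%:E < +oo)%E.
Proof. by have := IDk ltr01; under eq_integral do rewrite divr1. Qed.
Local Notation psi := (@psi R n s b Omega).
Local Notation comb := (comb b Omega).
Let K1 : R := 2 / c1.
Let K10 : 0 < K1. Proof. by rewrite divr_gt0. Qed.

(** As [pen k <= 1], this bounds the level functional at a fixed combination in all larger spans at
    once. *)
Definition cost k (d : nat -> R) : R := potential nu al (@Ds R n s (comb k d)) + \sum_(j < k) d j ^+ 2.

Definition approximate_eigenpair (alpha eps : R) (k : nat) (u : X -> R) (l : R) : Prop :=
  [/\ [/\ 0 < l, test_functions Omega u, admissible (2 / c1) u, (energy (2 / c1) u <= (th^-1)%:E)%E &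
          forall K, 0 < K -> (energy K u < +oo)%E],
      forall j, (j < k)%N ->
        `|\int[nu]_z (al z (@Ds R n s u z) * psi j z) - l * \int[la]_x (g (u x) * phi j x)| <= 2 / k.+1%:R,
      [/\ 1 <= l * \int[la]_x (g (u x) * u x),
          \int[nu]_z (al z (@Ds R n s u z) * @Ds R n s u z) <= l * \int[la]_x (g (u x) * u x)
        & alpha <= \int[la]_x G (u x) <= eps]
    & forall k' d, (k' <= k)%N -> (forall j, (k' <= j)%N -> d j = 0) ->
        l * \int[la]_x (g (u x) * (comb k' d x - u x)) <= cost k' d].

Definition coef k (c : 'rV[R]_k) (j : nat) : R := if insub j is Some i then c ord0 i else 0.

Lemma vc_comb k (c : 'rV[R]_k) : vcomb b Omega (@nat_of_ord k) c = comb k (coef c).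
Proof.
apply/funext => x; apply: eq_bigr => j _; rewrite /coef; case: insubP => [i _ ij|]; last by rewrite ltn_ord.
by congr (c ord0 _ * _); apply/val_inj.
Qed.

Lemma comb_vc k k' d : (k' <= k)%N -> (forall j, (k' <= j)%N -> d j = 0) ->
  comb k' d = vcomb b Omega (@nat_of_ord k) (\row_j d j).
Proof.
move=> kk d0; rewrite -(comb_widen b Omega kk d0); apply/funext => x.
by apply: eq_bigr => j _; rewrite mxE.
Qed.

Lemma approximate_eigenpairs (eps : R) : 0 < eps -> exists alpha, 0 < alpha /\ exists k0, forall k, (k0 <= k)%N ->
  exists u l, approximate_eigenpair alpha eps k u l.
Proof.
move=> /(ls_level n0 s01 youngM Omega_b Omega_open Omega_neq0 g_odd g_cont g_pos A0 C0 g_bound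
  al_m al_c al_odd al_mono b00 c00 mD ID al_le th0 c10 al_coercive) [alpha [k0 [a0 H]]].
exists alpha; split => //; exists k0 => k /H [c [l [l0 Ac Ec mc]]].
have dm := dmass_dotv n0 youngM Omega_b Omega_open g_cont C0 g_bound (@nat_of_ord k) c.
have dA := dAk_dotv s01 youngM b Omega al_m al_c b00 c00 mD ID al_le c.
have sub := Ak_sub s01 youngM b Omega al_m al_c al_odd al_mono b00 c00 mD ID al_le c.
have Al := Ak_le s01 youngM b Omega al_m al_c al_odd al_mono b00 c00 mD ID al_le c.
have pc := Ak_norm s b Omega al_c al_odd al_mono c; rewrite Ac in pc.
have p0 := pen_gt0 R k.
exists (vcomb b Omega (@nat_of_ord k) c), l; split.
- split => //; first by rewrite vc_comb; exact: test_functions_comb.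
    exact: vcomb_admissible.
    exact: (level_energy s01 youngM al_m al_c al_odd al_mono b00 c00 mD ID al_le th0 c10 al_coercive Ac).
  by move=> K K0; exact: vcomb_energy.
- move=> j jk; have := congr1 (fun v : 'rV_k => v ord0 (Ordinal jk)) Ec.
  rewrite !mxE (Ds_vc s b Omega c) /= => E.
  have alg (p q r : R) : p + q = r -> p - r = - q by move=> <-; ring.
  rewrite (alg _ _ _ E).
  (* The deviation is the derivative of the penalty; [pen k * |c| ^ 2 <= 1] on the level set, so
     [pen k * |c|] is at most the square root of [pen k]. *)
  rewrite normrN -mulrA normrM (ger0_norm (ler0n R 2)) ler_pM2l// normrM (gtr0_norm p0).
  apply: (@le_trans _ _ (pen R k * `|c|)); first by rewrite ler_pM2l// coord_le_norm.
  rewrite -ler_sqr ?nnegrE ?mulr_ge0 ?(ltW p0)// exprMn expr2 -mulrA -/(pen R k).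
  by rewrite -[leRHS]mulr1 ler_pM2l.
- have E : dotv (dAk s b Omega al c) c = l * \int[la]_x (g (vcomb b Omega (@nat_of_ord k) c x) * vcomb b Omega (@nat_of_ord k) c x).
    by rewrite Ec dotvZl dm.
  split => //; first by rewrite -E -Ac.
  by rewrite -E dA (Ds_vc s b Omega c) lerDl mulr_ge0 ?dotvv_ge0// mulr_ge0// ltW.
- move=> k' d kk d0; rewrite (comb_vc kk d0); set w := \row_j d j.
  under eq_Rintegral do rewrite vcombB.
  rewrite -dm; have -> : l * dotv (dmass b Omega g (@nat_of_ord k) c) (w - c) = dotv (dAk s b Omega al c) (w - c) by rewrite Ec dotvZl.
  have := sub w; rewrite Ac => h1; apply: (@le_trans _ _ (Ak s b Omega al w)); first by lra.
  rewrite /Ak /cost (comb_vc kk d0) -/w (Ds_vc s b Omega w) lerD2l.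
  apply: (@le_trans _ _ (1 * dotv w w)).
    rewrite ler_wpM2r ?dotvv_ge0// exprn_ile1// invf_le1//; by rewrite ler1n.
  rewrite mul1r /dotv; under eq_bigr do rewrite mxE -expr2.
  rewrite -(big_mkord predT (fun j => d j ^+ 2)) (big_cat_nat (n := k'))//= big_mkord [X in _ + X]big1_seq ?addr0// => j.
  by rewrite mem_index_iota => /andP[_ /andP[kj _]]; rewrite d0// expr0n.
Qed.

Lemma amod_ae K (u v : X -> R) : measurable_fun setT u -> measurable_fun setT v -> {ae la, forall x, u x = v x} ->
  amod K u = amod K v.
Proof.
move=> mu mv uv; apply: (@ae_eq_integral _ _ _ la setT (fun x => (M (v x / K))%:E) (fun x => (M (u x / K))%:E) measurableT).
- by apply/measurable_EFinP; exact: measurable_M_div.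
- by apply/measurable_EFinP; exact: measurable_M_div.
- by apply: ae_imp uv => x -> _.
Qed.

Lemma energy_ae K (u v : X -> R) : measurable_fun setT u -> measurable_fun setT v -> {ae la, forall x, u x = v x} ->
  energy K u = energy K v.
Proof.
move=> mu mv uv; rewrite -!(nu_energy s youngM)//.
apply: (@ae_eq_integral _ _ _ (@nu R n) setT (fun z => (M (@Ds R n s v z / K))%:E) (fun z => (M (@Ds R n s u z / K))%:E) measurableT).
- by apply/measurable_EFinP; apply: measurable_M_div => //; exact: measurable_Ds_nu.
- by apply/measurable_EFinP; apply: measurable_M_div => //; exact: measurable_Ds_nu.
- by apply: ae_imp (ae_nu_prod (ae_dx uv)) => z [z1 z2] _; rewrite /Ds z1 z2.
Qed.

(** The limit obtained before vanishes only a.e. outside [Omega]; multiplying by the indicator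
    changes no integral. *)
Lemma compact_limit_Omega (u : nat -> X -> R) : (forall k, admissible K1 (u k)) ->
  (forall k, (energy K1 (u k) <= (th^-1)%:E)%E) -> (forall k x, ~ Omega x -> u k x = 0) ->
  exists (f : nat -> nat) (U : X -> R), [/\ forall k, (k <= f k)%N, [/\ admissible K1 U,
    (energy K1 U <= (th^-1)%:E)%E & forall x, ~ Omega x -> U x = 0],
    {ae la, forall x, u (f k) x @[k --> \oo] --> U x} &
    forall k eta, 0 < k -> 0 < eta -> exists N, forall j, (N <= j)%N ->
      (amod k (fun x => u (f j) x - U x)%R <= eta%:E)%E].
Proof.
move=> au Eu uO; have thi : 0 <= th^-1 by rewrite invr_ge0 ltW.
have [f [U [ff [mU Ub EU] EU' cU aU]]] := compact_limit n0 s01 youngM K10 thi au Eu.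
have mO : measurable Omega by exact: open_measurable_rV.
pose V x := U x * \1_Omega x.
have mV : measurable_fun setT V by apply: measurable_funM => //; exact: measurable_indic.
have UV : {ae la, forall x, U x = V x}.
  apply: ae_imp cU => x cx; rewrite /V indicE; have [xO|xO] := boolP (x \in Omega); first by rewrite mulr1.
  rewrite mulr0; apply: (@cvg_unique _ _ (u (f k) x @[k --> \oo])) => //.
  have E : (fun k => u (f k) x) = (fun=> 0).
    by apply/funext => k; apply: uO => xO'; move: xO; rewrite mem_set.
  by rewrite /= E; exact: cvg_cst.
exists f, V; split => //.
- rewrite -(energy_ae K1 mU mV UV); split => //; last by move=> x xO; rewrite /V indicE memNset// mulr0.
  split => //; first by move=> x xb; rewrite /V Ub// mul0r.
  by rewrite -(energy_ae K1 mU mV UV).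
- by apply: ae_imp2 cU UV => x cx <-.
- move=> k eta k0 e0; have [N HN] := aU k eta k0 e0; exists N => j Nj.
  have muj : measurable_fun setT (u (f j)) by case: (au (f j)).
  rewrite -(@amod_ae k (fun x => u (f j) x - U x)); first exact: HN.
  + exact: measurable_funB.
  + exact: measurable_funB.
  + by apply: ae_imp UV => x ->.
Qed.

Section source_limits.
Variables (u : nat -> X -> R) (U : X -> R).
Hypothesis mu : forall k, measurable_fun setT (u k).
Hypothesis aU : admissible K1 U.
Hypothesis uO : forall k x, ~ Omega x -> u k x = 0.
Hypothesis UO : forall x, ~ Omega x -> U x = 0.
Hypothesis cu : {ae la, forall x, u k x @[k --> \oo] --> U x}.
Hypothesis amu : forall k eta, 0 < k -> 0 < eta -> exists N : nat, forall j, (N <= j)%N ->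
      (amod k (fun x => u j x - U x)%R <= eta%:E)%E.

Lemma source_limit (h : R -> X -> R) (c a : R) : 0 < c -> 0 <= a -> (forall x, continuous (h^~ x)) ->
  (forall v : X -> R, measurable_fun setT v -> measurable_fun setT (fun x => h (v x) x)) ->
  (forall t x, Omega x -> `|h t x| <= c * M (A * t) + a) -> (forall x, ~ Omega x -> h 0 x = 0) ->
  \int[la]_x h (u k x) x @[k --> \oo] --> \int[la]_x h (U x) x.
Proof.
move=> c0' a0 ch mh hb hO; have [mU _ _] := aU.
have mI : measurable_fun setT (fun x : X => a * \1_Omega x).
  by apply: measurable_funM => //; apply: measurable_indic; exact: open_measurable_rV.
have bd (v : X -> R) x : (~ Omega x -> v x = 0) -> `|h (v x) x| <= c * M (A * v x) + a * \1_Omega x.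
  move=> vO; rewrite indicE; have [xO|xO] := pselect (Omega x); first by rewrite mem_set// mulr1 hb.
  by rewrite vO// hO// normr0 (memNset xO) [X in _ + X]mulr0 addr0 mulr_ge0 ?(ltW c0')// M_ge0.
apply: (source_cvg youngM A0 (W := fun x => a * \1_Omega x) c0' mu mU) => //.
- by move=> k; exact: mh.
- exact: mh.
- by move=> x; rewrite mulr_ge0.
- exact: le_lt_trans (indic_Omega_int Omega_b Omega_open a0) (ltry _).
- by apply: ae_imp cu => x cx; apply: (@cvg_comp _ _ _ (fun k => u k x) (h^~ x) _ (nbhs (U x))) => //; exact: ch.
- by move=> k x; apply: bd; exact: uO.
- by move=> x; apply: bd; exact: UO.
- by move=> k k0; exact: (admissible_EM n0 s01 youngM K10 k0 aU).
Qed.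

Lemma source_limit_self : \int[la]_x (g (u k x) * u k x) @[k --> \oo] --> \int[la]_x (g (U x) * U x).
Proof.
have C20 : 0 < 2 * C by rewrite mulr_gt0.
apply: (@source_limit (fun t _ => g t * t) (2 * C) C) => //; first exact: ltW.
- by move=> x t; apply: (@cvgM _ _ (nbhs t)); [exact: g_cont|exact: cvg_id].
- by move=> v mv; apply: measurable_funM => //; exact: measurable_source.
- by move=> t x _; apply: le_trans (g_bound t t) _; rewrite !mulrDr mulr1 mulrAC mulr_natl mulr2n; lra.
- by move=> x _; rewrite mulr0.
Qed.

Lemma source_limit_prim : \int[la]_x G (u k x) @[k --> \oo] --> \int[la]_x G (U x).
Proof.
have C20 : 0 < C * 2 by rewrite mulr_gt0.
apply: (@source_limit (fun t _ => G t) (C * 2) C) => //; first exact: ltW.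
- by move=> x; exact: continuous_prim_source.
- by move=> v mv; exact: measurable_prim_source.
- move=> t x _; rewrite ger0_norm; last exact: prim_source_ge0.
  by apply: le_trans (prim_source_le youngM g_odd g_cont A0 C0 g_bound t) _; rewrite mulrDr mulr1 addrC mulrA.
- by move=> x _; exact: prim0.
Qed.

Lemma source_limit_test (w : X -> R) (B : R) : measurable_fun setT w -> 0 <= B -> (forall x, `|w x| <= B * \1_Omega x) ->
  \int[la]_x (g (u k x) * w x) @[k --> \oo] --> \int[la]_x (g (U x) * w x).
Proof.
move=> mw B0 wB; have MB := M_ge0 (A * B).
apply: (@source_limit (fun t x => g t * w x) C (C * (1 + M (A * B)))) => //; first by rewrite mulr_ge0 ?(ltW C0)// addr_ge0.
- by move=> x t; apply: (@cvgM _ _ (nbhs t)); [exact: g_cont|exact: cvg_cst].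
- by move=> v mv; apply: measurable_funM => //; exact: measurable_source.
- move=> t x xO; apply: le_trans (g_bound _ _) _; rewrite -mulrDr ler_pM2l// addrAC [leRHS]addrC lerD2r lerD2l.
  apply: young_le => //; rewrite !normrM ler_wpM2l// (ger0_norm B0); apply: le_trans (wB x) _.
  by rewrite indicE mem_set// mulr1.
- move=> x xO; have := wB x; rewrite indicE memNset// mulr0 normr_le0 => /eqP ->.
  by rewrite mulr0.
Qed.

End source_limits.

Lemma spanned_bounded w : spanned b Omega w -> measurable_fun setT w /\ exists B, 0 <= B /\ forall x, `|w x| <= B * \1_Omega x.
Proof.
move=> sw; split; first by apply: (@measurable_spanned R n b Omega).
have [k [d [d0 wE]]] := sw; pose c : 'rV[R]_k := \row_j d j.
exists (`|c| * k%:R); split; first by rewrite mulr_ge0.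
move=> x; rewrite wE (comb_vc (leqnn k) d0); exact: vcomb_le.
Qed.

Lemma source_modular (U : X -> R) : admissible K1 U -> (forall x, ~ Omega x -> U x = 0) ->
  measurable_fun setT (fun x => g (U x)) /\ (\int[la]_x (Mbar (g (U x) / (A * C)))%:E < +oo)%E.
Proof.
move=> aU UO; have [mU _ _] := aU; have mg := measurable_source g_cont mU; split => //.
have mI : measurable_fun setT (fun x : X => 1 * \1_Omega x : R).
  by apply: measurable_funM => //; apply: measurable_indic; exact: open_measurable_rV.
have mM : measurable_fun setT (fun x => M (U x / A^-1)) by exact: measurable_M_div.
apply: (@le_lt_trans _ _ (\int[la]_x (1 * \1_Omega x + M (U x / A^-1))%:E)%E).
  apply: int_le => [||x|x].
  - by apply: (measurableT_comp (measurable_complementary youngM)); exact: measurable_funM.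
  - exact: measurable_funD.
  - exact: complementary_ge0.
  - have [xO|xO] := pselect (Omega x); last first.
      by rewrite UO// (odd0 g_odd) mul0r complementary0// addr_ge0 ?M_ge0// mul1r indicE.
    by rewrite indicE mem_set// mul1r invrK [U x * A]mulrC; exact: source_complementary.
rewrite intD//; last by move=> x; exact: M_ge0.
apply: lte_add_pinfty; first exact: le_lt_trans (indic_Omega_int Omega_b Omega_open ler01) (ltry _).
by apply: (admissible_EM n0 s01 youngM K10 _ aU); rewrite invr_gt0.
Qed.

Lemma test_functions_out (u : X -> R) x : test_functions Omega u -> ~ Omega x -> u x = 0.
Proof.
move=> [_ _ su] xO; apply: contrapT => /eqP ux; apply: xO; apply: su; exact: subset_closure.
Qed.

Lemma seq_ge (x : nat -> R) (l a : R) : x k @[k --> \oo] --> l -> (forall k, a <= x k) -> a <= l.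
Proof.
move=> /cvgrPdist_lt cx H; rewrite leNgt; apply/negP => la.
have al0 : 0 < a - l by rewrite subr_gt0.
have [N _ HN] := cx _ al0; have := HN N (leqnn N); have := H N.
by rewrite ltr_norml => h /andP[h1 _]; lra.
Qed.

Lemma seq_le (x : nat -> R) (l a : R) : x k @[k --> \oo] --> l -> (forall k, x k <= a) -> l <= a.
Proof.
move=> /cvgrPdist_lt cx H; rewrite leNgt; apply/negP => la.
have al0 : 0 < l - a by rewrite subr_gt0.
have [N _ HN] := cx _ al0; have := HN N (leqnn N); have := H N.
by rewrite ltr_norml => h /andP[_ h1]; lra.
Qed.

Lemma cvg_subsequence (x : nat -> R) (i : nat -> nat) (l : R) : (forall k, (k <= i k)%N) ->
  x k @[k --> \oo] --> l -> x (i k) @[k --> \oo] --> l.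
Proof.
move=> ki cx B lB; have [N _ HN] := cx B lB; exists N => // k Nk; apply: HN => /=.
exact: leq_trans Nk (ki k).
Qed.

Lemma spanned_admissible w K : 0 < K -> spanned b Omega w -> admissible K w.
Proof.
move=> K0 [k [d [d0 wE]]]; have -> : w = vcomb b Omega (@nat_of_ord k) (\row_j d j).
  by apply/funext => x; rewrite wE (comb_vc (leqnn k) d0).
exact: vcomb_admissible.
Qed.

Lemma source_pair_integrable (U w : X -> R) K : 0 < K -> admissible K1 U -> (forall x, ~ Omega x -> U x = 0) ->
  admissible K w -> la.-integrable setT (EFin \o (fun x => g (U x) * w x)).
Proof.
move=> K0 aU UO aw; have [mg Ig] := source_modular aU UO; have [mw _ _] := aw.
apply: (modular_integrable youngM (mulr_gt0 A0 C0) ltr01 mg mw Ig).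
exact: (admissible_EM n0 s01 youngM K0 ltr01 aw).
Qed.

Section weak_limit.
Variables (U : X -> R) (l K : R).
Hypothesis aU : admissible K1 U.
Hypothesis UO : forall x, ~ Omega x -> U x = 0.
Let F z := al z (@Ds R n s U z).
Hypothesis K0 : 0 < K.
Hypothesis IF : (\int[nu]_z (Mbar (F z / K))%:E < +oo)%E.
Hypothesis UE : forall j, \int[nu]_z (F z * psi j z) = l * \int[la]_x (g (U x) * phi j x).

Let mF : measurable_fun setT F.
Proof. by case: aU => mU _ _; apply: measurable_superposition => //; exact: measurable_Ds_nu. Qed.

Lemma weak_spanned w : spanned b Omega w -> \int[nu]_z (F z * @Ds R n s w z) = l * \int[la]_x (g (U x) * w x).
Proof.
move=> [k [d [d0 wE]]]; pose c : 'rV[R]_k := \row_j d j.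
have -> : w = vcomb b Omega (@nat_of_ord k) c by apply/funext => x; rewrite wE (comb_vc (leqnn k) d0).
rewrite (Ds_vc s b Omega c) /vcomb /dcomb.
have [mg Ig] := source_modular aU UO.
rewrite -dotv_integral//; last first.
  move=> j; apply: (modular_integrable youngM K0 ltr01 mF _ IF); first by case: (psi_EM s01 youngM b Omega j).
  by case: (psi_EM s01 youngM b Omega j) => _ /(_ 1 ltr01); under eq_integral do rewrite mul1r; under [X in _ -> (X < _)%E]eq_integral do rewrite divr1.
rewrite -dotv_integral//; last first.
  by move=> j; apply: (source_pair_integrable ltr01 aU UO); apply: spanned_admissible => //; exact: spanned_phi.
rewrite -[RHS]dotvZl; congr (dotv _ _); apply/rowP => j; by rewrite !mxE UE.
Qed.

(** Combinations converge to [w] in modular at one scale, and by [modular_pair_cvg] this suffices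
    against [F] and [g (U)], which have finite dual modulars. *)
Lemma weak_admissible w L : 0 < L -> admissible L w -> (forall x, ~ Omega x -> w x = 0) ->
  [/\ nu.-integrable setT (EFin \o (fun z => F z * @Ds R n s w z)),
      la.-integrable setT (EFin \o (fun x => g (U x) * w x)) &
      \int[nu]_z (F z * @Ds R n s w z) = l * \int[la]_x (g (U x) * w x)].
Proof.
move=> L0 aw wO; have [mw _ Ew] := aw; have [mg Ig] := source_modular aU UO.
have mDw : measurable_fun setT (@Ds R n s w) by exact: measurable_Ds_nu.
have iF : nu.-integrable setT (EFin \o (fun z => F z * @Ds R n s w z)).
  by apply: (modular_integrable youngM K0 L0 mF mDw IF); rewrite nu_energy.
have iG := source_pair_integrable L0 aU UO aw.
split => //; have [v [L' [L'0 sv av Ev]]] := dense_sequence n0 s01 youngM Omega_b Omega_open Omega_segment L0 aw wO.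
have mv k : measurable_fun setT (v k) by case: (spanned_bounded (sv k)).
have mDv k : measurable_fun setT (@Ds R n s (v k)) by exact: measurable_Ds_nu.
have c1' : \int[nu]_z (F z * @Ds R n s (v k) z) @[k --> \oo] --> \int[nu]_z (F z * @Ds R n s w z).
  apply: (modular_pair_cvg youngM K0 L'0 mF mDv mDw IF iF) => k.
  apply: le_trans (Ev k); rewrite -(nu_energy s youngM L')//; last exact: measurable_funB.
  rewrite le_eqVlt; apply/orP; left; apply/eqP; apply: eq_integral => z _; congr (M _)%:E.
  by rewrite /Ds -mulrBl; congr (_ / _ / _); rewrite opprB addrACA opprB [X in _ = _ + X]addrC; ring.
have c2' : \int[la]_x (g (U x) * v k x) @[k --> \oo] --> \int[la]_x (g (U x) * w x).
  exact: (modular_pair_cvg youngM (mulr_gt0 A0 C0) L'0 mg mv mw Ig iG av).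
apply: (cvg_unique _ c1'); first exact: norm_hausdorff.
have Eq : (fun k => \int[nu]_z (F z * @Ds R n s (v k) z)) = (fun k => l * \int[la]_x (g (U x) * v k x)).
  by apply/funext => k; exact: (weak_spanned (sv k)).
by rewrite /= Eq; apply: cvgM => //; exact: cvg_cst.
Qed.

Lemma weak_Ws0L v : Ws0L s M Omega v ->
  (\int[nu]_z (F z * @Ds R n s v z)%:E = l%:E * \int[dx]_(x in Omega) (g (U x) * v x)%:E)%E.
Proof.
move=> Wv; have [[[mv _] [mDv _]] _] := Wv.
have [w [L [L0 aw wO wv]]] := Ws0L_borel youngM Omega_b Omega_open Wv.
have [iF iG E] := weak_admissible L0 aw wO; have [mw _ _] := aw; have [mU _ _] := aU.
have mg : measurable_fun setT (fun x => g (U x)) by exact: measurable_source.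
have mO : measurable (Omega : set (Rn R n)) by apply: borel_caratheodory; exact: open_measurable_rV.
have -> : (\int[nu]_z (F z * @Ds R n s v z)%:E = \int[nu]_z (F z * @Ds R n s w z)%:E)%E.
  apply: (@ae_eq_integral _ _ _ (@nu R n) setT (fun z => (F z * @Ds R n s w z)%:E) (fun z => (F z * @Ds R n s v z)%:E) measurableT).
  - by apply/measurable_EFinP; exact: measurable_funM.
  - by apply/measurable_EFinP; apply: measurable_funM => //; exact: measurable_Ds_nu.
  - by apply: ae_imp (ae_nu_prod wv) => z [z1 z2] _; rewrite /Ds z1 z2.
have -> : (\int[dx]_(x in Omega) (g (U x) * v x)%:E = \int[dx]_x ((fun x : X => g (U x) * w x) x)%:E)%E.
  transitivity (\int[dx]_(x in (Omega : set (Rn R n))) ((fun x : Rn R n => g (U x) * w x) x)%:E)%E.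
    apply: (@ae_eq_integral _ _ _ (@dx R n) Omega (fun x => (g (U x) * w x)%:E) (fun x => (g (U x) * v x)%:E) mO).
    - apply/measurable_EFinP; apply: measurable_funTS; apply: measurable_funM; [exact: measurable_dx|exact: mv].
    - apply/measurable_EFinP; apply: measurable_funTS; apply: measurable_dx; exact: measurable_funM.
    - by apply: ae_imp wv => x -> _.
  rewrite integral_mkcond; apply: eq_integral => x _; rewrite /patch; case: ifPn => // xO.
  by rewrite wO ?mulr0//= => Ox; move: xO; rewrite mem_set.
rewrite dx_integral; last exact: measurable_funM.
have fF : (\int[nu]_z (F z * @Ds R n s w z)%:E)%E \is a fin_num by exact: (integrable_fin_num measurableT iF).
have fG : (\int[la]_x (g (U x) * w x)%:E)%E \is a fin_num by exact: (integrable_fin_num measurableT iG).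
by rewrite -(fineK fF) -(fineK fG) -EFinM; congr _%:E; exact: E.
Qed.

End weak_limit.

(** The lower bound [alpha] passes to the limit and keeps [U] nonzero. This bounds the multipliers,
    hence the integrals of [al (D^s v) D^s v], hence the dual modulars; a.e. convergence then
    identifies the limit of the operator terms. *)
Lemma level (eps : R) : 0 < eps -> exists (l : R) (U : X -> R) (K : R),
  [/\ [/\ 0 < l, admissible K1 U, (energy K1 U <= (th^-1)%:E)%E & forall x, ~ Omega x -> U x = 0],
      Ws0L s M Omega U,
      0 < K /\ (\int[nu]_z (Mbar (al z (@Ds R n s U z) / K))%:E < +oo)%E,
      forall j, \int[nu]_z (al z (@Ds R n s U z) * psi j z) = l * \int[la]_x (g (U x) * phi j x)
    & 1 <= l * \int[la]_x (g (U x) * U x) /\ \int[la]_x G (U x) <= eps].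
Proof.
move=> eps0; have [alpha [a0 [k0 Hk]]] := approximate_eigenpairs eps0.
have Hch k : exists ul : (X -> R) * R, approximate_eigenpair alpha eps (k0 + k) ul.1 ul.2.
  by have [u [l H]] := Hk _ (leq_addr k k0); exists (u, l).
have [ul Hul] := choice Hch.
have uO k x : ~ Omega x -> (ul k).1 x = 0 by case: (Hul k) => -[_ tu _ _ _] _ _ _; exact: test_functions_out.
have au k : admissible K1 (ul k).1 by case: (Hul k) => -[].
have Eu k : (energy K1 (ul k).1 <= (th^-1)%:E)%E by case: (Hul k) => -[].
have [f [U [ff [aU EU UO] cU mU]]] := compact_limit_Omega au Eu uO.
pose v k := (ul (f k)).1; pose m k := (ul (f k)).2.
have mv k : measurable_fun setT (v k) by case: (au (f k)).
have vO k x : ~ Omega x -> v k x = 0 by exact: uO.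
have cD := source_limit_self mv aU vO UO cU mU.
have cG := source_limit_prim mv aU vO UO cU mU.
set DU := \int[la]_x (g (U x) * U x) in cD.
have G1 : alpha <= \int[la]_x G (U x) by apply: (seq_ge cG) => k; case: (Hul (f k)) => _ _ [_ _ /andP[]].
have G2 : \int[la]_x G (U x) <= eps by apply: (seq_le cG) => k; case: (Hul (f k)) => _ _ [_ _ /andP[]].
have [mmU _ _] := aU.
have DU0 : 0 < DU.
  rewrite ltNge; apply/negP => D0.
  have H := ge0_Rintegral_eq0 (source_pair_integrable K10 aU UO aU) (fun x => source_mul_ge0 g_odd g_pos _) D0.
  have : \int[la]_x G (U x) = 0.
    rewrite /Rintegral (@ae_eq_integral _ _ _ la setT (fun=> 0%E) (fun x => (G (U x))%:E) measurableT) ?integral0//.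
    - by apply/measurable_EFinP; exact: measurable_prim_source.
    - apply: ae_imp H => x Hx _; have [->|/(source_mul_gt0 g_odd g_pos)] := eqVneq (U x) 0; first by rewrite prim0.
      by rewrite Hx ltxx.
  by move: G1 => /(lt_le_trans a0)/[swap] ->; rewrite ltxx.
have [w [L [L0 sw aw _]]] := dense_sequence n0 s01 youngM Omega_b Omega_open Omega_segment K10 aU UO.
have [mg Ig] := source_modular aU UO.
have mw k : measurable_fun setT (w k) by case: (spanned_bounded (sw k)).
have cw := modular_pair_cvg youngM (mulr_gt0 A0 C0) L0 mg mw mmU Ig (source_pair_integrable K10 aU UO aU) aw.
have D40 : 0 < DU / 4 by rewrite divr_gt0.
have [N0 _ HN0] := (cvgrPdist_lt _ _).1 cw _ D40.
have := HN0 N0 (leqnn N0); rewrite -/DU ltr_norml => /andP[_ wD].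
(* Convexity is tested with about twice [U]: the integral of [g (U) (2 w - U)] exceeds half of [DU],
   so the last clause of [approximate_eigenpair] bounds the multipliers by [2 cost / DU]. *)
have s2w : spanned b Omega (fun x => 2 * w N0 x) by exact: spannedZ.
have [m2w [B [B0 wB]]] := spanned_bounded s2w; have [k2 [d2 [d20 w2E]]] := s2w.
have c2 := source_limit_test mv aU vO UO cU mU m2w B0 wB.
have c3 : \int[la]_x (g (v k x) * (2 * w N0 x)) - \int[la]_x (g (v k x) * v k x) @[k --> \oo] -->
    \int[la]_x (g (U x) * (2 * w N0 x)) - DU by exact: cvgB c2 cD.
have lim3 : DU / 2 < \int[la]_x (g (U x) * (2 * w N0 x)) - DU.
  have -> : \int[la]_x (g (U x) * (2 * w N0 x)) = 2 * \int[la]_x (g (U x) * w N0 x).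
    rewrite -RintegralZl//; last exact: (source_pair_integrable K10 aU UO (spanned_admissible K10 (sw N0))).
    by apply: eq_Rintegral => x _; rewrite mulrCA.
  by lra.
have gap : 0 < \int[la]_x (g (U x) * (2 * w N0 x)) - DU - DU / 2 by lra.
have [N1 _ HN1] := (cvgrPdist_lt _ _).1 c3 _ gap.
pose N := maxn N1 k2.
have m0 k : 0 < m k by case: (Hul (f k)) => -[].
have mb k : (N <= k)%N -> m k <= 2 * cost k2 d2 / DU.
  rewrite geq_max => /andP[k1' k2']; have [_ _ _ Hc] := Hul (f k).
  have := Hc k2 d2 (leq_trans k2' (leq_trans (ff k) (leq_addl _ _))) d20; rewrite -/(v k) -/(m k).
  have -> : \int[la]_x (g (v k x) * (comb k2 d2 x - v k x)) =
      \int[la]_x (g (v k x) * (2 * w N0 x)) - \int[la]_x (g (v k x) * v k x).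
    rewrite -RintegralB//.
    - by apply: eq_Rintegral => x _; rewrite -w2E mulrBr.
    - exact: (source_pair_integrable K10 (au (f k)) (vO k) (spanned_admissible K10 s2w)).
    - exact: (source_pair_integrable K10 (au (f k)) (vO k) (au (f k))).
  have := HN1 k k1'; rewrite ltr_norml => /andP[_ h1] h2.
  rewrite ler_pdivlMr//; have := m0 k; move: h1 h2 lim3.
  set I1 := _ - \int[la]_x (g (v k x) * v k x); set I2 := _ - DU; move=> h1 h2 h3 h4.
  have h5 : DU / 2 < I1 by lra.
  have h6 := ltr_pM2l h4 (DU / 2) I1; rewrite h5 in h6.
  by have := lt_le_trans h6 h2; lra.
(* An array constant in its second index: the extraction serves as Bolzano-Weierstrass for the
   multipliers. *)
have [p2 [xl [p2k Hx]]] := @diagonal_extraction R (fun j _ => m (N + j)%N) (fun=> 2 * cost k2 d2 / DU)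
  (fun j _ => ltac:(by rewrite gtr0_norm ?m0// mb// leq_addr)).
pose i k := (N + p2 k)%N; have ik k : (k <= i k)%N by rewrite /i (leq_trans (p2k k))// leq_addl.
pose l := xl 0%N.
have cm : m (i k) @[k --> \oo] --> l.
  apply/cvgrPdist_lt => e e0; have [N2 _ HN2] := near_infty_natSinv_lt (PosNum e0).
  by exists N2 => // k Nk; rewrite distrC; apply: lt_trans (Hx k 0%N (leq0n k)) (HN2 k Nk).
have cD' := cvg_subsequence ik cD.
have cmD : m (i k) * \int[la]_x (g (v (i k) x) * v (i k) x) @[k --> \oo] --> l * DU by exact: cvgM.
have lD : 1 <= l * DU by apply: (seq_ge cmD) => k; case: (Hul (f (i k))) => _ _ [].
have l_ge0 : 0 <= l by apply: (seq_ge cm) => k; exact/ltW/m0.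
have l0 : 0 < l by rewrite lt_neqAle l_ge0 andbT; apply: contraTneq lD => <-; rewrite mul0r ler10.
have cU' : {ae la, forall x, v (i k) x @[k --> \oo] --> U x} by apply: ae_imp cU => x; exact: cvg_subsequence.
have [Bd _ HBd] := pinfty_ex_gt0 (cvg_seq_bounded (cvgP _ cmD)).
pose K : R := 4 * b0; have K0 : 0 < K by rewrite mulr_gt0.
pose F k z := al z (@Ds R n s (v (i k)) z).
have mDs k : measurable_fun setT (@Ds R n s (v (i k))) by apply: measurable_Ds_nu; exact: mv.
have mF k : measurable_fun setT (F k) by exact: measurable_superposition.
have al_pos z x : 0 <= al z x * x.
  exact: le_trans (prim_ge0 (al_odd z) (@al_c z) (@al_mono z) x) (prim_le (al_odd z) (@al_c z) (@al_mono z) x).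
have [mDK IDK] := scaled_modular youngM K0 mD IDk.
have D2fin : (\int[nu]_z (Mbar (2 * D z / K) / 2)%:E)%E \is a fin_num.
  by rewrite ge0_fin_numE//; apply: int_ge0 => z; rewrite divr_ge0// complementary_ge0.
pose CB : R := c0 / K * Bd + fine (\int[nu]_z (Mbar (2 * D z / K) / 2)%:E)%E.
have IF k : (\int[nu]_z (Mbar (F k z / K))%:E <= CB%:E)%E.
  have eDs : EM nu M (@Ds R n s (v (i k))).
    have Ev K' : 0 < K' -> (energy K' (v (i k)) < +oo)%E by case: (Hul (f (i k))) => -[_ _ _ _ H] _ _ _; exact: H.
    exact: (Ds_EM youngM (mv (i k)) Ev).
  have iop := op_integrable youngM al_m al_c b00 c00 mD ID al_le eDs eDs.
  have mop : measurable_fun setT (fun z => al z (@Ds R n s (v (i k)) z) * @Ds R n s (v (i k)) z) := measurable_funM (mF k) (mDs k).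
  have Iop : (\int[nu]_z (al z (@Ds R n s (v (i k)) z) * @Ds R n s (v (i k)) z)%:E < +oo)%E.
    by have /integrableP[_] := iop; under eq_integral do rewrite /= (ger0_norm (al_pos _ _)).
  have cK : 0 <= c0 / K by rewrite divr_ge0// ltW.
  apply: (@le_trans _ _ (\int[nu]_z (c0 / K * (al z (@Ds R n s (v (i k)) z) * @Ds R n s (v (i k)) z) + Mbar (2 * D z / K) / 2)%:E)%E).
    apply: int_le => [||z|z].
    - exact: (measurable_complementary_div youngM K (mF k)).
    - exact: (measurable_affine (c0 / K) mop mDK).
    - exact: complementary_ge0.
    - exact: (complementary_monotone_bound youngM b00 c00 K0 (lexx _) (al_pos z) (al_le z)).
  have hM z : 0 <= Mbar (2 * D z / K) / 2 by rewrite divr_ge0// complementary_ge0.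
  rewrite (affine_integral _ cK mop mDK (fun z => al_pos _ _) hM).
  rewrite -(ge0_Rintegral_fin mop (fun z => al_pos _ _) Iop) -(fineK D2fin) -EFinM -EFinD lee_fin /CB lerD2r ler_wpM2l//.
  have [_ _ [_ h _] _] := Hul (f (i k)); apply: le_trans h _; apply: le_trans (ler_norm _) _; exact: (HBd k Logic.I).
have cF : {ae (@nu R n), forall z : Rnn R n, F k z @[k --> \oo] --> al z (@Ds R n s U z)}.
  apply: ae_imp (ae_Ds_cvg s cU') => z cz.
  by apply: (@cvg_comp _ _ _ (fun k => @Ds R n s (v (i k)) z) (al z) _ (nbhs (@Ds R n s U z))) => //; exact: al_c.
have mFU : measurable_fun setT (fun z => al z (@Ds R n s U z)) by apply: measurable_superposition => //; exact: measurable_Ds_nu.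
have yi x t : `|x * t| <= Mbar x + M t by rewrite mulrC addrC; exact: young_ineq.
have Mb0 := complementary_ge0 youngM.
have IFU : (\int[nu]_z (Mbar (al z (@Ds R n s U z) / K))%:E <= CB%:E)%E.
  apply: (fatou_le (f_ := fun k z => Mbar (F k z / K))) => [k||||].
  - exact: (measurable_complementary_div youngM K (mF k)).
  - exact: (measurable_complementary_div youngM K mFU).
  - by move=> *; exact: Mb0.
  - apply: ae_imp cF => z cz; apply: (@cvg_comp _ _ _ (fun k => F k z / K) Mbar _ (nbhs (al z (@Ds R n s U z) / K))).
      by apply: cvgM => //; exact: cvg_cst.
    exact: complementary_continuous.
  - exact: IF.
exists l, U, K; split => //.
- split; first split.
  + split; first exact: measurable_dx.
    by exists 1 => //; rewrite dx_amod//; exact: (admissible_EM n0 s01 youngM K10 ltr01 aU).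
  + split; first exact: measurable_Ds_nu.
    by exists K1 => //; rewrite nu_energy//; exact: le_lt_trans EU (ltry _).
  + apply: (@closure_of_limit R n s M Omega (fun k => v (i k))) => [k|h H hE HE].
      by case: (Hul (f (i k))) => -[].
    have [p1 p2'] := pairing_cvg n0 s01 youngM K10 (fun k => au (f (i k))) (fun k => Eu (f (i k))) mmU cU' hE HE.
    exact: cvgD p1 p2'.
- by split => //; exact: le_lt_trans IFU (ltry _).
- move=> j; have [mpsi Ipsi] := psi_EM s01 youngM b Omega j.
  have cFp : \int[nu]_z (F k z * psi j z) @[k --> \oo] --> \int[nu]_z (al z (@Ds R n s U z) * psi j z).
    apply: Rintegral_cvg => [k||e e0]; first exact: (measurable_funM (mF k) mpsi).
    - apply: (pair_integrable Mb0 M_ge0 (complementary_continuous youngM) (measurable_young youngM) yi K0 mFU mpsi) => //.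
      exact: le_lt_trans IFU (ltry _).
    - have [N2 HN2] := pair_cvg Mb0 M_ge0 (complementary_continuous youngM) (measurable_young youngM) yi K0 mF mFU mpsi cF IF Ipsi e0.
      by exists N2 => k Nk; apply: le_trans (HN2 k Nk); under eq_integral do rewrite -mulrBl.
  have [mphi [Bp [Bp0 phiB]]] := spanned_bounded (spanned_phi b Omega j).
  have cg := cvg_subsequence ik (source_limit_test mv aU vO UO cU mU mphi Bp0 phiB).
  have cdiff : \int[nu]_z (F k z * psi j z) - m (i k) * \int[la]_x (g (v (i k) x) * phi j x) @[k --> \oo] -->
      \int[nu]_z (al z (@Ds R n s U z) * psi j z) - l * \int[la]_x (g (U x) * phi j x).
    by apply: cvgB => //; exact: cvgM.
  apply/eqP; rewrite -subr_eq0; apply/eqP; apply: (cvg_unique _ cdiff); first exact: norm_hausdorff.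
  apply/cvgrPdist_le => e e0; have e20 : 0 < e / 2 by rewrite divr_gt0.
  have [N2 _ HN2] := near_infty_natSinv_lt (PosNum e20).
  exists (maxn N2 j.+1) => // k; rewrite /= geq_max => /andP[k1' k2']; rewrite sub0r normrN.
  have kk : (k <= k0 + f (i k))%N by exact: leq_trans (ik k) (leq_trans (ff _) (leq_addl _ _)).
  have [_ Hp _ _] := Hul (f (i k)); apply: le_trans (Hp j (leq_trans k2' kk)) _.
  have h : (k0 + f (i k)).+1%:R^-1 <= k.+1%:R^-1 :> R by rewrite lef_pV2 ?posrE// ler_nat ltnS.
  have h' : k.+1%:R^-1 < e / 2 := HN2 k k1'.
  by have := le_lt_trans h h'; move: (_^-1) => q; lra.
Qed.

(** At level [1 / (i + 1)] the mass is at most that number, while the energies share one bound; a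
    subsequence thus has a limit of mass 0, that is 0. The inequality that drives the eigenvalues to
    infinity also shows that no [u i] is null. *)
Lemma eigen_sequence : exists (lam : nat -> R) (u : nat -> X -> R),
  [/\ forall i, [/\ 0 < lam i, admissible K1 (u i), Ws0L s M Omega (u i) /\ ~ {ae (@dx R n), forall x : Rn R n, u i x = 0},
        exists2 K, 0 < K & (\int[nu]_z (Mbar (al z (@Ds R n s (u i) z) / K))%:E < +oo)%E
      & forall v, Ws0L s M Omega v -> (\int[nu]_z (al z (@Ds R n s (u i) z) * @Ds R n s v z)%:E =
          (lam i)%:E * \int[dx]_(x in Omega) (g (u i x) * v x)%:E)%E],
      lam i @[i --> \oo] --> +oo & sigma_cvg s M u (fun=> 0)].
Proof.
have pi (i : nat) : 0 < i.+1%:R^-1 :> R by rewrite invr_gt0.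
have [l0 Hl0] := choice (fun i => level (pi i)).
have [U0 HU0] := choice Hl0; have [K HK] := choice HU0.
have aU0 i : admissible K1 (U0 i) by case: (HK i) => -[].
have EU0 i : (energy K1 (U0 i) <= (th^-1)%:E)%E by case: (HK i) => -[].
have UO0 i x : ~ Omega x -> U0 i x = 0 by case: (HK i) => -[_ _ _ H] _ _ _ _; exact: H.
have [f [V [ff [aV EV VO] cV mV]]] := compact_limit_Omega aU0 EU0 UO0.
pose u k := U0 (f k); pose lam k := l0 (f k).
have [mmV _ _] := aV.
have mu k : measurable_fun setT (u k) by case: (aU0 (f k)).
have uO k x : ~ Omega x -> u k x = 0 by exact: UO0.
have cD := source_limit_self mu aV uO VO cV mV.
have cG := source_limit_prim mu aV uO VO cV mV.
have G0 : \int[la]_x G (V x) <= 0.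
  apply: (@seq_le (fun k => \int[la]_x G (u k x) - k.+1%:R^-1)).
    by rewrite -[X in _ --> X]subr0; apply: cvgB => //; exact: cvg_harmonic.
  move=> k; rewrite subr_le0; have [_ _ _ _ [_ h]] := HK (f k); apply: le_trans h _.
  by rewrite lef_pV2 ?posrE// ler_nat ltnS.
have iG : la.-integrable setT (EFin \o (fun x => G (V x))).
  have mI : measurable_fun setT (fun x : X => C * \1_Omega x).
    by apply: measurable_funM => //; apply: measurable_indic; exact: open_measurable_rV.
  have mM : measurable_fun setT (fun x => M (V x / A^-1)) by exact: measurable_M_div.
  have C20 : 0 <= 2 * C by rewrite mulr_ge0// ltW.
  have CM0 x : 0 <= 2 * C * M (V x / A^-1) by rewrite mulr_ge0// M_ge0.
  have CI0 x : 0 <= C * \1_Omega x :> R by rewrite mulr_ge0// ltW.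
  have mCM : measurable_fun setT (fun x => 2 * C * M (V x / A^-1)) by exact: measurable_funM.
  apply: (@integrable_dominated _ _ _ la _ (fun x => C * \1_Omega x + 2 * C * M (V x / A^-1))).
  - exact: measurable_prim_source.
  - exact: measurable_funD.
  - rewrite intD//; apply: lte_add_pinfty.
      exact: le_lt_trans (indic_Omega_int Omega_b Omega_open (ltW C0)) (ltry _).
    rewrite (intZ la mM (fun x => M_ge0 _) C20); apply: lte_mul_pinfty; rewrite ?lee_fin//.
    by apply: (admissible_EM n0 s01 youngM K10 _ aV); rewrite invr_gt0.
  - move=> x; have [xO|xO] := pselect (Omega x); last by rewrite VO// prim0 normr0 addr_ge0// mulr_ge0// M_ge0.
    rewrite ger0_norm; last exact: prim_source_ge0.
    apply: le_trans (prim_source_le youngM g_odd g_cont A0 C0 g_bound _) _.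
    by rewrite indicE mem_set// mulr1 invrK [V x * A]mulrC mulrDr mulr1 mulrA [C * 2]mulrC.
have V0 : {ae la, forall x, V x = 0}.
  have := ge0_Rintegral_eq0 iG (fun x => prim_source_ge0 g_odd g_cont g_pos _) G0.
  apply: ae_imp => x; have [//|/(prim_source_gt0 g_odd g_cont g_pos)] := eqVneq (V x) 0.
  by move=> + h; rewrite h ltxx.
have gV0 : \int[la]_x (g (V x) * V x) = 0.
  rewrite /Rintegral (@ae_eq_integral _ _ _ la setT (fun=> 0%E) (fun x => (g (V x) * V x)%:E) measurableT) ?integral0//.
  - by apply/measurable_EFinP; apply: measurable_funM => //; exact: measurable_source.
  - by apply: ae_imp V0 => x -> _; rewrite mulr0.
rewrite gV0 in cD.
have lD k : 1 <= lam k * \int[la]_x (g (u k x) * u k x) by case: (HK (f k)) => _ _ _ _ [].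
have lam0 k : 0 < lam k by case: (HK (f k)) => -[].
exists lam, u; split.
- move=> k; have [[_ _ _ _] Wu [K0 IK] UE _] := HK (f k); split => //; first exact: aU0.
  + split => // /ae_dx_inv u0; have := lD k.
    have -> : \int[la]_x (g (u k x) * u k x) = 0.
      rewrite /Rintegral (@ae_eq_integral _ _ _ la setT (fun=> 0%E) (fun x => (g (u k x) * u k x)%:E) measurableT) ?integral0//.
      - by apply/measurable_EFinP; apply: measurable_funM => //; exact: measurable_source.
      - by apply: ae_imp u0 => x -> _; rewrite mulr0.
    by rewrite mulr0 ler10.
  + by exists (K (f k)).
  + by move=> v Wv; exact: (weak_Ws0L (aU0 (f k)) (uO k) K0 IK UE Wv).
- apply/cvgryPge => B; have B0 : 0 < (`|B| + 1)^-1 by rewrite invr_gt0 ltr_wpDl.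
  have [N _ HN] := (cvgrPdist_lt _ _).1 cD _ B0; exists N => // k Nk.
  have := HN k Nk; rewrite sub0r normrN => h.
  have h1 : \int[la]_x (g (u k x) * u k x) < (`|B| + 1)^-1 by exact: le_lt_trans (ler_norm _) h.
  have h2 : 1 <= lam k * (`|B| + 1)^-1 by apply: le_trans (lD k) _; rewrite ler_pM2l//; exact: ltW.
  apply: (@le_trans _ _ (`|B| + 1)); first by apply: le_trans (ler_norm B) _; rewrite lerDl.
  by move: h2; rewrite ler_pdivlMr ?mul1r// ltr_wpDl.
- move=> _ [h [H [hE HE ->]]].
  have cu0 : {ae la, forall x, u k x @[k --> \oo] --> (fun=> 0 : R) x} by apply: ae_imp2 V0 cV => x ->.
  have [c1' c2'] := pairing_cvg n0 s01 youngM K10 (fun k => aU0 (f k)) (fun k => EU0 (f k)) (measurable_cst (0 : R)) cu0 hE HE.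
  pose Phi (v : Rn R n -> R) : R := \int[dx]_x (v x * h x) - \int[nu]_z (@Ds R n s v z * H z).
  have PE (v : Rn R n -> R) : \int[dx]_x (h x * v x) + fdiv s H v = Phi v.
    by rewrite /fdiv /Phi; congr (_ - _); apply: eq_Rintegral => x _; rewrite mulrC.
  have cPhi : Phi (u k) @[k --> \oo] --> Phi (fun=> 0) by apply: cvgB; [exact: c1'|exact: c2'].
  rewrite /= PE (_ : (fun i => _) = (fun k => Phi (u k))); first exact: cPhi.
  by apply/funext => k; exact: PE.
Qed.

End level_limit.

End LevelLimits.
Import LevelLimits.

(* Redefining the kernel to vanish on the exceptional null set makes every
   condition but coercivity hold everywhere. *)
Lemma clean_kernel (R : realType) (n : nat) (M : R -> R) (a : 'rV[R]_n -> 'rV[R]_n -> R -> R) :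
  young M -> admissible_kernel M a -> coercive_kernel M a ->
  exists (al : Rnn R n -> R -> R) (D : Rnn R n -> R) (b0 c0 th c1 : R),
  [/\ [/\ forall xi, measurable_fun setT (al^~ xi), forall z, continuous (al z),
          forall z xi, al z (- xi) = - al z xi & forall z x y, x <= y -> al z x <= al z y],
      [/\ 0 < b0, 0 < c0, measurable_fun setT D &
          forall k, 0 < k -> (\int[nu]_z (complementary M (D z / k))%:E < +oo)%E],
      forall z xi, `|al z xi| <= D z + b0 * complementary_inv M (M (c0 * xi)),
      [/\ 0 < th, 0 < c1 & {ae (@nu R n), forall z : Rnn R n, forall xi, th * M (c1 * xi) <= al z xi * xi}]
    & {ae (@dxdy R n), forall z : Rnn R n, forall xi, al z xi = a z.1 z.2 xi}].
Proof.
move=> youngM [am ac [d [b [c [[md Id] b0 c0 Ha]]]]] [th [c1 [th0 c10 Hc]]].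
have [N [mN N0 HN]] := ae_setT (ae_imp2 (fun z p q => conj p q) ac Ha).
pose al (z : Rnn R n) xi := \1_(~` N) z * a z.1 z.2 xi : R.
have alN z : N z -> al z = fun=> 0.
  by move=> Nz; apply/funext => xi; rewrite /al indicE memNset ?mul0r//; move=> h; exact: h Nz.
have alE z : ~ N z -> al z = a z.1 z.2.
  by move=> Nz; apply/funext => xi; rewrite /al indicE mem_set ?mul1r.
have eal : {ae (@dxdy R n), forall z : Rnn R n, forall xi, al z xi = a z.1 z.2 xi}.
  by exists N; split => // z /= nz; apply: contrapT => Nz; apply: nz => xi; rewrite alE.
exists al, (fun z => `|d z|), b, c, th, c1; split.
- split.
  + by move=> xi; exact: (measurable_funM (measurable_indic (measurableC mN)) (am xi)).
  + move=> z; have [Nz|Nz] := pselect (N z); first by rewrite alN// => x; exact: cvg_cst.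
    by rewrite alE//; case: (HN z Nz).
  + move=> z xi; have [Nz|Nz] := pselect (N z); first by rewrite alN// oppr0.
    by rewrite alE//; have [_ /(_ xi 0)[]] := HN z Nz.
  + move=> z x y xy; have [Nz|Nz] := pselect (N z); first by rewrite alN.
    rewrite alE//; have [_ /(_ y x)[_ _ _ h]] := HN z Nz.
    move: xy; rewrite le_eqVlt => /orP[/eqP ->//|xy].
    by move: h; rewrite pmulr_lge0 ?subr_gt0// subr_ge0.
- split; [exact: b0|exact: c0|exact: (measurableT_comp (@normr_measurable R setT) md)|].
  move=> k k0; rewrite (eq_integral (fun z => (complementary M (d z / k))%:E)); first exact: Id.
  move=> z _; rewrite -(complementary_abs M (d z / k)) -(complementary_abs M (`|d z| / k)).
  by rewrite !normrM normr_id.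
- move=> z xi; have [Nz|Nz] := pselect (N z).
    rewrite alN// normr0; apply: addr_ge0 => //; apply: mulr_ge0; first exact: ltW.
    by apply: complementary_inv_ge0 => //; exact: young_ge0.
  rewrite alE//; have [_ /(_ xi xi)[_ _ h _]] := HN z Nz.
  by apply: le_trans h _; rewrite lerD2r ler_norm.
- split; [exact: th0|exact: c10|apply: ae_nu; apply: ae_imp2 eal Hc].
  by move=> z e h xi; rewrite e; exact: h.
- exact: eal.
Qed.

Theorem theorem4p10 (R : realType) (n : nat) (s : R) (Omega : set 'rV[R]_n)
    (M : R -> R) (a : 'rV[R]_n -> 'rV[R]_n -> R -> R) (g : R -> R)
    (n_gt0 : (0 < n)%N) (s01 : 0 < s < 1)
    (Omega_neq0 : Omega !=set0) (Omega_open : open Omega)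
    (Omega_connected : connected Omega) (Omega_bounded : bounded_set Omega)
    (Omega_segment : segment_property Omega)
    (youngM : young M)
    (a_admissible : admissible_kernel M a) (a_coercive : coercive_kernel M a)
    (g_admissible : admissible_source M Omega g) :
  exists (lambda : nat -> R) (u : nat -> Rn R n -> R),
    [/\ forall i, [/\ 0 < lambda i, eigenpair s M a g Omega (lambda i) (u i)
                    & ~ {ae dx, forall x, u i x = 0}],
        lambda i @[i --> \oo] --> +oo
      & sigma_cvg s M u (fun=> 0)].
Proof.
have [b Omega_b] : exists b : nat, forall x, Omega x -> `|x| <= b%:R.
  have [r [_ Hr]] := Omega_bounded.
  exists (Num.bound (`|r| + 1)) => x Ox.
  have h : r < `|r| + 1 by apply: le_lt_trans (ler_norm r) _; rewrite ltrDl.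
  apply: le_trans (Hr _ h x Ox) _; apply: ltW.
  by apply: le_lt_trans (ler_norm _) _; rewrite ger0_norm ?addr_ge0//; apply: archi_boundP; rewrite addr_ge0.
have [A [C [A0 C0 g_bound]]] := source_bound youngM Omega_open g_admissible Omega_neq0.
have [g_odd g_cont g_pos _] := g_admissible.
have [al [D [b0 [c0 [th [c1 [[al_m al_c al_odd al_mono] [b00 c00 mD ID] al_le [th0 c10 al_co] eal]]]]]]] :=
  clean_kernel youngM a_admissible a_coercive.
have [lam [u [H lamoo uw]]] := eigen_sequence n_gt0 s01 youngM Omega_b Omega_open Omega_neq0 Omega_segment
  g_odd g_cont g_pos A0 C0 g_bound al_m al_c al_odd al_mono b00 c00 mD ID al_le th0 c10 al_co.
exists lam, u; split; [move=> i|exact: lamoo|exact: uw].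
have [lam0 [mu _ _] [Wu unz] [K K0 IK] eqn] := H i.
have mF : measurable_fun setT (fun z : Rnn R n => al z (Ds s (u i) z)).
  exact: (measurable_superposition al_m al_c (measurable_Ds_nu s mu)).
(* Continuity of [a] in its last argument holds only a.e.; measurability is inherited from [al],
   which agrees with [a] off a null set, because the measure is complete. *)
have mA : measurable_fun setT (fun z : Rnn R n => a z.1 z.2 (Ds s (u i) z)).
  apply/measurable_EFinP.
  apply: (@ae_measurable_fun _ _ _ (@dxdy R n) _ setT (EFin \o (fun z : Rnn R n => al z (Ds s (u i) z)))).
  - exact: measure_is_complete_caratheodory.
  - by apply: ae_imp eal => z e _; rewrite /= e.
  - exact/measurable_EFinP.
split; [exact: lam0| |exact: unz]; split.
  split; first exact: Wu.
  split; first exact: mA.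
  exists K; first exact: K0.
  suff -> : (\int[@nu R n]_z (complementary M (a z.1 z.2 (Ds s (u i) z) / K))%:E =
             \int[@nu R n]_z (complementary M (al z (Ds s (u i) z) / K))%:E)%E by exact: IK.
  apply: (@ae_eq_integral _ _ _ (@nu R n) setT _ _ measurableT).
  - by apply/measurable_EFinP; exact: (measurable_complementary_div youngM K mA).
  - by apply/measurable_EFinP; exact: (measurable_complementary_div youngM K mF).
  - by apply: ae_nu; apply: ae_imp eal => z e _; rewrite /= e.
move=> v Wv; rewrite -(eqn v Wv).
have mDv : measurable_fun setT (Ds s v) by case: Wv => -[_ []].
apply: (@ae_eq_integral _ _ _ (@nu R n) setT _ _ measurableT).
- by apply/measurable_EFinP; exact: (measurable_funM mA mDv).
- by apply/measurable_EFinP; exact: (measurable_funM mF mDv).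
- by apply: ae_nu; apply: ae_imp eal => z e _; rewrite /= e.
Qed.
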